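(* Let $k$ be an arbitrary field and let $C\subset \mathbb{P}^2_k$ be a nonsingular conic, i.e. there is a regular quadratic form $q$ in three variables such that $C=V(q)$. Let $\Omega_C$ denote the cotangent bundle (sheaf of Kähler differentials) on $C$ and let $\mathcal{V}$ be an arbitrary vector bundle on $C$. Then there exists a canonical indecomposable rank $2$ bundle $\mathcal{Q}$ on $C$ such that there is an isomorphism $$\mathcal{V} \cong \Big(\bigoplus_{i = 1}^{r_{0}} \Omega_C^{\otimes m_{i}}\Big) \oplus \Big(\bigoplus_{j = 1}^{r_{1}} \mathcal{Q} \otimes \Omega_C^{\otimes n_{j}}\Big)$$ for unique, up to reordering, integer sequences $\{m_i\}_{i=1}^{r_0}$ and $\{n_j\}_{j=1}^{r_1}$.
   Context: A vector bundle is a locally free sheaf of finite rank. For an integer $m$, $\Omega_C^{\otimes m}$ is the $m$-th tensor power of the line bundle $\Omega_C$ (negative powers meaning powers of the dual). A vector bundle is indecomposable if it is nonzero and not isomorphic to a direct sum of two nonzero vector bundles. The bundle $\mathcal{Q}$ is called the Quillen bundle; it is constructed explicitly when $C$ is anisotropic (i.e. $C(k)=\emptyset$), as the middle term, well defined up to isomorphism, of any non-split extension $0\to\Omega_C\to\mathcal{Q}\to\mathcal{O}_C\to 0$, where $\mathrm{Ext}^1_C(\mathcal{O}_C,\Omega_C)\cong \mathrm{H}^1(C,\Omega_C)$ is one-dimensional over $k$.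
   Formalization: Stated only for conics with no rational point: if C(k) is nonempty then C is the projective line, which has no indecomposable rank 2 bundle, so the claim fails. ''Regular'' is read as: q stays regular over every field extension, so that the cotangent bundle is a line bundle. *)

(* Defs.v *)
From HB Require Import structures.
From mathcomp Require Import all_boot all_order all_algebra.
From mathcomp Require Import generic_quotient.
From mathcomp Require Import mpoly ring.
From mathcomp Require Import boolp classical_sets topology_structure.

Set Implicit Arguments.
Unset Strict Implicit.
Unset Printing Implicit Defensive.

Import GRing.Theory.

Local Open Scope ring_scope.
Local Open Scope quotient_scope.
Local Open Scope classical_set_scope.

Record equivalence_on (T : Type) := EquivalenceOn {
  eqv_rel :> T -> T -> Prop;
  eqv_refl : forall x, eqv_rel x x;
  eqv_sym : forall x y, eqv_rel x y -> eqv_rel y x;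
  eqv_trans : forall y x z, eqv_rel x y -> eqv_rel y z -> eqv_rel x z }.

Section Quotient.
Variables (T : Type) (e : equivalence_on T).

Definition eqv_bool : rel {classic T} := fun x y => `[< e x y >].

Lemma eqv_bool_refl : reflexive eqv_bool.
Proof. by move=> x; apply/asboolP; apply: eqv_refl. Qed.

Lemma eqv_bool_sym : ssrbool.symmetric eqv_bool.
Proof. by move=> x y; apply/asboolP/asboolP; apply: eqv_sym. Qed.

Lemma eqv_bool_trans : transitive eqv_bool.
Proof.
by move=> y x z /asboolP h1 /asboolP h2; apply/asboolP; apply: eqv_trans h1 h2.
Qed.

Definition eqv_equiv := EquivRel eqv_bool eqv_bool_refl eqv_bool_sym eqv_bool_trans.

Definition Quot : choiceType := {eq_quot eqv_equiv}.
Definition cl (x : T) : Quot := \pi_({eq_quot eqv_equiv}) (x : {classic T}).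
Definition rep (a : Quot) : T := (repr (a : {eq_quot eqv_equiv}) : {classic T}).

Lemma cl_rep a : cl (rep a) = a.
Proof. exact: reprK. Qed.

Lemma clP x y : cl x = cl y <-> e x y.
Proof.
split=> [h|h]; last by apply/eqmodP/asboolP.
by apply/asboolP; rewrite -[`[< _ >]]/(eqv_equiv x y); apply/eqmodP.
Qed.

Lemma rep_cl x : e (rep (cl x)) x.
Proof. by apply/clP; rewrite cl_rep. Qed.

Lemma clW (P : Quot -> Prop) : (forall x, P (cl x)) -> forall a, P a.
Proof. by move=> h a; rewrite -(cl_rep a). Qed.

End Quotient.

HB.lock Definition qlift1 T1 T3 (e1 : equivalence_on T1) (e3 : equivalence_on T3)
  (f : T1 -> T3) (a : Quot e1) : Quot e3 := cl e3 (f (rep a)).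

HB.lock Definition qlift2 T1 T2 T3 (e1 : equivalence_on T1)
  (e2 : equivalence_on T2) (e3 : equivalence_on T3)
  (f : T1 -> T2 -> T3) (a : Quot e1) (b : Quot e2) : Quot e3 :=
  cl e3 (f (rep a) (rep b)).

Section QuotientLift.
Variables (T1 T2 T3 : Type).
Variables (e1 : equivalence_on T1) (e2 : equivalence_on T2) (e3 : equivalence_on T3).

Lemma qlift1E f : (forall x y, e1 x y -> e3 (f x) (f y)) ->
  forall x, qlift1 e3 f (cl e1 x) = cl e3 (f x).
Proof. by move=> h x; rewrite unlock; apply/clP/h/rep_cl. Qed.

Lemma qlift2E f :
  (forall x y x' y', e1 x y -> e2 x' y' -> e3 (f x x') (f y y')) ->
  forall x y, qlift2 e3 f (cl e1 x) (cl e2 y) = cl e3 (f x y).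
Proof. by move=> h x y; rewrite unlock; apply/clP/h; apply: rep_cl. Qed.

End QuotientLift.

Inductive mterm (R S : Type) :=
  | MGen of S
  | MZero
  | MOpp of mterm R S
  | MAdd of mterm R S & mterm R S
  | MScale of R & mterm R S.

Arguments MZero {R S}.
Arguments MGen {R S}.

Section PresentedModule.
Variables (R : comPzRingType) (S : Type).
Variable rel : mterm R S -> mterm R S -> Prop.
Implicit Types t u : mterm R S.

Inductive mcong : mterm R S -> mterm R S -> Prop :=
  | mcong_rel t u of rel t u : mcong t u
  | mcong_refl t : mcong t t
  | mcong_sym t u of mcong t u : mcong u t
  | mcong_trans u t v of mcong t u & mcong u v : mcong t v
  | mcong_opp t u of mcong t u : mcong (MOpp t) (MOpp u)
  | mcong_add t t' u u' of mcong t t' & mcong u u' : mcong (MAdd t u) (MAdd t' u')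
  | mcong_scale a t u of mcong t u : mcong (MScale a t) (MScale a u)
  | mcong_addA t u v : mcong (MAdd t (MAdd u v)) (MAdd (MAdd t u) v)
  | mcong_addC t u : mcong (MAdd t u) (MAdd u t)
  | mcong_add0 t : mcong (MAdd MZero t) t
  | mcong_addN t : mcong (MAdd (MOpp t) t) MZero
  | mcong_scaleA a b t : mcong (MScale a (MScale b t)) (MScale (a * b) t)
  | mcong_scale1 t : mcong (MScale 1 t) t
  | mcong_scaleDr a t u : mcong (MScale a (MAdd t u)) (MAdd (MScale a t) (MScale a u))
  | mcong_scaleDl a b t : mcong (MScale (a + b) t) (MAdd (MScale a t) (MScale b t)).

Definition mcong_eqv := EquivalenceOn mcong_refl mcong_sym mcong_trans.

Definition pmod : Type := Quot mcong_eqv.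
HB.instance Definition _ := Choice.on pmod.

Definition pm_cl (t : mterm R S) : pmod := cl mcong_eqv t.
Definition pm_zero : pmod := pm_cl MZero.
Definition pm_opp : pmod -> pmod := qlift1 mcong_eqv (@MOpp R S).
Definition pm_add : pmod -> pmod -> pmod := qlift2 mcong_eqv (@MAdd R S).
Definition pm_scale (a : R) : pmod -> pmod := qlift1 mcong_eqv (MScale a).

Lemma pm_oppE t : pm_opp (pm_cl t) = pm_cl (MOpp t).
Proof. by apply: qlift1E; exact: mcong_opp. Qed.
Lemma pm_addE t u : pm_add (pm_cl t) (pm_cl u) = pm_cl (MAdd t u).
Proof. by apply: qlift2E; exact: mcong_add. Qed.
Lemma pm_scaleE a t : pm_scale a (pm_cl t) = pm_cl (MScale a t).
Proof. by apply: qlift1E => ? ?; exact: mcong_scale. Qed.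

Lemma pm_addA : associative pm_add.
Proof.
elim/clW=> t; elim/clW=> u; elim/clW=> v; rewrite !pm_addE.
by apply/clP; exact: mcong_addA.
Qed.
Lemma pm_addC : commutative pm_add.
Proof. by elim/clW=> t; elim/clW=> u; rewrite !pm_addE; apply/clP; exact: mcong_addC. Qed.
Lemma pm_add0 : left_id pm_zero pm_add.
Proof. by elim/clW=> t; rewrite pm_addE; apply/clP; exact: mcong_add0. Qed.
Lemma pm_addN : left_inverse pm_zero pm_opp pm_add.
Proof. by elim/clW=> t; rewrite pm_oppE pm_addE; apply/clP; exact: mcong_addN. Qed.

HB.instance Definition _ :=
  GRing.isZmodule.Build pmod pm_addA pm_addC pm_add0 pm_addN.

Lemma pm_scaleA a b (v : pmod) : pm_scale a (pm_scale b v) = pm_scale (a * b) v.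
Proof. by elim/clW: v => t; rewrite !pm_scaleE; apply/clP; exact: mcong_scaleA. Qed.
Lemma pm_scale1 : left_id 1 pm_scale.
Proof. by elim/clW=> t; rewrite pm_scaleE; apply/clP; exact: mcong_scale1. Qed.
Lemma pm_scaleDr : right_distributive pm_scale +%R.
Proof.
move=> a; elim/clW=> t; elim/clW=> u; rewrite /GRing.add/= !(pm_addE, pm_scaleE).
by apply/clP; exact: mcong_scaleDr.
Qed.
Lemma pm_scaleDl (v : pmod) : {morph pm_scale^~ v : a b / a + b}.
Proof.
move=> a b; elim/clW: v => t; rewrite /= /GRing.add/= !(pm_addE, pm_scaleE).
by apply/clP; exact: mcong_scaleDl.
Qed.

HB.instance Definition _ := GRing.Zmodule_isLmodule.Build R pmod
  pm_scaleA pm_scale1 pm_scaleDr pm_scaleDl.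

Lemma pm_clW (P : pmod -> Prop) : (forall t, P (pm_cl t)) -> forall v : pmod, P v.
Proof. exact: clW. Qed.
Lemma pm_clD t u : pm_cl t + pm_cl u = pm_cl (MAdd t u).
Proof. exact: pm_addE. Qed.
Lemma pm_clZ a t : a *: pm_cl t = pm_cl (MScale a t).
Proof. exact: pm_scaleE. Qed.

End PresentedModule.

Local Obligation Tactic := idtac.

Definition opens (X : topologicalType) := {U : set X | open U}.
Definition oset (X : topologicalType) (U : opens X) : set X := sval U.
Coercion oset : opens >-> set.
Definition omem (X : topologicalType) (U : opens X) (x : X) : Prop := oset U x.
Coercion omem : opens >-> Funclass.

Definition full_open (X : topologicalType) : opens X := exist _ setT openT.
Definition interU (X : topologicalType) (U V : opens X) : opens X :=
  exist _ (U `&` V) (openI (svalP U) (svalP V)).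

Lemma sub_full (X : topologicalType) (U : opens X) : U `<=` full_open X.
Proof. by []. Qed.
Lemma interUl (X : topologicalType) (U V : opens X) : interU U V `<=` U.
Proof. by move=> x []. Qed.
Lemma interUr (X : topologicalType) (U V : opens X) : interU U V `<=` V.
Proof. by move=> x []. Qed.

Definition sheaf_axiom (X : topologicalType) (F : opens X -> Type)
    (res : forall U V : opens X, V `<=` U -> F U -> F V) : Prop :=
  forall (I : Type) (U : opens X) (W : I -> opens X)
    (WU : forall i, W i `<=` U), U `<=` \bigcup_i oset (W i) ->
  forall s : forall i, F (W i),
    (forall i j, res _ _ (@interUl _ (W i) (W j)) (s i) =
                 res _ _ (@interUr _ (W i) (W j)) (s j)) ->
  exists! t : F U, forall i, res _ _ (WU i) t = s i.

(* [rs_cst] makes the structure sheaf a sheaf of [k]-algebras. *)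
Record ringed_space (k : fieldType) := RingedSpace {
  rs_top :> topologicalType;
  rs_sec : opens rs_top -> comPzRingType;
  rs_res : forall U V : opens rs_top, V `<=` U -> {rmorphism rs_sec U -> rs_sec V};
  rs_cst : forall U : opens rs_top, {rmorphism k -> rs_sec U};
  rs_res_id : forall (U : opens rs_top) (UU : U `<=` U) a, rs_res UU a = a;
  rs_res_comp : forall (U V W : opens rs_top) (VU : V `<=` U) (WV : W `<=` V)
    (WU : W `<=` U) a, rs_res WV (rs_res VU a) = rs_res WU a;
  rs_res_cst : forall (U V : opens rs_top) (VU : V `<=` U) c,
    rs_res VU (rs_cst U c) = rs_cst V c;
  rs_sheaf : sheaf_axiom (fun U V (VU : V `<=` U) => rs_res VU : rs_sec U -> rs_sec V) }.

Notation "''O' U" := (rs_sec U) (at level 10, U at level 8).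

Section Modules.
Variables (k : fieldType) (X : ringed_space k).
Implicit Types U V W : opens X.

(* These are only presheaves of [O_X]-modules; the gluing condition is [is_sheaf]. *)
Record omod := OMod {
  om_sec :> forall U, lmodType ('O U);
  om_res : forall U V, V `<=` U -> om_sec U -> om_sec V;
  om_resD : forall U V (VU : V `<=` U) s t,
    om_res VU (s + t) = om_res VU s + om_res VU t;
  om_resZ : forall U V (VU : V `<=` U) (a : 'O U) s,
    om_res VU (a *: s) = rs_res VU a *: om_res VU s;
  om_res_id : forall U (UU : U `<=` U) s, om_res UU s = s;
  om_res_comp : forall U V W (VU : V `<=` U) (WV : W `<=` V) (WU : W `<=` U) s,
    om_res WV (om_res VU s) = om_res WU s }.

Definition is_sheaf (F : omod) : Prop := sheaf_axiom (@om_res F).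

(** Morphisms [F|_U -> G|_U]. *)
Record hom_over U (F G : omod) := HomOver {
  hom_fun :> forall V, V `<=` U -> F V -> G V;
  homD : forall V (VU : V `<=` U) s t,
    hom_fun VU (s + t) = hom_fun VU s + hom_fun VU t;
  homZ : forall V (VU : V `<=` U) (a : 'O V) s,
    hom_fun VU (a *: s) = a *: hom_fun VU s;
  hom_res : forall V W (VU : V `<=` U) (WU : W `<=` U) (WV : W `<=` V) s,
    om_res WV (hom_fun VU s) = hom_fun WU (om_res WV s) }.

Definition hom (F G : omod) := hom_over (full_open X) F G.

Definition hom_at (F G : omod) (f : hom F G) U : F U -> G U :=
  f U (@sub_full _ U).

Definition iso_over U (F G : omod) : Prop :=
  exists f : hom_over U F G, forall V (VU : V `<=` U), bijective (f V VU).

Definition iso (F G : omod) : Prop := iso_over (full_open X) F G.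

Lemma hom_overP U F G (f g : hom_over U F G) :
  (forall V (VU : V `<=` U) s, f V VU s = g V VU s) -> f = g.
Proof.
case: f g => [f fD fZ fR] [g gD gZ gR] /= e.
have ? : f = g.
  apply: functional_extensionality_dep => V; apply: functional_extensionality_dep => VU.
  by apply/funext => s; apply: e.
by subst g; congr HomOver; apply: Prop_irrelevance.
Qed.

Program Definition O_mod : omod := {|
  om_sec := fun U => (('O U)^o : lmodType ('O U));
  om_res := fun U V VU a => rs_res VU a |}.
Next Obligation. by move=> U V VU; exact: (rmorphD (rs_res VU)). Qed.
Next Obligation. by move=> U V VU; exact: (rmorphM (rs_res VU)). Qed.
Next Obligation. exact: rs_res_id. Qed.
Next Obligation. exact: rs_res_comp. Qed.

Program Definition zero_mod : omod := {|
  om_sec := fun U => ('rV['O U]_0 : lmodType ('O U));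
  om_res := fun U V VU _ => 0 |}.
Next Obligation. by move=> * /=; rewrite addr0. Qed.
Next Obligation. by move=> * /=; rewrite scaler0. Qed.
Next Obligation. by move=> *; apply/rowP=> -[]. Qed.
Next Obligation. by []. Qed.

Program Definition dsum (F G : omod) : omod := {|
  om_sec := fun U => ((F U * G U)%type : lmodType ('O U));
  om_res := fun U V VU s => (om_res VU s.1, om_res VU s.2) |}.
Next Obligation. by move=> *; congr pair; apply: om_resD. Qed.
Next Obligation. by move=> *; congr pair; apply: om_resZ. Qed.
Next Obligation. by move=> F G U UU [s t]; rewrite !om_res_id. Qed.
Next Obligation. by move=> *; congr pair; apply: om_res_comp. Qed.

Definition bigdsum (s : seq omod) : omod := foldr dsum zero_mod s.

Definition free_mod (r : nat) : omod := bigdsum (nseq r O_mod).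

Section Shom.
Variables F G : omod.

Section AtU.
Variable U : opens X.
Local Notation H := (hom_over U F G).

HB.instance Definition _ := gen_eqMixin H.
HB.instance Definition _ := gen_choiceMixin H.

Program Definition shom_zero : H := {| hom_fun := fun V VU s => 0 |}.
Next Obligation. by move=> * /=; rewrite addr0. Qed.
Next Obligation. by move=> * /=; rewrite scaler0. Qed.
Next Obligation. by move=> V W VU WU WV s; have := om_resZ WV 0 (0 : G V); rewrite !scale0r rmorph0 scale0r. Qed.

Program Definition shom_opp (f : H) : H :=
  {| hom_fun := fun V VU s => - f V VU s |}.
Next Obligation. by move=> * /=; rewrite homD opprD. Qed.
Next Obligation. by move=> * /=; rewrite homZ scalerN. Qed.
Next Obligation.
move=> f V W VU WU WV s /=.
by rewrite -(hom_res f VU WU WV) -!scaleN1r om_resZ rmorphN1.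
Qed.

Program Definition shom_add (f g : H) : H :=
  {| hom_fun := fun V VU s => f V VU s + g V VU s |}.
Next Obligation. by move=> * /=; rewrite !homD addrACA. Qed.
Next Obligation. by move=> * /=; rewrite !homZ scalerDr. Qed.
Next Obligation. by move=> f g V W VU WU WV s /=; rewrite om_resD !(hom_res _ VU WU WV). Qed.

Program Definition shom_scale (a : 'O U) (f : H) : H :=
  {| hom_fun := fun V VU s => rs_res VU a *: f V VU s |}.
Next Obligation. by move=> * /=; rewrite homD scalerDr. Qed.
Next Obligation. by move=> * /=; rewrite homZ !scalerA mulrC. Qed.
Next Obligation.
by move=> a f V W VU WU WV s /=; rewrite om_resZ (rs_res_comp VU WV WU) (hom_res f VU WU WV).
Qed.

Lemma shom_addA : associative shom_add.
Proof. by move=> f g h; apply: hom_overP => V VU s /=; rewrite addrA. Qed.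
Lemma shom_addC : commutative shom_add.
Proof. by move=> f g; apply: hom_overP => V VU s /=; rewrite addrC. Qed.
Lemma shom_add0 : left_id shom_zero shom_add.
Proof. by move=> f; apply: hom_overP => V VU s /=; rewrite add0r. Qed.
Lemma shom_addN : left_inverse shom_zero shom_opp shom_add.
Proof. by move=> f; apply: hom_overP => V VU s /=; rewrite addNr. Qed.
HB.instance Definition _ :=
  GRing.isZmodule.Build H shom_addA shom_addC shom_add0 shom_addN.

Lemma shom_scaleA a b f : shom_scale a (shom_scale b f) = shom_scale (a * b) f.
Proof. by apply: hom_overP => V VU s /=; rewrite scalerA rmorphM. Qed.
Lemma shom_scale1 : left_id 1 shom_scale.
Proof. by move=> f; apply: hom_overP => V VU s /=; rewrite rmorph1 scale1r. Qed.
Lemma shom_scaleDr : right_distributive shom_scale +%R.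
Proof. by move=> a f g; apply: hom_overP => V VU s /=; rewrite scalerDr. Qed.
Lemma shom_scaleDl f : {morph shom_scale^~ f : a b / a + b}.
Proof. by move=> a b; apply: hom_overP => V VU s /=; rewrite rmorphD scalerDl. Qed.
HB.instance Definition _ := GRing.Zmodule_isLmodule.Build ('O U) H
  shom_scaleA shom_scale1 shom_scaleDr shom_scaleDl.

End AtU.

Program Definition shom_res U V (VU : V `<=` U) (f : hom_over U F G) : hom_over V F G :=
  {| hom_fun := fun W WV s => f W (subset_trans WV VU) s |}.
Next Obligation. by move=> *; exact: homD. Qed.
Next Obligation. by move=> *; exact: homZ. Qed.
Next Obligation. by move=> *; exact: hom_res. Qed.

Program Definition shom : omod := {|
  om_sec := fun U => (hom_over U F G : lmodType ('O U));
  om_res := shom_res |}.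
Next Obligation. by move=> *; apply: hom_overP. Qed.
Next Obligation.
move=> U V VU a f; apply: hom_overP => W WV t /=.
by rewrite (rs_res_comp VU WV (subset_trans WV VU)).
Qed.
Next Obligation.
by move=> U UU s; apply: hom_overP => W WU t /=; congr (s _ _ _); apply: Prop_irrelevance.
Qed.
Next Obligation.
by move=> U V W VU WV WU s; apply: hom_overP => Z ZW t /=; congr (s _ _ _); apply: Prop_irrelevance.
Qed.

End Shom.

Definition dual (F : omod) : omod := shom F O_mod.

Section Sheafify.
Variable F : omod.

Section Stalk.
Variable x : X.

Record pregerm := PreGerm {
  pg_dom : opens X;
  pg_in : pg_dom x;
  pg_sec : F pg_dom }.

Definition germ_rel (g h : pregerm) : Prop :=
  exists W : opens X, exists (_ : W x) (Wg : W `<=` pg_dom g) (Wh : W `<=` pg_dom h),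
    om_res Wg (pg_sec g) = om_res Wh (pg_sec h).

Lemma germ_refl g : germ_rel g g.
Proof. by exists (pg_dom g), (pg_in g), (@subset_refl _ _), (@subset_refl _ _). Qed.

Lemma germ_sym g h : germ_rel g h -> germ_rel h g.
Proof. by case=> W [xW [Wg [Wh e]]]; exists W, xW, Wh, Wg. Qed.

Lemma germ_trans h g i : germ_rel g h -> germ_rel h i -> germ_rel g i.
Proof.
case=> V [xV [Vg [Vh e]]] [W [xW [Wh [Wi e']]]].
have hV : interU V W `<=` V by move=> y [].
have hW : interU V W `<=` W by move=> y [].
exists (interU V W), (conj xV xW), (subset_trans hV Vg), (subset_trans hW Wi).
rewrite -(om_res_comp Vg hV) e -(om_res_comp Wi hW) -e'.
by rewrite (om_res_comp _ _ (subset_trans hV Vh)) (om_res_comp _ _ (subset_trans hV Vh)).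
Qed.

Definition germ_eqv := EquivalenceOn germ_refl germ_sym germ_trans.
Definition stalk : Type := Quot germ_eqv.
HB.instance Definition _ := Choice.on stalk.

Definition germ (U : opens X) (Ux : U x) (s : F U) : stalk :=
  cl germ_eqv (PreGerm Ux s).

Lemma germW (P : stalk -> Prop) : (forall U Ux s, P (@germ U Ux s)) -> forall a, P a.
Proof. by move=> h; elim/clW => -[U Ux s]; apply: h. Qed.

Lemma germ_res U V (Ux : U x) (Vx : V x) (VU : V `<=` U) s :
  germ Vx (om_res VU s) = germ Ux s.
Proof. by apply/clP; exists V, Vx, (@subset_refl _ _), VU => /=; rewrite om_res_id. Qed.

Lemma germ_repr U (Ux : U x) a :
  exists W : opens X, exists (Wx : W x) (WU : W `<=` U) (s : F W), a = germ Wx s.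
Proof.
elim/germW: a => V Vx s; exists (interU U V), (conj Ux Vx), (@interUl _ _ _).
by exists (om_res (@interUr _ U V) s); rewrite germ_res.
Qed.

Lemma germ_repr2 U (Ux : U x) a b :
  exists W : opens X, exists (Wx : W x) (WU : W `<=` U) (s t : F W),
    a = germ Wx s /\ b = germ Wx t.
Proof.
have [V [Vx [VU [s ->]]]] := germ_repr Ux a.
have [W [Wx [WV [t ->]]]] := germ_repr Vx b.
by exists W, Wx, (subset_trans WV VU), (om_res WV s), t; rewrite germ_res.
Qed.

Lemma germ_repr3 U (Ux : U x) a b c :
  exists W : opens X, exists (Wx : W x) (WU : W `<=` U) (s t u : F W),
    [/\ a = germ Wx s, b = germ Wx t & c = germ Wx u].
Proof.
have [V [Vx [VU [s [t [-> ->]]]]]] := germ_repr2 Ux a b.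
have [W [Wx [WV [u ->]]]] := germ_repr Vx c.
exists W, Wx, (subset_trans WV VU), (om_res WV s), (om_res WV t), u.
by rewrite !germ_res.
Qed.

Definition pg_opp (g : pregerm) := PreGerm (pg_in g) (- pg_sec g).

Definition pg_add (g h : pregerm) :=
  @PreGerm (interU (pg_dom g) (pg_dom h)) (conj (pg_in g) (pg_in h))
    (om_res (@interUl _ _ _) (pg_sec g) + om_res (@interUr _ _ _) (pg_sec h)).

Definition pg_scale U (Ux : U x) (a : 'O U) (g : pregerm) :=
  @PreGerm (interU U (pg_dom g)) (conj Ux (pg_in g))
    (rs_res (@interUl _ _ _) a *: om_res (@interUr _ _ _) (pg_sec g)).

Definition germ_zero : stalk := germ (U := full_open X) I 0.
Definition germ_opp : stalk -> stalk := qlift1 germ_eqv pg_opp.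
Definition germ_add : stalk -> stalk -> stalk := qlift2 germ_eqv pg_add.
Definition germ_scale U (Ux : U x) (a : 'O U) : stalk -> stalk :=
  qlift1 germ_eqv (pg_scale Ux a).

Lemma om_res0 U V (VU : V `<=` U) : om_res VU (0 : F U) = 0.
Proof. by have := om_resZ VU 0 (0 : F U); rewrite !scale0r rmorph0 scale0r. Qed.

Lemma om_resN U V (VU : V `<=` U) (s : F U) : om_res VU (- s) = - om_res VU s.
Proof. by rewrite -!scaleN1r om_resZ rmorphN1. Qed.

Lemma germ0E U (Ux : U x) : germ Ux 0 = germ_zero.
Proof. by rewrite /germ_zero -(germ_res _ Ux (@sub_full _ U)) om_res0. Qed.

Lemma germ_oppE U (Ux : U x) s : germ_opp (germ Ux s) = germ Ux (- s).
Proof.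
rewrite /germ_opp /germ qlift1E //= => g h [W [xW [Wg [Wh e]]]].
by exists W, xW, Wg, Wh => /=; rewrite !om_resN e.
Qed.

Lemma germ_addE U (Ux : U x) s t :
  germ_add (germ Ux s) (germ Ux t) = germ Ux (s + t).
Proof.
rewrite /germ_add /germ qlift2E /= => [|g h g' h' [W [xW [Wg [Wh e]]]] [W' [xW' [Wg' [Wh' e']]]]].
  apply/clP; exists (interU U U), (conj Ux Ux), (@subset_refl _ _), (@interUl _ _ _) => /=.
  by rewrite om_res_id om_resD; congr (_ + om_res _ _); apply: Prop_irrelevance.
have l : interU W W' `<=` W by move=> ? [].
have r : interU W W' `<=` W' by move=> ? [].
exists (interU W W'), (conj xW xW'), (setISS Wg Wg'), (setISS Wh Wh') => /=.
rewrite !om_resD; congr (_ + _).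
  rewrite !(om_res_comp _ _ (subset_trans l Wg)) !(om_res_comp _ _ (subset_trans l Wh)).
  by rewrite -(om_res_comp Wg l) -(om_res_comp Wh l) e.
rewrite !(om_res_comp _ _ (subset_trans r Wg')) !(om_res_comp _ _ (subset_trans r Wh')).
by rewrite -(om_res_comp Wg' r) -(om_res_comp Wh' r) e'.
Qed.

Lemma germ_scaleE U V (Ux : U x) (Vx : V x) (VU : V `<=` U) a s :
  germ_scale Ux a (germ Vx s) = germ Vx (rs_res VU a *: s).
Proof.
rewrite /germ_scale /germ qlift1E /= => [|g h [W [xW [Wg [Wh e]]]]].
  have VUV : V `<=` interU U V by move=> y Vy; split => //; apply: VU.
  apply/clP; exists V, Vx, VUV, (@subset_refl _ _) => /=.
  by rewrite om_resZ (rs_res_comp _ _ VU) (om_res_comp _ _ (@subset_refl _ _)) !om_res_id.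
have l : interU U W `<=` U by move=> ? [].
have r : interU U W `<=` W by move=> ? [].
have hg : interU U W `<=` interU U (pg_dom g) by move=> y [? /Wg].
have hh : interU U W `<=` interU U (pg_dom h) by move=> y [? /Wh].
exists (interU U W), (conj Ux xW), hg, hh => /=.
rewrite !om_resZ !(rs_res_comp _ _ l); congr (_ *: _).
rewrite !(om_res_comp _ _ (subset_trans r Wg)) !(om_res_comp _ _ (subset_trans r Wh)).
by rewrite -(om_res_comp Wg r) -(om_res_comp Wh r) e.
Qed.

Let xT : full_open X x := I.

Lemma germ_addA : associative germ_add.
Proof.
move=> a b c; have [W [Wx [_ [s [t [u [-> -> ->]]]]]]] := germ_repr3 xT a b c.
by rewrite !germ_addE addrA.
Qed.
Lemma germ_addC : commutative germ_add.
Proof.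
move=> a b; have [W [Wx [_ [s [t [-> ->]]]]]] := germ_repr2 xT a b.
by rewrite !germ_addE addrC.
Qed.
Lemma germ_add0 : left_id germ_zero germ_add.
Proof. by elim/germW=> U Ux s; rewrite -(germ0E Ux) germ_addE add0r. Qed.
Lemma germ_addN : left_inverse germ_zero germ_opp germ_add.
Proof. by elim/germW=> U Ux s; rewrite germ_oppE germ_addE addNr germ0E. Qed.

HB.instance Definition _ :=
  GRing.isZmodule.Build stalk germ_addA germ_addC germ_add0 germ_addN.

Lemma germD U (Ux : U x) s t : germ Ux (s + t) = germ Ux s + germ Ux t.
Proof. by rewrite -germ_addE. Qed.

Lemma germ_scaleA U (Ux : U x) (a b : 'O U) g :
  germ_scale Ux a (germ_scale Ux b g) = germ_scale Ux (a * b) g.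
Proof.
have [W [Wx [WU [s ->]]]] := germ_repr Ux g.
by rewrite !(germ_scaleE _ _ WU) scalerA rmorphM.
Qed.
Lemma germ_scale1 U (Ux : U x) : left_id 1 (@germ_scale U Ux).
Proof.
move=> g; have [W [Wx [WU [s ->]]]] := germ_repr Ux g.
by rewrite !(germ_scaleE _ _ WU) rmorph1 scale1r.
Qed.
Lemma germ_scaleDr U (Ux : U x) (a : 'O U) g h :
  germ_scale Ux a (g + h) = germ_scale Ux a g + germ_scale Ux a h.
Proof.
have [W [Wx [WU [s [t [-> ->]]]]]] := germ_repr2 Ux g h.
by rewrite -germD !(germ_scaleE _ _ WU) scalerDr germD.
Qed.
Lemma germ_scaleDl U (Ux : U x) (a b : 'O U) g :
  germ_scale Ux (a + b) g = germ_scale Ux a g + germ_scale Ux b g.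
Proof.
have [W [Wx [WU [s ->]]]] := germ_repr Ux g.
by rewrite !(germ_scaleE _ _ WU) rmorphD scalerDl germD.
Qed.
Lemma germ_scale_res U V (Ux : U x) (Vx : V x) (VU : V `<=` U) a g :
  germ_scale Vx (rs_res VU a) g = germ_scale Ux a g.
Proof.
have [W [Wx [WV [s ->]]]] := germ_repr Vx g.
rewrite (germ_scaleE _ _ WV) (germ_scaleE _ _ (subset_trans WV VU)).
by rewrite (rs_res_comp _ _ (subset_trans WV VU)).
Qed.

End Stalk.

Section AtU.
Variable U : opens X.

(* Families of germs that are locally given by sections of [F]. *)
Record shf := Shf {
  shf_val :> forall x, U x -> stalk x;
  shf_loc : forall x, U x -> exists V : opens X, exists (_ : V x) (VU : V `<=` U) (t : F V),
    forall y (Vy : V y), shf_val (VU y Vy) = germ Vy t }.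

HB.instance Definition _ := gen_eqMixin shf.
HB.instance Definition _ := gen_choiceMixin shf.

Lemma shfP (s t : shf) : (forall x (Ux : U x), s x Ux = t x Ux) -> s = t.
Proof.
case: s t => [s sl] [t tl] /= e.
have ? : s = t.
  by apply: functional_extensionality_dep => x; apply: functional_extensionality_dep => Ux.
by subst t; congr Shf; apply: Prop_irrelevance.
Qed.

Program Definition shf_zero : shf := {| shf_val := fun x Ux => 0 |}.
Next Obligation.
by move=> x Ux; exists U, Ux, (@subset_refl _ _), 0 => y Uy; rewrite germ0E.
Qed.

Program Definition shf_opp (s : shf) : shf := {| shf_val := fun x Ux => - s x Ux |}.
Next Obligation.
move=> s x Ux; have [V [Vx [VU [t e]]]] := shf_loc s Ux.
by exists V, Vx, VU, (- t) => y Vy /=; rewrite e -germ_oppE.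
Qed.

Program Definition shf_add (s t : shf) : shf :=
  {| shf_val := fun x Ux => s x Ux + t x Ux |}.
Next Obligation.
move=> s s' x Ux; have [V [Vx [VU [t e]]]] := shf_loc s Ux.
have [V' [Vx' [VU' [t' e']]]] := shf_loc s' Ux.
have l : interU V V' `<=` V by move=> ? [].
have r : interU V V' `<=` V' by move=> ? [].
exists (interU V V'), (conj Vx Vx'), (subset_trans l VU), (om_res l t + om_res r t').
move=> y [Vy Vy']; rewrite germD !(germ_res Vy, germ_res Vy') -e -e'.
by congr (s _ _ + s' _ _); apply: Prop_irrelevance.
Qed.

Program Definition shf_scale (a : 'O U) (s : shf) : shf :=
  {| shf_val := fun x Ux => germ_scale Ux a (s x Ux) |}.
Next Obligation.
move=> a s x Ux; have [V [Vx [VU [t e]]]] := shf_loc s Ux.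
by exists V, Vx, VU, (rs_res VU a *: t) => y Vy /=; rewrite e germ_scaleE.
Qed.

Lemma shf_addA : associative shf_add.
Proof. by move=> s t u; apply: shfP => x Ux /=; rewrite addrA. Qed.
Lemma shf_addC : commutative shf_add.
Proof. by move=> s t; apply: shfP => x Ux /=; rewrite addrC. Qed.
Lemma shf_add0 : left_id shf_zero shf_add.
Proof. by move=> s; apply: shfP => x Ux /=; rewrite add0r. Qed.
Lemma shf_addN : left_inverse shf_zero shf_opp shf_add.
Proof. by move=> s; apply: shfP => x Ux /=; rewrite addNr. Qed.
HB.instance Definition _ :=
  GRing.isZmodule.Build shf shf_addA shf_addC shf_add0 shf_addN.

Lemma shf_scaleA a b s : shf_scale a (shf_scale b s) = shf_scale (a * b) s.
Proof. by apply: shfP => x Ux /=; rewrite germ_scaleA. Qed.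
Lemma shf_scale1 : left_id 1 shf_scale.
Proof. by move=> s; apply: shfP => x Ux /=; rewrite germ_scale1. Qed.
Lemma shf_scaleDr : right_distributive shf_scale +%R.
Proof. by move=> a s t; apply: shfP => x Ux /=; rewrite germ_scaleDr. Qed.
Lemma shf_scaleDl s : {morph shf_scale^~ s : a b / a + b}.
Proof. by move=> a b; apply: shfP => x Ux /=; rewrite germ_scaleDl. Qed.
HB.instance Definition _ := GRing.Zmodule_isLmodule.Build ('O U) shf
  shf_scaleA shf_scale1 shf_scaleDr shf_scaleDl.

End AtU.

Program Definition shf_res U V (VU : V `<=` U) (s : shf U) : shf V :=
  {| shf_val := fun x Vx => s x (VU x Vx) |}.
Next Obligation.
move=> U V VU s x Vx; have [W [Wx [WU [t e]]]] := shf_loc s (VU x Vx).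
have r : interU V W `<=` W by move=> ? [].
exists (interU V W), (conj Vx Wx), (@interUl _ _ _), (om_res r t) => y [Vy Wy].
by rewrite (germ_res Wy) -e; congr (s _ _); apply: Prop_irrelevance.
Qed.

Program Definition sheafify : omod := {|
  om_sec := fun U => (shf U : lmodType ('O U));
  om_res := shf_res |}.
Next Obligation. by move=> *; apply: shfP. Qed.
Next Obligation.
by move=> U V VU a s; apply: shfP => x Vx /=; rewrite (germ_scale_res (VU x Vx)).
Qed.
Next Obligation.
by move=> U UU s; apply: shfP => x Ux /=; congr (s _ _); apply: Prop_irrelevance.
Qed.
Next Obligation.
by move=> U V W VU WV WU s; apply: shfP => x Ux /=; congr (s _ _); apply: Prop_irrelevance.
Qed.

Lemma sheafify_sheaf : is_sheaf sheafify.
Proof.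
move=> I U W WU cov s hs.
have ix x (Ux : U x) : {i : I | W i x}.
  by apply: cid; have [i _ Wix] := cov x Ux; exists i.
pose v x (Ux : U x) : stalk x := shf_val (s (sval (ix x Ux))) (svalP (ix x Ux)).
have vE i x (Wx : W i x) (Ux : U x) : v x Ux = shf_val (s i) Wx.
  rewrite /v; case: (ix x Ux) => j Wjx; rewrite [svalP _](Prop_irrelevance _ Wjx).
  have := congr1 (fun t : shf (interU (W j) (W i)) => shf_val t (conj Wjx Wx)) (hs j i).
  rewrite /= (Prop_irrelevance (@interUl _ _ _ x _) Wjx).
  by rewrite (Prop_irrelevance (@interUr _ _ _ x _) Wx).
have vl x : U x -> exists V : opens X, exists (_ : V x) (VU : V `<=` U) (t : F V),
    forall y (Vy : V y), v y (VU y Vy) = germ Vy t.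
  move=> Ux; have [i _ Wx] := cov x Ux.
  have [V [Vx [VU [t e]]]] := shf_loc (s i) Wx.
  exists V, Vx, (subset_trans VU (WU i)), t => y Vy.
  by rewrite (vE i y (VU y Vy)).
exists (Shf vl); split=> [i|t ht]; first by apply: shfP => x Wx /=; apply: vE.
apply: shfP => x Ux /=; have [i _ Wx] := cov x Ux.
rewrite (vE i x Wx) -(ht i) /=.
by congr (t _ _); apply: Prop_irrelevance.
Qed.

End Sheafify.

Section PresentedPresheaf.
Variables (S : opens X -> Type) (Sres : forall U V, V `<=` U -> S U -> S V).
Hypothesis Sres_id : forall U (UU : U `<=` U) s, Sres UU s = s.
Hypothesis Sres_comp : forall U V W (VU : V `<=` U) (WV : W `<=` V) (WU : W `<=` U) s,
  Sres WV (Sres VU s) = Sres WU s.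
Variable rel : forall U, mterm ('O U) (S U) -> mterm ('O U) (S U) -> Prop.

Fixpoint mterm_res U V (VU : V `<=` U) (t : mterm ('O U) (S U)) : mterm ('O V) (S V) :=
  match t with
  | MGen s => MGen (Sres VU s)
  | MZero => MZero
  | MOpp t => MOpp (mterm_res VU t)
  | MAdd t u => MAdd (mterm_res VU t) (mterm_res VU u)
  | MScale a t => MScale (rs_res VU a) (mterm_res VU t)
  end.

Hypothesis rel_res : forall U V (VU : V `<=` U) t u,
  rel t u -> rel (mterm_res VU t) (mterm_res VU u).

Lemma mcong_res U V (VU : V `<=` U) t u :
  mcong (@rel U) t u -> mcong (@rel V) (mterm_res VU t) (mterm_res VU u).
Proof.
elim=> /= {t u}.
- by move=> t u h; apply: mcong_rel; apply: rel_res.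
- by move=> t; apply: mcong_refl.
- by move=> t u _; apply: mcong_sym.
- by move=> u t v _ h _; apply: mcong_trans h.
- by move=> t u _; apply: mcong_opp.
- by move=> t t' u u' _ h _; apply: mcong_add h.
- by move=> a t u _; apply: mcong_scale.
- by move=> t u v; apply: mcong_addA.
- by move=> t u; apply: mcong_addC.
- by move=> t; apply: mcong_add0.
- by move=> t; apply: mcong_addN.
- by move=> a b t; rewrite rmorphM; apply: mcong_scaleA.
- by move=> t; rewrite rmorph1; apply: mcong_scale1.
- by move=> a t u; apply: mcong_scaleDr.
- by move=> a b t; rewrite rmorphD; apply: mcong_scaleDl.
Qed.

Lemma mterm_res_id U (UU : U `<=` U) t : mterm_res UU t = t.
Proof. by elim: t => //= [s|t ->|t -> u ->|a t ->] //; rewrite ?Sres_id ?rs_res_id. Qed.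

Lemma mterm_res_comp U V W (VU : V `<=` U) (WV : W `<=` V) (WU : W `<=` U) t :
  mterm_res WV (mterm_res VU t) = mterm_res WU t.
Proof.
elim: t => //= [s|t ->|t -> u ->|a t ->] //; first by rewrite (Sres_comp _ _ WU).
by rewrite (rs_res_comp _ _ WU).
Qed.

Definition pres_res U V (VU : V `<=` U) : pmod (@rel U) -> pmod (@rel V) :=
  qlift1 _ (mterm_res VU).

Lemma pres_resE U V (VU : V `<=` U) t :
  pres_res VU (pm_cl (@rel U) t) = pm_cl (@rel V) (mterm_res VU t).
Proof. by apply: qlift1E => *; apply: mcong_res. Qed.

Program Definition presented : omod := {|
  om_sec := fun U => (pmod (@rel U) : lmodType ('O U));
  om_res := pres_res |}.
Next Obligation.
move=> U V VU; elim/pm_clW=> t; elim/pm_clW=> u.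
by rewrite pm_clD !pres_resE /= -pm_clD.
Qed.
Next Obligation.
move=> U V VU a; elim/pm_clW=> t.
by rewrite pm_clZ !pres_resE /= -pm_clZ.
Qed.
Next Obligation. by move=> U UU; elim/pm_clW=> t; rewrite pres_resE mterm_res_id. Qed.
Next Obligation.
by move=> U V W VU WV WU; elim/pm_clW=> t; rewrite !pres_resE (mterm_res_comp _ _ WU).
Qed.

End PresentedPresheaf.

Section Tensor.
Variables F G : omod.

Inductive tensor_rel U : mterm ('O U) (F U * G U) -> mterm ('O U) (F U * G U) -> Prop :=
  | tensor_Dl s s' t : tensor_rel (MGen (s + s', t)) (MAdd (MGen (s, t)) (MGen (s', t)))
  | tensor_Dr s t t' : tensor_rel (MGen (s, t + t')) (MAdd (MGen (s, t)) (MGen (s, t')))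
  | tensor_Zl a s t : tensor_rel (MGen (a *: s, t)) (MScale a (MGen (s, t)))
  | tensor_Zr a s t : tensor_rel (MGen (s, a *: t)) (MScale a (MGen (s, t))).

Definition tensor_gen_res U V (VU : V `<=` U) (p : F U * G U) : F V * G V :=
  (om_res VU p.1, om_res VU p.2).

Lemma tensor_rel_res U V (VU : V `<=` U) t u :
  tensor_rel t u -> tensor_rel (mterm_res tensor_gen_res VU t) (mterm_res tensor_gen_res VU u).
Proof.
by case=> *; rewrite /= /tensor_gen_res /= ?(om_resD, om_resZ); constructor.
Qed.

Definition pretensor : omod.
Proof.
apply: (@presented (fun U => (F U * G U)%type) tensor_gen_res _ _ tensor_rel tensor_rel_res).
- by move=> U UU [s t]; rewrite /tensor_gen_res !om_res_id.
- by move=> U V W VU WV WU [s t]; rewrite /tensor_gen_res !(om_res_comp _ _ WU).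
Defined.

Definition tensor : omod := sheafify pretensor.

End Tensor.

(* The power 0 is [O_X] and [tensor_pow L (Negz n)] is the power [- (n + 1)]. *)
Definition tensor_pow (L : omod) (m : int) : omod :=
  match m with
  | Posz n => iter n (tensor L) O_mod
  | Negz n => iter n.+1 (tensor (dual L)) O_mod
  end.

Inductive kaehler_rel U : mterm ('O U) ('O U) -> mterm ('O U) ('O U) -> Prop :=
  | kaehler_D a b : kaehler_rel (MGen (a + b)) (MAdd (MGen a) (MGen b))
  | kaehler_M a b : kaehler_rel (MGen (a * b)) (MAdd (MScale a (MGen b)) (MScale b (MGen a)))
  | kaehler_cst c : kaehler_rel (MGen (rs_cst U c)) MZero.

Lemma kaehler_rel_res U V (VU : V `<=` U) t u : kaehler_rel t u ->
  kaehler_rel (mterm_res (fun U V VU => @rs_res k X U V VU) VU t)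
              (mterm_res (fun U V VU => @rs_res k X U V VU) VU u).
Proof.
by case=> *; rewrite /= ?(rmorphD, rmorphM, rs_res_cst); constructor.
Qed.

Definition prekaehler : omod :=
  @presented (fun U => 'O U) (fun U V VU => @rs_res k X U V VU)
    (@rs_res_id k X) (@rs_res_comp k X) kaehler_rel kaehler_rel_res.

(* The sheaf associated with [U |-> Omega_(O(U)/k)]. *)
Definition Omega : omod := sheafify prekaehler.

Definition vector_bundle (F : omod) : Prop :=
  is_sheaf F /\
  forall x : X, exists U : opens X, U x /\ exists r, iso_over U F (free_mod r).

Definition bundle_of_rank (r : nat) (F : omod) : Prop :=
  is_sheaf F /\
  forall x : X, exists U : opens X, U x /\ iso_over U F (free_mod r).

Definition nonzero (F : omod) : Prop := ~ iso F zero_mod.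

Definition indecomposable (F : omod) : Prop :=
  nonzero F /\
  ~ exists F1 F2 : omod, [/\ vector_bundle F1, nonzero F1,
      vector_bundle F2, nonzero F2 & iso F (dsum F1 F2)].

(* Exactness of [0 -> F1 -> F -> F2 -> 0] as sheaves: images are taken locally. *)
Definition short_exact (F1 F F2 : omod) (i : hom F1 F) (p : hom F F2) : Prop :=
  [/\ forall U, injective (hom_at i (U := U)),
      forall U (s : F U), hom_at p s = 0 <->
        forall x, U x -> exists V : opens X, exists (_ : V x) (VU : V `<=` U) (t : F1 V),
          om_res VU s = hom_at i t
    & forall U (s : F2 U) x, U x ->
        exists V : opens X, exists (_ : V x) (VU : V `<=` U) (t : F V),
          om_res VU s = hom_at p t].

Definition splits (F F2 : omod) (p : hom F F2) : Prop :=
  exists j : hom F2 F, forall U (s : F2 U), hom_at p (hom_at j s) = s.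

Definition nonsplit_extension (F1 F2 F : omod) : Prop :=
  is_sheaf F /\
  exists (i : hom F1 F) (p : hom F F2), short_exact i p /\ ~ splits p.

End Modules.

Definition polar (K : fieldType) (f : {mpoly K[3]}) (v w : 'I_3 -> K) : K :=
  f.@[fun i => v i + w i] - f.@[v] - f.@[w].

(* The radical of the polar form contains no nonzero zero of [f]; this, rather
   than nondegeneracy of the polar form, is the usual notion in characteristic 2. *)
Definition regular_form (K : fieldType) (f : {mpoly K[3]}) : Prop :=
  f \is 2.-homog /\
  forall v : 'I_3 -> K, f.@[v] = 0 -> (forall w, polar f v w = 0) ->
    forall i, v i = 0.

(* Regularity is required after every field extension, i.e. the quadric is
   smooth. In characteristic 2 this excludes the forms [x^2 + a y^2 + b z^2],
   which may be regular over [k] itself. *)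
Definition nonsingular_form (k : fieldType) (q : {mpoly k[3]}) : Prop :=
  forall (K : fieldType) (i : {rmorphism k -> K}), regular_form (map_mpoly i q).

Definition no_rational_point (k : fieldType) (q : {mpoly k[3]}) : Prop :=
  forall v : 'I_3 -> k, q.@[v] = 0 -> forall i, v i = 0.

Section Conic.
Variables (k : fieldType) (q : {mpoly k[3]}).
Local Notation A := {mpoly k[3]}.

(* Points of [Proj k[x_0,x_1,x_2]/(q)]. *)
Record conic_point := ConicPoint {
  cp_pred : A -> bool;
  cp_ideal : idealr_closed cp_pred;
  cp_prime : prime_idealr_closed cp_pred;
  cp_homog : forall f d, f \in cp_pred -> pihomog mdeg d f \in cp_pred;
  cp_q : q \in cp_pred;
  cp_relevant : exists i, 'X_i \notin cp_pred }.

HB.instance Definition _ := gen_eqMixin conic_point.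
HB.instance Definition _ := gen_choiceMixin conic_point.

Implicit Types P : conic_point.

Lemma cp_mulN P f g : f \notin cp_pred P -> g \notin cp_pred P -> f * g \notin cp_pred P.
Proof. by move=> hf hg; apply/negP=> /cp_prime; rewrite (negbTE hf) (negbTE hg). Qed.

Lemma cp_mulr P f g : f * g \notin cp_pred P -> f \notin cp_pred P /\ g \notin cp_pred P.
Proof.
have [h0 _ hD] := cp_ideal P.
move=> h; split; apply: contra h => h; last by rewrite -[_ * _]addr0; apply: hD.
by rewrite mulrC -[_ * _]addr0; apply: hD.
Qed.

Lemma cp_1 P : 1 \notin cp_pred P.
Proof. by have [] := cp_ideal P. Qed.

Lemma mpolyC_homog (c : k) : (c%:MP : A) \is 0.-homog.
Proof. by rewrite -[c%:MP]mulr1 mul_mpolyC rpredZ ?dhomog1. Qed.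

Lemma homogN d (f : A) : f \is d.-homog -> - f \is d.-homog.
Proof. by rewrite rpredN. Qed.

(* Complements of the sets [V(E)], for [E] a set of homogeneous polynomials. *)
Definition zariski_open : set_system conic_point := [set U |
  exists2 E : set A, (forall f, E f -> exists d, f \is d.-homog) &
    U = [set P | exists2 f, E f & f \notin cp_pred P]].

Lemma zariski_openT : zariski_open setT.
Proof.
exists [set f | exists i, f = 'X_i].
  by move=> _ [i ->]; exists 1%N; rewrite dhomogX; apply/eqP; exact: mdeg1.
rewrite predeqE => P; split=> // _; have [i hi] := cp_relevant P.
by exists 'X_i => //; exists i.
Qed.

Lemma zariski_openI : setI_closed zariski_open.
Proof.
move=> _ _ [E hE ->] [E' hE' ->].
exists [set f | exists g h, [/\ E g, E' h & f = g * h]].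
  move=> _ [g [h [/hE[d hd] /hE'[d' hd'] ->]]].
  by exists (d + d')%N; apply: dhomogM.
rewrite predeqE => P; split=> [[[g Eg gP] [h Eh hP]]|[_ [g [h [Eg Eh ->]]] /cp_mulr[gP hP]]].
  by exists (g * h); [exists g, h | apply: cp_mulN].
by split; [exists g | exists h].
Qed.

Lemma zariski_open_bigU (I : Type) (F : I -> set conic_point) :
  (forall i, zariski_open (F i)) -> zariski_open (\bigcup_i F i).
Proof.
move=> hF; exists [set f | (exists d, f \is d.-homog) /\
    [set P | f \notin cp_pred P] `<=` \bigcup_i F i].
  by move=> f [].
rewrite predeqE => P; split=> [[i _ FiP]|[f [_ h] fP]]; last exact: h.
have [E hE e] := hF i; move: (FiP); rewrite {1}e => -[f Ef fP].
exists f => //; split; first exact: hE.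
by move=> Q fQ; exists i => //; rewrite e; exists f.
Qed.

HB.instance Definition _ := isOpenTopological.Build conic_point
  zariski_openT zariski_openI zariski_open_bigU.

Section LocalRing.
Variable P : conic_point.

(* Degree zero fractions of the graded ring [k[x_0,x_1,x_2]/(q)], written with
   representatives in [k[x_0,x_1,x_2]]; the relation [frac_rel] works modulo [q]. *)
Record frac := Frac {
  fr_num : A;
  fr_den : A;
  fr_deg : nat;
  fr_numH : fr_num \is fr_deg.-homog;
  fr_denH : fr_den \is fr_deg.-homog;
  fr_denP : fr_den \notin cp_pred P }.

Implicit Types a b c : frac.

Definition frac_rel a b : Prop :=
  exists c : A, [/\ exists d, c \is d.-homog, c \notin cp_pred P &
    exists h, c * (fr_num a * fr_den b - fr_num b * fr_den a) = h * q].

Lemma frac_rel0 a b : fr_num a * fr_den b = fr_num b * fr_den a -> frac_rel a b.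
Proof.
move=> e; exists 1; split; first by exists 0%N; apply: dhomog1.
  exact: cp_1.
by exists 0; rewrite e subrr mulr0 mul0r.
Qed.

Lemma frac_refl a : frac_rel a a.
Proof. exact: frac_rel0. Qed.

Lemma frac_sym a b : frac_rel a b -> frac_rel b a.
Proof.
case=> c [ch cP [h e]]; exists c; split=> //; exists (- h).
by rewrite mulNr -e; ring.
Qed.

Lemma frac_trans b a c : frac_rel a b -> frac_rel b c -> frac_rel a c.
Proof.
case=> u [[d uH] uP [h e]] [v [[d' vH] vP [h' e']]].
exists (u * v * fr_den b); split.
- by exists (d + d' + fr_deg b)%N; rewrite !dhomogM ?fr_denH.
- by rewrite !cp_mulN // fr_denP.
exists (h * v * fr_den c + h' * u * fr_den a).
rewrite (_ : (_ + _) * q = h * q * (v * fr_den c) + h' * q * (u * fr_den a)); last by ring.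
by rewrite -e -e'; ring.
Qed.

Definition frac_eqv := EquivalenceOn frac_refl frac_sym frac_trans.

Definition local_ring : Type := Quot frac_eqv.
HB.instance Definition _ := Choice.on local_ring.

Definition frac_cst (c : k) : frac :=
  @Frac c%:MP 1 0 (mpolyC_homog c) (dhomog1 _ _) (cp_1 P).

Definition frac_opp a : frac :=
  @Frac (- fr_num a) (fr_den a) (fr_deg a)
    (homogN (fr_numH a)) (fr_denH a) (fr_denP a).

Definition frac_add a b : frac :=
  @Frac (fr_num a * fr_den b + fr_den a * fr_num b) (fr_den a * fr_den b)
    (fr_deg a + fr_deg b)
    (dhomogD (dhomogM (fr_numH a) (fr_denH b)) (dhomogM (fr_denH a) (fr_numH b)))
    (dhomogM (fr_denH a) (fr_denH b)) (cp_mulN (fr_denP a) (fr_denP b)).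

Definition frac_mul a b : frac :=
  @Frac (fr_num a * fr_num b) (fr_den a * fr_den b) (fr_deg a + fr_deg b)
    (dhomogM (fr_numH a) (fr_numH b)) (dhomogM (fr_denH a) (fr_denH b))
    (cp_mulN (fr_denP a) (fr_denP b)).

Definition lr_cl a : local_ring := cl frac_eqv a.
Definition lr_opp : local_ring -> local_ring := qlift1 frac_eqv frac_opp.
Definition lr_add : local_ring -> local_ring -> local_ring := qlift2 frac_eqv frac_add.
Definition lr_mul : local_ring -> local_ring -> local_ring := qlift2 frac_eqv frac_mul.

Lemma lr_oppE a : lr_opp (lr_cl a) = lr_cl (frac_opp a).
Proof.
apply: qlift1E => x y [c [ch cP [h e]]]; exists c; split => //; exists (- h).
by rewrite [RHS]mulNr -e /=; ring.
Qed.

Lemma frac_rel_mul2 (u v : frac) (u' v' : frac) (w : frac) (w' : frac) (s t : A) :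
  frac_rel u v -> frac_rel u' v' ->
  fr_num w * fr_den w' - fr_num w' * fr_den w =
    s * (fr_num u * fr_den v - fr_num v * fr_den u) +
    t * (fr_num u' * fr_den v' - fr_num v' * fr_den u') ->
  frac_rel w w'.
Proof.
case=> c [[d cH] cP [h e]] [c' [[d' cH'] cP' [h' e']]] E.
exists (c * c'); split; [by exists (d + d')%N; apply: dhomogM | exact: cp_mulN|].
exists (s * c' * h + t * c * h'); rewrite E.
rewrite (_ : (_ + _) * q = s * c' * (h * q) + t * c * (h' * q)); last by ring.
by rewrite -e -e'; ring.
Qed.

Lemma lr_addE a b : lr_add (lr_cl a) (lr_cl b) = lr_cl (frac_add a b).
Proof.
apply: qlift2E => u v u' v' h h'.
by apply: (frac_rel_mul2 (s := fr_den u' * fr_den v') (t := fr_den u * fr_den v) h h') => /=; ring.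
Qed.

Lemma lr_mulE a b : lr_mul (lr_cl a) (lr_cl b) = lr_cl (frac_mul a b).
Proof.
apply: qlift2E => u v u' v' h h'.
by apply: (frac_rel_mul2 (s := fr_num u' * fr_den v') (t := fr_num v * fr_den u) h h') => /=; ring.
Qed.

Lemma lr_clW (Q : local_ring -> Prop) : (forall a, Q (lr_cl a)) -> forall x, Q x.
Proof. exact: clW. Qed.

Lemma lr_eq a b : fr_num a * fr_den b = fr_num b * fr_den a -> lr_cl a = lr_cl b.
Proof. by move=> /frac_rel0 h; apply/clP. Qed.

Lemma lr_addA : associative lr_add.
Proof.
elim/lr_clW=> a; elim/lr_clW=> b; elim/lr_clW=> c; rewrite !lr_addE.
by apply: lr_eq => /=; ring.
Qed.
Lemma lr_addC : commutative lr_add.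
Proof. by elim/lr_clW=> a; elim/lr_clW=> b; rewrite !lr_addE; apply: lr_eq => /=; ring. Qed.
Lemma lr_add0 : left_id (lr_cl (frac_cst 0)) lr_add.
Proof. by elim/lr_clW=> a; rewrite lr_addE; apply: lr_eq => /=; rewrite mpolyC0; ring. Qed.
Lemma lr_addN : left_inverse (lr_cl (frac_cst 0)) lr_opp lr_add.
Proof. by elim/lr_clW=> a; rewrite lr_oppE lr_addE; apply: lr_eq => /=; rewrite mpolyC0; ring. Qed.
HB.instance Definition _ :=
  GRing.isZmodule.Build local_ring lr_addA lr_addC lr_add0 lr_addN.

Lemma lr_clD a b : lr_cl a + lr_cl b = lr_cl (frac_add a b).
Proof. exact: lr_addE. Qed.

Lemma lr_mulA : associative lr_mul.
Proof.
elim/lr_clW=> a; elim/lr_clW=> b; elim/lr_clW=> c; rewrite !lr_mulE.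
by apply: lr_eq => /=; ring.
Qed.
Lemma lr_mulC : commutative lr_mul.
Proof. by elim/lr_clW=> a; elim/lr_clW=> b; rewrite !lr_mulE; apply: lr_eq => /=; ring. Qed.
Lemma lr_mul1 : left_id (lr_cl (frac_cst 1)) lr_mul.
Proof. by elim/lr_clW=> a; rewrite lr_mulE; apply: lr_eq => /=; rewrite mpolyC1; ring. Qed.
Lemma lr_mulD : left_distributive lr_mul +%R.
Proof.
elim/lr_clW=> a; elim/lr_clW=> b; elim/lr_clW=> c.
by rewrite !(lr_mulE, lr_clD); apply: lr_eq => /=; ring.
Qed.
HB.instance Definition _ := GRing.Zmodule_isComPzRing.Build local_ring
  lr_mulA lr_mulC lr_mul1 lr_mulD.

Lemma lr_clN a : - lr_cl a = lr_cl (frac_opp a).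
Proof. exact: lr_oppE. Qed.
Lemma lr_clM a b : lr_cl a * lr_cl b = lr_cl (frac_mul a b).
Proof. exact: lr_mulE. Qed.

End LocalRing.

Section Regular.
Variable U : opens conic_point.

Record regular := Regular {
  rg_val :> forall P, U P -> local_ring P;
  rg_loc : forall P, U P -> exists V : opens conic_point, exists (_ : V P) (VU : V `<=` U)
    (f g : A) (d : nat) (fH : f \is d.-homog) (gH : g \is d.-homog)
    (gV : forall Q, V Q -> g \notin cp_pred Q),
    forall Q (VQ : V Q), rg_val (VU Q VQ) = lr_cl (Frac fH gH (gV Q VQ)) }.

HB.instance Definition _ := gen_eqMixin regular.
HB.instance Definition _ := gen_choiceMixin regular.

Lemma regularP (s t : regular) : (forall P (UP : U P), s P UP = t P UP) -> s = t.
Proof.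
case: s t => [s sl] [t tl] /= e.
have ? : s = t.
  by apply: functional_extensionality_dep => x; apply: functional_extensionality_dep => Ux.
by subst t; congr Regular; apply: Prop_irrelevance.
Qed.

Program Definition rg_cst (c : k) : regular := {| rg_val := fun P UP => lr_cl (frac_cst P c) |}.
Next Obligation.
move=> c P UP; exists U, UP, (@subset_refl _ _), c%:MP, 1, 0%N.
by exists (mpolyC_homog c), (dhomog1 _ _), (fun Q _ => cp_1 Q).
Qed.

Program Definition rg_opp (s : regular) : regular := {| rg_val := fun P UP => - s P UP |}.
Next Obligation.
move=> s P UP; have [V [VP [VU [f [g [d [fH [gH [gV e]]]]]]]]] := rg_loc s UP.
exists V, VP, VU, (- f), g, d, (homogN fH), gH, gV => Q VQ /=.
by rewrite e lr_clN; apply: lr_eq.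
Qed.

Program Definition rg_add (s t : regular) : regular :=
  {| rg_val := fun P UP => s P UP + t P UP |}.
Next Obligation.
move=> s s' P UP; have [V [VP [VU [f [g [d [fH [gH [gV e]]]]]]]]] := rg_loc s UP.
have [V' [VP' [VU' [f' [g' [d' [fH' [gH' [gV' e']]]]]]]]] := rg_loc s' UP.
exists (interU V V'), (conj VP VP'), (subset_trans (@interUl _ V V') VU).
exists (f * g' + g * f'), (g * g'), (d + d')%N.
exists (dhomogD (dhomogM fH gH') (dhomogM gH fH')), (dhomogM gH gH').
exists (fun Q VQ => cp_mulN (gV Q (@interUl _ _ _ Q VQ)) (gV' Q (@interUr _ _ _ Q VQ))) => Q [VQ VQ'].
rewrite /= (Prop_irrelevance (subset_trans _ _ _) (VU Q VQ)) e.
by rewrite (Prop_irrelevance (VU Q VQ) (VU' Q VQ')) e' lr_clD; apply: lr_eq.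
Qed.

Program Definition rg_mul (s t : regular) : regular :=
  {| rg_val := fun P UP => s P UP * t P UP |}.
Next Obligation.
move=> s s' P UP; have [V [VP [VU [f [g [d [fH [gH [gV e]]]]]]]]] := rg_loc s UP.
have [V' [VP' [VU' [f' [g' [d' [fH' [gH' [gV' e']]]]]]]]] := rg_loc s' UP.
exists (interU V V'), (conj VP VP'), (subset_trans (@interUl _ V V') VU).
exists (f * f'), (g * g'), (d + d')%N.
exists (dhomogM fH fH'), (dhomogM gH gH').
exists (fun Q VQ => cp_mulN (gV Q (@interUl _ _ _ Q VQ)) (gV' Q (@interUr _ _ _ Q VQ))) => Q [VQ VQ'].
rewrite /= (Prop_irrelevance (subset_trans _ _ _) (VU Q VQ)) e.
by rewrite (Prop_irrelevance (VU Q VQ) (VU' Q VQ')) e' lr_clM; apply: lr_eq.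
Qed.

Lemma rg_addA : associative rg_add.
Proof. by move=> s t u; apply: regularP => P UP /=; rewrite addrA. Qed.
Lemma rg_addC : commutative rg_add.
Proof. by move=> s t; apply: regularP => P UP /=; rewrite addrC. Qed.
Lemma rg_add0 : left_id (rg_cst 0) rg_add.
Proof. by move=> s; apply: regularP => P UP; apply: (add0r (s P UP)). Qed.
Lemma rg_addN : left_inverse (rg_cst 0) rg_opp rg_add.
Proof. by move=> s; apply: regularP => P UP; apply: (addNr (s P UP)). Qed.
HB.instance Definition _ :=
  GRing.isZmodule.Build regular rg_addA rg_addC rg_add0 rg_addN.

Lemma rg_mulA : associative rg_mul.
Proof. by move=> s t u; apply: regularP => P UP /=; rewrite mulrA. Qed.
Lemma rg_mulC : commutative rg_mul.
Proof. by move=> s t; apply: regularP => P UP /=; rewrite mulrC. Qed.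
Lemma rg_mul1 : left_id (rg_cst 1) rg_mul.
Proof. by move=> s; apply: regularP => P UP; apply: (mul1r (s P UP)). Qed.
Lemma rg_mulD : left_distributive rg_mul +%R.
Proof. by move=> s t u; apply: regularP => P UP /=; rewrite mulrDl. Qed.
HB.instance Definition _ := GRing.Zmodule_isComPzRing.Build regular
  rg_mulA rg_mulC rg_mul1 rg_mulD.

Lemma rg_cst_zmod : zmod_morphism rg_cst.
Proof.
move=> c d; apply: regularP => P UP /=; rewrite lr_clN lr_clD; apply: lr_eq => /=.
by rewrite mpolyCB; ring.
Qed.
Lemma rg_cst_monoid : monoid_morphism rg_cst.
Proof.
split=> // c d; apply: regularP => P UP /=; rewrite lr_clM; apply: lr_eq => /=.
by rewrite mpolyCM; ring.
Qed.
HB.instance Definition _ := GRing.isZmodMorphism.Build k regular rg_cst rg_cst_zmod.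
HB.instance Definition _ := GRing.isMonoidMorphism.Build k regular rg_cst rg_cst_monoid.

End Regular.

Program Definition rg_res (U V : opens conic_point) (VU : V `<=` U) (s : regular U) : regular V :=
  {| rg_val := fun P VP => s P (VU P VP) |}.
Next Obligation.
move=> U V VU s P VP; have [W [WP [WU [f [g [d [fH [gH [gW e]]]]]]]]] := rg_loc s (VU P VP).
exists (interU V W), (conj VP WP), (@interUl _ _ _), f, g, d, fH, gH.
exists (fun Q VWQ => gW Q (@interUr _ _ _ Q VWQ)) => Q [VQ WQ].
by rewrite (Prop_irrelevance (VU Q _) (WU Q WQ)) e; apply: lr_eq.
Qed.

Section Res.
Variables (U V : opens conic_point) (VU : V `<=` U).

Lemma rg_res_zmod : zmod_morphism (rg_res VU).
Proof. by move=> s t; apply: regularP. Qed.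
Lemma rg_res_monoid : monoid_morphism (rg_res VU).
Proof. by split=> [|s t]; apply: regularP. Qed.
HB.instance Definition _ :=
  GRing.isZmodMorphism.Build (regular U) (regular V) (rg_res VU) rg_res_zmod.
HB.instance Definition _ :=
  GRing.isMonoidMorphism.Build (regular U) (regular V) (rg_res VU) rg_res_monoid.

End Res.

Lemma rg_sheaf : sheaf_axiom (F := regular) rg_res.
Proof.
move=> I U W WU cov s hs.
have ix P (UP : U P) : {i : I | W i P}.
  by apply: cid; have [i _ WiP] := cov P UP; exists i.
pose v P (UP : U P) := s (sval (ix P UP)) P (svalP (ix P UP)).
have vE i P (WP : W i P) (UP : U P) : v P UP = s i P WP.
  rewrite /v; case: (ix P UP) => j WjP; rewrite [svalP _](Prop_irrelevance _ WjP).
  have := congr1 (fun t : regular (interU (W j) (W i)) => rg_val t (conj WjP WP)) (hs j i).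
  rewrite /= (Prop_irrelevance (@interUl _ _ _ P _) WjP).
  rewrite (Prop_irrelevance (@interUr _ _ _ P _) WP) => ->.
  by [].
have vl P : U P -> exists V : opens conic_point, exists (_ : V P) (VU : V `<=` U)
    (f g : A) (d : nat) (fH : f \is d.-homog) (gH : g \is d.-homog)
    (gV : forall Q, V Q -> g \notin cp_pred Q),
    forall Q (VQ : V Q), v Q (VU Q VQ) = lr_cl (Frac fH gH (gV Q VQ)).
  move=> UP; have [i _ WP] := cov P UP.
  have [V [VP [VU [f [g [d [fH [gH [gV e]]]]]]]]] := rg_loc (s i) WP.
  exists V, VP, (subset_trans VU (WU i)), f, g, d, fH, gH, gV => Q VQ.
  by rewrite (vE i Q (VU Q VQ)).
exists (Regular vl); split=> [i|t ht].
  by apply: regularP => P WP /=; apply: vE.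
apply: regularP => P UP /=; have [i _ WP] := cov P UP.
rewrite (vE i P WP) -(ht i) /=.
by congr (t _ _); apply: Prop_irrelevance.
Qed.

Lemma rg_res_id U (UU : (U : opens conic_point) `<=` U) s : rg_res UU s = s.
Proof. by apply: regularP => P UP /=; congr (s _ _); apply: Prop_irrelevance. Qed.

Lemma rg_res_comp (U V W : opens conic_point) (VU : V `<=` U) (WV : W `<=` V)
  (WU : W `<=` U) s : rg_res WV (rg_res VU s) = rg_res WU s.
Proof. by apply: regularP => P UP /=; congr (s _ _); apply: Prop_irrelevance. Qed.

Lemma rg_res_cst (U V : opens conic_point) (VU : V `<=` U) c :
  rg_res VU (rg_cst U c) = rg_cst V c.
Proof. exact: regularP. Qed.

Definition conic : ringed_space k :=
  @RingedSpace k conic_point (fun U => regular U : comPzRingType)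
    (fun U V VU => rg_res VU : {rmorphism regular U -> regular V})
    (fun U => @rg_cst U : {rmorphism k -> regular U})
    rg_res_id rg_res_comp rg_res_cst rg_sheaf.

End Conic.

(* Main.v *)
(* Let [inf] be the point of the conic with [x_0 = 0]. It is unique, because there is no
   rational point; its residue field is quadratic over [k], and the coordinate ring [B] of
   the complement is a principal ideal domain. So a vector bundle is trivial away from
   [inf], and it is given by an invertible matrix over the function field [F], up to [GL(B)]
   on the left and [GL(O)] on the right, where [O] is the local ring at [inf]. If [t = x_0 / x_1]
   and [z = x_2 / x_0], the bundle [Omega] is given by [1/t], and the sum [B + k t z + t O] is
   all of [F]: this makes [[1/t, 0], [z, 1]] the only nonsplit extension of O by [Omega].
   As in Grothendieck's theorem on the projective line, splitting off a section of a minimal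
   twist triangularizes the matrix; the same decomposition of [F] then leaves at most
   one off-diagonal entry, which creates a Quillen block. Uniqueness holds because there is
   no nonzero homomorphism from a block to a block of smaller slope. *)

Require Import Defs.
From HB Require Import structures.
From mathcomp Require Import all_boot all_order all_algebra.
From mathcomp Require generic_quotient ring_quotient.
From mathcomp Require Import mpoly ring zify.
From mathcomp Require Import boolp classical_sets topology_structure.

Set Implicit Arguments.
Unset Strict Implicit.
Unset Printing Implicit Defensive.

Import Order.TTheory GRing.Theory Num.Theory.

Local Open Scope ring_scope.

(** * Matrices over a subring of a field *)

(** The argument is shaped by the residue field k(zeta) of [inf], where zeta is the value of z / y
    and y = 1 / t. Among the functions without pole at infinity, B has only k, whereas their values
    there fill k + k zeta. This gap of dimension one is the term k t z of the decomposition of F; it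
    makes division with remainder in B stop at equal pole orders, so that principality of ideals
    needs the absence of rational points a second time; and it is H^1(Omega), which creates the
    Quillen block. Pole orders are controlled by the norm to k[y]: its leading form is the norm form
    of k(zeta), and its anisotropy makes the order additive. As [inf] has degree 2, lines have even
    slopes 2n and Quillen blocks odd slopes 2n - 1. Distinct blocks thus have distinct slopes, and
    the ranks of the slope filtration recover all multiplicities. Omega is 1/t because the
    derivation y -> dq/dx_2, z -> - dq/dx_1 kills q and turns x_j dx_a - x_a dx_j into the third
    partial derivative up to sign. At each point the indices can be chosen so that this is
    invertible. *)

Section SubringMatrices.
Variable F : fieldType.

(** A [Prop]-valued predicate on one field: B, O and all local rings are cut out of F by existential
    conditions, and matrices over different subrings can be multiplied inside 'M[F]. *)
Record subring := Subring {
  sr_mem :> F -> Prop;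
  sr0 : sr_mem 0;
  sr1 : sr_mem 1;
  srD : forall a b, sr_mem a -> sr_mem b -> sr_mem (a + b);
  srN : forall a, sr_mem a -> sr_mem (- a);
  srM : forall a b, sr_mem a -> sr_mem b -> sr_mem (a * b) }.

Lemma srB (R : subring) a b : R a -> R b -> R (a - b).
Proof. by move=> ha hb; apply/srD/srN. Qed.

Lemma srX (R : subring) a n : R a -> R (a ^+ n).
Proof.
by move=> ha; elim: n => [|n ih]; rewrite ?expr0 ?exprS; [apply: sr1|apply: srM].
Qed.

Lemma sr_sum (R : subring) I (r : seq I) (P : pred I) (f : I -> F) :
  (forall i, R (f i)) -> R (\sum_(i <- r | P i) f i).
Proof. by move=> h; elim/big_ind: _ => //; [exact: sr0 | exact: srD]. Qed.

Definition mxin (R : F -> Prop) m n (a : 'M[F]_(m, n)) := forall i j, R (a i j).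

Section In.
Variable R : subring.

Lemma mxin0 m n : mxin R (0 : 'M_(m, n)).
Proof. by move=> i j; rewrite mxE; apply: sr0. Qed.

Lemma mxin_scalar n c : R c -> mxin R (c%:M : 'M_n).
Proof. by move=> hc i j; rewrite mxE; case: eqP => _ //=; apply: sr0. Qed.

Lemma mxin1 n : mxin R (1%:M : 'M_n).
Proof. exact/mxin_scalar/sr1. Qed.

Lemma mxinD m n (a b : 'M_(m, n)) : mxin R a -> mxin R b -> mxin R (a + b).
Proof. by move=> ha hb i j; rewrite mxE; apply: srD. Qed.

Lemma mxinN m n (a : 'M_(m, n)) : mxin R a -> mxin R (- a).
Proof. by move=> ha i j; rewrite mxE; apply: srN. Qed.

Lemma mxinB m n (a b : 'M_(m, n)) : mxin R a -> mxin R b -> mxin R (a - b).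
Proof. by move=> ha hb; apply/mxinD/mxinN. Qed.

Lemma mxinZ m n c (a : 'M_(m, n)) : R c -> mxin R a -> mxin R (c *: a).
Proof. by move=> hc ha i j; rewrite mxE; apply: srM. Qed.

Lemma mxinM m n p (a : 'M_(m, n)) (b : 'M_(n, p)) :
  mxin R a -> mxin R b -> mxin R (a *m b).
Proof. by move=> ha hb i j; rewrite mxE; apply: sr_sum => l; apply: srM. Qed.

End In.

Lemma mxin_row (R : F -> Prop) m n p (a : 'M_(m, n)) (b : 'M_(m, p)) :
  mxin R (row_mx a b) <-> mxin R a /\ mxin R b.
Proof.
split=> [h|[ha hb] i j]; last by rewrite mxE; case: split.
by split=> i j; [have := h i (lshift _ j); rewrite row_mxEl
               | have := h i (rshift _ j); rewrite row_mxEr].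
Qed.

Lemma mxin_col (R : F -> Prop) m n p (a : 'M_(m, n)) (b : 'M_(p, n)) :
  mxin R (col_mx a b) <-> mxin R a /\ mxin R b.
Proof.
split=> [h|[ha hb] i j]; last by rewrite mxE; case: split.
by split=> i j; [have := h (lshift _ i) j; rewrite col_mxEu
               | have := h (rshift _ i) j; rewrite col_mxEd].
Qed.

Lemma mxin_block (R : F -> Prop) m n p q (a : 'M_(m, n)) (b : 'M_(m, p))
    (c : 'M_(q, n)) (d : 'M_(q, p)) :
  mxin R a -> mxin R b -> mxin R c -> mxin R d -> mxin R (block_mx a b c d).
Proof. by move=> *; apply/mxin_col; split; apply/mxin_row. Qed.

Lemma mxin_map (R R' : F -> Prop) m n (a : 'M[F]_(m, n)) :
  (forall x, R x -> R' x) -> mxin R a -> mxin R' a.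
Proof. by move=> h ha i j; apply/h/ha. Qed.

(** The two sizes may differ, so that isomorphic lattices need not be assumed to have the same
    rank. *)
Definition mxinv (R : F -> Prop) m n (a : 'M[F]_(m, n)) (b : 'M_(n, m)) :=
  [/\ a *m b = 1%:M, b *m a = 1%:M, mxin R a & mxin R b].

Definition gl (R : F -> Prop) n (a : 'M_n) := exists b : 'M_n, mxinv R a b.

Lemma mxinv_sym R m n (a : 'M_(m, n)) b : mxinv R a b -> mxinv R b a.
Proof. by case. Qed.

Lemma mxinvM (R : subring) m n p (a : 'M_(m, n)) a' (b : 'M_(n, p)) b' :
  mxinv R a a' -> mxinv R b b' -> mxinv R (a *m b) (b' *m a').
Proof.
move=> [e1 e2 h1 h2] [e3 e4 h3 h4]; split; try exact: mxinM.
  by rewrite mulmxA -(mulmxA a) e3 mulmx1.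
by rewrite mulmxA -(mulmxA b') e2 mulmx1.
Qed.

Lemma mxinv1 (R : subring) n : mxinv R (1%:M : 'M_n) 1%:M.
Proof. by split; rewrite ?mulmx1 //; apply: mxin1. Qed.

Lemma mxinv_diag (R : subring) m n p q (a : 'M_(m, n)) a' (b : 'M_(p, q)) b' :
  mxinv R a a' -> mxinv R b b' -> mxinv R (block_mx a 0 0 b) (block_mx a' 0 0 b').
Proof.
move=> [e1 e2 h1 h2] [e3 e4 h3 h4].
split; try by apply: mxin_block => //; apply: mxin0.
all: by rewrite mulmx_block !mulmx0 !mul0mx !addr0 !add0r ?e1 ?e2 ?e3 ?e4 -scalar_mx_block.
Qed.

Lemma mxinv_low (R : subring) m n (c : 'M_(n, m)) : mxin R c ->
  mxinv R (block_mx 1%:M 0 c 1%:M) (block_mx 1%:M 0 (- c) 1%:M).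
Proof.
move=> hc; split; try by apply: mxin_block => //; try apply: mxinN => //; try apply: mxin1; apply: mxin0.
all: by rewrite mulmx_block !(mulmx0, mul0mx, mulmx1, mul1mx) !(addr0, add0r, subrr, addNr) -scalar_mx_block.
Qed.

Lemma gl_unitmx R n (a : 'M_n) : gl R a -> a \in unitmx.
Proof. by case=> b [e _ _ _]; case/mulmx1_unit: e. Qed.

Lemma glM (R : subring) n (a b : 'M_n) : gl R a -> gl R b -> gl R (a *m b).
Proof. by move=> [a' ha] [b' hb]; exists (b' *m a'); apply: mxinvM. Qed.

Lemma gl1 (R : subring) n : gl R (1%:M : 'M_n).
Proof. by exists 1%:M; apply: mxinv1. Qed.

Lemma gl_in R n (a : 'M_n) : gl R a -> mxin R a.
Proof. by case=> b []. Qed.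

Lemma gl_inv R n (a : 'M_n) : gl R a -> gl R (invmx a).
Proof.
move=> ha; have ua := gl_unitmx ha; case: ha => b [e1 e2 h1 h2].
have -> : invmx a = b by rewrite -[invmx a]mulmx1 -e1 mulmxA mulVmx // mul1mx.
by exists a.
Qed.

Lemma gl_map (R R' : F -> Prop) n (a : 'M[F]_n) :
  (forall x, R x -> R' x) -> gl R a -> gl R' a.
Proof. by move=> h [b [e1 e2 h1 h2]]; exists b; split=> //; apply: mxin_map h _. Qed.

Lemma mxin_gl (R : subring) m n (v : 'M_(m, n)) a : gl R a -> mxin R (v *m a) <-> mxin R v.
Proof.
case=> b [e1 e2 h1 h2]; split=> h; last exact: mxinM.
by rewrite -[v]mulmx1 -e1 mulmxA; apply: mxinM.
Qed.

Section RowReduction.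
Variables (R : subring) (X : F -> Prop).
Hypothesis X_lin : forall a b p u, X a -> X b -> R p -> R u -> X (a * p + b * u).
Hypothesis red2 : forall a b, X a -> X b -> exists p q u v,
  [/\ [/\ R p, R q, R u & R v], p * v - q * u = 1 & a * q + b * v = 0].

(** The tail is reduced by induction to one entry, which [red2] then clears against the head by a
    matrix of determinant 1. X is the domain on which [red2] is available: B itself for the Bezout
    ring B, all of F for a valuation ring. *)
Lemma row_reduction n (w : 'rV_(1 + n)) : mxin X w ->
  exists c d, [/\ gl R c, X d & w *m c = row_mx d%:M 0].
Proof.
elim: n w => [|n IH] w hw.
  exists 1%:M, (w 0 0); split=> //; first exact: gl1.
  rewrite mulmx1 -[LHS](hsubmxK (w : 'rV_(1 + 0))); congr row_mx; last by apply/matrixP=> i [].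
  by apply/matrixP=> i j; rewrite !ord1 !mxE; congr (w _ _); apply: val_inj.
have := hw; rewrite -[w](hsubmxK (w : 'rV_(1 + (1 + n)))).
set a := lsubmx _; set w1 := rsubmx _ => /mxin_row[ha hw1].
have [c1 [d1 [[c1' hc1] hd1 e1]]] := IH w1 hw1.
have [p [q [u [v [[hp hq hu hv] det ez]]]]] := red2 (ha 0 0) hd1.
(* The 2 x 2 matrix with rows (p, q) and (u, v), acting on the first two coordinates; as its
   determinant is 1, its inverse is again of the form [M]. *)
pose M p q u v : 'M[F]_(1 + (1 + n)) :=
  block_mx p%:M (row_mx q%:M 0) (col_mx u%:M 0) (block_mx v%:M 0 0 1%:M).
have inM p' q' u' v' : R p' -> R q' -> R u' -> R v' -> mxin R (M p' q' u' v').
  move=> h1 h2 h3 h4; apply: mxin_block; first exact: mxin_scalar.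
  - by apply/mxin_row; split; [apply: mxin_scalar | apply: mxin0].
  - by apply/mxin_col; split; [apply: mxin_scalar | apply: mxin0].
  by apply: mxin_block; [apply: mxin_scalar|apply: mxin0|apply: mxin0|apply: mxin1].
have smM (x y : F) : x%:M *m y%:M = (x * y)%:M :> 'M_1 by rewrite scalar_mxM.
have smD (x y : F) : x%:M + y%:M = (x + y)%:M :> 'M_1 by rewrite raddfD.
have MM p1 q1 u1 v1 p2 q2 u2 v2 : M p1 q1 u1 v1 *m M p2 q2 u2 v2 =
    M (p1 * p2 + q1 * u2) (p1 * q2 + q1 * v2) (u1 * p2 + v1 * u2) (u1 * q2 + v1 * v2).
  rewrite /M mulmx_block mul_row_block mul_row_col mul_mx_row mul_block_col mul_col_mx mul_col_row.
  by rewrite mulmx_block !(mulmx0, mul0mx, addr0, add0r, mulmx1) !smM add_row_mx add_col_mx add_block_mx !smD !(addr0, add0r).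
have rM a0 d0 p0 q0 u0 v0 : row_mx a0%:M (row_mx d0%:M 0) *m M p0 q0 u0 v0 =
    row_mx (a0 * p0 + d0 * u0)%:M (row_mx (a0 * q0 + d0 * v0)%:M 0 : 'rV_(1 + n)).
  rewrite mul_row_block mul_mx_row mul_row_block mul_row_col.
  by rewrite !(mulmx0, mul0mx, addr0, add0r) !smM !smD add_row_mx addr0 smD.
have M1 : M 1 0 0 1 = 1%:M.
  rewrite /M !(raddf0 (@scalar_mx _ 1)) row_mx0 col_mx0.
  by rewrite -(scalar_mx_block 1 n) -scalar_mx_block.
have hM : mxinv R (M p q u v) (M v (- q) (- u) p).
  split; try by apply: inM => //; apply: srN.
    rewrite MM -M1; congr (M _ _ _ _); rewrite -?det; ring.
  rewrite MM -M1; congr (M _ _ _ _); rewrite -?det; ring.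
exists (block_mx 1%:M 0 0 c1 *m M p q u v), (a 0 0 * p + d1 * u); split.
- exists (M v (- q) (- u) p *m block_mx 1%:M 0 0 c1').
  by apply: mxinvM hM; apply: mxinv_diag hc1; apply: mxinv1.
- exact: X_lin.
rewrite mulmxA mul_row_block !mulmx0 mulmx1 addr0 add0r e1.
by rewrite {1}[a]mx11_scalar rM ez raddf0 row_mx0.
Qed.

End RowReduction.

End SubringMatrices.

Section Subring.
Variables (F : fieldType) (R : subring F).

Lemma gl_lower m n (a : 'M[F]_m) (c : 'M_(n, m)) (b : 'M_n) : gl R a -> gl R b -> mxin R c ->
  gl R (block_mx a 0 c b).
Proof.
move=> ha hb hc; have ua := gl_unitmx ha.
have -> : block_mx a 0 c b = block_mx 1%:M 0 (c *m invmx a) 1%:M *m block_mx a 0 0 b.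
  by rewrite mulmx_block !(mul1mx, mulmx0, mul0mx, addr0, add0r) mulmxKV.
apply: glM; first by eexists; apply: mxinv_low; apply: mxinM => //; apply: gl_in (gl_inv ha).
by case: ha => a' ha'; case: hb => b' hb'; eexists; apply: mxinv_diag ha' hb'.
Qed.

Lemma gl_scalar c : c != 0 -> R c -> R c^-1 -> gl R (c%:M : 'M_1).
Proof.
move=> c0 h1 h2; exists c^-1%:M.
by split; rewrite -?scalar_mxM ?mulfV ?mulVf //; apply: mxin_scalar.
Qed.

(** One of a / b and b / a lies in R, and a multiple of one entry then clears the other; a and b
    themselves need not lie in R. *)
Lemma valuation_red2 : (forall f, R f \/ R f^-1) -> forall a b : F, exists p q u v : F,
  [/\ [/\ R p, R q, R u & R v], p * v - q * u = 1 & a * q + b * v = 0].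
Proof.
move=> val a b; have [b0|b0] := eqVneq b 0.
  exists 1, 0, 0, 1; split; try by split; try apply: sr0; apply: sr1.
    by ring.
  by rewrite b0; ring.
have [h|h] := val (a / b).
  exists 0, 1, (- 1), (- (a / b)); split; last by field.
    by split; try apply: srN => //; try apply: sr0; apply: sr1.
  by ring.
have [a0|a0] := eqVneq a 0.
  exists 0, 1, (- 1), 0; split; last by rewrite a0; ring.
    by split; try apply: srN; try apply: sr0; apply: sr1.
  by ring.
exists 1, (- (b / a)), 0, 1; split; last by field.
  by split; try apply: srN; try apply: sr0; try apply: sr1; rewrite -invf_div.
by ring.
Qed.

End Subring.

(** * Classification of lattices *)

(* [aB] is the coordinate ring of the affine conic, [aO] the local ring at infinity with
   uniformizer [at_], and [az] the coordinate whose value [at_ * az] at infinity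
   generates the quadratic residue field. *)
Record conic_rings (k : fieldType) := ConicRings {
  aF :> fieldType;
  ai : {rmorphism k -> aF};
  aB : subring aF;
  aO : subring aF;
  at_ : aF;
  az : aF;
  at0 : at_ != 0;
  aBz : aB az;
  aBt : aB at_^-1;
  aBk : forall c, aB (ai c);
  aOk : forall c, aO (ai c);
  aOt : aO at_;
  aOz : aO (at_ * az);
  aOtV : ~ aO at_^-1;
  aBO : forall f, aB f -> aO f -> exists c, f = ai c;
  a_dec : forall f, exists b c o, [/\ aB b, aO o & f = b + ai c * (at_ * az) + at_ * o];
  a_indep : forall a b, aO ((ai a + ai b * (at_ * az)) / at_) -> a = 0 /\ b = 0;
  a_val : forall f, f != 0 -> exists (n : int) u, [/\ aO u, aO u^-1 & f = at_ ^ n * u];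
  a_bezout : forall a b, aB a -> aB b -> exists d p u a' b',
    [/\ [/\ aB p, aB u, aB a' & aB b'], a = d * a', b = d * b' & d = a * p + b * u] }.

Section Classification.
Variables (k : fieldType) (D : conic_rings k).
Local Notation F := (aF D).
Local Notation B := (aB D).
Local Notation O := (aO D).
Local Notation t := (at_ D).
Local Notation z := (az D).
Local Notation i := (ai D).
Let t0 : t != 0 := at0 D.

(** The double coset relation of GL(B) \ GL(F) / GL(O). It is enough to ask that u and u' be
    integral: for invertible g and h the two equations force them to be inverse to each other. *)
Definition lattice_iso r s (g : 'M[F]_r) (h : 'M[F]_s) :=
  exists (a : 'M_(r, s)) (a' : 'M_(s, r)) (u : 'M_(r, s)) (u' : 'M_(s, r)),
    [/\ mxinv B a a', mxin O u, mxin O u', a *m h = g *m u & a' *m g = h *m u'].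

Lemma lattice_iso_refl r (g : 'M_r) : lattice_iso g g.
Proof.
exists 1%:M, 1%:M, 1%:M, 1%:M; split; rewrite ?mulmx1 ?mul1mx //; try exact: mxin1.
exact: mxinv1.
Qed.

Lemma lattice_iso_sym r s (g : 'M_r) (h : 'M_s) : lattice_iso g h -> lattice_iso h g.
Proof. by case=> a [a' [u [u' [ha *]]]]; exists a', a, u', u; split=> //; apply: mxinv_sym. Qed.

Lemma lattice_iso_trans r s p (g : 'M_r) (h : 'M_s) (l : 'M_p) :
  lattice_iso g h -> lattice_iso h l -> lattice_iso g l.
Proof.
case=> a [a' [u [u' [ha hu hu' e e']]]] [b [b' [w [w' [hb hw hw' f f']]]]].
exists (a *m b), (b' *m a'), (u *m w), (w' *m u'); split; try exact: mxinM.
- exact: mxinvM.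
- by rewrite -mulmxA f mulmxA e mulmxA.
- by rewrite -mulmxA e' mulmxA f' mulmxA.
Qed.

Lemma lattice_isoZ r s (g : 'M_r) (h : 'M_s) c :
  lattice_iso g h -> lattice_iso (c *: g) (c *: h).
Proof.
case=> a [a' [u [u' [ha hu hu' e e']]]]; exists a, a', u, u'; split=> //.
  by rewrite -scalemxAr e scalemxAl.
by rewrite -scalemxAr e' scalemxAl.
Qed.

Lemma lattice_iso_diag r s r' s' (g : 'M_r) (h : 'M_s) (g' : 'M_r') (h' : 'M_s') :
  lattice_iso g h -> lattice_iso g' h' ->
  lattice_iso (block_mx g 0 0 g') (block_mx h 0 0 h').
Proof.
case=> a [a' [u [u' [ha hu hu' e e']]]] [b [b' [w [w' [hb hw hw' f f']]]]].
exists (block_mx a 0 0 b), (block_mx a' 0 0 b'), (block_mx u 0 0 w), (block_mx u' 0 0 w').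
split; try by apply: mxin_block => //; apply: mxin0.
- exact: mxinv_diag.
all: by rewrite !mulmx_block !(mulmx0, mul0mx, addr0, add0r) ?e ?e' ?f ?f'.
Qed.

Lemma lattice_iso_gl r (g a u : 'M_r) : gl B a -> gl O u -> lattice_iso g (a *m g *m u).
Proof.
move=> [a' ha] [u' hu]; exists a', a, u, u'.
have [e1 e2 h1 h2] := ha; have [f1 f2 k1 k2] := hu.
split=> //.
  by rewrite !mulmxA e2 mul1mx.
by rewrite -!mulmxA f1 mulmx1.
Qed.

Definition blk_rank (c : bool) := if c then 2%N else 1%N.

(* [true] stands for the Quillen block, the nonsplit extension of O by O(-1). *)
Definition blk (c : bool) : 'M[F]_(blk_rank c) :=
  if c return 'M[F]_(blk_rank c)
  then block_mx (t^-1%:M : 'M_1) (0 : 'M_1) (z%:M : 'M_1) (1%:M : 'M_1) else 1%:M.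

Fixpoint std_dim (s : seq (bool * int)) : nat :=
  if s is b :: s' then (blk_rank b.1 + std_dim s')%N else 0%N.

Fixpoint std (s : seq (bool * int)) : 'M[F]_(std_dim s) :=
  if s is b :: s' return 'M[F]_(std_dim s)
  then block_mx (t ^ b.2 *: blk b.1) 0 0 (std s') else 0.

Definition twist (n : int) (s : seq (bool * int)) := [seq (b.1, b.2 + n) | b <- s].

Lemma std_twist n s : lattice_iso (t ^ n *: std s) (std (twist n s)).
Proof.
elim: s => [|b s IH] /=.
  by exists 0, 0, 0, 0; split; try (by move=> []); first split; try apply/matrixP; move=> [].
rewrite scale_block_mx !scaler0; apply: lattice_iso_diag IH.
by rewrite scalerA -expfzDr // addrC; apply: lattice_iso_refl.
Qed.

Lemma std_move s1 b s2 : lattice_iso (std (s1 ++ b :: s2)) (std (b :: s1 ++ s2)).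
Proof.
elim: s1 => [|c s1 IH] /=; first exact: lattice_iso_refl.
apply: lattice_iso_trans (lattice_iso_diag (lattice_iso_refl _) IH) _.
(* The exchange of the first two of three blocks. Its entries are 0 and 1, so that it serves both
   over B and over O. *)
pose sw m n p : 'M[F]_(m + (n + p), n + (m + p)) :=
  block_mx 0 (row_mx 1%:M 0) (col_mx 1%:M 0) (block_mx 0 0 0 1%:M).
have swK m n p : sw m n p *m sw n m p = 1%:M.
  rewrite /sw mulmx_block mul_row_col mul_col_mx mul_mx_row mul_col_row mul_row_block mul_block_col mulmx_block.
  rewrite !(mulmx0, mul0mx, mulmx1, mul1mx, addr0, add0r, row_mx0, col_mx0, add_block_mx).
  by rewrite -!scalar_mx_block.
have sw_in (R : subring F) m n p : mxin R (sw m n p).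
  apply: mxin_block; first exact: mxin0.
  - by apply/mxin_row; split; [apply: mxin1 | apply: mxin0].
  - by apply/mxin_col; split; [apply: mxin1 | apply: mxin0].
  by apply: mxin_block; try apply: mxin0; apply: mxin1.
have swE m n p (g1 : 'M_m) (h1 : 'M_n) (l1 : 'M_p) :
    sw m n p *m block_mx h1 0 0 (block_mx g1 0 0 l1) =
    block_mx g1 0 0 (block_mx h1 0 0 l1) *m sw m n p.
  rewrite /sw !mulmx_block !(mulmx0, mul0mx, addr0, add0r).
  rewrite !(mul_row_block, mul_block_col, mul_col_mx, mul_mx_row, mulmx_block).
  by rewrite !(mulmx0, mul0mx, addr0, add0r, mulmx1, mul1mx).
have gen m n p (g1 : 'M_m) (h1 : 'M_n) (l1 : 'M_p) :
    lattice_iso (block_mx g1 0 0 (block_mx h1 0 0 l1)) (block_mx h1 0 0 (block_mx g1 0 0 l1)).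
  by exists (sw m n p), (sw n m p), (sw m n p), (sw n m p); split=> //; split.
exact: gen.
Qed.

Lemma OtX (n : nat) f : O f -> O (t ^+ n * f).
Proof. by move=> hf; apply: srM hf; apply/srX/aOt. Qed.

Lemma pole_bound m n (a : 'M[F]_(m, n)) : exists N : nat, mxin O (t ^+ N *: a).
Proof.
have h (x : 'I_m * 'I_n) : exists N : nat, O (t ^+ N * a x.1 x.2).
  have [->|fn0] := eqVneq (a x.1 x.2) 0; first by exists 0; rewrite mulr0; apply: sr0.
  have [[N|N] [u [hu _ ->]]] := a_val fn0.
    by exists 0; rewrite mul1r; apply: OtX.
  by exists N.+1; rewrite NegzE -exprnN mulrA divff ?mul1r // expf_neq0.
have [N hN] := choice h; exists (\sum_x N x)%N => x y; rewrite mxE.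
by rewrite (bigD1 (x, y)) //= addnC exprD -mulrA; apply/OtX/hN.
Qed.

(** The vanishing of H^0(O(-1)): an element of B that vanishes at infinity is a constant, and a
    nonzero constant is a unit there. *)
Lemma BtO f : B f -> O (f / t) -> f = 0.
Proof.
move=> hb ho; have ho' : O f by rewrite -[f](divfK t0); apply: srM ho _; apply: aOt.
have [c e] := aBO hb ho'; have [c0|c0] := eqVneq c 0; first by rewrite e c0 rmorph0.
case: (@aOtV _ D); rewrite -[t^-1]mul1r -(divff (_ : i c != 0)) ?fmorph_eq0 //.
by rewrite mulrC mulrA -fmorphV; apply: srM; [rewrite mulrC -e | apply: aOk].
Qed.

Lemma mxin_tO_eq0 m n (v : 'M[F]_(m, n)) : mxin B v -> mxin O (t^-1 *: v) -> v = 0.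
Proof.
move=> hb ho; apply/matrixP=> x y; rewrite [RHS]mxE; apply: BtO => //.
by have := ho x y; rewrite mxE mulrC.
Qed.

(** The bundle has nonzero sections after a large twist by [pole_bound], and none after a very
    negative one by [BtO]; n is the least twist that has one. *)
Lemma minimal_twist r (g : 'M[F]_r.+1) : g \in unitmx -> exists n : int,
  (exists v : 'rV_r.+1, [/\ v != 0, mxin B v & mxin O (t ^ n *: (v *m g))]) /\
  forall v : 'rV_r.+1, mxin B v -> mxin O (t^-1 *: (v *m (t ^ n *: g))) -> v = 0.
Proof.
move=> gu; pose P (n : int) := exists v : 'rV_r.+1,
  [/\ v != 0, mxin B v & mxin O (t ^ n *: (v *m g))].
have [N0 hN0] := pole_bound (delta_mx 0 0 *m g : 'rV_r.+1).
have PN0 : P N0.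
  exists (delta_mx 0 0); split=> //.
    by apply/eqP => /rowP/(_ 0); rewrite !mxE !eqxx; apply/eqP/oner_neq0.
  by move=> x y; rewrite mxE; case: (_ && _) => /=; [apply: sr1 | apply: sr0].
(* The extra factor 1/t is what [mxin_tO_eq0] asks for: an integral t^(-N1) v g, multiplied by this
   matrix, makes t^-1 v integral. *)
have [N1 hN1] := pole_bound (t^-1 *: invmx g).
have PN1 : ~ P (- N1%:Z).
  case=> v [/eqP v0 hv h]; apply: v0; apply: mxin_tO_eq0 => //.
  have := mxinM h hN1; rewrite -!(scalemxAl, scalemxAr) !scalerA -mulmxA mulmxV // mulmx1.
  by rewrite mulrA -[t ^+ N1]/(t ^ N1) -expfzDr // addNr mul1r.
have ex : exists j : nat, `[< P (j%:Z - N1%:Z) >].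
  by exists (N0 + N1)%N; apply/asboolP; rewrite PoszD addrK.
case: (ex_minnP ex) => -[|j] /asboolP hj hmin; first by rewrite sub0r in hj.
exists (j.+1%:Z - N1%:Z); split=> // v hv h; apply: contrapT => /eqP v0.
suff : (j.+1 <= j)%N by rewrite ltnn.
apply/hmin/asboolP; exists v; split=> //; move: h.
rewrite -scalemxAr scalerA -[t^-1]/(t ^ (-1)) -expfzDr //.
by congr (mxin _ (t ^ _ *: _)); lia.
Qed.

Lemma a_bezout2 a b : B a -> B b -> exists p q u v,
  [/\ [/\ B p, B q, B u & B v], p * v - q * u = 1 & a * q + b * v = 0].
Proof.
move=> ha hb; have [d [p [u [a' [b' [[hp hu ha' hb'] ea eb ed]]]]]] := a_bezout ha hb.
have [d0|d0] := eqVneq d 0.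
  exists 1, 0, 0, 1; split; try by split; try apply: sr0; apply: sr1.
    ring.
  by rewrite ea eb d0; ring.
exists p, (- b'), u, a'; split; first by split=> //; apply: srN.
  by apply: (mulfI d0); rewrite {2}ed ea eb; ring.
by rewrite ea eb; ring.
Qed.

Lemma O_valuation f : O f \/ O f^-1.
Proof.
have [->|f0] := eqVneq f 0; first by left; apply: sr0.
have [[n|n] [u [hu hu' ->]]] := a_val f0; [left|right]; first exact: OtX.
by rewrite invfM NegzE -exprnN invrK; apply: OtX.
Qed.

(** A section of minimal twist vanishes nowhere. On the affine part one divides by its content d; a
    zero at infinity would leave a section of the previous twist. The section thus spans a trivial
    subbundle, which is the first row of the new matrix. *)
Lemma split_minimal r (g : 'M[F]_(1 + r)) : g \in unitmx ->
  (exists v : 'rV_(1 + r), [/\ v != 0, mxin B v & mxin O (v *m g)]) ->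
  (forall v : 'rV_(1 + r), mxin B v -> mxin O (t^-1 *: (v *m g)) -> v = 0) ->
  exists c g', g' \in unitmx /\ lattice_iso g (block_mx (1%:M : 'M_1) 0 c (g' : 'M_r)).
Proof.
move=> gu [v [v0 vB vO]] hmin.
have [al [d [alB dB e]]] := row_reduction
  (fun a b p u ha hb hp hu => srD (srM ha hp) (srM hb hu)) a_bezout2 vB.
have alu := gl_unitmx alB.
have d0 : d != 0.
  apply: contraNneq v0 => d0; rewrite -[v]mulmx1 -(mulmxV alu) mulmxA e d0.
  by rewrite raddf0 row_mx0 mul0mx.
(* The section v divided by its content d. As a row of [invmx al] it is part of a basis over B. *)
pose w := (row_mx 1%:M 0 : 'rV_(1 + r)) *m invmx al.
have wB : mxin B w.
  by apply/(mxin_gl _ (gl_inv alB))/mxin_row; split; [apply: mxin1|apply: mxin0].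
have wE : w = d^-1 *: v.
  rewrite -[v]mulmx1 -(mulmxV alu) mulmxA e /w scalemxAl; congr (_ *m _).
  by rewrite scale_row_mx scaler0 scale_scalar_mx mulVf.
have w0 : w != 0.
  by rewrite wE scaler_eq0 negb_or invr_eq0 d0.
(* Dividing by d creates no pole at infinity: if d has no pole there it is a constant, and otherwise
   d^-1 lies in O. *)
have wO : mxin O (w *m g).
  rewrite wE -scalemxAl; apply: mxinZ => //.
  have [[n|n] [u [hu hu' ed]]] := a_val d0.
    have [c ec] : exists c, d = i c by apply: aBO => //; rewrite ed; apply: OtX.
    by rewrite ec -fmorphV; apply: aOk.
  by rewrite ed invfM NegzE -exprnN invrK; apply: OtX.
have := row_reduction (X := fun=> True) (fun a b p u _ _ _ _ => I) (fun a b _ _ => valuation_red2 O_valuation a b)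
  (w := w *m g) (fun _ _ => I).
case=> ga [p [gaO _ e2]]; have gau := gl_unitmx gaO.
have p0 : p != 0.
  apply: contraNneq w0 => p0; rewrite -[w]mulmx1 -(mulmxV gu) mulmxA -[w *m g]mulmx1.
  by rewrite -(mulmxV gau) (mulmxA _ ga) e2 p0 raddf0 row_mx0 !mul0mx.
have pO : O p by have := (mxin_gl (w *m g) gaO).2 wO; rewrite e2 => /mxin_row[/(_ 0 0)]; rewrite mxE.
(* A positive valuation of p would make t^-1 w g integral, against the minimality of the twist. *)
have pV : O p^-1.
  have [[[|n]|n] [u [hu hu' ep]]] := a_val p0.
  - by rewrite ep mul1r.
  - case/eqP: w0; apply: hmin => //; apply/(mxin_gl _ gaO).
    rewrite -scalemxAl e2 scale_row_mx scaler0; apply/mxin_row; split; last exact: mxin0.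
    rewrite scale_scalar_mx; apply: mxin_scalar; rewrite ep -exprnP exprS -mulrA mulKf //.
    exact: OtX.
  - by rewrite ep invfM NegzE -exprnN invrK; apply: OtX.
pose de : 'M[F]_(1 + r) := block_mx p^-1%:M 0 0 1%:M.
have deO : gl O de.
  exists (block_mx p%:M 0 0 1%:M); apply: mxinv_diag (mxinv1 _ _).
  by split; rewrite -?scalar_mxM ?mulVf ?mulfV //; apply: mxin_scalar.
pose g1 := invmx al *m g *m (ga *m de).
have e3 : usubmx g1 = row_mx 1%:M 0.
  have -> : usubmx g1 = row_mx 1%:M 0 *m g1.
    rewrite -[g1 in RHS]vsubmxK mul_row_col mul1mx mul0mx addr0 //.
  rewrite /g1 !mulmxA -/w e2 mul_row_block !(mulmx0, mul0mx, addr0, add0r) -scalar_mxM mulfV //.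
exists (dlsubmx g1), (drsubmx g1).
have eg : g1 = block_mx 1%:M 0 (dlsubmx g1) (drsubmx g1).
  rewrite -[LHS]submxK /ulsubmx /ursubmx e3 row_mxKl row_mxKr //.
split; last by rewrite -eg; apply: lattice_iso_gl; [apply: gl_inv | apply: glM].
have : g1 \in unitmx by rewrite !unitmx_mul unitmx_inv alu gu gau (gl_unitmx deO).
by rewrite {1}eg !unitmxE det_lblock det1 mul1r.
Qed.

Lemma lattice_iso_corner r s (c : 'cV[F]_r) (g : 'M_r) (h : 'M_s) :
  lattice_iso g h -> exists c', lattice_iso (block_mx (1%:M : 'M_1) 0 c g) (block_mx (1%:M : 'M_1) 0 c' h).
Proof.
case=> a [a' [u [u' [ha hu hu' e e']]]]; exists (a' *m c).
exists (block_mx 1%:M 0 0 a), (block_mx 1%:M 0 0 a'), (block_mx 1%:M 0 0 u), (block_mx 1%:M 0 0 u').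
have [a1 _ _ _] := ha.
split; try by apply: mxin_block => //; try apply: mxin0; apply: mxin1.
- by apply: mxinv_diag ha; apply: mxinv1.
- by rewrite !mulmx_block !(mulmx0, mul0mx, addr0, add0r, mul1mx, mulmx1) mulmxA a1 mul1mx e.
- by rewrite !mulmx_block !(mulmx0, mul0mx, addr0, add0r, mul1mx, mulmx1) e'.
Qed.

(** The column below the 1 is an extension class, which matters only modulo B^r + h O^r: row
    operations over B remove b, and column operations over O remove h o. *)
Lemma corner_clean r (h : 'M[F]_r) (b o c : 'cV_r) : mxin B b -> mxin O o ->
  lattice_iso (block_mx (1%:M : 'M_1) 0 (b + h *m o + c) h) (block_mx (1%:M : 'M_1) 0 c h).
Proof.
move=> hb ho.
have -> : block_mx (1%:M : 'M_1) 0 c h =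
  block_mx 1%:M 0 (- b) 1%:M *m block_mx (1%:M : 'M_1) 0 (b + h *m o + c) h *m block_mx 1%:M 0 (- o) 1%:M.
  rewrite !mulmx_block !(mulmx0, mul0mx, addr0, add0r, mul1mx, mulmx1) mulmxN.
  by congr block_mx; rewrite -(addrA b) addKr addrAC subrr add0r.
by apply: lattice_iso_gl; eexists; apply: mxinv_low; apply: mxinN.
Qed.

(** The blocks h for which B^r + h O^r is everything ([good_blk_clean]); all others have a short
    vector ([bad_blk_short]). In terms of [slope] below, the condition is slope at most 1. *)
Definition good (b : bool * int) := if b.1 then b.2 <= 1 else b.2 <= 0.

Lemma quillen_blk n : t ^ n *: blk true =
  block_mx (t ^ n / t)%:M 0 (t ^ n * z)%:M (t ^ n)%:M :> 'M_(1 + 1).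
Proof.
apply: etrans (@scale_block_mx _ 1 1 1 1 _ _ _ _ _) _.
by rewrite scaler0 !scale_scalar_mx mulr1.
Qed.

Lemma OtXz (n : int) f : 0 <= n -> O f -> O (t ^ n * f).
Proof. by case: n => // n _; apply: OtX. Qed.

(** The vanishing of H^1(O): both remaining terms of [a_dec] are integral at infinity. *)
Lemma O_dec f : exists b o, [/\ B b, O o & f = b + o].
Proof.
have [b [c [o [hb ho e]]]] := a_dec f.
exists b, (i c * (t * z) + t * o); split=> //; last by rewrite addrA.
by apply: srD; apply: srM => //; [apply: aOk | apply: aOz | apply: aOt].
Qed.

Lemma quillen_clean n (c : 'cV[F]_(1 + 1)) : n <= 1 -> exists b o : 'cV_(1 + 1),
  [/\ mxin B b, mxin O o &
      c = b + (block_mx (t ^ n / t)%:M 0 (t ^ n * z)%:M (t ^ n)%:M : 'M_(1 + 1)) *m o].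
Proof.
move=> hn; have [b1 [o1 [hb1 ho1 e1]]] := O_dec (usubmx c 0 0).
have [b2 [al [o2 [hb2 ho2 e2]]]] := a_dec (dsubmx c 0 0 - t * z * o1).
(* The obstruction al t z in the second row is absorbed by adding the constant al to o1, since the
   block multiplies the first entry of o by z there. In the first row this is compensated by
   subtracting al from b1, which is allowed because constants lie in B and in O. *)
exists (col_mx (b1 - i al)%:M b2%:M).
exists (t ^ (1 - n) *: col_mx (o1 + i al)%:M o2%:M); split.
- by apply/mxin_col; split; apply: mxin_scalar => //; apply: srB hb1 _; apply: aBk.
- apply: mxinZ; first by rewrite -[t ^ _]mulr1; apply: OtXz; [lia | apply: sr1].
  by apply/mxin_col; split; apply: mxin_scalar => //; apply: srD => //; apply: aOk.
have tn : t ^ (1 - n) * t ^ n = t by rewrite -expfzDr // subrK expr1z.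
rewrite -scalemxAr scalemxAl (@scale_block_mx _ 1 1 1 1) !scale_scalar_mx scaler0 !mulrA tn divff //.
rewrite mul_block_col !mul0mx addr0 mul1mx -!scalar_mxM -[c in LHS]vsubmxK add_col_mx -!(raddfD (@scalar_mx _ 1)) /=.
congr col_mx; rewrite [LHS]mx11_scalar; congr scalar_mx; first by rewrite e1; ring.
by rewrite -[LHS](subrK (t * z * o1)) e2; ring.
Qed.

Lemma good_blk_clean b (c : 'cV[F]_(blk_rank b.1)) : good b ->
  exists b' o, [/\ mxin B b', mxin O o & c = b' + (t ^ b.2 *: blk b.1) *m o].
Proof.
case: b c => -[] n /= c; rewrite /good /= => hn.
  by rewrite quillen_blk; apply: quillen_clean.
have [b [o [hb ho e]]] := O_dec (c 0 0).
exists b%:M, (t ^ (- n) * o)%:M; split; try exact: mxin_scalar.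
  by apply/mxin_scalar/OtXz => //; lia.
rewrite scale_scalar_mx mulr1 -scalar_mxM mulrA -expfzDr // subrr mul1r -raddfD /=.
by rewrite [c]mx11_scalar e.
Qed.

Lemma good_clean s (c : 'cV[F]_(std_dim s)) : all good s ->
  exists b o, [/\ mxin B b, mxin O o & c = b + std s *m o].
Proof.
elim: s c => [|b s IH] c /=.
  by exists 0, 0; split; [apply: mxin0|apply: mxin0|apply/matrixP=> -[]].
move=> /andP[gb gs]; rewrite -[c]vsubmxK.
have [b1 [o1 [hb1 ho1 ->]]] := good_blk_clean (usubmx c) gb.
have [b2 [o2 [hb2 ho2 ->]]] := IH (dsubmx c) gs.
exists (col_mx b1 b2), (col_mx o1 o2); split; try by apply/mxin_col.
by rewrite mul_block_col !mul0mx addr0 add0r add_col_mx.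
Qed.

(* Nonzero such [w] are the sections of the bundle twisted by -1. *)
Definition short r (g : 'M[F]_r) (w : 'rV_r) := mxin B w /\ mxin O (t^-1 *: (w *m g)).

Definition indep r (v w : 'rV[F]_r) :=
  forall al be, i al *: v + i be *: w = 0 -> al = 0 /\ be = 0.

Lemma OtXV (n : int) f : 1 <= n -> O f -> O (t^-1 * (t ^ n * f)).
Proof. by move=> hn hf; rewrite mulrA -[t^-1]/(t ^ (-1)) -expfzDr //; apply: OtXz => //; lia. Qed.

Lemma indep_quillen : indep (row_mx 1%:M 0 : 'rV_(1 + 1)) (row_mx 0 1%:M).
Proof.
move=> al be; rewrite !scale_row_mx !scaler0 add_row_mx addr0 add0r !scale_scalar_mx !mulr1.
rewrite -row_mx0 => /eq_row_mx[/matrixP/(_ 0 0) + /matrixP/(_ 0 0)].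
by rewrite !mxE /= !mulr1n => /eqP + /eqP; rewrite !fmorph_eq0 => /eqP + /eqP.
Qed.

Lemma short_quillen1 n : 2 <= n -> short
  (block_mx (t ^ n / t)%:M 0 (t ^ n * z)%:M (t ^ n)%:M : 'M_(1 + 1)) (row_mx 1%:M 0).
Proof.
move=> hn; split; first by apply/mxin_row; split; [apply: mxin1 | apply: mxin0].
rewrite mul_row_block !mul0mx !addr0 mulmx0 mul1mx scale_row_mx scaler0.
apply/mxin_row; split; last exact: mxin0.
rewrite scale_scalar_mx; apply: mxin_scalar; rewrite -[t^-1]/(t ^ (-1)) -!expfzDr // -[t ^ _]mulr1.
by apply: OtXz; [lia | apply: sr1].
Qed.

Lemma short_quillen2 n : 2 <= n -> short
  (block_mx (t ^ n / t)%:M 0 (t ^ n * z)%:M (t ^ n)%:M : 'M_(1 + 1)) (row_mx 0 1%:M).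
Proof.
move=> hn; split; first by apply/mxin_row; split; [apply: mxin0 | apply: mxin1].
rewrite mul_row_block !mul0mx !mul1mx !add0r scale_row_mx !scale_scalar_mx.
apply/mxin_row; split; apply: mxin_scalar; last by rewrite -[t ^ n]mulr1; apply: OtXV; [lia | apply: sr1].
rewrite -[n](subrK 1) expfzDr // expr1z -mulrA; apply: OtXV; [lia | exact: aOz].
Qed.

Lemma bad_blk_short b : ~~ good b -> exists2 w : 'rV_(blk_rank b.1),
  w != 0 & short (t ^ b.2 *: blk b.1) w.
Proof.
case: b => -[] n; rewrite /good -ltNge => hn.
  rewrite quillen_blk; exists (row_mx 1%:M 0 : 'rV_(1 + 1)); last exact: short_quillen1.
  by apply/eqP => /(congr1 (fun w : 'rV_(1 + 1) => lsubmx w 0 0)); rewrite row_mxKl !mxE; apply/eqP/oner_neq0.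
exists 1%:M; first exact: oner_neq0.
split; first exact: mxin1.
rewrite mul1mx scale_scalar_mx scale_scalar_mx; apply: mxin_scalar; apply: OtXV; last exact: sr1.
by move: hn => /=; lia.
Qed.

Lemma vbad_blk_short b : 2 <= b.2 -> exists w1 w2 : 'rV_(blk_rank b.1),
  [/\ indep w1 w2, short (t ^ b.2 *: blk b.1) w1 & short (t ^ b.2 *: blk b.1) w2].
Proof.
case: b => -[] n /= hn.
  rewrite quillen_blk; exists (row_mx 1%:M 0 : 'rV_(1 + 1)), (row_mx 0 1%:M : 'rV_(1 + 1)).
  by split; [apply: indep_quillen | apply: short_quillen1 | apply: short_quillen2].
(* For n at least 2 both 1 and 1/t are short, and they are independent over k because 1/t lies
   outside O. *)
exists 1%:M, (t^-1)%:M; split.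
- move=> al be; rewrite !scale_scalar_mx mulr1 -raddfD /= => /matrixP/(_ 0 0); rewrite !mxE /= mulr1n => e.
  have [be0|be0] := eqVneq be 0.
    by move: e; rewrite be0 rmorph0 mul0r addr0 => /eqP; rewrite fmorph_eq0 => /eqP.
  case: (@aOtV _ D); suff -> : t^-1 = i (- al / be) by apply: aOk.
  apply: (mulfI (_ : i be != 0)); first by rewrite fmorph_eq0.
  by rewrite -rmorphM [be * _]mulrC divfK // rmorphN; apply/eqP; rewrite -addr_eq0 addrC e.
- split; first exact: mxin1.
  rewrite mul1mx !scale_scalar_mx; apply: mxin_scalar; apply: OtXV; [lia | exact: sr1].
split; first exact/mxin_scalar/aBt.
rewrite scale_scalar_mx -scalar_mxM scale_scalar_mx; apply: mxin_scalar.
rewrite mulr1 -[t^-1]/(t ^ (-1)) -!expfzDr // -[t ^ _]mulr1; apply: OtXz; [lia | exact: sr1].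
Qed.

Lemma short_row0 r s (g : 'M[F]_r) (h : 'M[F]_s) w :
  short g w -> short (block_mx g 0 0 h) (row_mx w 0).
Proof.
move=> [hB hO]; split; first by apply/mxin_row; split=> //; apply: mxin0.
rewrite mul_row_block !mulmx0 !mul0mx !addr0 scale_row_mx scaler0.
by apply/mxin_row; split=> //; apply: mxin0.
Qed.

Lemma short_row1 r s (g : 'M[F]_r) (h : 'M[F]_s) w :
  short h w -> short (block_mx g 0 0 h) (row_mx 0 w).
Proof.
move=> [hB hO]; split; first by apply/mxin_row; split=> //; apply: mxin0.
rewrite mul_row_block !mulmx0 !mul0mx !add0r scale_row_mx scaler0.
by apply/mxin_row; split=> //; apply: mxin0.
Qed.

Lemma row_mx_eq0' r s (v : 'rV[F]_r) (w : 'rV[F]_s) : row_mx v w = 0 -> v = 0 /\ w = 0.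
Proof. by rewrite -row_mx0 => /eq_row_mx. Qed.

Lemma bad_short s : ~~ all good s -> exists2 w, w != 0 & short (std s) w.
Proof.
elim: s => //= b s IH; rewrite negb_and; case: (boolP (good b)) => /= [_ /IH|hb _].
  case=> w w0 hw; exists (row_mx 0 w); last exact: short_row1.
  by apply: contra_neq w0 => /row_mx_eq0'[].
have [w w0 hw] := bad_blk_short hb; exists (row_mx w 0); last exact: short_row0.
by apply: contra_neq w0 => /row_mx_eq0'[].
Qed.

(** A block of twist at least 2 has two independent short vectors, and two bad blocks have one each.
    A bad Quillen block has twist at least 2, so the only other possibility is a single bad block,
    which is a line of twist 1. *)
Lemma std_cases s : [\/ all good s,
  exists s1 s2, s = s1 ++ (false, 1) :: s2 /\ all good (s1 ++ s2) |
  exists w1 w2, [/\ indep w1 w2, short (std s) w1 & short (std s) w2]].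
Proof.
elim: s => [|b s IH]; first by constructor 1.
case: (boolP (good b)) => hb.
  case: IH => [hs|[s1 [s2 [-> hs]]]|[w1 [w2 [hi h1 h2]]]].
  - by constructor 1; rewrite /= hb.
  - by constructor 2; exists (b :: s1), s2; rewrite /= hb.
  constructor 3; exists (row_mx 0 w1), (row_mx 0 w2).
  split; try exact: short_row1.
  by move=> al be; rewrite !scale_row_mx !scaler0 add_row_mx => /row_mx_eq0'[_ /hi].
have [b2|b2] := lerP 2 b.2.
  have [w1 [w2 [hi h1 h2]]] := vbad_blk_short b2.
  constructor 3; exists (row_mx w1 0), (row_mx w2 0).
  split; try exact: short_row0.
  by move=> al be; rewrite !scale_row_mx !scaler0 add_row_mx => /row_mx_eq0'[/hi].
have eb : b = (false, 1).
  by case: b hb b2 {IH} => -[] n; rewrite /good /= -ltNge => h1 h2; [lia | congr pair; lia].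
case: (boolP (all good s)) => hs.
  by constructor 2; exists [::], s; rewrite eb.
have [w1 w10 h1] := bad_blk_short hb; have [w2 w20 h2] := bad_short hs.
constructor 3; exists (row_mx w1 0), (row_mx 0 w2).
split; [|exact: short_row0|exact: short_row1].
move=> al be; rewrite !scale_row_mx !scaler0 add_row_mx addr0 add0r => /row_mx_eq0'[/eqP + /eqP].
by rewrite !scaler_eq0 !fmorph_eq0 (negbTE w10) (negbTE w20) !orbF => /eqP + /eqP.
Qed.

(* The connecting map sends the sections [w] of the twisted quotient to the class of
   [w *m c] in H^1(O(-1)), which is one-dimensional over [k]. *)
Lemma corner_short r (c : 'cV[F]_r) h w1 w2 : indep w1 w2 -> short h w1 -> short h w2 ->
  exists2 v, v != 0 & short (block_mx (1%:M : 'M_1) 0 c h) v.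
Proof.
move=> hi [hB1 hO1] [hB2 hO2].
have [b1 [a1 [o1 [hb1 ho1 e1]]]] := a_dec ((w1 *m c) 0 0).
have [b2 [a2 [o2 [hb2 ho2 e2]]]] := a_dec ((w2 *m c) 0 0).
have [x [y [hxy e]]] : exists x y, (x != 0) || (y != 0) /\ x * a1 + y * a2 = 0.
  have [a10|a10] := eqVneq a1 0; first by exists 1, 0; rewrite oner_neq0 a10; split=> //; ring.
  by exists a2, (- a1); rewrite oppr_eq0 a10 orbT; split=> //; ring.
pose w := i x *: w1 + i y *: w2.
exists (row_mx (- (i x * b1 + i y * b2))%:M w).
  apply/eqP => /row_mx_eq0'[_ /hi[x0 y0]]; move: hxy; rewrite x0 y0 eqxx //.
split.
  apply/mxin_row; split.
    by apply/mxin_scalar/srN; apply: srD; apply: srM => //; apply: aBk.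
  by apply: mxinD; apply: mxinZ => //; apply: aBk.
rewrite mul_row_block mulmx1 mulmx0 add0r scale_row_mx; apply/mxin_row; split; last first.
  rewrite /w mulmxDl scalerDr -!scalemxAl !scalerA ![t^-1 * _]mulrC -!scalerA.
  by apply: mxinD; apply: mxinZ => //; apply: aOk.
have -> : w *m c = (i x * (b1 + i a1 * (t * z) + t * o1) + i y * (b2 + i a2 * (t * z) + t * o2))%:M.
  by rewrite /w mulmxDl -!scalemxAl [w1 *m c]mx11_scalar [w2 *m c]mx11_scalar e1 e2 !scale_scalar_mx -(raddfD (@scalar_mx _ 1)).
rewrite -(raddfD (@scalar_mx _ 1)) /= scale_scalar_mx; apply: mxin_scalar.
have -> : t^-1 * (- (i x * b1 + i y * b2) + (i x * (b1 + i a1 * (t * z) + t * o1) +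
    i y * (b2 + i a2 * (t * z) + t * o2))) =
    i x * o1 + i y * o2 + (i x * i a1 + i y * i a2) * z by field.
rewrite -!rmorphM -rmorphD e rmorph0 mul0r addr0.
by apply: srD; apply: srM => //; apply: aOk.
Qed.

Lemma no_short_iso r s (g : 'M[F]_r) (h : 'M[F]_s) : lattice_iso g h ->
  (forall v, short g v -> v = 0) -> forall v, short h v -> v = 0.
Proof.
case=> a [a' [u [u' [[e1 e2 hB hB'] hO hO' e e']]]] hg v [hvB hvO].
have /hg/(congr1 (mulmx^~ a)) : short g (v *m a').
  by split; [apply: mxinM | rewrite -mulmxA e' mulmxA scalemxAl; apply: mxinM].
by rewrite -mulmxA e2 mulmx1 mul0mx.
Qed.

(** The constant al is a unit both of B and of O, so that rescaling the first basis vector on both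
    sides turns it into 1. The leading 2 x 2 part [[1, 0], [t z, t]] is then t times the Quillen
    block. *)
Lemma quillen_corner n (l : 'M[F]_n) (al : k) : al != 0 ->
  lattice_iso (block_mx (1%:M : 'M_1) 0 (col_mx (i al * (t * z))%:M 0)
                        (block_mx (t ^ 1 *: (1%:M : 'M_1)) 0 0 l))
              (block_mx (t ^ 1 *: blk true) 0 0 l).
Proof.
move=> al0.
have alV0 : al^-1 != 0 by rewrite invr_eq0.
have inv1 (R : subring F) : (forall c, R (i c)) -> forall x, x != 0 ->
    gl R (block_mx (i x)%:M 0 0 1%:M : 'M_(1 + (1 + n))).
  move=> hR x x0; exists (block_mx (i x^-1)%:M 0 0 1%:M); apply: mxinv_diag (mxinv1 _ _).
  by split; try exact: mxin_scalar; rewrite -scalar_mxM -rmorphM ?mulVf ?mulfV // rmorph1.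
have h := lattice_iso_gl (block_mx (1%:M : 'M_1) 0 (col_mx (i al * (t * z))%:M 0)
  (block_mx (t ^ 1 *: (1%:M : 'M_1)) 0 0 l)) (inv1 B (@aBk _ D) al al0)
  (inv1 O (@aOk _ D) _ alV0).
apply: lattice_iso_trans h _.
have -> : (block_mx (t ^ 1 *: blk true) 0 0 l : 'M_(2 + n)) =
  block_mx (1%:M : 'M_1) 0 (col_mx (t * z)%:M 0) (block_mx (t ^ 1 *: (1%:M : 'M_1)) 0 0 l).
  rewrite quillen_blk expr1z divff // scale_scalar_mx mulr1.
  have := @block_mxA _ 1 1 n 1 1 n 1%:M 0 0 (t * z)%:M t%:M 0 0 0 l.
  by rewrite /= !row_mx0 !col_mx0 castmx_id => ->.
rewrite !mulmx_block !(mulmx0, mul0mx, mulmx1, mul1mx, addr0, add0r) -scalar_mxM -rmorphM mulfV // rmorph1.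
rewrite mul_col_mx mul0mx -scalar_mxM mulrAC -rmorphM mulfV // rmorph1 mul1r.
exact: lattice_iso_refl.
Qed.

(** Induction on the rank. The quotient by a section of minimal twist is standard; minimality says
    that no equivalent matrix has a short vector ([nos]). By [corner_short] this excludes two
    independent short vectors in the quotient, so that the corner can be cleared except for one
    constant against a line of twist 1. *)
Theorem lattice_classification r (g : 'M[F]_r) : g \in unitmx ->
  exists s, lattice_iso g (std s).
Proof.
elim: r g => [|r IH] g gu.
  by exists [::]; rewrite [g](_ : _ = 0); [apply: lattice_iso_refl | apply/matrixP=> -[]].
suff [n [s h]] : exists n s, lattice_iso (t ^ n *: g) (std s).
  exists (twist (- n) s); apply: lattice_iso_trans (std_twist _ _).
  have := lattice_isoZ (t ^ (- n)) h.
  by rewrite scalerA -expfzDr // addNr scale1r.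
have [n [[v [v0 hvB hvO]] hmin]] := minimal_twist gu.
exists n; set g1 := t ^ n *: g in hmin *.
have g1u : g1 \in unitmx by rewrite unitmxZ // unitfE expfz_neq0.
have [|c [g' [g'u h1]]] := @split_minimal r g1 g1u _ hmin.
  by exists v; split=> //; rewrite -scalemxAr.
have [s hs] := IH _ g'u; have [c1 h2] := lattice_iso_corner c hs.
have {h1 h2} h := lattice_iso_trans h1 h2.
have nos s' c' : lattice_iso g1 (block_mx (1%:M : 'M_1) 0 c' (std s')) ->
    forall v, short (block_mx (1%:M : 'M_1) 0 c' (std s')) v -> v = 0.
  by move=> h'; apply: no_short_iso h' _ => w [hw1 hw2]; apply: hmin.
have [gs|[s1 [s2 [es gs]]]|[w1 [w2 [hi k1 k2]]]] := std_cases s.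
- exists ((false, 0) :: s); apply: lattice_iso_trans h _.
  have [b [o [hb ho ->]]] := good_clean c1 gs.
  rewrite /= scale1r -[b + _]addr0; exact: corner_clean.
- subst s; have [c2 h2] := lattice_iso_corner c1 (std_move s1 (false, 1) s2).
  have {h2} h := lattice_iso_trans h h2.
  have [b2 [o2 [hb2 ho2 e2]]] := good_clean (dsubmx c2) gs.
  have [b1 [al [o1 [hb1 ho1 e1]]]] := a_dec (usubmx c2 0 0).
  pose c3 : 'cV[F]_(1 + _) := col_mx (i al * (t * z))%:M (0 : 'cV_(std_dim (s1 ++ s2))).
  have ec : c2 = col_mx b1%:M b2 + std ((false, 1) :: s1 ++ s2) *m col_mx o1%:M o2 + c3.
    rewrite /c3 /= mul_block_col !mul0mx addr0 add0r !add_col_mx addr0 -e2 -[LHS]vsubmxK.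
    congr col_mx; rewrite [LHS]mx11_scalar e1 scale_scalar_mx mulr1 -scalar_mxM -!raddfD /=.
    by rewrite expr1z addrAC.
  have {}h : lattice_iso g1 (block_mx (1%:M : 'M_1) 0 c3 (std ((false, 1) :: s1 ++ s2))).
    apply: lattice_iso_trans h _; rewrite ec; apply: corner_clean; apply/mxin_col; split=> //; exact: mxin_scalar.
  have [al0|al0] := eqVneq al 0; last first.
    exists ((true, 1) :: s1 ++ s2); apply: lattice_iso_trans h _.
    exact: quillen_corner.
  (* If al were 0, the line of twist 1 would be a direct summand, and its basis vector would be
     short. *)
  have /(nos ((false, 1) :: s1 ++ s2) c3 h)/row_mx_eq0'[_ /eqP] : short (block_mx (1%:M : 'M_1) 0 c3 (std ((false, 1) :: s1 ++ s2)))
      (row_mx 0 (row_mx 1%:M 0 : 'rV_(1 + _))).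
    have -> : c3 = 0 by rewrite /c3 al0 rmorph0 mul0r raddf0 col_mx0.
    apply: short_row1; apply: short_row0; split; first exact: mxin1.
    by rewrite mul1mx scalerA -[t^-1]/(t ^ (-1)) -expfzDr // scale1r; apply: mxin1.
  by rewrite -row_mx0 => /eqP/eq_row_mx[/matrixP/(_ 0 0)/eqP]; rewrite !mxE (negbTE (oner_neq0 _)).
have [w w0 /(nos _ _ h)] := corner_short c1 hi k1 k2.
by move/eqP: w0.
Qed.

End Classification.

(** * Uniqueness of the standard form: the slope filtration *)

Section Uniqueness.
Variables (k : fieldType) (D : conic_rings k).
Local Notation F := (aF D).
Local Notation B := (aB D).
Local Notation O := (aO D).
Local Notation t := (at_ D).
Local Notation z := (az D).
Local Notation i := (ai D).
Let t0 : t != 0 := at0 D.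

(** Degree over rank, with the point at infinity counted with its degree 2: a line of twist n has
    slope 2n, and an extension of O by O(-1) has degree -2 and rank 2, hence slope -1. *)
Definition slope (b : bool * int) : int := b.2 *+ 2 - b.1%:R.

Lemma slope_inj : injective slope.
Proof. by case=> [[] m] [[] n]; rewrite /slope /= => h; congr pair; lia. Qed.

Definition qm n : 'M[F]_(1 + 1) := block_mx (t ^ n / t)%:M 0 (t ^ n * z)%:M (t ^ n)%:M.

(* In the four lemmas [hom_*], [x] is a homomorphism between two blocks, of decreasing slope. *)
Lemma hom_line_line (x u : F) (a b : int) : b < a -> B x -> O u -> x * t ^ b = t ^ a * u -> x = 0.
Proof.
move=> hab hx hu e; apply: (BtO hx).
have -> : x / t = t^-1 * (t ^ (a - b) * u).
  by rewrite mulrC -[x](mulfK (_ : t ^ b != 0)) ?expfz_neq0 // e expfzDr // -invr_expz; ring.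
by apply: OtXV => //; lia.
Qed.

Lemma hom_line_quillen (x1 x2 u1 u2 : F) (a b : int) : b <= a -> B x1 -> B x2 -> O u1 -> O u2 ->
  x1 * (t ^ b / t) + x2 * (t ^ b * z) = t ^ a * u1 -> x2 * t ^ b = t ^ a * u2 ->
  x1 = 0 /\ x2 = 0.
Proof.
move=> hab h1 h2 hu1 hu2 e1 e2; have tb : t ^ b != 0 by rewrite expfz_neq0.
have hO u : O u -> O (t ^ a * u / t ^ b).
  by move=> hu; rewrite mulrAC invr_expz -expfzDr //; apply: OtXz => //; lia.
have [be ebe] : exists c, x2 = i c by apply: aBO => //; rewrite -[x2](mulfK tb) e2; apply: hO.
have e3 : x1 / t + x2 * z = t ^ a * u1 / t ^ b by rewrite -e1; field; rewrite ?t0 ?tb.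
have [al eal] : exists c, x1 = i c.
  apply: aBO => //; have -> : x1 = t * (t ^ a * u1 / t ^ b) - i be * (t * z).
    by rewrite -e3 ebe; field.
  by apply: srB; apply: srM; [apply: aOt | apply: hO | apply: aOk | apply: aOz].
have [] : al = 0 /\ be = 0.
  apply: (@a_indep _ D); rewrite -eal -ebe; have -> : (x1 + x2 * (t * z)) / t = x1 / t + x2 * z by field.
  by rewrite e3; apply: hO.
by rewrite eal ebe => -> ->; rewrite rmorph0.
Qed.

Lemma hom_quillen_line (x1 x2 u1 u2 : F) (a b : int) : b < a -> B x1 -> B x2 -> O u1 -> O u2 ->
  x1 * t ^ b = t ^ a / t * u1 -> x2 * t ^ b = t ^ a * z * u1 + t ^ a * u2 ->
  x1 = 0 /\ x2 = 0.
Proof.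
move=> hab h1 h2 hu1 hu2 e1 e2; have tb : t ^ b != 0 by rewrite expfz_neq0.
have hO u : O u -> O (t^-1 * (t ^ (a - b) * u)) by move=> hu; apply: OtXV => //; lia.
have e3 : x1 = t^-1 * (t ^ (a - b) * u1).
  by apply: (mulIf tb); rewrite e1 expfzDr // -invr_expz; field; rewrite ?t0 ?tb.
have [al eal] : exists c, x1 = i c by apply: aBO => //; rewrite e3; apply: hO.
have e4 : x2 - x1 * (t * z) = t * (t^-1 * (t ^ (a - b) * u2)).
  by apply: (mulIf tb); rewrite mulrBl e2 e3 expfzDr // -invr_expz; field; rewrite ?t0 ?tb.
have [be ebe] : exists c, x2 = i c.
  apply: aBO => //; rewrite -[x2](subrK (x1 * (t * z))) e4 eal.
  by apply: srD; apply: srM; [apply: aOt | apply: hO | apply: aOk | apply: aOz].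
have [] : be = 0 /\ - al = 0.
  apply: (@a_indep _ D); rewrite rmorphN mulNr -eal -ebe e4 mulrAC divff // mul1r.
  exact: hO.
by move=> be0 /eqP; rewrite oppr_eq0 eal ebe be0 => /eqP ->; rewrite rmorph0.
Qed.

Lemma col2P (v : 'cV[F]_(1 + 1)) : v = col_mx (v ord0 0)%:M (v (lift ord0 ord0) 0)%:M.
Proof.
rewrite -[LHS]vsubmxK; congr col_mx; rewrite [LHS]mx11_scalar !mxE; congr (v _ _)%:M; exact: val_inj.
Qed.

Lemma row2P (v : 'rV[F]_(1 + 1)) : v = row_mx (v 0 ord0)%:M (v 0 (lift ord0 ord0))%:M.
Proof.
rewrite -[LHS]hsubmxK; congr row_mx; rewrite [LHS]mx11_scalar !mxE; congr (v _ _)%:M; exact: val_inj.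
Qed.

Lemma hom_quillen_line_mx (x u : 'cV[F]_(1 + 1)) (a b : int) : b < a -> mxin B x -> mxin O u ->
  x *m (t ^ b)%:M = qm a *m u -> x = 0.
Proof.
rewrite [x]col2P [u]col2P => hab /mxin_col[h1 h2] /mxin_col[k1 k2].
rewrite mul_col_mx mul_block_col -!scalar_mxM mul0mx addr0 -(raddfD (@scalar_mx _ 1)) => /eq_col_mx[] /(congr1 (fun m : 'M__ => m 0 0)) + /(congr1 (fun m : 'M__ => m 0 0)).
move: (h1 0 0) (h2 0 0) (k1 0 0) (k2 0 0); rewrite ![_%:M 0 0]mxE !mulr1n => g1 g2 l1 l2 e1 e2.
have [-> ->] := hom_quillen_line hab g1 g2 l1 l2 e1 e2; by rewrite !raddf0 col_mx0.
Qed.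

Lemma hom_line_quillen_mx (x u : 'rV[F]_(1 + 1)) (a b : int) : b <= a -> mxin B x -> mxin O u ->
  x *m qm b = (t ^ a)%:M *m u -> x = 0.
Proof.
rewrite [x]row2P [u]row2P => hab /mxin_row[h1 h2] /mxin_row[k1 k2].
rewrite mul_mx_row mul_row_block -!scalar_mxM mulmx0 add0r -(raddfD (@scalar_mx _ 1)) => /eq_row_mx[] /(congr1 (fun m : 'M__ => m 0 0)) + /(congr1 (fun m : 'M__ => m 0 0)).
move: (h1 0 0) (h2 0 0) (k1 0 0) (k2 0 0); rewrite ![_%:M 0 0]mxE !mulr1n => g1 g2 l1 l2 e1 e2.
have [-> ->] := hom_line_quillen hab g1 g2 l1 l2 e1 e2; by rewrite !raddf0 row_mx0.
Qed.

Lemma hom_quillen_quillen_mx (x u : 'M[F]_(1 + 1)) (a b : int) : b < a -> mxin B x -> mxin O u ->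
  x *m qm b = qm a *m u -> x = 0.
Proof.
rewrite -[x]hsubmxK -[u]hsubmxK; set x1 := lsubmx x; set x2 := rsubmx x; set u1 := lsubmx u; set u2 := rsubmx u.
move=> hab /mxin_row[h1 h2] /mxin_row[k1 k2].
rewrite mul_mx_row mul_row_block mulmx0 add0r => /eq_row_mx[e1 e2].
have x20 : x2 = 0 by apply: hom_quillen_line_mx hab h2 k2 e2.
have x10 : x1 = 0.
  apply: (@hom_quillen_line_mx _ u1 a (b - 1)) => //; first by lia.
  by rewrite -e1 x20 mul0mx addr0 expfzDr.
by rewrite x10 x20 row_mx0.
Qed.

Lemma blk_hom_eq0 b b' (x u : 'M[F]_(blk_rank b.1, blk_rank b'.1)) :
  slope b' < slope b -> mxin B x -> mxin O u ->
  x *m (t ^ b'.2 *: blk D b'.1) = (t ^ b.2 *: blk D b.1) *m u -> x = 0.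
Proof.
case: b b' x u => [[] m] [[] n] /= x u; rewrite /slope /= => h hx hu.
- by rewrite !quillen_blk; apply: hom_quillen_quillen_mx => //; lia.
- rewrite quillen_blk scale_scalar_mx mulr1; apply: hom_quillen_line_mx => //; lia.
- rewrite quillen_blk scale_scalar_mx mulr1; apply: hom_line_quillen_mx => //; lia.
rewrite !scale_scalar_mx !mulr1 [x]mx11_scalar [u]mx11_scalar -!scalar_mxM => /(congr1 (fun m : 'M__ => m 0 0)).
rewrite ![_%:M 0 0]mxE !mulr1n => e; rewrite (@hom_line_line (x 0 0) (u 0 0) m n) ?raddf0 //; lia.
Qed.

(** The idempotent onto the blocks of slope at least c, whose image is a step of the
    Harder-Narasimhan filtration. Homomorphisms preserve that step ([std_hom]). *)
Fixpoint slope_proj (c : int) (s : seq (bool * int)) : 'M[F]_(std_dim s) :=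
  if s is b :: s' return 'M[F]_(std_dim s)
  then block_mx (c <= slope b)%R%:R%:M 0 0 (slope_proj c s') else 0.

Lemma blk_std_hom b s (x u : 'M[F]_(blk_rank b.1, std_dim s)) c : c <= slope b ->
  mxin B x -> mxin O u -> x *m std D s = (t ^ b.2 *: blk D b.1) *m u ->
  x *m slope_proj c s = x.
Proof.
move=> hc; elim: s x u => [|b' s IH] /= x u; first by move=> *; apply/matrixP=> ? [].
rewrite -[x]hsubmxK -[u]hsubmxK => /mxin_row[hx1 hx2] /mxin_row[hu1 hu2].
rewrite mul_mx_row !mul_row_block !mulmx0 addr0 !add0r addr0 => /eq_row_mx[e1 e2].
rewrite (IH _ _ hx2 hu2 e2); congr row_mx.
case: lerP => hb'; first by rewrite mulmx1.
by rewrite raddf0 mulmx0 (blk_hom_eq0 _ hx1 hu1 e1) // (lt_le_trans hb' hc).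
Qed.

Lemma std_hom c s s' (x u : 'M[F]_(std_dim s, std_dim s')) :
  mxin B x -> mxin O u -> x *m std D s' = std D s *m u ->
  slope_proj c s *m x *m slope_proj c s' = slope_proj c s *m x.
Proof.
elim: s x u => [|b s IH] /= x u; first by move=> *; apply/matrixP=> -[].
rewrite -[x]vsubmxK -[u]vsubmxK => /mxin_col[hx1 hx2] /mxin_col[hu1 hu2].
rewrite mul_col_mx !mul_block_col !mul0mx addr0 !add0r addr0 => /eq_col_mx[e1 e2].
rewrite mul_col_mx (IH _ _ hx2 hu2 e2); congr col_mx.
case: lerP => hb; last by rewrite raddf0 !mul0mx.
by rewrite mul1mx; apply: blk_std_hom hu1 e1.
Qed.

Definition slope_rank c (s : seq (bool * int)) : nat :=
  (\sum_(b <- s | (c <= slope b)%R) blk_rank b.1)%N.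

Lemma rank_slope_proj c s : \rank (slope_proj c s) = slope_rank c s.
Proof.
rewrite /slope_rank; elim: s => [|b s IH] /=; first by rewrite big_nil mxrank0.
rewrite big_cons rank_diag_block_mx IH; case: ifP => _; last by rewrite raddf0 mxrank0.
by rewrite mxrank1.
Qed.

(** An isomorphism a is injective and maps the step of slope at least c into the corresponding step
    of the target, so the ranks compare: with P and P' the two idempotents, P and P a = P a P' have
    the same rank. *)
Lemma slope_rank_le c s s' : lattice_iso (std D s) (std D s') ->
  (slope_rank c s <= slope_rank c s')%N.
Proof.
case=> a [a' [u [u' [[e1 e2 ha ha'] hu hu' e e']]]].
rewrite -!rank_slope_proj -[slope_proj c s]mulmx1 -e1 mulmxA.
apply: leq_trans (mxrankM_maxl _ _) _.
by rewrite -(std_hom c ha hu e) mxrankM_maxr.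
Qed.

(** Slopes are integers and [slope] is injective, so the jump of the filtration at the slope of b
    comes from the copies of b alone. *)
Lemma slope_rank_count s b : (slope_rank (slope b) s =
  slope_rank (slope b + 1)%R s + blk_rank b.1 * count_mem b s)%N.
Proof.
rewrite /slope_rank; elim: s => [|c s IH] /=; first by rewrite !big_nil muln0.
rewrite !big_cons IH mulnDr; case: (eqVneq c b) => [->|ncb].
  have -> : (slope b + 1 <= slope b) = false by lia.
  by rewrite lexx muln1 /=; lia.
rewrite muln0; suff -> : (slope b <= slope c) = (slope b + 1 <= slope c) by case: ifP => _; rewrite add0n ?addnA.
by have : slope c <> slope b by [move=> /slope_inj; apply/eqP]; lia.
Qed.

Theorem std_unique s s' : lattice_iso (std D s) (std D s') -> perm_eq s s'.
Proof.
move=> h; have e c : slope_rank c s = slope_rank c s'.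
  by apply/eqP; rewrite eqn_leq !slope_rank_le //; apply: lattice_iso_sym.
apply/allP => b _ /=; have := slope_rank_count s b; rewrite !e slope_rank_count.
by case: b => -[] n /=; lia.
Qed.

End Uniqueness.

(** * The function field of the conic *)

Section IntegralDomain.
Variable T : comNzRingType.
Hypothesis T_int : forall x y : T, x * y = 0 -> x = 0 \/ y = 0.

(* [T] with its classical structure of integral domain, so that it has a fraction field. *)
Definition int_dom of (forall x y : T, x * y = 0 -> x = 0 \/ y = 0) : Type := T.
Local Notation D := (int_dom T_int).
HB.instance Definition _ := GRing.ComNzRing.copy D T.

Definition id_unit : pred D := fun x => `[< exists y : D, y * x = 1 >].
Definition id_inv (x : D) : D :=
  if pselect (exists y : D, y * x = 1) is left h then projT1 (cid h) else x.

Lemma id_mulVx : {in id_unit, left_inverse 1 id_inv *%R}.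
Proof. by move=> x /asboolP hx; rewrite /id_inv; case: pselect => // h; case: cid. Qed.
Lemma id_unitPl x y : y * x = 1 -> id_unit x.
Proof. by move=> h; apply/asboolP; exists y. Qed.
Lemma id_inv_out : {in [predC id_unit], id_inv =1 id}.
Proof. by move=> x /asboolP hx; rewrite /id_inv; case: pselect. Qed.
HB.instance Definition _ :=
  GRing.ComNzRing_hasMulInverse.Build D id_mulVx id_unitPl id_inv_out.

Lemma id_integral (x y : D) : x * y = 0 -> (x == 0) || (y == 0).
Proof. by move/T_int => -[] ->; rewrite eqxx ?orbT. Qed.
HB.instance Definition _ := GRing.ComUnitRing_isIntegral.Build D id_integral.

End IntegralDomain.

(* The algebra [R[z]/(z^2 - l z - m)], with [Quad a b] for [a + b z]. *)
Record quadratic (R : comNzRingType) (l m : R) := Quad { qa : R; qb : R }.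
Arguments Quad {R l m}.

Section Quadratic.
Variables (R : comNzRingType) (l m : R).
Local Notation quad := (quadratic l m).
Implicit Types u v w : quad.

HB.instance Definition _ := gen_eqMixin quad.
HB.instance Definition _ := gen_choiceMixin quad.

Lemma quadP u v : qa u = qa v -> qb u = qb v -> u = v.
Proof. by case: u v => [? ?] [? ?] /= -> ->. Qed.

Definition quad_add u v : quad := Quad (qa u + qa v) (qb u + qb v).
Definition quad_opp u : quad := Quad (- qa u) (- qb u).
Definition quad_mul u v : quad :=
  Quad (qa u * qa v + qb u * qb v * m) (qa u * qb v + qb u * qa v + qb u * qb v * l).

Lemma quad_addA : associative quad_add.
Proof. by move=> u v w; apply: quadP; rewrite /= addrA. Qed.
Lemma quad_addC : commutative quad_add.
Proof. by move=> u v; apply: quadP; rewrite /= addrC. Qed.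
Lemma quad_add0 : left_id (Quad 0 0) quad_add.
Proof. by move=> u; apply: quadP; rewrite /= add0r. Qed.
Lemma quad_addN : left_inverse (Quad 0 0) quad_opp quad_add.
Proof. by move=> u; apply: quadP; rewrite /= addNr. Qed.
HB.instance Definition _ := GRing.isZmodule.Build quad quad_addA quad_addC quad_add0 quad_addN.

Lemma quad_mulA : associative quad_mul.
Proof. by move=> u v w; apply: quadP => /=; ring. Qed.
Lemma quad_mulC : commutative quad_mul.
Proof. by move=> u v; apply: quadP => /=; ring. Qed.
Lemma quad_mul1 : left_id (Quad 1 0) quad_mul.
Proof. by move=> u; apply: quadP => /=; ring. Qed.
Lemma quad_mulD : left_distributive quad_mul +%R.
Proof. by move=> u v w; apply: quadP => /=; ring. Qed.
Lemma quad_1_neq0 : Quad 1 0 != 0 :> quad.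
Proof. by apply/eqP => -[/eqP]; rewrite oner_eq0. Qed.
HB.instance Definition _ := GRing.Zmodule_isComNzRing.Build quad
  quad_mulA quad_mulC quad_mul1 quad_mulD quad_1_neq0.

Definition quad_norm u := qa u ^+ 2 + qa u * qb u * l - qb u ^+ 2 * m.

Lemma quad_normM u v : quad_norm (u * v) = quad_norm u * quad_norm v.
Proof. by rewrite /quad_norm /=; ring. Qed.

End Quadratic.

Lemma coefM_top (k : fieldType) (p q : {poly k}) i j :
  (size p <= i.+1)%N -> (size q <= j.+1)%N -> (p * q)`_(i + j) = p`_i * q`_j.
Proof.
move=> hp hq; rewrite coefM (bigD1 (Ordinal (leq_addr j i.+1 : (i < (i + j).+1)%N))) //= addKn.
rewrite big1 ?addr0 // => -[x hx] /= /eqP hne.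
have {hne} hne : x <> i by move=> e; apply: hne; apply: val_inj.
case: (ltnP i x) => h; first by rewrite nth_default ?mul0r // (leq_trans hp).
by rewrite [X in _ * X]nth_default ?mulr0 // (leq_trans hq) //; lia.
Qed.

Lemma sizeM_le (k : fieldType) (p q : {poly k}) i j :
  (size p <= i.+1)%N -> (size q <= j.+1)%N -> (size (p * q)%R <= (i + j).+1)%N.
Proof. by move=> hp hq; apply: leq_trans (size_polyMleq _ _) _; lia. Qed.

Lemma size_drop_top (k : fieldType) (p : {poly k}) n :
  (size p <= n.+1)%N -> p`_n = 0 -> (size p <= n)%N.
Proof.
move=> hp h0; apply/leq_sizeP => j; rewrite leq_eqVlt => /orP[/eqP <- //|hj].
by rewrite nth_default // (leq_trans hp).
Qed.

(** Taylor expansion of the affine equation at (a, b): modulo the equation itself, its value there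
    is a combination of y - a and z - b. *)
Lemma quadric_taylor (R : comNzRingType) (l0 l1 m0 m1 m2 y z a b : R) :
  b ^+ 2 - (l0 + l1 * a) * b - (m0 + m1 * a + m2 * a ^+ 2) =
  (z - b) * (l0 + l1 * y - z - b) + (y - a) * (l1 * b + m1 + m2 * (y + a)) +
  (z ^+ 2 - (l0 + l1 * y) * z - (m0 + m1 * y + m2 * y ^+ 2)).
Proof. ring. Qed.

Module FractionDiv.
Import generic_quotient.
Lemma fraction_div (R : idomainType) (x : {fraction R}) :
  exists u v : R, v != 0 /\ x = FracField.tofrac u / FracField.tofrac v.
Proof.
elim/quotW: x => r; exists (frac r).1, (frac r).2; split; first exact: denom_ratioP.
have d0 := denom_ratioP r.
apply: (canRL (mulfK _)); first by rewrite tofrac_eq0.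
unlock FracField.tofrac; rewrite -[LHS]FracField.pi_mul; apply/eqmodP.
rewrite /= FracField.equivfE /FracField.mulf !numden_Ratio ?oner_eq0 ?mulf_neq0 ?oner_neq0 //.
by rewrite !mulr1 mulrC.
Qed.
End FractionDiv.

(** * The coordinate ring of the affine conic *)

Section AffineConic.
Variables (k : fieldType) (l0 l1 m0 m1 m2 : k).
Hypothesis aniso : forall a b c : k,
  c ^+ 2 - (l0 * a + l1 * b) * c - (m0 * a ^+ 2 + m1 * a * b + m2 * b ^+ 2) = 0 ->
  [/\ a = 0, b = 0 & c = 0].

Definition lpol : {poly k} := l0%:P + l1 *: 'X.
Definition mpol : {poly k} := m0%:P + m1 *: 'X + m2 *: 'X^2.
Local Notation Q := (quadratic lpol mpol).
Implicit Types u v w f g h : Q.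

(** For u nonzero, one more than the pole order at infinity; the convention of [size] gives 0 for u
    = 0. The factor 'X accounts for z having the same pole order as y. *)
Definition dg u := maxn (size (qa u)) (size (qb u * 'X)).

Lemma dg_le u n : (dg u <= n)%N = (size (qa u) <= n)%N && (size (qb u * 'X)%R <= n)%N.
Proof. exact: geq_max. Qed.

Lemma dg0 : dg 0 = 0%N.
Proof. by rewrite /dg /= mul0r size_poly0. Qed.

Lemma dg_eq0 u : (dg u == 0%N) = (u == 0).
Proof.
rewrite -leqn0 dg_le !leqn0 !size_poly_eq0 mulf_eq0 polyX_eq0 orbF.
apply/andP/eqP => [[/eqP ha /eqP hb]|-> //]; by apply: quadP.
Qed.

Lemma dgD u v n : (dg u <= n)%N -> (dg v <= n)%N -> (dg (u + v)%R <= n)%N.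
Proof.
rewrite !dg_le => /andP[h1 h2] /andP[h3 h4] /=; rewrite mulrDl.
by apply/andP; split; apply: leq_trans (size_polyD _ _) _; rewrite geq_max ?h1 ?h2.
Qed.

Lemma dgN u : dg (- u) = dg u.
Proof. by rewrite /dg /= mulNr !size_polyN. Qed.

(** The norm of a + b zeta, where zeta, the value of z / y at infinity, satisfies zeta^2 = l1 zeta +
    m2. A zero (a, b) would give the rational point (0 : b : - a). *)
Definition top_norm (a b : k) := a ^+ 2 + a * b * l1 - b ^+ 2 * m2.

Lemma top_norm_eq0 a b : top_norm a b = 0 -> a = 0 /\ b = 0.
Proof.
move=> h; have [|_ -> /eqP] := @aniso 0 b (- a); last by rewrite oppr_eq0 => /eqP ->.
by rewrite -[RHS]h /top_norm; ring.
Qed.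

Lemma lpolE : (size lpol <= 2)%N /\ lpol`_1 = l1.
Proof.
rewrite /lpol; split; last by rewrite coefD coefC coefZ coefX /= mulr1 add0r.
apply: leq_trans (size_polyD _ _) _; rewrite geq_max; apply/andP; split.
  exact: leq_trans (size_polyC_leq1 _) _.
by apply: leq_trans (size_scale_leq _ _) _; rewrite size_polyX.
Qed.

Lemma mpolE : (size mpol <= 3)%N /\ mpol`_2 = m2.
Proof.
rewrite /mpol; split; last by rewrite !coefD coefC !coefZ coefX coefXn /= mulr1 mulr0 !add0r.
apply: leq_trans (size_polyD _ _) _; rewrite geq_max; apply/andP; split; last first.
  by apply: leq_trans (size_scale_leq _ _) _; rewrite size_polyXn.
apply: leq_trans (size_polyD _ _) _; rewrite geq_max; apply/andP; split.
  exact: leq_trans (size_polyC_leq1 _) _.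
by apply: leq_trans (size_scale_leq _ _) _; rewrite size_polyX.
Qed.

Lemma coefMX' (p : {poly k}) n : (p * 'X)`_n.+1 = p`_n.
Proof. by rewrite coefMX. Qed.

Lemma norm_top u n : (dg u <= n.+1)%N ->
  (size (quad_norm u) <= (n + n).+1)%N /\
  (quad_norm u)`_(n + n) = top_norm (qa u)`_n (qb u * 'X)`_n.
Proof.
rewrite dg_le => /andP[ha hb]; set b := qb u * 'X in hb *.
have [sl cl] := lpolE; have [sm cm] := mpolE.
(* After multiplication by X^2 the norm is expressed through [qa u] and b, which have degree at most
   n, and its coefficient in degree 2n + 2 is the value of [top_norm]. *)
have e : quad_norm u * 'X * 'X = 'X * qa u * ('X * qa u) + qa u * b * ('X * lpol) - b * b * mpol.
  by rewrite /quad_norm /b; ring.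
have sX : (size ('X : {poly k}) <= 2)%N by rewrite size_polyX.
have sXa : (size ('X * qa u)%R <= n.+2)%N by apply: (sizeM_le (i := 1) (j := n)).
have sXl : (size ('X * lpol)%R <= 3)%N by apply: (sizeM_le (i := 1) (j := 1)).
have sab : (size (qa u * b)%R <= (n + n).+1)%N by apply: sizeM_le.
have sbb : (size (b * b)%R <= (n + n).+1)%N by apply: sizeM_le.
have cXl : ('X * lpol)`_2 = l1 by rewrite mulrC coefMX' cl.
have cXa : ('X * qa u)`_n.+1 = (qa u)`_n by rewrite mulrC coefMX'.
have s1 := sizeM_le sXa sXa; have s2 := sizeM_le sab sXl; have s3 := sizeM_le sbb sm.
split; last first.
  rewrite -[LHS]coefMX' -coefMX' e coefB coefD.
  rewrite (_ : (n + n).+2 = n.+1 + n.+1)%N; last by lia.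
  rewrite (coefM_top sXa sXa) cXa (_ : n.+1 + n.+1 = n + n + 2)%N; last by lia.
  rewrite (coefM_top sab sXl) (coefM_top sbb sm) cXl cm !coefM_top //.
have : (size (quad_norm u * 'X * 'X)%R <= (n + n).+3)%N.
  rewrite e; apply: leq_trans (size_polyD _ _) _; rewrite size_polyN geq_max; apply/andP; split.
    apply: leq_trans (size_polyD _ _) _; rewrite geq_max; apply/andP.
    by split; [apply: leq_trans s1 _ | apply: leq_trans s2 _]; lia.
  by apply: leq_trans s3 _; lia.
have [->|h0] := eqVneq (quad_norm u) 0; first by rewrite size_poly0.
by rewrite !size_mulX ?mulf_neq0 ?polyX_eq0.
Qed.

(** The leading coefficient of the norm is a value of the anisotropic form [top_norm], so the norm
    has exactly twice the degree. Integrality of the ring and additivity of [dg] follow from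
    multiplicativity of the norm. *)
Lemma size_norm u : u != 0 -> (size (quad_norm u)).+1 = (dg u + dg u)%N.
Proof.
move=> u0; case e : (dg u) => [|n]; first by move: u0; rewrite -dg_eq0 e.
have [s c] := norm_top (eq_leq e).
suff : (size (quad_norm u) > n + n)%N by lia.
rewrite ltnNge; apply/negP => /leq_sizeP/(_ _ (leqnn _)); rewrite c => /top_norm_eq0[h1 h2].
have : (dg u <= n)%N by move: (eq_leq e); rewrite !dg_le => /andP[k1 k2]; apply/andP; split; apply: size_drop_top.
by rewrite e ltnn.
Qed.

Lemma quad_norm_eq0 u : quad_norm u = 0 -> u = 0.
Proof. by move=> h; apply/eqP/contraT => /size_norm; rewrite h size_poly0; lia. Qed.

Lemma quad_integral u v : u * v = 0 -> u = 0 \/ v = 0.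
Proof.
move=> h; have /eqP : quad_norm u * quad_norm v = 0.
  by rewrite -quad_normM h /quad_norm /= expr0n /= !mul0r subr0 addr0.
by rewrite mulf_eq0 => /orP[]/eqP/quad_norm_eq0; [left|right].
Qed.

Lemma dgM u v : u != 0 -> v != 0 -> (dg (u * v)%R).+1 = (dg u + dg v)%N.
Proof.
move=> u0 v0; have uv0 : u * v != 0.
  by apply/eqP => /quad_integral[]/eqP; apply/negP.
have := size_norm uv0; rewrite quad_normM size_mul; last 2 first.
- by apply: contra u0 => /eqP/quad_norm_eq0 ->.
- by apply: contra v0 => /eqP/quad_norm_eq0 ->.
have := size_norm u0; have := size_norm v0.
move: (size (quad_norm u)) (size (quad_norm v)) (dg u) (dg v) (dg _) => *; lia.
Qed.

Definition lin_mono (a b : k) (n : nat) : Q := Quad (a *: 'X^(n.+1)) (b *: 'X^n).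

(** The leading terms are divided in k(zeta), and the quotient a + b zeta is realized by a y^(n+1) +
    b y^n z. This needs a strict inequality of pole orders: at equal orders a + b z / y is not in
    the ring, so that division with remainder stops one step short of the Euclidean algorithm. *)
Lemma dg_cancel u v n : v != 0 -> dg u = (dg v + n.+1)%N ->
  exists a b : k, (dg (u - lin_mono a b n * v)%R < dg u)%N.
Proof.
move=> v0; case e : (dg v) => [|M]; first by move: v0; rewrite -dg_eq0 e.
rewrite addSn => eu; have := eq_leq e; have := eq_leq eu; rewrite !dg_le.
set q := qb v * 'X; set p := qa v => /andP[su su'] /andP[sp sq].
set U := (qa u)`_(M + n.+1); set U' := (qb u * 'X)`_(M + n.+1).
pose P := p`_M; pose S := q`_M.
have D0 : top_norm P S != 0.
  apply/eqP => /top_norm_eq0[h1 h2].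
  have : (dg v <= M)%N by rewrite dg_le; apply/andP; split; apply: size_drop_top.
  by rewrite e ltnn.
(* Cramer's rule for (a + b zeta) (P + S zeta) = U + U' zeta; the determinant is the norm of P + S
   zeta. *)
pose a := (U * (P + S * l1) - U' * S * m2) / top_norm P S.
pose b := (U' * P - U * S) / top_norm P S.
have [sl cl] := lpolE; have [sm cm] := mpolE.
exists a, b; rewrite eu ltnS dg_le /= -/p.
have szX (c : k) r j i (pp : {poly k}) : (size pp <= j)%N -> (j + r <= i)%N ->
    (size (c *: 'X^r * pp)%R <= i)%N.
  move=> h hi; apply: leq_trans hi; rewrite -scalerAl; apply: leq_trans (size_scale_leq _ _) _.
  have [->|pp0] := eqVneq pp 0; first by rewrite mulr0 size_poly0.
  by rewrite mulrC size_mulXn //; lia.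
have cX (c : k) r j i (pp : {poly k}) : i = (j + r)%N -> (c *: 'X^r * pp)`_i = c * pp`_j.
  by move=> ->; rewrite -scalerAl coefZ coefXnM ltnNge leq_addl /= addnK.
have sqm : (size (qb v * mpol)%R <= M.+2)%N.
  have [->|w0] := eqVneq (qb v) 0; first by rewrite mul0r size_poly0.
  apply: leq_trans (size_polyMleq _ _) _; move: sq sm; rewrite /q size_mulX //.
  by move: (size (qb v)) (size mpol) => x y; lia.
have cqm : (qb v * mpol)`_M.+1 = S * m2.
  rewrite -coefMX' (_ : _ * 'X = q * mpol); last by rewrite /q; ring.
  by rewrite -addn2 coefM_top // cm.
have sql : (size (q * lpol)%R <= M.+2)%N by rewrite -(addn1 M); apply: sizeM_le.
have cql : (q * lpol)`_M.+1 = S * l1 by rewrite -(addn1 M) coefM_top // cl.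
have e2 : (qb u - (a *: 'X^(n.+1) * qb v + b *: 'X^n * p + b *: 'X^n * qb v * lpol)) * 'X =
   qb u * 'X - (a *: 'X^(n.+1) * q + b *: 'X^(n.+1) * p + b *: 'X^n * (q * lpol)).
  by rewrite /q -!mul_polyC exprS; ring.
rewrite e2 -mulrA; apply/andP; split; apply: size_drop_top.
- apply: leq_trans (size_polyD _ _) _; rewrite size_polyN geq_max su /=.
  apply: leq_trans (size_polyD _ _) _; rewrite geq_max (szX _ _ _ _ _ sp) ?(szX _ _ _ _ _ sqm) //; lia.
- rewrite coefB -/U coefD (cX _ _ M) ?(cX _ _ M.+1) ?cqm -/P //; last by lia.
  by rewrite /a /b /top_norm; field.
- apply: leq_trans (size_polyD _ _) _; rewrite size_polyN geq_max su' /=.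
  apply: leq_trans (size_polyD _ _) _; rewrite geq_max (szX _ _ _ _ _ sql) ?andbT; last by lia.
  by apply: leq_trans (size_polyD _ _) _; rewrite geq_max (szX _ _ _ _ _ sq) ?(szX _ _ _ _ _ sp) //; lia.
rewrite coefB -/U' !coefD (cX _ _ M) // (cX _ _ M) // (cX _ _ M.+1) ?cql -/P -/S; last by lia.
by rewrite /a /b /top_norm; field.
Qed.

Definition cst (c : k) : Q := Quad c%:P 0.
Definition Y : Q := Quad 'X 0.
Definition Z : Q := Quad 0 1.

Lemma cst_zmod : zmod_morphism cst.
Proof. by move=> a b; apply: quadP; rewrite /= ?polyCB ?subr0. Qed.
Lemma cst_monoid : monoid_morphism cst.
Proof. by split=> // a b; apply: quadP => /=; rewrite ?polyCM; ring. Qed.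
HB.instance Definition _ := GRing.isZmodMorphism.Build k Q cst cst_zmod.
HB.instance Definition _ := GRing.isMonoidMorphism.Build k Q cst cst_monoid.

Lemma quadric_eq0 : Z ^+ 2 - (cst l0 + cst l1 * Y) * Z
  - (cst m0 + cst m1 * Y + cst m2 * Y ^+ 2) = 0.
Proof. by apply: quadP; rewrite /= /lpol /mpol -!mul_polyC; ring. Qed.

Lemma dg_drop u n : (dg u <= n.+1)%N -> (qa u)`_n = 0 -> (qb u * 'X)`_n = 0 -> (dg u <= n)%N.
Proof. by rewrite !dg_le => /andP[h1 h2] h3 h4; apply/andP; split; apply: size_drop_top. Qed.

Lemma dg_cst c : (dg (cst c) <= 1)%N.
Proof. by rewrite dg_le /= mul0r size_poly0 size_polyC leq_b1. Qed.

Lemma dg_le1 u : (dg u <= 1)%N -> exists c, u = cst c.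
Proof.
rewrite dg_le => /andP[h1 h2]; exists (qa u)`_0; apply: quadP => /=; first exact: size1_polyC.
apply/eqP/contraT => b0; move: h2; rewrite size_mulX //.
by have := b0; rewrite -size_poly_gt0; lia.
Qed.

Lemma dg_cstM c u n : (dg u <= n)%N -> (dg (cst c * u)%R <= n)%N.
Proof.
rewrite !dg_le /= !mul0r !addr0 -mulrA !mul_polyC => /andP[h1 h2].
by apply/andP; split; apply: leq_trans (size_scale_leq _ _) _.
Qed.

Section Principal.
Variable I : Q -> Prop.
Hypotheses (I0 : I 0) (ID : forall u v, I u -> I v -> I (u + v))
  (IM : forall w u, I u -> I (w * u)).

Lemma ideal_sub u v : I u -> I v -> I (u - v).
Proof. by move=> hu hv; rewrite -mulN1r; apply/ID/IM. Qed.

Lemma ideal_reduce f u : I f -> f != 0 -> I u ->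
  exists w, I (u - w * f) /\ (dg (u - w * f)%R <= dg f)%N.
Proof.
move=> hf f0; have [n] := ubnP (dg u); elim: n u => // n IH u hn hu.
case: (leqP (dg u) (dg f)) => h; first by exists 0; rewrite mul0r subr0.
have [|a [b hab]] := @dg_cancel u f (dg u - dg f).-1 f0; first by lia.
set w := lin_mono _ _ _ in hab; have [||w' [h1 h2]] := IH (u - w * f).
- by apply: leq_trans hab _; rewrite -ltnS.
- exact/ideal_sub/IM.
by exists (w + w'); rewrite mulrDl opprD addrA.
Qed.

(* Let [f] have minimal degree in the ideal. If some [g] in it is not a multiple of [f],
   then [g] may be taken of the same degree and the ideal is [(f) + k g]; hence
   [y g = delta g] and [z g = delta' g] modulo [f], and [(1 : delta : delta')] would be a
   rational point of the conic. *)
Lemma ideal_principal : exists d, I d /\ forall u, I u -> exists w, u = w * d.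
Proof.
have [[u [hu u0]]|no] := pselect (exists u, I u /\ u != 0); last first.
  exists 0; split=> // u hu; exists 0; rewrite mul0r.
  by apply/eqP/contraT => u0; case: no; exists u.
have ex : exists n, `[< exists u, [/\ I u, u != 0 & dg u = n] >].
  by exists (dg u); apply/asboolP; exists u.
case: (ex_minnP ex) => n /asboolP[f [hf f0 en]] hmin {u hu u0 ex}.
have {}hmin u : I u -> (dg u < n)%N -> u = 0.
  move=> hu h; apply/eqP/contraT => u0; have : (n <= dg u)%N by apply/hmin/asboolP; exists u.
  by rewrite leqNgt h.
exists f; split=> // g0 hg0; apply: contrapT => ng0.
have [w0 [hg dg_g]] := ideal_reduce hf f0 hg0; set g := g0 - _ in hg dg_g.
have ng w : g <> w * f.
  by move=> e; apply: ng0; exists (w0 + w); rewrite mulrDl -e /g addrC subrK.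
case: n en hmin => [|M] en hmin; first by move: f0; rewrite -dg_eq0 en.
have top u (a b : k) : I u -> (dg u <= M.+1)%N -> (qa u)`_M = a * (qa f)`_M + b * (qa g)`_M ->
    (qb u * 'X)`_M = a * (qb f * 'X)`_M + b * (qb g * 'X)`_M ->
    u = cst a * f + cst b * g.
  move=> hu du e1 e2; apply/eqP; rewrite -subr_eq0; apply/eqP; apply: hmin.
    by apply: ideal_sub => //; apply: ID; apply: IM.
  rewrite ltnS; apply: dg_drop.
  - apply: dgD => //; rewrite dgN; apply: dgD; apply: dg_cstM; by rewrite -en.
  - by rewrite /= !mul0r !addr0 !mul_polyC coefB coefD !coefZ e1 subrr.
  rewrite /= !mul0r !addr0 !mul_polyC mulrBl mulrDl -!scalerAl coefB coefD !coefZ e2 subrr //.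
set f1 := (qa f)`_M in top; set f2 := (qb f * 'X)`_M in top.
set g1 := (qa g)`_M in top; set g2 := (qb g * 'X)`_M in top.
(* The leading terms of f and g are independent over k: otherwise a constant multiple of f could be
   subtracted from g, with a result of degree below the minimum, hence zero. They therefore span all
   leading terms in that degree. *)
have det0 : f1 * g2 - f2 * g1 != 0.
  apply/eqP => det; have le_g : (dg g <= M.+1)%N by rewrite -en.
  have [f10|f10] := eqVneq f1 0; last first.
    apply: (ng (cst (g1 / f1))); have := top g (g1 / f1) 0 hg le_g.
    rewrite rmorph0 !mul0r !addr0; apply; first by rewrite divfK.
    apply: (mulfI f10); move/eqP: det; rewrite subr_eq0 => /eqP ->; field.
    exact: f10.
  have [f20|f20] := eqVneq f2 0.
    have : (dg f <= M)%N by apply: dg_drop => //; rewrite en.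
    by rewrite en ltnn.
  apply: (ng (cst (g2 / f2))); have := top g (g2 / f2) 0 hg le_g.
  rewrite rmorph0 !mul0r !addr0; apply; last by rewrite divfK.
  move: det; rewrite f10 mul0r sub0r mulr0 => /eqP; rewrite oppr_eq0 mulf_eq0 (negbTE f20) /=.
  by move/eqP.
have span u : I u -> exists w c, u = w * f + cst c * g.
  move=> hu; have [w [hw dw]] := ideal_reduce hf f0 hu; rewrite en in dw.
  set u1 := (qa (u - w * f))`_M; set u2 := (qb (u - w * f) * 'X)`_M.
  have e := top _ ((u1 * g2 - u2 * g1) / (f1 * g2 - f2 * g1))
                  ((f1 * u2 - f2 * u1) / (f1 * g2 - f2 * g1)) hw dw.
  exists (w + cst ((u1 * g2 - u2 * g1) / (f1 * g2 - f2 * g1))).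
  exists ((f1 * u2 - f2 * u1) / (f1 * g2 - f2 * g1)).
  rewrite mulrDl -addrA -e ?(addrC (w * f)) ?subrK // -/u1 -/u2; field; exact: det0.
have [w1 [d1 e1]] := span _ (IM Y hg); have [w2 [d2 e2]] := span _ (IM Z hg).
pose c0 := d2 ^+ 2 - (l0 + l1 * d1) * d2 - (m0 + m1 * d1 + m2 * d1 ^+ 2).
have c00 : c0 != 0.
  apply/eqP => h; have [|/eqP] := @aniso 1 d1 d2; last by rewrite oner_eq0.
  by rewrite -[RHS]h /c0 expr1n !mulr1.
pose P := cst l0 + cst l1 * Y - Z - cst d2.
pose P' := cst l1 * cst d2 + cst m1 + cst m2 * (Y + cst d1).
have ec : cst c0 * g = (w2 * P + w1 * P') * f.
  have -> : cst c0 = (Z - cst d2) * P + (Y - cst d1) * P'.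
    rewrite /c0 !(rmorphB cst, rmorphD cst, rmorphM cst, rmorphXn cst).
    by rewrite (quadric_taylor _ _ _ _ _ Y Z) quadric_eq0 addr0.
  have h1 : (Z - cst d2) * g = w2 * f by rewrite mulrBl e2 addrK.
  have h2 : (Y - cst d1) * g = w1 * f by rewrite mulrBl e1 addrK.
  rewrite (mulrDl _ _ g) (mulrAC _ P g) h1 (mulrAC _ P' g) h2 (mulrDl _ _ f).
  by rewrite (mulrAC w2 P f) (mulrAC w1 P' f).
apply: (ng (cst c0^-1 * (w2 * P + w1 * P'))).
by rewrite -mulrA -ec mulrA -(rmorphM cst) mulVf // rmorph1 mul1r.
Qed.

End Principal.

Section Fractions.
Variables (F : fieldType) (frac_of : {rmorphism Q -> F}).
Hypothesis frac_of_inj : injective frac_of.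
Hypothesis frac_ofP : forall x : F, exists u v : Q, v != 0 /\ x = frac_of u / frac_of v.

Lemma frac_of_eq0 u : (frac_of u == 0) = (u == 0).
Proof. by rewrite -(rmorph0 frac_of) (inj_eq frac_of_inj). Qed.

Definition in_coord (x : F) := exists u, x = frac_of u.

Lemma in_coord0 : in_coord 0. Proof. by exists 0; rewrite (rmorph0 frac_of). Qed.
Lemma in_coord1 : in_coord 1. Proof. by exists 1; rewrite (rmorph1 frac_of). Qed.
Lemma in_coordD x y : in_coord x -> in_coord y -> in_coord (x + y).
Proof. by move=> [u ->] [v ->]; exists (u + v); rewrite (rmorphD frac_of). Qed.
Lemma in_coordN x : in_coord x -> in_coord (- x).
Proof. by move=> [u ->]; exists (- u); rewrite (rmorphN frac_of). Qed.
Lemma in_coordM x y : in_coord x -> in_coord y -> in_coord (x * y).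
Proof. by move=> [u ->] [v ->]; exists (u * v); rewrite (rmorphM frac_of). Qed.
Definition coord_sub := Subring in_coord0 in_coord1 in_coordD in_coordN in_coordM.

Definition at_infty (x : F) := exists u v, [/\ v != 0, (dg u <= dg v)%N & x = frac_of u / frac_of v].

Lemma at_infty_cst c : at_infty (frac_of (cst c)).
Proof.
exists (cst c), 1; rewrite oner_neq0 (rmorph1 frac_of) divr1; split=> //.
apply: leq_trans (dg_cst _) _; rewrite lt0n dg_eq0; exact: oner_neq0.
Qed.
Lemma at_infty0 : at_infty 0.
Proof. by have := at_infty_cst 0; rewrite (rmorph0 cst) (rmorph0 frac_of). Qed.
Lemma at_infty1 : at_infty 1.
Proof. by have := at_infty_cst 1; rewrite (rmorph1 cst) (rmorph1 frac_of). Qed.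

Lemma dgM_le u v u' v' : u' != 0 -> v' != 0 -> (dg u <= dg u')%N -> (dg v <= dg v')%N ->
  (dg (u * v)%R <= dg (u' * v')%R)%N.
Proof.
move=> u'0 v'0 hu hv; have [->|u0] := eqVneq u 0; first by rewrite mul0r dg0.
have [->|v0] := eqVneq v 0; first by rewrite mulr0 dg0.
by have := dgM u0 v0; have := dgM u'0 v'0; lia.
Qed.

Lemma quad_neq0M u v : u != 0 -> v != 0 -> u * v != 0.
Proof. by move=> u0 v0; apply/eqP => /quad_integral[]/eqP; apply/negP. Qed.

Lemma at_inftyD x y : at_infty x -> at_infty y -> at_infty (x + y).
Proof.
move=> [u [v [v0 d1 ->]]] [u' [v' [v'0 d2 ->]]]; exists (u * v' + u' * v), (v * v').
split; first exact: quad_neq0M.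
  by apply: dgD; [|rewrite (mulrC v)]; apply: dgM_le.
by rewrite (rmorphD frac_of) !(rmorphM frac_of) addf_div ?frac_of_eq0.
Qed.
Lemma at_inftyM x y : at_infty x -> at_infty y -> at_infty (x * y).
Proof.
move=> [u [v [v0 d1 ->]]] [u' [v' [v'0 d2 ->]]]; exists (u * u'), (v * v').
split; [exact: quad_neq0M | exact: dgM_le |].
by rewrite !(rmorphM frac_of) mulf_div.
Qed.
Lemma at_inftyN x : at_infty x -> at_infty (- x).
Proof. by move=> [u [v [v0 d1 ->]]]; exists (- u), v; rewrite dgN (rmorphN frac_of) mulNr. Qed.
Definition infty_sub := Subring at_infty0 at_infty1 at_inftyD at_inftyN at_inftyM.

Lemma YX n : Y ^+ n = Quad 'X^n 0.
Proof.
elim: n => [|n IH]; first by rewrite !expr0.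
by rewrite exprS IH exprS; apply: quadP; rewrite /= !(mul0r, mulr0, addr0).
Qed.

Lemma dg_YX n : dg (Y ^+ n) = n.+1.
Proof. by rewrite YX /dg /= mul0r size_poly0 size_polyXn maxn0. Qed.

Lemma Y_neq0 n : Y ^+ n != 0.
Proof. by rewrite -dg_eq0 dg_YX. Qed.

Local Notation y := (frac_of Y).
Local Notation z := (frac_of Z).

Lemma y_neq0 : y != 0.
Proof. by rewrite frac_of_eq0 -(expr1 Y) Y_neq0. Qed.

Lemma dg_YXM u n : u != 0 -> dg (Y ^+ n * u)%R = (n + dg u)%N.
Proof. by move=> u0; have := dgM (Y_neq0 n) u0; rewrite dg_YX; lia. Qed.

Lemma dg_Y : dg Y = 2%N.
Proof. by have := dg_YX 1; rewrite expr1. Qed.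

Lemma dg_YM u : u != 0 -> dg (Y * u)%R = (dg u).+1.
Proof. by move=> u0; have := dg_YXM 1 u0; rewrite expr1. Qed.

Lemma at_infty_frac u v : v != 0 -> at_infty (frac_of u / frac_of v) -> (dg u <= dg v)%N.
Proof.
move=> v0 [u' [v' [v'0 h e]]].
have [->|u0] := eqVneq u 0; first by rewrite dg0.
have e2 : u * v' = u' * v.
  apply: frac_of_inj; rewrite !(rmorphM frac_of).
  by apply/eqP; rewrite -eqr_div ?frac_of_eq0 //; apply/eqP.
have u'0 : u' != 0.
  apply/eqP => u'0; move: e2; rewrite u'0 mul0r => /eqP; apply/negP; exact: quad_neq0M.
by have := dgM u0 v'0; have := dgM u'0 v0; rewrite e2; lia.
Qed.

Lemma decompose_step u v : v != 0 -> dg u = dg v ->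
  exists (a b : k), at_infty (y * (frac_of u / frac_of v - (frac_of (cst a) + frac_of (cst b) * (y^-1 * z)))).
Proof.
move=> v0 e; have u0 : u != 0 by rewrite -dg_eq0 e dg_eq0.
have [|a [b h]] := @dg_cancel (Y * u) v 0 v0.
  by rewrite dg_YM // e addn1.
exists a, b; exists (Y * u - lin_mono a b 0 * v), v; split=> //.
  by move: h; rewrite dg_YM // e ltnS.
have -> : lin_mono a b 0 = cst a * Y + cst b * Z.
  by apply: quadP; rewrite /lin_mono /= ?expr1 ?expr0 -!mul_polyC; ring.
rewrite (rmorphB frac_of) !(rmorphM frac_of) (rmorphD frac_of) !(rmorphM frac_of).
by field; rewrite ?y_neq0 ?frac_of_eq0 ?v0 ?y_neq0.
Qed.

(** Write x = u / v and compare pole orders. If that of u is larger, a multiple of v with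
    coefficient in B lowers it; if smaller, x lies in tO; if equal, x has a value a + b zeta at
    infinity, which a + b t z represents, and a lies in B. *)
Lemma decompose (x : F) : exists b c o,
  [/\ in_coord b, at_infty o & x = b + frac_of (cst c) * (y^-1 * z) + y^-1 * o].
Proof.
have [u [v [v0 ->]]] := frac_ofP x; have [n] := ubnP (dg u).
elim: n u => // n IH u hn.
case: (ltngtP (dg u) (dg v)) => h.
- exists 0, 0, (y * (frac_of u / frac_of v)); split; first exact: in_coord0.
    exists (Y * u), v; split=> //; last by rewrite (rmorphM frac_of) mulrA.
    have [->|u0] := eqVneq u 0; first by rewrite mulr0 dg0.
    by rewrite dg_YM.
  by rewrite (rmorph0 cst) (rmorph0 frac_of); field; rewrite ?y_neq0 ?frac_of_eq0 ?v0 ?y_neq0.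
- have [|a [b hab]] := @dg_cancel u v (dg u - dg v).-1 v0; first by lia.
  set w := lin_mono _ _ _ in hab; have [|b' [c [o [hb ho e]]]] := IH (u - w * v).
    by apply: leq_trans hab _; rewrite -ltnS.
  exists (frac_of w + b'), c, o; split=> //; first by apply: in_coordD => //; exists w.
  rewrite -!addrA [b' + _]addrA -e (rmorphB frac_of) (rmorphM frac_of).
  by field; rewrite frac_of_eq0.
have [a [b ho]] := decompose_step v0 h.
exists (frac_of (cst a)), b; eexists; split; [by exists (cst a) | exact: ho |].
by field; rewrite ?y_neq0 ?frac_of_eq0 ?v0 ?y_neq0.
Qed.

Lemma valuation_infty (x : F) : x != 0 -> exists (n : int) (w : F),
  [/\ at_infty w, at_infty w^-1 & x = y^-1 ^ n * w].
Proof.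
have [u [v [v0 ->]]] := frac_ofP x; rewrite mulf_eq0 negb_or frac_of_eq0 => /andP[u0 _].
have unit u' v' : u' != 0 -> v' != 0 -> dg u' = dg v' ->
    at_infty (frac_of u' / frac_of v') /\ at_infty (frac_of u' / frac_of v')^-1.
  by move=> u'0 v'0 e; split; [exists u', v' | exists v', u'; rewrite invf_div]; rewrite e.
have yn n : y ^+ n != 0 by rewrite expf_neq0 ?y_neq0.
case: (leqP (dg u) (dg v)) => h.
  have [//|//||h1 h2] := unit (Y ^+ (dg v - dg u) * u) v.
  - exact/quad_neq0M/u0/Y_neq0.
  - by rewrite dg_YXM // subnK.
  exists (dg v - dg u)%N, (frac_of (Y ^+ (dg v - dg u) * u) / frac_of v); split=> //.
  by rewrite (rmorphM frac_of) (rmorphXn frac_of) -exprnP exprVn !mulrA mulVf // mul1r.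
have [//|//||h1 h2] := unit u (Y ^+ (dg u - dg v) * v).
- exact/quad_neq0M/v0/Y_neq0.
- by rewrite dg_YXM // subnK // ltnW.
exists (- (dg u - dg v)%N%:Z), (frac_of u / frac_of (Y ^+ (dg u - dg v) * v)); split=> //.
rewrite (rmorphM frac_of) (rmorphXn frac_of) -exprnN exprVn invrK.
by field; rewrite ?yn ?frac_of_eq0 ?v0 ?yn.
Qed.

Definition base (c : k) : F := frac_of (cst c).
HB.instance Definition _ := GRing.RMorphism.copy base (frac_of \o cst).

Lemma dg_lin a b : dg (cst a * Y + cst b * Z) = if (a == 0) && (b == 0) then 0%N else 2%N.
Proof.
have -> : cst a * Y + cst b * Z = Quad (a *: 'X) b%:P.
  by apply: quadP; rewrite /= -?mul_polyC; ring.
rewrite /dg /= mul_polyC; have [->|a0] := eqVneq a 0; rewrite ?scale0r ?size_poly0 ?max0n.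
  by have [->|b0] := eqVneq b 0; rewrite ?scale0r ?size_poly0 // size_scale // size_polyX.
by have [->|b0] := eqVneq b 0; rewrite ?scale0r ?size_poly0 !size_scale // size_polyX.
Qed.

Definition affine_conic_rings : conic_rings k.
Proof.
apply: (@ConicRings k F base coord_sub infty_sub y^-1 z).
- by rewrite invr_eq0 y_neq0.
- by exists Z.
- by rewrite invrK; exists Y.
- by move=> c; exists (cst c).
- exact: at_infty_cst.
- exists 1, Y; rewrite dg_Y (rmorph1 frac_of) div1r; split=> //; first by rewrite -dg_eq0 dg_Y.
  by have := dg_cst 1; rewrite (rmorph1 cst); lia.
- exists Z, Y; rewrite mulrC dg_Y; split=> //; first by rewrite -dg_eq0 dg_Y.
  by rewrite dg_le /= size_poly0 mul1r size_polyX.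
- rewrite invrK => -[u [v [v0 h e]]].
  have /eqP : frac_of (Y * v) = frac_of u by rewrite (rmorphM frac_of) e divfK // frac_of_eq0.
  by rewrite (inj_eq frac_of_inj) => /eqP eu; move: h; rewrite -eu dg_YM // ltnn.
- move=> _ [u ->] h; have [|c ->] := @dg_le1 u; last by exists c.
  rewrite -[frac_of u]divr1 -(rmorph1 frac_of) in h.
  by apply: leq_trans (at_infty_frac (oner_neq0 _) h) _; have := dg_cst 1; rewrite (rmorph1 cst).
- exact: decompose.
- move=> a b; rewrite invrK.
  have -> : (base a + base b * (y^-1 * z)) * y = frac_of (cst a * Y + cst b * Z) / frac_of 1.
    by rewrite (rmorphD frac_of) !(rmorphM frac_of) (rmorph1 frac_of) divr1 /base; field; rewrite ?y_neq0.
  move/(at_infty_frac (oner_neq0 _)) => h.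
  have := dg_cst 1; rewrite (rmorph1 cst) => /(leq_trans h); rewrite dg_lin.
  by have [->|_] := eqVneq a 0; have [->|_] := eqVneq b 0.
- exact: valuation_infty.
move=> _ _ [u ->] [v ->]; pose I x := exists p q, x = u * p + v * q.
have [|||d [[p [q e]] hd]] := @ideal_principal I.
- by exists 0, 0; rewrite !mulr0 addr0.
- by move=> _ _ [p [q ->]] [p' [q' ->]]; exists (p + p'), (q + q'); ring.
- by move=> w _ [p [q ->]]; exists (w * p), (w * q); ring.
have [a ea] : exists a, u = a * d by apply: hd; exists 1, 0; ring.
have [b eb] : exists b, v = b * d by apply: hd; exists 0, 1; ring.
exists (frac_of d), (frac_of p), (frac_of q), (frac_of a), (frac_of b).
split; first by split; eexists.
- by rewrite {1}ea (rmorphM frac_of) mulrC.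
- by rewrite {1}eb (rmorphM frac_of) mulrC.
by rewrite {1}e (rmorphD frac_of) !(rmorphM frac_of).
Defined.

End Fractions.

End AffineConic.

(** * Homogeneous polynomials and the equation of the conic *)

Definition i0 : 'I_3 := @Ordinal 3 0 isT.
Definition i1 : 'I_3 := @Ordinal 3 1 isT.
Definition i2 : 'I_3 := @Ordinal 3 2 isT.

Lemma I3_ind (P : 'I_3 -> Prop) : P i0 -> P i1 -> P i2 -> forall i, P i.
Proof.
move=> h0 h1 h2 [[|[|[|//]]] h].
- by rewrite (_ : Ordinal h = i0) //; apply: val_inj.
- by rewrite (_ : Ordinal h = i1) //; apply: val_inj.
by rewrite (_ : Ordinal h = i2) //; apply: val_inj.
Qed.

Lemma sum3 (V : nmodType) (f : 'I_3 -> V) : \sum_i f i = f i0 + f i1 + f i2.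
Proof.
rewrite !big_ord_recl big_ord0 addr0 addrA.
by congr (_ + _ + _); congr f; apply: val_inj.
Qed.

Section HomogInd.
Variable k : fieldType.
Local Notation A := {mpoly k[3]}.

(** The degree is an argument of the property because most uses prove a bound depending on it, such
    as the integrality of [ev h * t ^+ d]. *)
Lemma homog_ind (P : nat -> A -> Prop) :
  (forall d, P d 0) -> (forall d f g, P d f -> P d g -> P d (f + g)) ->
  (forall c, P 0 c%:MP) ->
  (forall d i f, f \is d.-homog -> P d f -> P d.+1 ('X_i * f)) ->
  forall d h, h \is d.-homog -> P d h.
Proof.
move=> P0 PD PC PX.
have mon d (m : 'X_{1..3}) c : mdeg m = d -> P d (c *: 'X_[m]).
  elim: d m => [|d IH] m hm.
    have -> : m = 0%MM by apply/eqP; rewrite -mdeg_eq0 hm.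
    by rewrite mpolyX0 -[c *: 1]mul_mpolyC mulr1; apply: PC.
  have [i hi] : exists i, (m i != 0)%N.
    apply: contrapT => h; suff : mdeg m = 0%N by rewrite hm.
    apply/eqP; rewrite mdeg_eq0; apply/eqP/mnmP => i; rewrite mnm0E.
    by apply/eqP/negPn/negP => hi; apply: h; exists i.
  have em : m = (U_(i) + (m - U_(i)))%MM by rewrite addmC submK // lep1mP.
  have dm : mdeg (m - U_(i))%MM = d by move: hm; rewrite {1}em mdegD mdeg1 => -[].
  rewrite {1}em mpolyXD scalerAr; apply: PX; last exact: IH.
  by rewrite rpredZ // dhomogX; apply/eqP.
move=> d h /dhomogP hh; rewrite [h]mpolyE big_seq.
elim/big_ind: _ => [|f g|m hm]; [exact: P0 | exact: PD | exact/mon/hh].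
Qed.

Lemma homogS d (h : A) : h \is d.+1.-homog ->
  exists f : 'I_3 -> A, (forall i, f i \is d.-homog) /\ h = \sum_i 'X_i * f i.
Proof.
move=> hh; pose P n (h : A) := n = d.+1 ->
  exists f : 'I_3 -> A, (forall i, f i \is d.-homog) /\ h = \sum_i 'X_i * f i.
suff : P d.+1 h by apply.
apply: (homog_ind (P := P)) hh => {h}.
- move=> n _; exists (fun=> 0); split; first by move=> i; rewrite rpred0.
  by rewrite big1 // => i _; rewrite mulr0.
- move=> n f g Pf Pg en; have [f' [hf ->]] := Pf en; have [g' [hg ->]] := Pg en.
  exists (fun i => f' i + g' i); split; first by move=> i; rewrite rpredD.
  by rewrite -big_split; apply: eq_bigr => i _; rewrite mulrDr.
- by [].
move=> n i f hf _ [en]; exists (fun j => if j == i then f else 0); split.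
  by move=> j; case: eqP; rewrite ?rpred0 // -en.
by rewrite (bigD1 i) //= eqxx big1 ?addr0 // => j /negbTE ->; rewrite mulr0.
Qed.

Lemma homog0C (h : A) : h \is 0.-homog -> exists c, h = c%:MP.
Proof.
move=> hh; pose P n (h : A) := n = 0%N -> exists c, h = c%:MP.
suff : P 0%N h by apply.
apply: (homog_ind (P := P)) hh => {h}.
- by exists 0; rewrite mpolyC0.
- move=> n f g Pf Pg en; have [a ->] := Pf en; have [b ->] := Pg en.
  by exists (a + b); rewrite mpolyCD.
- by move=> c; exists c.
by [].
Qed.

End HomogInd.

Section Form.
Variables (k : fieldType) (c l0 l1 m0 m1 m2 : k).
Local Notation A := {mpoly k[3]}.
Local Notation x0 := ('X_i0 : A).
Local Notation x1 := ('X_i1 : A).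
Local Notation x2 := ('X_i2 : A).

(** The equation solved for x_2^2, which makes the affine ring a quadratic extension of k[y].
    [std_form_d] lists its partial derivatives. *)
Definition std_form : A := c%:MP * (x2 ^+ 2 - (l0%:MP * x0 + l1%:MP * x1) * x2
  - (m0%:MP * x0 ^+ 2 + m1%:MP * x0 * x1 + m2%:MP * x1 ^+ 2)).

Definition std_form_d (i : 'I_3) : A :=
  if i == i0 then c%:MP * (- l0%:MP * x2 - m0%:MP * x0 *+ 2 - m1%:MP * x1)
  else if i == i1 then c%:MP * (- l1%:MP * x2 - m1%:MP * x0 - m2%:MP * x1 *+ 2)
  else c%:MP * (x2 *+ 2 - (l0%:MP * x0 + l1%:MP * x1)).

End Form.

(* The function field [aF] of the conic; [ev] dehomogenizes by [x_0 = 1]. *)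
Record func_field (k : fieldType) (q : {mpoly k[3]}) := FuncField {
  ffR :> conic_rings k;
  ff_c : k; ff_l0 : k; ff_l1 : k; ff_m0 : k; ff_m1 : k; ff_m2 : k;
  ff_q : q = std_form ff_c ff_l0 ff_l1 ff_m0 ff_m1 ff_m2;
  ff_c0 : ff_c != 0;
  ev : {rmorphism {mpoly k[3]} -> aF ffR};
  ev_C : forall a, ev a%:MP = ai ffR a;
  ev_X0 : ev 'X_i0 = 1;
  ev_X1 : ev 'X_i1 = (at_ ffR)^-1;
  ev_X2 : ev 'X_i2 = az ffR;
  ev_q : ev q = 0;
  ev_ker : forall d h, h \is d.-homog -> ev h = 0 -> exists h', h = h' * q;
  ev_sur : forall d f, aB ffR f -> aO ffR (f * at_ ffR ^+ d) ->
    exists2 h, h \is d.-homog & ev h = f;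
  ff_frac : forall f, exists a b, [/\ aB ffR a, aB ffR b, b != 0 & f = a / b];
  ff_pid : forall I : aF ffR -> Prop, (forall f, I f -> aB ffR f) -> I 0 ->
    (forall f g, I f -> I g -> I (f + g)) -> (forall f g, aB ffR f -> I g -> I (f * g)) ->
    exists d, I d /\ forall f, I f -> exists2 w, aB ffR w & f = w * d;
  der : aF ffR -> aF ffR;
  derD : forall f g, der (f + g) = der f + der g;
  derM : forall f g, der (f * g) = der f * g + f * der g;
  der_cst : forall a, der (ai ffR a) = 0;
  der_X1 : der (at_ ffR)^-1 = ev (std_form_d ff_c ff_l0 ff_l1 ff_m0 ff_m1 ff_m2 i2);
  der_X2 : der (az ffR) = - ev (std_form_d ff_c ff_l0 ff_l1 ff_m0 ff_m1 ff_m2 i1) }.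

Section Homogeneous.
Variables (k : fieldType) (c l0 l1 m0 m1 m2 : k).
Hypothesis c0 : c != 0.
Hypothesis aniso : forall a b c : k,
  c ^+ 2 - (l0 * a + l1 * b) * c - (m0 * a ^+ 2 + m1 * a * b + m2 * b ^+ 2) = 0 ->
  [/\ a = 0, b = 0 & c = 0].
Local Notation A := {mpoly k[3]}.
Local Notation x0 := ('X_i0 : A).
Local Notation x1 := ('X_i1 : A).
Local Notation x2 := ('X_i2 : A).
Local Notation q := (std_form c l0 l1 m0 m1 m2).
Local Notation lpol := (lpol l0 l1).
Local Notation mpol := (mpol m0 m1 m2).
Local Notation Q := (quadratic lpol mpol).
Local Notation cst := (@cst k l0 l1 m0 m1 m2).
Local Notation Y := (@Y k l0 l1 m0 m1 m2).
Local Notation Z := (@Z k l0 l1 m0 m1 m2).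

Implicit Types a b : {poly k}.
(** The homogenization of a(y) in degree d; [hmg2 d b] is that of b(y) z, and is 0 for d = 0, where
    no such term exists. *)
Definition hmg d (a : {poly k}) : A := \sum_(i < d.+1) (a`_i)%:MP * x0 ^+ (d - i) * x1 ^+ i.
Definition hmg2 d (b : {poly k}) : A := if d is d'.+1 then hmg d' b * x2 else 0.

Lemma hmgD d a b : hmg d (a + b) = hmg d a + hmg d b.
Proof.
by rewrite /hmg -big_split; apply: eq_bigr => i _; rewrite coefD mpolyCD !mulrDl.
Qed.

Lemma hmg_0 d : hmg d 0 = 0.
Proof. by rewrite /hmg big1 // => i _; rewrite coef0 mpolyC0 !mul0r. Qed.

Lemma hmgC e d a : hmg d (e%:P * a) = e%:MP * hmg d a.
Proof.
by rewrite /hmg mulr_sumr; apply: eq_bigr => i _; rewrite coefCM mpolyCM !mulrA.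
Qed.

Lemma hmg_x1 d a : x1 * hmg d a = hmg d.+1 ('X * a).
Proof.
rewrite /hmg [RHS]big_ord_recl coefXM mpolyC0 !mul0r add0r mulr_sumr.
apply: eq_bigr => i _; rewrite coefXM /= /bump /= add1n subSS.
by rewrite exprS; ring.
Qed.

Lemma hmg_x0 d a : (size a <= d.+1)%N -> x0 * hmg d a = hmg d.+1 a.
Proof.
move=> ha; rewrite /hmg [RHS]big_ord_recr /= nth_default // mpolyC0 !mul0r addr0 mulr_sumr.
apply: eq_bigr => i _; rewrite subSn; last by rewrite -ltnS.
by rewrite exprS; ring.
Qed.

Lemma dhomogXn (j : 'I_3) n : ('X_j : A) ^+ n \is n.-homog.
Proof. by have := @dhomogMn _ _ mdeg 1 'X_j n; rewrite mul1n; apply; rewrite dhomogX; apply/eqP; exact: mdeg1. Qed.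

Lemma hmg_homog d a : hmg d a \is d.-homog.
Proof.
apply: rpred_sum => i _; rewrite -mulrA.
have := dhomogM (mpolyC_homog a`_i) (dhomogM (dhomogXn i0 (d - i)) (dhomogXn i1 i)).
by rewrite add0n subnK // -ltnS.
Qed.

Lemma hmg2_homog d b : hmg2 d b \is d.-homog.
Proof.
case: d => [|d]; first by rewrite rpred0.
by have := dhomogM (hmg_homog d b) (dhomogXn i2 1); rewrite addn1.
Qed.

(** Division by q, which is monic in x_2 up to the unit c: the remainder is at most linear in x_2.
    Since it can be read off from its dehomogenization, the kernel of the latter on forms consists
    of multiples of q. *)
Lemma homog_reduction d h : h \is d.-homog -> exists a b h',
  [/\ (size a <= d.+1)%N, (size (b * 'X)%R <= d.+1)%N & h = h' * q + hmg d a + hmg2 d b].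
Proof.
apply: (homog_ind (P := fun d h => exists a b h', [/\ (size a <= d.+1)%N,
  (size (b * 'X)%R <= d.+1)%N & h = h' * q + hmg d a + hmg2 d b])) => {d h}.
- move=> d; exists 0, 0, 0; rewrite mul0r size_poly0; split=> //.
  by rewrite hmg_0 /hmg2; case: d => [|d]; rewrite ?hmg_0 !mul0r !addr0.
- move=> d _ _ [a [b [h [ha hb ->]]]] [a' [b' [h' [ha' hb' ->]]]].
  exists (a + a'), (b + b'), (h + h'); rewrite hmgD; split.
  + by apply: leq_trans (size_polyD _ _) _; rewrite geq_max ha.
  + by rewrite mulrDl; apply: leq_trans (size_polyD _ _) _; rewrite geq_max hb.
  by rewrite /hmg2; case: d {ha hb ha' hb'} => [|d]; rewrite ?hmgD; ring.
- move=> e; exists e%:P, 0, 0; rewrite !mul0r size_poly0 size_polyC_leq1; split=> //.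
  by rewrite /hmg big_ord1 coefC eqxx !expr0 /=; ring.
move=> d i f hd [a [b [h [ha hb ef]]]]; rewrite {}ef; clear f hd.
have sX (p : {poly k}) n : (size p <= n)%N -> (size ('X * p)%R <= n.+1)%N.
  by move=> hp; rewrite mulrC; apply: leq_trans (size_polyMleq _ _) _; rewrite size_polyX addn2.
have hb2 : (size b <= d)%N.
  have [->|b0] := eqVneq b 0; first by rewrite size_poly0.
  by move: hb; rewrite size_mulX.
elim/I3_ind: i.
- exists a, b, (x0 * h); split; [exact: leqW | exact: leqW |].
  rewrite -hmg_x0 // mulrDr mulrDr mulrA; congr (_ + _).
  case: d ha hb hb2 => [|d] ha hb hb2 /=; last by rewrite mulrA hmg_x0.
  have -> : b = 0 by apply/eqP; rewrite -size_poly_eq0 -leqn0.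
  by rewrite hmg_0 mulr0 mul0r.
- exists ('X * a), ('X * b), (x1 * h); split; first exact: sX.
    by rewrite -mulrA; apply: sX.
  rewrite -hmg_x1 mulrDr mulrDr mulrA; congr (_ + _).
  case: d ha hb hb2 => [|d] ha hb hb2 /=; last by rewrite mulrA hmg_x1.
  have -> : b = 0 by apply/eqP; rewrite -size_poly_eq0 -leqn0.
  by rewrite !mulr0 hmg_0 mul0r.
case: d ha hb hb2 => [|d] ha hb hb2.
  exists 0, a, (x2 * h); split; rewrite ?size_poly0 //.
    by rewrite mulrC; apply: sX.
  have -> : b = 0 by apply/eqP; rewrite -size_poly_eq0 -leqn0.
  by rewrite hmg_0 /=; ring.
have [sl _] := lpolE l0 l1; have [sm _] := mpolE m0 m1 m2.
exists (mpol * b), (a + lpol * b), (x2 * h + c^-1%:MP * hmg d b); split.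
- apply: leq_trans (size_polyMleq _ _) _; move: sm hb2.
  by move: (size mpol) (size b) => x y; lia.
- rewrite mulrC; apply: sX; apply: leq_trans (size_polyD _ _) _; rewrite geq_max ha /=.
  apply: leq_trans (size_polyMleq _ _) _; move: sl hb2.
  by move: (size lpol) (size b) => x y; lia.
have sb1 := leqW hb2.
have el : hmg d.+1 (lpol * b) = (l0%:MP * x0 + l1%:MP * x1) * hmg d b.
  have -> : lpol * b = l0%:P * b + l1%:P * ('X * b) by rewrite /lpol -mul_polyC; ring.
  by rewrite hmgD !hmgC -hmg_x1 -(hmg_x0 hb2); ring.
have em : hmg d.+2 (mpol * b) =
    (m0%:MP * x0 ^+ 2 + m1%:MP * x0 * x1 + m2%:MP * x1 ^+ 2) * hmg d b.
  have -> : mpol * b = m0%:P * b + m1%:P * ('X * b) + m2%:P * ('X * ('X * b)).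
    by rewrite /mpol -!mul_polyC; ring.
  rewrite !hmgD !hmgC -!hmg_x1 -(hmg_x0 sb1) -(hmg_x0 hb2).
  by move: (hmg d b) => h'; ring.
rewrite /= hmgD el em mulrDl.
have e1 : c^-1%:MP * hmg d b * q = hmg d b * (x2 ^+ 2 - (l0%:MP * x0 + l1%:MP * x1) * x2
  - (m0%:MP * x0 ^+ 2 + m1%:MP * x0 * x1 + m2%:MP * x1 ^+ 2)).
  rewrite /std_form mulrCA mulrA [c%:MP * _]mulrA -mpolyCM mulfV // mpolyC1 mul1r //.
rewrite e1; ring.
Qed.

Section Field.
Variables (F : fieldType) (frac_of : {rmorphism Q -> F}).
Hypothesis frac_of_inj : injective frac_of.
Hypothesis frac_ofP : forall x : F, exists u v : Q, v != 0 /\ x = frac_of u / frac_of v.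
Local Notation R := (affine_conic_rings aniso frac_of_inj frac_ofP).

Definition coords (i : 'I_3) : Q := if i == i0 then 1 else if i == i1 then Y else Z.

Definition evQ : {rmorphism A -> Q} := mmap cst coords.

Lemma evQX i : evQ 'X_i = coords i.
Proof. exact: etrans (mmapX _ _ _) (mmap1U _ _). Qed.

Lemma evQC (a : k) : evQ a%:MP = cst a.
Proof. exact: mmapC. Qed.

Lemma evQ_hmg d a : (size a <= d.+1)%N -> evQ (hmg d a) = Quad a 0.
Proof.
move=> ha; have -> : a = \sum_(i < d.+1) a`_i *: 'X^i.
  rewrite -[LHS]coefK poly_def (big_ord_widen _ (fun i => a`_i *: 'X^i) ha) big_mkcond /=.
  by apply: eq_bigr => i _; case: ltnP => // h; rewrite nth_default // scale0r.
rewrite /hmg rmorph_sum /=.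
transitivity (\sum_(i < d.+1) (Quad (a`_i *: 'X^i) 0 : Q)).
  apply: eq_bigr => i _; rewrite !rmorphM !rmorphXn /= evQC !evQX /coords /= expr1n mulr1.
  rewrite -poly_def coef_poly ltn_ord.
  have -> : Y ^+ i = Quad 'X^i 0 by apply: YX.
  by apply: quadP; rewrite /= !(mulr0, mul0r, addr0) ?mul_polyC.
by elim/big_rec2: _ => [|i p u _ ->] //; apply: quadP; rewrite /= ?addr0.
Qed.

Lemma evQ_hmg2 d b : (size (b * 'X)%R <= d.+1)%N -> evQ (hmg2 d b) = Quad 0 b.
Proof.
have [->|b0] := eqVneq b 0.
  move=> _; case: d => [|d] /=; last rewrite hmg_0 mul0r; by rewrite rmorph0; apply: quadP.
rewrite size_mulX // ltnS; case: d => [|d] h; first by move: h; rewrite leqn0 size_poly_eq0 (negbTE b0).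
rewrite /= rmorphM /= evQ_hmg // evQX /coords /=.
by apply: quadP; rewrite /= !(mulr0, mul0r, addr0, add0r, mulr1).
Qed.

Lemma evQ_q : evQ q = 0.
Proof.
rewrite /std_form !(rmorphM, rmorphB, rmorphD, rmorphXn) /= !evQC !evQX /coords /=.
rewrite ?expr1n !mulr1.
exact: etrans (congr1 (fun u => cst c * u) (quadric_eq0 l0 l1 m0 m1 m2)) (mulr0 _).
Qed.

Lemma evQ_ker d h : h \is d.-homog -> evQ h = 0 -> exists h', h = h' * q.
Proof.
move=> /homog_reduction[a [b [h' [ha hb ->]]]].
rewrite !rmorphD rmorphM /= evQ_q mulr0 add0r evQ_hmg // evQ_hmg2 // => -[].
rewrite addr0 add0r => -> ->; exists h'.
by rewrite hmg_0 /hmg2; case: (d) => [|n]; rewrite ?hmg_0 ?mul0r !addr0.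
Qed.

Lemma evQ_sur d u : (dg u <= d.+1)%N -> exists2 h, h \is d.-homog & evQ h = u.
Proof.
rewrite dg_le => /andP[ha hb]; exists (hmg d (qa u) + hmg2 d (qb u)).
  by rewrite rpredD ?hmg_homog ?hmg2_homog.
by rewrite rmorphD /= evQ_hmg // evQ_hmg2 //; apply: quadP; rewrite /= ?addr0 ?add0r.
Qed.

(** Together with [der_Z], the Hamiltonian derivation of q, y -> dq/dx_2 and z -> - dq/dx_1. It
    kills the equation without any division by a partial derivative. *)
Definition der_Y : Q := cst c * (Z *+ 2 - Quad lpol 0).
Definition der_Z : Q := cst c * Quad mpol^`() lpol^`().

Definition derQ (u : Q) : Q :=
  Quad (qa u)^`() (qb u)^`() * der_Y + Quad (qb u) 0 * der_Z.

Lemma derQD u v : derQ (u + v) = derQ u + derQ v.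
Proof. by apply: quadP; rewrite /= !derivD; ring. Qed.

Lemma derQM u v : derQ (u * v) = derQ u * v + u * derQ v.
Proof. by apply: quadP; rewrite /= !(derivD, derivM); ring. Qed.

Lemma derQ_cst (a : k) : derQ (cst a) = 0.
Proof. by apply: quadP; rewrite /= derivC linear0; ring. Qed.

(** The quotient rule applied to a chosen fraction; [derF_frac] shows that the choice does not
    matter. *)
Definition derF (x : F) : F :=
  let h := cid (frac_ofP x) in let u := sval h in let v := sval (cid (svalP h)) in
  (frac_of (derQ u) * frac_of v - frac_of u * frac_of (derQ v)) / frac_of v ^+ 2.

Lemma derF_frac u v : v != 0 -> derF (frac_of u / frac_of v) =
  (frac_of (derQ u) * frac_of v - frac_of u * frac_of (derQ v)) / frac_of v ^+ 2.
Proof.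
move=> v0; rewrite /derF; case: cid => /= u' hu; case: cid => /= v' [v'0 e].
have hv : frac_of v != 0 by rewrite frac_of_eq0.
have hv' : frac_of v' != 0 by rewrite frac_of_eq0.
have e1 : frac_of u * frac_of v' = frac_of u' * frac_of v by apply/eqP; rewrite -eqr_div //; apply/eqP.
have e2 : frac_of (derQ u) * frac_of v' + frac_of u * frac_of (derQ v') =
    frac_of (derQ u') * frac_of v + frac_of u' * frac_of (derQ v).
  rewrite -!(rmorphM frac_of) -!(rmorphD frac_of) -!derQM; congr (frac_of (derQ _)).
  by apply: frac_of_inj; rewrite !(rmorphM frac_of).
apply/eqP; rewrite eqr_div ?expf_neq0 //; apply/eqP.
move: e1 e2; move: (frac_of (derQ u)) (frac_of (derQ v)) (frac_of (derQ u')) (frac_of (derQ v')) => du dv du' dv'.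
move: (frac_of u) (frac_of v) hv (frac_of u') (frac_of v') hv' => U V hV U' V' hV' e1 e2.
have eU' : U' = U * V' / V by rewrite e1 mulfK.
have edu' : du' = (du * V' + U * dv' - U' * dv) / V by rewrite e2 addrK mulfK.
by rewrite edu' eU'; field.
Qed.

Lemma derFD f g : derF (f + g) = derF f + derF g.
Proof.
have [u [v [v0 ->]]] := frac_ofP f; have [u' [v' [v'0 ->]]] := frac_ofP g.
have hv : frac_of v != 0 by rewrite frac_of_eq0.
have hv' : frac_of v' != 0 by rewrite frac_of_eq0.
rewrite addf_div // -!(rmorphM frac_of) -(rmorphD frac_of) !derF_frac //; last exact: quad_neq0M.
by rewrite derQD !derQM !(rmorphD frac_of) !(rmorphM frac_of) !(rmorphD frac_of) !(rmorphM frac_of); field; rewrite ?hv ?hv'.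
Qed.

Lemma derFM f g : derF (f * g) = derF f * g + f * derF g.
Proof.
have [u [v [v0 ->]]] := frac_ofP f; have [u' [v' [v'0 ->]]] := frac_ofP g.
have hv : frac_of v != 0 by rewrite frac_of_eq0.
have hv' : frac_of v' != 0 by rewrite frac_of_eq0.
rewrite mulf_div -!(rmorphM frac_of) !derF_frac //; last exact: quad_neq0M.
rewrite !derQM; move: (derQ u) (derQ v) (derQ u') (derQ v') => du dv du' dv'.
by rewrite !(rmorphD frac_of) !(rmorphM frac_of); field; rewrite hv hv'.
Qed.

Lemma derF_of u : derF (frac_of u) = frac_of (derQ u).
Proof.
have := @derF_frac u 1 (oner_neq0 _); rewrite (rmorph1 frac_of) divr1 => ->.
have -> : derQ 1 = 0 by rewrite -(rmorph1 cst) derQ_cst.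
by rewrite (rmorph0 frac_of) mulr0 subr0 expr1n divr1 mulr1.
Qed.

Lemma ev_std (i : 'I_3) : frac_of (evQ (std_form_d c l0 l1 m0 m1 m2 i)) =
  frac_of (if i == i0 then cst c * (- cst l0 * Z - cst m0 * 1 *+ 2 - cst m1 * Y) else
   if i == i1 then - der_Z else der_Y).
Proof.
apply: (congr1 frac_of); elim/I3_ind: i; rewrite /std_form_d /=.
- by rewrite !(rmorphM, rmorphB, rmorphN, rmorphMn) /= !evQC !evQX.
- rewrite !(rmorphM, rmorphB, rmorphN, rmorphMn) /= !evQC !evQX /coords /= mulr1.
  apply: quadP; rewrite /= /lpol /mpol !derivE -!mul_polyC; ring.
rewrite !(rmorphM, rmorphB, rmorphD, rmorphN, rmorphMn) /= !evQC !evQX /coords /= mulr1.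
apply: quadP; rewrite /= /lpol -?mul_polyC; ring.
Qed.

Definition std_func_field : func_field q.
Proof.
apply: (@FuncField k q R c l0 l1 m0 m1 m2 erefl c0 (frac_of \o evQ : {rmorphism A -> F})).
- by move=> a; rewrite /= evQC.
- by rewrite /= evQX /coords /= (rmorph1 frac_of).
- by rewrite /= evQX invrK.
- by rewrite /= evQX.
- by rewrite /= evQ_q (rmorph0 frac_of).
- move=> d h hh /= e; apply: evQ_ker hh _; apply: frac_of_inj; by rewrite e (rmorph0 frac_of).
- move=> d _ [u ->] /= hO; have [|h hh e] := @evQ_sur d u; last by exists h; rewrite //= e.
  have Yd : dg (Y ^+ d) = d.+1 by rewrite dg_YX.
  rewrite -Yd; apply: (at_infty_frac aniso frac_of_inj) => //; first by rewrite Y_neq0.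
  by move: hO; rewrite exprVn (rmorphXn frac_of).
- move=> f; have [u [v [v0 ->]]] := frac_ofP f; exists (frac_of u), (frac_of v).
  by split; [exists u | exists v | rewrite frac_of_eq0 |].
- move=> I IB I0 ID IM; have [|||d [hd dP]] := @ideal_principal k l0 l1 m0 m1 m2 aniso (fun u => I (frac_of u)).
  + by rewrite (rmorph0 frac_of).
  + by move=> u v hu hv; rewrite (rmorphD frac_of); apply: ID.
  + by move=> w u hu; rewrite (rmorphM frac_of); apply: IM => //; exists w.
  exists (frac_of d); split=> // f hf; have [u eu] := IB f hf; rewrite eu in hf *.
  by have [w ->] := dP u hf; exists (frac_of w); [exists w | rewrite (rmorphM frac_of)].
- exact: derFD.
- exact: derFM.
- by move=> a; rewrite derF_of derQ_cst (rmorph0 frac_of).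
- rewrite /= ev_std /= invrK derF_of; apply: (congr1 frac_of).
  rewrite /derQ /=; have -> : Quad (deriv 'X) (deriv 0) = 1 :> Q by rewrite derivX linear0.
  have -> : Quad 0 0 = 0 :> Q by [].
  by rewrite mul1r mul0r addr0.
rewrite /= ev_std /= derF_of (rmorphN frac_of) opprK; apply: (congr1 frac_of).
rewrite /derQ /=; have -> : Quad (deriv 0) (deriv 1) = 0 :> Q by rewrite linear0 derivC.
have -> : Quad 1 0 = 1 :> Q by [].
by rewrite mul0r add0r mul1r.
Defined.

End Field.
End Homogeneous.

Definition vec3 (T : Type) (a b c : T) (i : 'I_3) : T :=
  if i == i0 then a else if i == i1 then b else c.

Lemma quadratic_form_coefs (k : fieldType) (q : {mpoly k[3]}) : q \is 2.-homog ->
  exists c : 'I_3 -> 'I_3 -> k, q = \sum_i 'X_i * \sum_j 'X_j * (c i j)%:MP.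
Proof.
move=> /homogS[f [hf ->]]; have h i := homogS (hf i).
have [g hg] := choice h; have h' i : exists c : 'I_3 -> k, forall j, g i j = (c j)%:MP.
  have hc j : exists c, g i j = c%:MP by apply/homog0C/(hg i).1.
  by have [c h''] := choice hc; exists c.
have [c hc] := choice h'; exists c.
by apply: eq_bigr => i _; rewrite (hg i).2; congr (_ * _); apply: eq_bigr => j _; rewrite hc.
Qed.

Section FractionField.
Variables (T : comNzRingType) (T_int : forall x y : T, x * y = 0 -> x = 0 \/ y = 0).
Definition to_fraction (x : T) : {fraction int_dom T_int} :=
  FracField.tofrac (x : int_dom T_int).
HB.instance Definition _ := GRing.RMorphism.copy to_fraction (@FracField.tofrac (int_dom T_int)).

Lemma fraction_field_exists : exists (F : fieldType) (f : {rmorphism T -> F}),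
  injective f /\ forall x : F, exists u v, v != 0 /\ x = f u / f v.
Proof.
exists {fraction int_dom T_int}, to_fraction; split=> [u v e|x].
  by apply/eqP; rewrite -(@tofrac_eq (int_dom T_int)); apply/eqP.
exact: (@FractionDiv.fraction_div (int_dom T_int)).
Qed.
End FractionField.

(** The point (0 : 0 : 1) is not on the conic, so the coefficient c of x_2^2 is nonzero. The
    remaining constants are the coefficients of q divided by - c. *)
Lemma func_field_exists (k : fieldType) (q : {mpoly k[3]}) :
  q \is 2.-homog -> no_rational_point q -> inhabited (func_field q).
Proof.
move=> /quadratic_form_coefs[g eq] aniso.
have evq (a b e : k) : q.@[vec3 a b e] =
    g i0 i0 * a ^+ 2 + (g i0 i1 + g i1 i0) * a * b + g i1 i1 * b ^+ 2 +
    (g i0 i2 + g i2 i0) * a * e + (g i1 i2 + g i2 i1) * b * e + g i2 i2 * e ^+ 2.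
  rewrite eq !sum3 !(rmorphM, rmorphD) /= !mevalC !mevalXU /vec3 /=; ring.
have c0 : g i2 i2 != 0.
  apply/eqP => c0; have := aniso (vec3 0 0 1) _ i2; rewrite evq c0 /vec3 /=.
  by move=> h; have /eqP := h ltac:(ring); rewrite oner_eq0.
set c := g i2 i2 in evq c0.
pose l0 := - (g i0 i2 + g i2 i0) / c; pose l1 := - (g i1 i2 + g i2 i1) / c.
pose m0 := - g i0 i0 / c; pose m1 := - (g i0 i1 + g i1 i0) / c; pose m2 := - g i1 i1 / c.
have an (a b e : k) : e ^+ 2 - (l0 * a + l1 * b) * e - (m0 * a ^+ 2 + m1 * a * b + m2 * b ^+ 2) = 0 ->
    [/\ a = 0, b = 0 & e = 0].
  move=> h; have /aniso h' : q.@[vec3 a b e] = 0.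
    by rewrite evq -[RHS](mulr0 c) -[in RHS]h /l0 /l1 /m0 /m1 /m2; field.
  by split; [have := h' i0 | have := h' i1 | have := h' i2].
have -> : q = std_form c l0 l1 m0 m1 m2.
  have cV x : c%:MP * (x / c)%:MP = x%:MP :> {mpoly k[3]} by rewrite -mpolyCM mulrC divfK.
  rewrite /std_form !mulrBr !mulrDl !mulrDr !mulrA !cV.
  rewrite eq !sum3 -/c !mpolyCN !mpolyCD; ring.
have [F [f [f_inj fP]]] := fraction_field_exists (quad_integral an).
constructor; refine (@std_func_field k c l0 l1 m0 m1 m2 c0 an F f f_inj fP).
Qed.

(** The polar form at v is w -> sum of the partials of q at v times the w_j. A common zero v of q
    and its partials in a field over k is thus a zero of q in the radical, and regularity over that
    field makes v zero. *)
Lemma nonsingular_partials (k : fieldType) (c l0 l1 m0 m1 m2 : k) (K : fieldType)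
    (th : {rmorphism {mpoly k[3]} -> K}) :
  nonsingular_form (std_form c l0 l1 m0 m1 m2) -> th (std_form c l0 l1 m0 m1 m2) = 0 ->
  (forall j, th (std_form_d c l0 l1 m0 m1 m2 j) = 0) -> forall j, th 'X_j = 0.
Proof.
move=> ns hq hd; pose i := th \o (@mpolyC 3 k) : {rmorphism k -> K}.
have [_ reg] := ns K i; pose v j := th 'X_j.
have ev (w : 'I_3 -> K) : (map_mpoly i (std_form c l0 l1 m0 m1 m2)).@[w] =
    i c * (w i2 ^+ 2 - (i l0 * w i0 + i l1 * w i1) * w i2
      - (i m0 * w i0 ^+ 2 + i m1 * w i0 * w i1 + i m2 * w i1 ^+ 2)).
  rewrite /std_form !(rmorphM, rmorphB, rmorphD, rmorphXn) /= !map_mpolyC !map_mpolyX.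
  by rewrite !mevalC !mevalXU.
apply: (reg v).
  by rewrite ev -hq /std_form !(rmorphM, rmorphB, rmorphD, rmorphXn).
move=> w; rewrite /polar !ev.
have e : th (std_form_d c l0 l1 m0 m1 m2 i0) * w i0 + th (std_form_d c l0 l1 m0 m1 m2 i1) * w i1 +
    th (std_form_d c l0 l1 m0 m1 m2 i2) * w i2 = 0 by rewrite !hd !mul0r !addr0.
rewrite -[RHS]e /std_form_d /= !(rmorphM, rmorphB, rmorphD, rmorphXn, rmorphN, rmorphMn) /= -!/(i _) -!/(v _).
ring.
Qed.

Module ResidueField.
Import generic_quotient ring_quotient.

Section Residue.
Variables (R : comNzRingType) (S : R -> bool).
Hypotheses (S_ideal : idealr_closed S) (S_prime : prime_idealr_closed S).

Definition ideal_pred (_ : idealr_closed S) : R -> bool := S.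
HB.instance Definition _ := isIdealr.Build R (ideal_pred S_ideal) S_ideal.
Local Notation I := (ideal_pred S_ideal : idealr R).
Local Notation T := {ideal_quot I}.

Definition residue (x : R) : T := (\pi_(T) x)%qT.

Lemma residue_zmod : zmod_morphism residue.
Proof. by move=> x y; rewrite /residue !piE. Qed.
Lemma residue_monoid : monoid_morphism residue.
Proof. by split=> [|x y]; rewrite /residue !piE. Qed.
HB.instance Definition _ := GRing.isZmodMorphism.Build R T residue residue_zmod.
HB.instance Definition _ := GRing.isMonoidMorphism.Build R T residue residue_monoid.

Lemma residue_eq0 x : residue x = 0 <-> x \in S.
Proof.
have e : (x \in S) = (residue x == 0).
  by rewrite -(rmorph0 residue) -[x in LHS]subr0; apply: (Quotient.idealrBE I).
by rewrite e; split=> [->|/eqP].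
Qed.

Lemma residue_integral (x y : T) : x * y = 0 -> x = 0 \/ y = 0.
Proof.
have ex (u : T) : exists v, u = residue v by exists (repr u); rewrite /residue reprK.
have [u ->] := ex x; have [v ->] := ex y.
by rewrite -rmorphM => /residue_eq0 /S_prime /orP[] /residue_eq0 ->; [left|right].
Qed.

(** K is the field of fractions of R / S, so that membership in the prime S becomes vanishing at a
    K-valued point. This brings in the field extensions occurring in [nonsingular_form]. *)
Lemma residue_field : exists (K : fieldType) (th : {rmorphism R -> K}), forall x, th x = 0 <-> x \in S.
Proof.
have [K [f [f_inj _]]] := fraction_field_exists residue_integral.
exists K, (f \o residue) => x /=; rewrite -residue_eq0; split=> [e|->]; last exact: rmorph0.
by apply: f_inj; rewrite e rmorph0.
Qed.
End Residue.

End ResidueField.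

(** * Points and local rings *)

Section Points.
Variables (k : fieldType) (q : {mpoly k[3]}) (D : func_field q).
Local Notation A := {mpoly k[3]}.
Local Notation F := (aF D).
Local Notation B := (aB D).
Local Notation O := (aO D).
Local Notation t := (at_ D).
Let t0 : t != 0 := at0 D.
Local Notation ev := (@ev k q D).
Local Notation pt := (conic_point q).

Lemma homog_ev d (h : A) : h \is d.-homog -> B (ev h) /\ O (ev h * t ^+ d).
Proof.
apply: (homog_ind (P := fun d h => B (ev h) /\ O (ev h * t ^+ d))) => {d h}.
- by move=> d; rewrite rmorph0 mul0r; split; apply: sr0.
- by move=> d f g [h1 h2] [h3 h4]; rewrite rmorphD mulrDl; split; apply: srD.
- by move=> c; rewrite ev_C expr0 mulr1; split; [apply: aBk | apply: aOk].
move=> d i f _ [h1 h2]; rewrite rmorphM exprS mulrACA.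
split; apply: srM => //; elim/I3_ind: i; rewrite ?ev_X0 ?ev_X1 ?ev_X2.
- exact: sr1.
- exact: aBt.
- exact: aBz.
- by rewrite mul1r; apply: aOt.
- by rewrite mulVf //; apply: sr1.
by rewrite mulrC; apply: aOz.
Qed.

Section Theta.
Variable s : F.

(** A form of evaluation that keeps degrees apart: coefficient d is the value of the homogeneous
    part of degree d, times s^d. All coefficients lie in B for s = 1, and in O for s = t. *)
Definition theta : {rmorphism A -> {poly F}} :=
  mmap (@polyC F \o ai D) (fun i => (ev 'X_i * s) *: 'X).

Lemma theta_homog d (h : A) : h \is d.-homog -> theta h = (ev h * s ^+ d) *: 'X^d.
Proof.
apply: (homog_ind (P := fun d h => theta h = (ev h * s ^+ d) *: 'X^d)) => {d h}.
- by move=> d; rewrite !rmorph0 mul0r scale0r.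
- by move=> d f g e1 e2; rewrite !rmorphD e1 e2 mulrDl scalerDl.
- by move=> c; rewrite expr0 mulr1 ev_C -mul_polyC mulr1; apply: mmapC.
move=> d i f _ e; rewrite !rmorphM e exprS exprS mulrACA.
have -> : theta 'X_i = (ev 'X_i * s) *: 'X by exact: etrans (mmapX _ _ _) (mmap1U _ _).
by rewrite -scalerAl -scalerAr scalerA.
Qed.

Lemma theta_coef d (h : A) : (theta h)`_d = ev (pihomog mdeg d h) * s ^+ d.
Proof.
rewrite {1}(@pihomog_partitionE _ _ mdeg (maxn (mmeasure mdeg h) d.+1) h); last exact: leq_maxl.
rewrite rmorph_sum coef_sum /=.
rewrite (bigD1 (Ordinal (leq_maxr (mmeasure mdeg h) d.+1 : (d < _)%N))) //=.
rewrite (theta_homog (pihomogP _ _ _)) coefZ coefXn eqxx mulr1 big1 ?addr0 // => i hi.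
rewrite (theta_homog (pihomogP _ _ _)) coefZ coefXn (_ : (d == i :> nat) = false) ?mulr0 //.
by apply: contraNF hi => /eqP e; apply/eqP/val_inj.
Qed.

End Theta.

Section PointOf.
Variables (I : F -> Prop) (R : subring F) (s : F).
Hypotheses (I0 : I 0) (ID : forall f g, I f -> I g -> I (f + g))
  (IM : forall f g, R f -> I g -> I (f * g)) (I1 : ~ I 1)
  (Iprime : forall f g, R f -> R g -> I (f * g) -> I f \/ I g)
  (Rev : forall d (h : A), h \is d.-homog -> R (ev h * s ^+ d))
  (Irel : exists i, ~ I (ev 'X_i * s)).

(** The homogeneous prime attached to a prime I of R. It is used for the zero ideal (generic point),
    for tO with s = t (infinity), and for the ideal of a prime element of B. *)
Definition point_pred (h : A) : bool := `[< forall d, I (theta s h)`_d >].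

Lemma theta_R h d : R (theta s h)`_d.
Proof. by rewrite theta_coef; apply/Rev/pihomogP. Qed.

Lemma I_sum J (r : seq J) (P : pred J) (f : J -> F) :
  (forall i, P i -> I (f i)) -> I (\sum_(i <- r | P i) f i).
Proof. by move=> h; elim/big_ind: _. Qed.

Lemma point_ideal : idealr_closed point_pred.
Proof.
split; first by apply/asboolP => d; rewrite rmorph0 coef0.
  apply/asboolP => /(_ 0%N); rewrite rmorph1 coefC eqxx; exact: I1.
move=> a u v /asboolP hu /asboolP hv; apply/asboolP => d.
rewrite rmorphD rmorphM coefD coefM; apply: ID => //; apply: I_sum => i _.
by apply: IM => //; apply: theta_R.
Qed.

(** As in Gauss's lemma: if i and j are the highest indices of coefficients of [theta s u] and
    [theta s v] outside I, all other contributions to coefficient i + j of the product lie in I, so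
    the product of these two does as well. *)
Lemma point_prime : prime_idealr_closed point_pred.
Proof.
move=> u v /asboolP huv; apply: contrapT => /negP; rewrite negb_or => /andP[/asboolP hu /asboolP hv].
have mx (p : {poly F}) : ~ (forall d, I p`_d) -> exists n, ~ I p`_n /\ forall m, (n < m)%N -> I p`_m.
  move=> hp; have ex : exists n, `[< ~ I p`_n >].
    by apply: contrapT => h; apply: hp => d; apply: contrapT => hd; apply: h; exists d; apply/asboolP.
  have bd n : `[< ~ I p`_n >] -> (n <= size p)%N.
    by move=> /asboolP hn; rewrite leqNgt; apply/negP => h; apply: hn; rewrite nth_default // ltnW.
  case: (ex_maxnP ex bd) => n /asboolP hn hmax; exists n; split=> // m hm.
  by apply: contrapT => h; have := hmax m (introT (asboolP _) h); rewrite leqNgt hm.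
have [i [hi ui]] := mx _ hu; have [j [hj vj]] := mx _ hv.
have : I ((theta s u)`_i * (theta s v)`_j).
  have := huv (i + j)%N; rewrite rmorphM coefM.
  rewrite (bigD1 (Ordinal (leq_addr j i.+1 : (i < (i + j).+1)%N))) //= addKn.
  set S := \sum_(_ < _ | _) _ => h.
  have hS : I S.
    apply: I_sum => -[x hx] /= /eqP hne.
    have {}hne : x <> i by move=> e; apply: hne; apply: val_inj.
    case: (ltnP i x) => hix; first by rewrite mulrC; apply: IM (ui _ hix); apply: theta_R.
    by apply: IM; [apply: theta_R | apply: vj; lia].
  have := ID h (IM (srN (sr1 R)) hS); by rewrite mulN1r addrK.
by case/Iprime => //; apply: theta_R.
Qed.

Lemma point_homog (f : A) d : f \in point_pred -> pihomog mdeg d f \in point_pred.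
Proof.
move=> /asboolP hf; apply/asboolP => e.
rewrite (theta_homog _ (pihomogP _ _ _)) coefZ coefXn.
by case: eqP => _; rewrite ?mulr0 // mulr1 -theta_coef.
Qed.

Lemma homog_point_pred d (h : A) : h \is d.-homog -> (h \in point_pred) <-> I (ev h * s ^+ d).
Proof.
move=> hh; split=> [/asboolP/(_ d)|h']; first by rewrite (theta_homog _ hh) coefZ coefXn eqxx mulr1.
by apply/asboolP => e; rewrite (theta_homog _ hh) coefZ coefXn; case: eqP; rewrite ?mulr1 ?mulr0.
Qed.

Lemma q_homog : q \is 2.-homog.
Proof.
have c0 (a : k) : a%:MP \is [in k[3], 0.-homog] by exact: mpolyC_homog.
have X i : ('X_i : A) \is 1.-homog by rewrite dhomogX; apply/eqP; exact: mdeg1.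
have M a b := @dhomogM _ _ mdeg 1 a 1 b.
rewrite (ff_q D) /std_form; apply: (@dhomogM _ _ mdeg 0 _ 2) => //.
have h1 (a : k) i : a%:MP * 'X_i \is [in k[3], 1.-homog] by apply: (@dhomogM _ _ mdeg 0 _ 1).
have h2 (a : k) f : f \is [in k[3], 2.-homog] -> a%:MP * f \is [in k[3], 2.-homog] by apply: (@dhomogM _ _ mdeg 0 _ 2).
apply: rpredB; [apply: rpredB; [exact: M | apply: M; [apply: rpredD; exact: h1 | exact: X]] |].
apply: rpredD; [apply: rpredD; [apply: h2; exact: M | rewrite -mulrA; apply: h2; exact: M] |].
by apply: h2; exact: M.
Qed.

Lemma point_q : q \in point_pred.
Proof. by apply/(homog_point_pred q_homog); rewrite ev_q mul0r. Qed.

Lemma X_homog (i : 'I_3) : ('X_i : A) \is 1.-homog.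
Proof. by rewrite dhomogX; apply/eqP; exact: mdeg1. Qed.

Lemma point_relevant : exists i, 'X_i \notin point_pred.
Proof. by have [i hi] := Irel; exists i; apply/negP => /(homog_point_pred (X_homog i)). Qed.

Definition point_of : pt := ConicPoint point_ideal point_prime point_homog point_q point_relevant.

End PointOf.
End Points.

Section PointFacts.
Variables (k : fieldType) (q : {mpoly k[3]}) (D : func_field q).
Local Notation A := {mpoly k[3]}.
Local Notation F := (aF D).
Local Notation B := (aB D).
Local Notation O := (aO D).
Local Notation t := (at_ D).
Local Notation z := (az D).
Local Notation i := (ai D).
Local Notation ev := (@ev k q D).
Local Notation pt := (conic_point q).
Local Notation x0 := ('X_i0 : A).
Local Notation x1 := ('X_i1 : A).
Local Notation x2 := ('X_i2 : A).
Let t0 : t != 0 := at0 D.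
Implicit Types (P : pt) (g h : A) (f b : F).

Lemma cpD P g h : g \in cp_pred P -> h \in cp_pred P -> g + h \in cp_pred P.
Proof. by have [_ _ H] := cp_ideal P; move=> hg hh; rewrite -[g]mul1r; apply: H. Qed.

Lemma cpMl P g h : h \in cp_pred P -> g * h \in cp_pred P.
Proof. by have [H0 _ H] := cp_ideal P; move=> hh; rewrite -[_ * _]addr0; apply: H. Qed.

Lemma cpB P g h : g \in cp_pred P -> h \in cp_pred P -> g - h \in cp_pred P.
Proof. by move=> hg hh; apply: cpD => //; rewrite -mulN1r; apply: cpMl. Qed.

Lemma cp0 P : 0 \in cp_pred P. Proof. by have [] := cp_ideal P. Qed.

Lemma cpX P g n : g ^+ n \in cp_pred P -> g \in cp_pred P.
Proof.
elim: n => [|n IH]; first by rewrite expr0 (negbTE (cp_1 P)).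
by rewrite exprS => /(cp_prime (c:=P)) /orP[].
Qed.

Lemma cpXN P g n : g \notin cp_pred P -> g ^+ n \notin cp_pred P.
Proof. by apply: contra; apply: cpX. Qed.

Lemma cp_eq P P' : (forall d h, h \is d.-homog -> h \in cp_pred P -> h \in cp_pred P') ->
  (forall d h, h \is d.-homog -> h \in cp_pred P' -> h \in cp_pred P) -> P = P'.
Proof.
move=> h1 h2; have sub (P1 P2 : pt) : (forall d h, h \is d.-homog -> h \in cp_pred P1 -> h \in cp_pred P2) ->
    forall h, h \in cp_pred P1 -> h \in cp_pred P2.
  move=> H h hh; rewrite (@pihomog_partitionE _ _ mdeg (mmeasure mdeg h) h) //.
  elim/big_ind: _ => [|u v|j _]; [exact: cp0|exact: cpD|].
  by apply: (H j); [apply: pihomogP | apply: cp_homog].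
have e : cp_pred P = cp_pred P' by apply/funext => h; apply/idP/idP; apply: sub.
case: P P' e {h1 h2} => [p a1 a2 a3 a4 a5] [p' b1 b2 b3 b4 b5] /= e.
by subst p'; congr ConicPoint; apply: Prop_irrelevance.
Qed.

Lemma cp_ker P d h : h \is d.-homog -> ev h = 0 -> h \in cp_pred P.
Proof. by move=> hh /(ev_ker hh)[h' ->]; apply/cpMl/cp_q. Qed.

Lemma cp_ev P d g h : g \is d.-homog -> h \is d.-homog -> ev g = ev h ->
  g \in cp_pred P -> h \in cp_pred P.
Proof.
move=> hg hh e gP; rewrite -[h](subKr g); apply: cpB => //; apply: (@cp_ker _ d); first exact: rpredB.
by rewrite rmorphB e subrr.
Qed.

Lemma ev_neq0 P d g : g \is d.-homog -> g \notin cp_pred P -> ev g != 0.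
Proof. by move=> hg; apply: contraNneq => e; apply: cp_ker hg e. Qed.

Definition in_local P f := exists d g h,
  [/\ g \is d.-homog, h \is d.-homog, h \notin cp_pred P & f = ev g / ev h].

Lemma in_local_cst P c : in_local P (i c).
Proof.
exists 0%N, c%:MP, 1; split; [exact: mpolyC_homog|exact: dhomog1|exact: cp_1|].
by rewrite ev_C rmorph1 divr1.
Qed.
Lemma in_local0 P : in_local P 0. Proof. by rewrite -(rmorph0 i); apply: in_local_cst. Qed.
Lemma in_local1 P : in_local P 1. Proof. by rewrite -(rmorph1 i); apply: in_local_cst. Qed.
Lemma in_localD P f f' : in_local P f -> in_local P f' -> in_local P (f + f').
Proof.
move=> [d [g [h [hg hh hP ->]]]] [d' [g' [h' [hg' hh' hP' ->]]]].
exists (d + d')%N, (g * h' + h * g'), (h * h'); split.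
- by apply: rpredD; apply: dhomogM.
- exact: dhomogM.
- exact: cp_mulN.
by rewrite rmorphD !rmorphM addf_div ?(ev_neq0 hh hP) ?(ev_neq0 hh' hP') // [ev h * ev g']mulrC.
Qed.
Lemma in_localM P f f' : in_local P f -> in_local P f' -> in_local P (f * f').
Proof.
move=> [d [g [h [hg hh hP ->]]]] [d' [g' [h' [hg' hh' hP' ->]]]].
exists (d + d')%N, (g * g'), (h * h'); split; try exact: dhomogM; first exact: cp_mulN.
by rewrite !rmorphM mulf_div.
Qed.
Lemma in_localN P f : in_local P f -> in_local P (- f).
Proof.
by rewrite -mulN1r -(rmorph1 i) -rmorphN; apply: in_localM; apply: in_local_cst.
Qed.
Definition OP P := Subring (in_local0 P) (in_local1 P) (@in_localD P) (@in_localN P) (@in_localM P).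

Lemma homogX d (j : 'I_3) : ('X_j : A) ^+ d \is d.-homog.
Proof. by have := @dhomogMn _ _ mdeg 1 'X_j d; rewrite mul1n; apply; apply: X_homog. Qed.

Lemma OP_homog P d g h : g \is d.-homog -> h \is d.-homog -> h \notin cp_pred P -> OP P (ev g / ev h).
Proof. by move=> hg hh hP; exists d, g, h. Qed.

Lemma aB_homog b : B b -> exists d h, h \is d.-homog /\ ev h = b.
Proof.
move=> hb; have [N] := pole_bound (b%:M : 'M[F]_1); move/(_ 0 0); rewrite !mxE mulr1n mulrC => hN.
by have [h hh e] := ev_sur hb hN; exists N, h.
Qed.

Lemma aB_homog2 a b : B a -> B b -> exists d g h,
  [/\ g \is d.-homog, h \is d.-homog, ev g = a & ev h = b].
Proof.
move=> /aB_homog[d [g [hg <-]]] /aB_homog[d' [h [hh <-]]].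
exists (d + d')%N, (x0 ^+ d' * g), (x0 ^+ d * h); split.
- by rewrite addnC; apply: dhomogM => //; apply: homogX.
- by apply: dhomogM => //; apply: homogX.
- by rewrite rmorphM rmorphXn ev_X0 expr1n mul1r.
by rewrite rmorphM rmorphXn ev_X0 expr1n mul1r.
Qed.

Lemma OP_B P b : x0 \notin cp_pred P -> B b -> OP P b.
Proof.
move=> hx /aB_homog[d [h [hh <-]]]; exists d, h, (x0 ^+ d).
by rewrite rmorphXn ev_X0 expr1n divr1; split=> //; [apply: homogX | apply: cpXN].
Qed.

Definition full_subring : subring F := Subring (sr_mem := fun=> True) I I
  (fun _ _ _ _ => I) (fun _ _ => I) (fun _ _ _ _ => I).

Definition generic_point : pt.
Proof.
apply: (@point_of k q D (fun f => f = 0) full_subring 1) => //.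
- by move=> f g -> ->; rewrite addr0.
- by move=> f g _ ->; rewrite mulr0.
- by move/eqP; rewrite oner_eq0.
- by move=> f g _ _ /eqP; rewrite mulf_eq0 => /orP[/eqP|/eqP]; [left|right].
by exists i0; rewrite ev_X0 mul1r => /eqP; rewrite oner_eq0.
Defined.

Lemma generic_point_mem d h : h \is d.-homog -> h \in cp_pred generic_point <-> ev h = 0.
Proof.
by move=> hh; have := @homog_point_pred k q D (fun f => f = 0) 1 erefl d h hh; rewrite expr1n mulr1.
Qed.

Lemma unit_or_tO f : O f -> O (f / t) \/ O f^-1.
Proof.
move=> hf; have [->|f0] := eqVneq f 0; first by left; rewrite mul0r; apply: sr0.
have [[[|n]|n] [u [hu hu' ef]]] := a_val f0.
- by right; rewrite ef mul1r.
- by left; rewrite ef -exprnP exprS -mulrA mulrAC divff // mul1r; apply: OtX.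
by right; rewrite ef invfM NegzE -exprnN invrK; apply: OtX.
Qed.

Lemma one_notin_tO : ~ O (1 / t).
Proof. by rewrite div1r; apply: aOtV. Qed.

Definition inf : pt.
Proof.
apply: (@point_of k q D (fun f => O (f / t)) O t).
- by rewrite mul0r; apply: sr0.
- by move=> f g h1 h2; rewrite mulrDl; apply: srD.
- by move=> f g h1 h2; rewrite -mulrA; apply: srM.
- exact: one_notin_tO.
- move=> f g hf hg h; have [f0|f0] := eqVneq f 0; first by left; rewrite f0 mul0r; apply: sr0.
  have [|hf'] := unit_or_tO hf; [by left | right].
  by rewrite -[g](mulKf f0) -mulrA; apply: srM.
- by move=> d h /(homog_ev D)[].
by exists i1; rewrite ev_X1 mulVf //; exact: one_notin_tO.
Defined.

Lemma inf_mem d h : h \is d.-homog -> h \in cp_pred inf <-> O (ev h * t ^+ d / t).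
Proof.
move=> hh; apply: (@homog_point_pred k q D (fun f => O (f / t)) t _ d h hh).
by rewrite mul0r; apply: sr0.
Qed.

Lemma x0_inf : x0 \in cp_pred inf.
Proof. by apply/(inf_mem (X_homog k _)); rewrite ev_X0 mul1r expr1 divff //; apply: sr1. Qed.

Lemma x2_sqr P : x0 \in cp_pred P -> x1 \in cp_pred P -> x2 \in cp_pred P.
Proof.
move=> h0 h1; apply: (@cpX P x2 2).
have [c [l0 [l1 [m0 [m1 [m2 [c0 eq]]]]]]] : exists c l0 l1 m0 m1 m2, c != 0 /\ q = @std_form k c l0 l1 m0 m1 m2.
  by do 6 eexists; split; [exact: (ff_c0 D) | exact: (ff_q D)].
have -> : x2 ^+ 2 = c^-1%:MP * q + (l0%:MP * x2 + m0%:MP * x0 + m1%:MP * x1) * x0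
    + (l1%:MP * x2 + m2%:MP * x1) * x1.
  rewrite eq /std_form mulrA -mpolyCM mulVf // mpolyC1; ring.
by apply: cpD; [apply: cpD|]; apply: cpMl => //; apply: cp_q.
Qed.

Lemma x1_notin P : x0 \in cp_pred P -> x1 \notin cp_pred P.
Proof.
move=> h0; apply/negP => h1; have h2 := x2_sqr h0 h1.
by have [j] := cp_relevant P; elim/I3_ind: j => /negP.
Qed.

(** A form h of degree d + 1 that vanishes at infinity has integral [ev h * t ^+ d], so some form h'
    of degree d has the same value; then h - x_0 h' is a multiple of q. *)
Lemma sub_inf P d h : x0 \in cp_pred P -> h \is d.-homog -> h \in cp_pred inf -> h \in cp_pred P.
Proof.
move=> h0 hh /(inf_mem hh); case: d hh => [|d] hh.
  rewrite expr0 mulr1 => /(BtO (homog_ev D hh).1) /eqP e; apply: cp_ker hh _; exact/eqP.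
rewrite exprSr mulrA mulfK // => /(ev_sur (homog_ev D hh).1)[h' hh' e].
apply: (@cp_ev P d.+1 (x0 * h')) => //; last by rewrite mulrC; apply: cpMl.
  by apply: (@dhomogM _ _ mdeg 1) => //; apply: X_homog.
by rewrite rmorphM ev_X0 mul1r.
Qed.

(** If h were in P but not in [inf], it would be invertible at infinity; multiplied by a linear form
    that represents its inverse in the residue field, it agrees with x_1^(d+1) modulo [inf], hence
    modulo P by [sub_inf]. Then x_1 would be in P. *)
Lemma x0_in_inf P : x0 \in cp_pred P -> P = inf.
Proof.
move=> h0; apply: cp_eq => d h hh; last exact: (sub_inf h0 hh).
move=> hP; apply/(inf_mem hh); have [->|eh0] := eqVneq (ev h) 0.
  by rewrite !mul0r; apply: sr0.
have [//|hu] := unit_or_tO (homog_ev D hh).2.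
have [b [al [o [hb ho e]]]] := a_dec (ev h * t ^+ d)^-1.
have [c ec] : exists c, b = i c.
  apply: aBO => //; rewrite -[b](addrK (i al * (t * z) + t * o)) addrA -e.
  apply: srB => //; apply: srD; apply: srM => //; [exact: aOk | exact: aOz | exact: aOt].
(* The residue field at infinity is k + k t z, and t h2 takes there the value c + al t z, the
   inverse of that of h t^d. *)
pose h2 := c%:MP * x1 + al%:MP * x2.
have hh2 : h2 \is 1.-homog.
  by apply: rpredD; apply: (@dhomogM _ _ mdeg 0 _ 1); try exact: mpolyC_homog; apply: X_homog.
have hX : x1 ^+ d.+1 \is d.+1.-homog by apply: homogX.
have hd : h * h2 - x1 ^+ d.+1 \is d.+1.-homog.
  by apply: rpredB => //; have := dhomogM hh hh2; rewrite addn1.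
have u0 : ev h * t ^+ d != 0 by rewrite mulf_neq0 ?expf_neq0.
have : h * h2 - x1 ^+ d.+1 \in cp_pred inf.
  apply/(inf_mem hd); rewrite rmorphB rmorphM rmorphXn ev_X1 rmorphD !rmorphM !ev_C ev_X1 ev_X2.
  have -> : (ev h * (i c / t + i al * z) - t^-1 ^+ d.+1) * t ^+ d.+1 / t =
      (ev h * t ^+ d) * (- o).
    have e2 : i c + i al * (t * z) = (ev h * t ^+ d)^-1 - t * o by rewrite e ec addrK.
    have -> : i c / t + i al * z = (i c + i al * (t * z)) / t by field.
    by rewrite e2 exprVn !exprS; field; rewrite t0 expf_neq0 //= u0.
  by apply: srM; [apply: (homog_ev D hh).2 | apply: srN].
move/(sub_inf h0 hd) => h3.
have : x1 ^+ d.+1 \in cp_pred P.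
  by rewrite -[x1 ^+ _](subKr (h * h2)); apply: cpB => //; rewrite mulrC; apply: cpMl.
by move/cpX; rewrite (negbTE (x1_notin h0)).
Qed.

End PointFacts.

Section LocalRings.
Variables (k : fieldType) (q : {mpoly k[3]}) (D : func_field q).
Local Notation A := {mpoly k[3]}.
Local Notation F := (aF D).
Local Notation B := (aB D).
Local Notation O := (aO D).
Local Notation t := (at_ D).
Local Notation ev := (@ev k q D).
Local Notation pt := (conic_point q).
Local Notation OP := (OP D).
Local Notation inf := (inf D).
Local Notation x0 := ('X_i0 : A).
Let t0 : t != 0 := at0 D.
Implicit Types (P : pt) (g h : A) (f b : F).

Lemma aB_degree b : B b -> b != 0 -> exists d : nat, O (b * t ^+ d) /\ O (b * t ^+ d)^-1.
Proof.
move=> hb b0; have [[n|n] [u [hu hu' e]]] := a_val b0; last first.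
  by exists n.+1; rewrite e NegzE -exprnN mulrAC mulVf ?mul1r // expf_neq0.
case: n e => [|n] e; first by exists 0%N; rewrite expr0 mulr1 e mul1r.
move/eqP: b0; case; apply: (BtO hb); rewrite e -exprnP exprS -mulrA mulrAC divff // mul1r.
exact: OtX.
Qed.

(** For the converse, f = a / b with b of exact pole order d: both a and b are then values of forms
    of degree d, and that of b does not vanish at infinity. *)
Lemma OP_inf f : OP inf f <-> O f.
Proof.
split=> [[d [g [h [hg hh hP ->]]]]|hf].
  have [/(inf_mem D hh)|hu] := unit_or_tO (homog_ev D hh).2; first by rewrite (negbTE hP).
  have -> : ev g / ev h = (ev g * t ^+ d) * (ev h * t ^+ d)^-1.
    by rewrite -mulf_div divff ?mulr1 // expf_neq0.
  by apply: srM => //; apply: (homog_ev D hg).2.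
have [a [b [ha hb b0 e]]] := ff_frac f; have [d [h1 h2]] := aB_degree hb b0.
have ha' : O (a * t ^+ d).
  have -> : a * t ^+ d = f * (b * t ^+ d) by rewrite e mulrA divfK.
  exact: srM.
have [g hg eg] := ev_sur ha ha'; have [h hh eh] := ev_sur hb h1.
exists d, g, h; split=> //; last by rewrite eg eh.
apply/negP => /(inf_mem D hh); rewrite eh => h3; apply: (@one_notin_tO k q D).
have u0 : b * t ^+ d != 0 by rewrite mulf_neq0 ?expf_neq0.
by rewrite -(mulVf u0) -mulrA; apply: srM.
Qed.

Definition in_ideal P b := exists d h, [/\ h \is d.-homog, h \in cp_pred P & ev h = b].

Section Affine.
Variable P : pt.
Hypothesis x0P : x0 \notin cp_pred P.

Lemma in_idealP d h : h \is d.-homog -> h \in cp_pred P <-> in_ideal P (ev h).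
Proof.
move=> hh; split=> [hP|[e [g [hg gP eg]]]]; first by exists d, h.
have : x0 ^+ e * h \in cp_pred P.
  apply: (@cp_ev _ _ D _ (d + e)%N (x0 ^+ d * g)).
  - by apply: dhomogM => //; apply: homogX.
  - by rewrite addnC; apply: dhomogM => //; apply: homogX.
  - by rewrite !rmorphM !rmorphXn ev_X0 !expr1n !mul1r.
  exact: cpMl.
by move/(cp_prime (c:=P)) => /orP[/cpX|//]; rewrite (negbTE x0P).
Qed.

Lemma in_ideal_principal : exists p, [/\ B p, in_ideal P p &
  forall b, in_ideal P b -> exists2 w, B w & b = w * p].
Proof.
have [||||p [hp hw]] := @ff_pid k q D (in_ideal P).
- by move=> _ [d [h [hh _ <-]]]; apply: (homog_ev D hh).1.
- by exists 0%N, 0; split; [exact: rpred0 | exact: cp0 | exact: rmorph0].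
- move=> _ _ [d [h [hh hP <-]]] [d' [h' [hh' hP' <-]]].
  exists (d + d')%N, (x0 ^+ d' * h + x0 ^+ d * h'); split.
  + by apply: rpredD; [rewrite addnC|]; apply: dhomogM => //; apply: homogX.
  + by apply: cpD; apply: cpMl.
  by rewrite rmorphD !rmorphM !rmorphXn ev_X0 !expr1n !mul1r.
- move=> _ _ /(@aB_homog k q D)[d [h [hh <-]]] [d' [h' [hh' hP' <-]]].
  by exists (d + d')%N, (h * h'); split; [apply: dhomogM | apply: cpMl | rewrite rmorphM].
exists p; split=> //.
by have [d [h [hh _ <-]]] := hp; apply: (homog_ev D hh).1.
Qed.

Lemma OP_inv b : B b -> b != 0 -> OP P b^-1 <-> ~ in_ideal P b.
Proof.
move=> /(@aB_homog k q D)[d [h [hh <-]]] h0; split=> [[e [g [g' [hg hg' g'P e1]]]] /(in_idealP hh) hP|hP].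
  have g'0 : ev g' != 0 := ev_neq0 D hg' g'P.
  have : x0 ^+ d * g' \in cp_pred P.
    apply: (@cp_ev _ _ D _ (d + e)%N (h * g)); try by apply: dhomogM => //; apply: homogX.
      rewrite !rmorphM rmorphXn ev_X0 expr1n mul1r; apply: (mulIf (invr_neq0 g'0)).
      by rewrite divff // -mulrA -e1 divff.
    by rewrite mulrC; apply: cpMl.
  by move/(cp_prime (c:=P)) => /orP[/cpX|]; apply/negP.
exists d, (x0 ^+ d), h; split=> //; first exact: homogX.
  by apply/negP => /(in_idealP hh).
by rewrite rmorphXn ev_X0 expr1n div1r.
Qed.

Lemma in_ideal1 : ~ in_ideal P 1.
Proof.
move=> h; have := @OP_inv 1 (sr1 B) (oner_neq0 _); rewrite invr1 => -[h' _].
by apply: h' h; apply: sr1.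
Qed.

Lemma in_ideal_prime a b : B a -> B b -> in_ideal P (a * b) -> in_ideal P a \/ in_ideal P b.
Proof.
move=> /(@aB_homog k q D)[d [g [hg <-]]] /(@aB_homog k q D)[e [h [hh <-]]].
rewrite -rmorphM => /(in_idealP (dhomogM hg hh))/(cp_prime (c:=P))/orP[|].
  by move/(in_idealP hg); left.
by move/(in_idealP hh); right.
Qed.

(** p generates the ideal of P in B. The elements vanishing at P are described as those without
    inverse in [OP P], so that only the local ring occurs. *)
Definition closed_at p := [/\ B p, p != 0, ~ OP P p^-1 &
  forall b, B b -> b != 0 -> ~ OP P b^-1 -> exists2 w, B w & b = w * p].

Lemma generic_or_closed : (forall f, OP P f) \/ exists p, closed_at p.
Proof.
have [p [hp ip hdiv]] := in_ideal_principal; have [p0|p0] := eqVneq p 0; [left|right].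
  move=> f; have [a [b [ha hb b0 ->]]] := ff_frac f.
  apply: srM; first exact: OP_B.
  apply/(OP_inv hb b0) => /hdiv[w _ e]; by move: b0; rewrite e p0 mulr0 eqxx.
exists p; split=> //; first by move/(OP_inv hp p0).
move=> b hb b0 hbP; apply: hdiv; apply: contrapT => h; apply: hbP; exact/(OP_inv hb b0).
Qed.

End Affine.

(** Nonzero primes of a principal ideal domain are maximal: if p also vanishes at P', the generator
    p' of the ideal of P' divides p, and since p is prime they generate the same ideal. *)
Lemma closed_other P P' p : x0 \notin cp_pred P -> x0 \notin cp_pred P' ->
  closed_at P p -> P' = P \/ OP P' p^-1.
Proof.
move=> xP xP' [hp p0 hpP hdiv]; have [|hpP'] := pselect (OP P' p^-1); [by right | left].
have ip : in_ideal P p.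
  by apply: contrapT => h; apply: hpP; apply/(OP_inv xP hp p0).
have ip' : in_ideal P' p.
  by apply: contrapT => h; apply: hpP'; apply/(OP_inv xP' hp p0).
have mem b : in_ideal P b -> exists2 w, B w & b = w * p.
  move=> hb; have Bb : B b by have [d [h [hh _ <-]]] := hb; apply: (homog_ev D hh).1.
  have [->|b0] := eqVneq b 0; first by exists 0; rewrite ?mul0r //; apply: sr0.
  by apply: hdiv => //; move/(OP_inv xP Bb b0).
have mulI P1 a b : B a -> in_ideal P1 b -> in_ideal P1 (a * b).
  move=> /(@aB_homog k q D)[d [h [hh <-]]] [d' [h' [hh' hP' <-]]].
  by exists (d + d')%N, (h * h'); split; [apply: dhomogM | apply: cpMl | rewrite rmorphM].
have [p' [hp' ip'' hdiv']] := in_ideal_principal P' .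
have [w hw ew] := hdiv' _ ip'.
have sub : in_ideal P p'.
  have [|h|//] := in_ideal_prime xP hw hp'; first by rewrite -ew.
  have [w' hw' ew'] := mem _ h.
  case: (in_ideal1 xP'); have -> : 1 = w' * p'.
    by apply: (mulIf p0); rewrite mul1r {1}ew ew' mulrAC.
  exact: mulI.
apply: cp_eq => d h hh /(in_idealP _ hh) => [/(_ xP') | /(_ xP)] hI.
  apply/(in_idealP xP hh); have [w1 hw1 ->] := hdiv' _ hI; exact: mulI.
apply/(in_idealP xP' hh); have [w1 hw1 ->] := mem _ hI; exact: mulI.
Qed.

Section Closed.
Variables (P : pt) (p : F).
Hypotheses (xP : x0 \notin cp_pred P) (pP : closed_at P p).

Lemma closed_coprime b m : B b -> b != 0 -> OP P b^-1 ->
  exists x y, [/\ B x, B y & x * p ^+ m + y * b = 1].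
Proof.
move=> hb b0 hbP; have [hp p0 hpP hdiv] := pP.
have [e [x [y [p' [b' [[hx hy hp' hb'] ep eb ee]]]]]] := a_bezout hp hb.
have he : B e by rewrite ee; apply: srD; apply: srM.
have e0 : e != 0 by apply: contraNneq p0 => e0; rewrite ep e0 mul0r.
have hePV : OP P e^-1.
  have -> : e^-1 = b' * b^-1 by rewrite eb invfM mulrCA divff ?mulr1 //; apply: contraNneq b0 => b'0; rewrite eb b'0 mulr0.
  by apply: srM => //; apply: OP_B.
have p'0 : p' != 0 by apply: contraNneq p0 => p'0; rewrite ep p'0 mulr0.
have [w hw ew] : exists2 w, B w & p' = w * p.
  apply: hdiv => // h; apply: hpP; rewrite ep invfM; exact: srM.
have we : w * e = 1 by apply: (mulIf p0); rewrite mul1r {2}ep ew; ring.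
have one : w * x * p + w * y * b = 1 by rewrite -we ee; ring.
elim: m => [|m [x' [y' [hx' hy' IH]]]].
  by exists 1, 0; split; [apply: sr1 | apply: sr0 | rewrite expr0; ring].
exists (x' * (w * x)), (y' * (w * x * p) + w * y); split.
- by apply: srM => //; apply: srM.
- by apply: srD; [apply: srM => //; apply: srM => //; apply: srM | apply: srM].
rewrite -[RHS]one exprS -[w * x * p in RHS]mulr1 -[in RHS]IH; ring.
Qed.

(** Division by p lowers the bound d on the pole order of b by the order of p, which is positive
    since a constant would be invertible at P. Hence the factors p can be exhausted. *)
Lemma closed_factor b : B b -> b != 0 -> exists (m : nat) b',
  [/\ B b', OP P b'^-1 & b = p ^+ m * b'].
Proof.
have [hp p0 hpP hdiv] := pP.
have [dp [hp1 hp2]] := aB_degree hp p0.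
have dp0 : (0 < dp)%N.
  rewrite lt0n; apply/negP => /eqP dp0; apply: hpP.
  have [|c ec] := @aBO _ D p hp; first by move: hp1; rewrite dp0 expr0 mulr1.
  by rewrite ec -fmorphV; apply: in_local_cst.
move=> hb b0; have [d [hd1 _]] := aB_degree hb b0.
have [n] := ubnP d; elim: n d b hb b0 hd1 => // n IH d b hb b0 hd1 hn.
have [hbP|hbP] := pselect (OP P b^-1); first by exists 0%N, b; rewrite expr0 mul1r.
have [w hw ew] := hdiv b hb b0 hbP.
have w0 : w != 0 by apply: contraNneq b0 => w0; rewrite ew w0 mul0r.
have hwO : O (w * t ^+ d * t ^- dp).
  have -> : w * t ^+ d * t ^- dp = b * t ^+ d * (p * t ^+ dp)^-1.
    by rewrite ew invfM; field; rewrite p0 expf_neq0.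
  exact: srM.
have [le|lt] := leqP dp d; last first.
  case/eqP: w0; apply: (BtO hw).
  have -> : w / t = w * t ^+ d * t ^- dp * t ^+ (dp - d.+1).
    rewrite -{1}(subnK lt) addnS exprS exprD; field.
    by rewrite !expf_neq0.
  by rewrite mulrC; apply: OtX.
have [||m [b' [hb' hbP' e]]] := IH (d - dp)%N w hw w0.
- by move: hwO; rewrite -{1}(subnK le) exprD -!mulrA mulfV ?mulr1 // expf_neq0.
- by lia.
exists m.+1, b'; split=> //; by rewrite ew e exprS; ring.
Qed.

Lemma closed_valuation f : f != 0 -> exists (n : int) u, [/\ OP P u, OP P u^-1 & f = p ^ n * u].
Proof.
have [hp p0 hpP hdiv] := pP.
have [a [b [ha hb b0 ->]]] := ff_frac f; rewrite mulf_eq0 negb_or => /andP[a0 _].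
have [m [a' [ha' haP ea]]] := closed_factor ha a0.
have [m' [b' [hb' hbP eb]]] := closed_factor hb b0.
exists (m%:Z - m'%:Z), (a' / b'); split.
- by apply: srM => //; apply: OP_B.
- by rewrite invf_div; apply: srM => //; apply: OP_B.
by rewrite expfzDr // -invr_expz -!exprnP ea eb invfM mulrACA.
Qed.

(** Partial fractions: for f = a / (p^m b') with b' a unit at P, a relation x p^m + y b' = 1 gives f
    = a x / b' + a y / p^m. *)
Lemma closed_decompose f : exists (g : F) (n : nat) (h : F), [/\ OP P g, B h & f = g + h / p ^+ n].
Proof.
have [hp p0 hpP hdiv] := pP; have [a [b [ha hb b0 ->]]] := ff_frac f.
have [m [b' [hb' hbP eb]]] := closed_factor hb b0.
have b'0 : b' != 0 by apply: contraNneq b0 => e; rewrite eb e mulr0.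
have [x [y [hx hy e]]] := closed_coprime m hb' b'0 hbP.
exists (a * x / b'), m, (a * y); split.
- by apply: srM hbP; apply: OP_B => //; apply: srM.
- exact: srM.
rewrite eb -[in LHS](mulr1 a) -e; field.
by rewrite b'0 expf_neq0.
Qed.

End Closed.

End LocalRings.

Local Open Scope classical_set_scope.

(** * Rational functions and the structure sheaf *)

Section Functions.
Variables (k : fieldType) (q : {mpoly k[3]}) (D : func_field q).
Local Notation A := {mpoly k[3]}.
Local Notation F := (aF D).
Local Notation B := (aB D).
Local Notation O := (aO D).
Local Notation t := (at_ D).
Let t0 : t != 0 := at0 D.
Local Notation ev := (@ev k q D).
Local Notation pt := (conic_point q).
Local Notation OP := (OP D).
Local Notation x0 := ('X_i0 : A).
Implicit Types (P : pt) (g h : A) (f b : F).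

Lemma prime_point p : B p -> p != 0 -> ~ B p^-1 ->
  (forall a b, B a -> B b -> (exists2 w, B w & a * b = w * p) ->
    (exists2 w, B w & a = w * p) \/ (exists2 w, B w & b = w * p)) ->
  exists P : pt, x0 \notin cp_pred P /\
    forall d h, h \is d.-homog -> (h \in cp_pred P <-> exists2 w, B w & ev h = w * p).
Proof.
move=> hp p0 hpV hprime; pose I f := exists2 w, B w & f = w * p.
have I0 : I 0 by exists 0; rewrite ?mul0r //; apply: sr0.
have I1 : ~ I 1.
  move=> [w hw e]; apply: hpV; suff -> : p^-1 = w by [].
  by apply: (mulIf p0); rewrite mulVf // e.
have ID f f' : I f -> I f' -> I (f + f').
  by move=> [w hw ->] [w' hw' ->]; exists (w + w'); rewrite ?mulrDl //; apply: srD.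
have IM f f' : B f -> I f' -> I (f * f').
  by move=> hf [w hw ->]; exists (f * w); rewrite ?mulrA //; apply: srM.
have Rev d h : h \is d.-homog -> B (ev h * 1 ^+ d).
  by move=> hh; rewrite expr1n mulr1; apply: (homog_ev D hh).1.
have rel : exists j : 'I_3, ~ I (ev 'X_j * 1) by exists i0; rewrite ev_X0 mulr1.
exists (point_of I0 ID IM I1 hprime Rev rel).
have mem d h : h \is d.-homog -> (h \in @point_pred k q D I 1 <-> I (ev h)).
  by move=> hh; have := @homog_point_pred k q D I 1 I0 d h hh; rewrite expr1n mulr1.
by split=> [|d h /mem //]; apply/negP => /(mem _ _ (X_homog k _)); rewrite ev_X0.
Qed.

Lemma aB_unit b : B b -> O b -> b != 0 -> B b^-1.
Proof. by move=> hb ho b0; have [c ->] := aBO hb ho; rewrite -fmorphV; apply: aBk. Qed.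

(** Let d generate the ideal of denominators of f in B. If d is not a unit, its nonunit divisor p of
    least pole order is prime and defines a point P. All denominators of f are multiples of p, so f
    is not regular at P. *)
Lemma affine_functions f : (forall P, x0 \notin cp_pred P -> OP P f) -> B f.
Proof.
move=> hf; pose I c := B c /\ B (c * f).
have [||||d [[hd hdf] hI]] := @ff_pid k q D I.
- by move=> c [].
- by split; rewrite ?mul0r; apply: sr0.
- by move=> c c' [h1 h2] [h3 h4]; split; rewrite ?mulrDl; apply: srD.
- by move=> c c' hc [h1 h2]; split; rewrite -?mulrA; apply: srM.
have d0 : d != 0.
  have [a [b [ha hb b0 e]]] := ff_frac f.
  have [|w _ e'] := hI b; first by split; rewrite // e mulrC divfK.
  by apply: contraNneq b0 => d0; rewrite e' d0 mulr0.
have [hdV|hdV] := pselect (B d^-1); first by rewrite -[f](mulKf d0); apply: srM.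
pose deg p n := O (p * t ^+ n) /\ O (p * t ^+ n)^-1.
pose good p := [/\ B p, p != 0, ~ B p^-1 & exists2 w, B w & d = w * p].
have ex : exists n, `[< exists p, good p /\ deg p n >].
  have [n hn] := aB_degree hd d0; exists n; apply/asboolP; exists d; split=> //; split=> //.
  by exists 1; rewrite ?mul1r //; apply: sr1.
case: (ex_minnP ex) => n /asboolP[p [[hp p0 hpV [w hw ew]] [hn hn']]] hmin.
have [|P [xP mem]] := prime_point hp p0 hpV.
  move=> a b ha hb [v hv ev].
  have [e [x [y [p' [a' [[hx hy hp' ha'] ep ea ee]]]]]] := a_bezout hp ha.
  have he : B e by rewrite ee; apply: srD; apply: srM.
  have e0 : e != 0 by apply: contraNneq p0 => e0; rewrite ep e0 mul0r.
  have p'0 : p' != 0 by apply: contraNneq p0 => p'0; rewrite ep p'0 mulr0.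
  (* The greatest common divisor e of p and a is either a unit, and then p divides b, or a nonunit
     divisor of d. In the second case minimality makes p / e integral at infinity, hence a constant,
     and p divides a. *)
  have [heV|heV] := pselect (B e^-1).
    right; exists (e^-1 * (x * b + v * y)).
      by apply: srM => //; apply: srD; apply: srM.
    apply: (mulfI e0); rewrite -!mulrA mulVKf // {1}ee.
    by rewrite mulrDl (mulrAC a) ev; ring.
  left; have [m [hm hm']] := aB_degree he e0.
  have le : (n <= m)%N.
    apply: hmin; apply/asboolP; exists e; split=> //; split=> //.
    by exists (w * p'); [apply: srM | rewrite ew ep; ring].
  have hp'O : O p'.
    have -> : p' = (p * t ^+ n) * (e * t ^+ m)^-1 * t ^+ (m - n).
      rewrite ep -{1}(subnK le) exprD; field.
      by rewrite e0 !expf_neq0.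
    by rewrite mulrC; apply: OtX; apply: srM.
  exists (p'^-1 * a'); first by apply: srM => //; apply: aB_unit.
  by rewrite {1}ea ep; field.
have [e [g [h [hg hh hP ef]]]] := hf P xP.
have h0 := ev_neq0 D hh hP; case/negP: hP; apply/(mem _ _ hh).
have [|v hv ev] := hI (ev h).
  split; first exact: (homog_ev D hh).1.
  rewrite ef mulrC divfK //.
  exact: (homog_ev D hg).1.
by exists (v * w); [apply: srM | rewrite ev ew mulrA].
Qed.

Lemma open_nonvanishing d g : g \is d.-homog -> open ([set P : pt | g \notin cp_pred P] : set pt).
Proof.
move=> hg; exists [set g]; first by move=> _ ->; exists d.
rewrite predeqE => P; split=> [h|[_ -> //]]; by exists g.
Qed.

Lemma open_basis (U : opens pt) P : U P -> exists d g, [/\ g \is d.-homog, g \notin cp_pred P &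
  forall P', g \notin cp_pred P' -> U P'].
Proof.
case: U => U /= [E hE eU]; rewrite /omem /oset /= eU => -[g Eg gP].
by have [d hd] := hE _ Eg; exists d, g; split=> // P' gP'; exists g.
Qed.

End Functions.

Section RegularFunctions.
Variables (k : fieldType) (q : {mpoly k[3]}) (D : func_field q).
Local Notation A := {mpoly k[3]}.
Local Notation F := (aF D).
Local Notation t := (at_ D).
Let t0 : t != 0 := at0 D.
Local Notation i := (ai D).
Local Notation ev := (@ev k q D).
Local Notation pt := (conic_point q).
Local Notation C := (conic q).
Local Notation OP := (OP D).
Local Notation eta := (generic_point D).
Implicit Types (P : pt) (g h : A) (f b : F) (U V W : opens C).

Definition nonvanishing d g (hg : g \is d.-homog) : opens C :=
  exist _ ([set P : pt | g \notin cp_pred P] : set pt) (open_nonvanishing q hg).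

Lemma eta_open U P : U P -> U eta.
Proof.
move=> UP; have [d [g [hg gP]]] := @open_basis k q U P UP; apply.
apply/negP => /(generic_point_mem D hg); apply/eqP; exact: (ev_neq0 D hg gP).
Qed.

Lemma OP_nbhd U P f : U P -> OP P f -> exists W : opens C, exists (_ : W P) (WU : W `<=` U),
  forall P', W P' -> OP P' f.
Proof.
move=> UP [d [g [h [hg hh hP ->]]]].
exists (interU U (nonvanishing hh)), (conj UP hP), (@interUl _ _ _).
by move=> P' [_ hP']; exists d, g, h.
Qed.

Definition germ_val P (x : local_ring P) : F :=
  let a := rep (e := @frac_eqv k q P) x in ev (fr_num a) / ev (fr_den a).

Lemma germ_valE P (a : Defs.frac P) : germ_val (lr_cl a) = ev (fr_num a) / ev (fr_den a).
Proof.
rewrite /germ_val; have := rep_cl (@frac_eqv k q P) a.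
move: (rep _) => b [c [[e hc] cP [h eq]]].
have c0 := ev_neq0 D hc cP; have a0 := ev_neq0 D (fr_denH a) (@fr_denP _ _ _ a).
have b0 := ev_neq0 D (fr_denH b) (@fr_denP _ _ _ b).
apply/eqP; rewrite eqr_div // -subr_eq0; apply/eqP; apply: (mulfI c0).
by rewrite mulr0 -!rmorphM -rmorphB -rmorphM eq rmorphM ev_q mulr0.
Qed.

Lemma germ_val_inj P : injective (@germ_val P).
Proof.
elim/lr_clW=> a; elim/lr_clW=> b; rewrite !germ_valE => /eqP.
have a0 := ev_neq0 D (fr_denH a) (@fr_denP _ _ _ a).
have b0 := ev_neq0 D (fr_denH b) (@fr_denP _ _ _ b).
rewrite eqr_div // => /eqP e; apply/clP; exists 1; split; [by exists 0%N; apply: dhomog1|exact: cp_1|].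
have hh : fr_num a * fr_den b - fr_num b * fr_den a \is (fr_deg a + fr_deg b).-homog.
  apply: rpredB; first exact: dhomogM (fr_numH a) (fr_denH b).
  by rewrite addnC; apply: dhomogM (fr_numH b) (fr_denH a).
have [h' eh] : exists h', fr_num a * fr_den b - fr_num b * fr_den a = h' * q.
  by apply: (@ev_ker k q D _ _ hh); rewrite rmorphB !rmorphM e subrr.
by exists h'; rewrite mul1r eh.
Qed.

Lemma germ_valD P (x y : local_ring P) : germ_val (x + y) = germ_val x + germ_val y.
Proof.
elim/lr_clW: x => a; elim/lr_clW: y => b; rewrite lr_clD !germ_valE /= rmorphD !rmorphM.
rewrite addf_div ?(ev_neq0 D (fr_denH a) (@fr_denP _ _ _ a)) ?(ev_neq0 D (fr_denH b) (@fr_denP _ _ _ b)) //.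
by rewrite [ev (fr_den a) * ev (fr_num b)]mulrC.
Qed.

Lemma germ_valM P (x y : local_ring P) : germ_val (x * y) = germ_val x * germ_val y.
Proof.
elim/lr_clW: x => a; elim/lr_clW: y => b; rewrite lr_clM !germ_valE /= !rmorphM.
by rewrite mulf_div.
Qed.

Lemma germ_val_cst P c : germ_val (lr_cl (frac_cst P c)) = i c.
Proof. by rewrite germ_valE /= ev_C rmorph1 divr1. Qed.

Lemma germ_val_OP P (x : local_ring P) : OP P (germ_val x).
Proof.
elim/lr_clW: x => a; rewrite germ_valE; exists (fr_deg a), (fr_num a), (fr_den a).
by split; [apply: fr_numH | apply: fr_denH | apply: fr_denP |].
Qed.

Lemma germ_val_sur P f : OP P f -> exists x : local_ring P, germ_val x = f.
Proof. by move=> [d [g [h [hg hh hP ->]]]]; exists (lr_cl (Frac hg hh hP)); rewrite germ_valE. Qed.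

(** The value at the generic point, which lies in every nonempty open set. The default 0 is taken
    only on the empty set, where the ring of sections is zero. *)
Definition fval U (a : 'O U) : F :=
  if pselect (U eta) is left h then germ_val (rg_val a h) else 0.

Lemma fvalE U (a : 'O U) P (UP : U P) : germ_val (rg_val a UP) = fval a.
Proof.
rewrite /fval; case: pselect => [h|/(_ (eta_open UP)) //].
have [V [VP [VU [f [g [d [fH [gH [gV e]]]]]]]]] := rg_loc a UP.
have Ve : V eta by exact: (@eta_open V P).
rewrite (Prop_irrelevance UP (VU _ VP)) (Prop_irrelevance h (VU _ Ve)) !e.
by rewrite !germ_valE.
Qed.

Lemma fval_OP U (a : 'O U) P : U P -> OP P (fval a).
Proof. by move=> UP; rewrite -(fvalE a UP); apply: germ_val_OP. Qed.

Lemma fval_inj U : injective (@fval U).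
Proof.
move=> a b e; apply: regularP => P UP; apply: germ_val_inj.
by rewrite !fvalE.
Qed.

Lemma fval_sur U f : (forall P, U P -> OP P f) -> (~ U eta -> f = 0) -> exists a : 'O U, fval a = f.
Proof.
move=> hf f0; pose v P (UP : U P) : local_ring P := sval (cid (germ_val_sur (hf P UP))).
have vE P UP : germ_val (@v P UP) = f by rewrite /v; case: cid.
have vl P : U P -> exists V : opens pt, exists (_ : V P) (VU : V `<=` U)
    (f g : A) (d : nat) (fH : f \is d.-homog) (gH : g \is d.-homog)
    (gV : forall Q, V Q -> g \notin cp_pred Q),
    forall Q (VQ : V Q), v Q (VU Q VQ) = lr_cl (Frac fH gH (gV Q VQ)).
  move=> UP; have [d [g [h [hg hh hP ef]]]] := hf P UP.
  exists (interU U (nonvanishing hh)), (conj UP hP), (@interUl _ _ _), g, h, d, hg, hh.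
  exists (@interUr _ U (nonvanishing hh)) => Q UQ; apply: germ_val_inj.
  by rewrite vE germ_valE.
exists (Regular vl); rewrite /fval; case: pselect => [h|h]; last by rewrite f0.
exact: vE.
Qed.

Lemma fval_res U V (VU : V `<=` U) (a : 'O U) : V eta -> fval (rs_res VU a) = fval a.
Proof. by move=> Ve; rewrite -(fvalE _ Ve) -(fvalE _ (VU _ Ve)). Qed.

Lemma fvalD U (a b : 'O U) : fval (a + b) = fval a + fval b.
Proof. by rewrite /fval; case: pselect => [h|h]; rewrite ?addr0 // -germ_valD. Qed.

Lemma fvalM U (a b : 'O U) : fval (a * b) = fval a * fval b.
Proof. by rewrite /fval; case: pselect => [h|h]; rewrite ?mulr0 // -germ_valM. Qed.

Lemma fval_cst U c : U eta -> fval (rs_cst (r:=C) U c) = i c.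
Proof. by rewrite /fval; case: pselect => // h _; apply: germ_val_cst. Qed.

Lemma fval1 U : U eta -> fval (1 : 'O U) = 1.
Proof. by move=> Ue; rewrite -(rmorph1 (rs_cst (r:=C) U)) fval_cst // rmorph1. Qed.

Lemma fval_empty U (a : 'O U) : ~ U eta -> fval a = 0.
Proof. by rewrite /fval; case: pselect. Qed.

End RegularFunctions.

(** * Sheaves of modules *)

Section ModuleSheaves.
Variables (k : fieldType) (X : ringed_space k).
Implicit Types (U V W : opens X) (F G H : omod X).

Lemma om_resB F U V (VU : V `<=` U) (s t : F U) : om_res VU (s - t) = om_res VU s - om_res VU t.
Proof. by rewrite om_resD om_resN. Qed.

Section Hom.
Variables (U : opens X) (F G : omod X) (f : hom_over U F G).

Lemma hom0 V (VU : V `<=` U) : f V VU 0 = 0.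
Proof. by have := homZ f VU 0 0; rewrite !scale0r. Qed.

Lemma homB V (VU : V `<=` U) s t : f V VU (s - t) = f V VU s - f V VU t.
Proof. by rewrite homD -scaleN1r homZ scaleN1r. Qed.

End Hom.

Lemma iso_over_refl U F : iso_over U F F.
Proof.
have f : hom_over U F F by refine (@HomOver _ _ U F F (fun V VU s => s) _ _ _).
by exists (@HomOver _ _ U F F (fun V VU s => s) (fun _ _ _ _ => erefl) (fun _ _ _ _ => erefl)
  (fun _ _ _ _ _ _ => erefl)) => V VU; exists id.
Qed.

Lemma hom_over_inv U F G (f : hom_over U F G) : (forall V (VU : V `<=` U), bijective (f V VU)) ->
  exists g : hom_over U G F, forall V (VU : V `<=` U),
    cancel (f V VU) (g V VU) /\ cancel (g V VU) (f V VU).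
Proof.
move=> bf; have inv V (VU : V `<=` U) : {g : G V -> F V | cancel (f V VU) g /\ cancel g (f V VU)}.
  by apply: cid; case: (bf V VU) => g h1 h2; exists g.
pose g V (VU : V `<=` U) := sval (inv V VU).
have fK V VU : cancel (f V VU) (g V VU) := (svalP (inv V VU)).1.
have gK V VU : cancel (g V VU) (f V VU) := (svalP (inv V VU)).2.
have finj V VU : injective (f V VU) := can_inj (fK V VU).
have gD V (VU : V `<=` U) s t : g V VU (s + t) = g V VU s + g V VU t.
  by apply: (finj V VU); rewrite homD !gK.
have gZ V (VU : V `<=` U) (a : 'O V) s : g V VU (a *: s) = a *: g V VU s.
  by apply: (finj V VU); rewrite homZ !gK.
have gR V W (VU : V `<=` U) (WU : W `<=` U) (WV : W `<=` V) s :
    om_res WV (g V VU s) = g W WU (om_res WV s).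
  by apply: (finj W WU); rewrite -(hom_res f VU WU WV) !gK.
by exists (HomOver gD gZ gR).
Qed.

Lemma iso_over_sym U F G : iso_over U F G -> iso_over U G F.
Proof.
by move=> [f /hom_over_inv[g h]]; exists g => V VU; exists (f V VU); have [] := h V VU.
Qed.

Definition hom_comp U F G H (g : hom_over U G H) (f : hom_over U F G) : hom_over U F H.
Proof.
refine (@HomOver _ _ U F H (fun V VU s => g V VU (f V VU s)) _ _ _).
- by move=> V VU s t; rewrite !homD.
- by move=> V VU a s; rewrite !homZ.
- by move=> V W VU WU WV s; rewrite (hom_res g VU WU WV) (hom_res f VU WU WV).
Defined.

Lemma iso_over_trans U G F H : iso_over U F G -> iso_over U G H -> iso_over U F H.
Proof.
move=> [f hf] [g hg]; exists (hom_comp g f) => V VU.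
exact: (bij_comp (hg V VU) (hf V VU)).
Qed.

Definition hom_restrict U U' (h : U' `<=` U) F G (f : hom_over U F G) : hom_over U' F G.
Proof.
refine (@HomOver _ _ U' F G (fun V VU s => f V (subset_trans VU h) s) _ _ _).
- by move=> V VU s t; rewrite homD.
- by move=> V VU a s; rewrite homZ.
- by move=> V W VU WU WV s; apply: hom_res.
Defined.

Lemma iso_over_restrict U U' F G : U' `<=` U -> iso_over U F G -> iso_over U' F G.
Proof. by move=> h [f hf]; exists (hom_restrict h f) => V VU; apply: hf. Qed.

Lemma iso_iso_over U F G : iso F G -> iso_over U F G.
Proof. exact/iso_over_restrict/sub_full. Qed.

Lemma iso_refl F : iso F F. Proof. exact: iso_over_refl. Qed.
Lemma iso_sym F G : iso F G -> iso G F. Proof. exact: iso_over_sym. Qed.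
Lemma iso_trans G F H : iso F G -> iso G H -> iso F H. Proof. exact: iso_over_trans. Qed.

Lemma iso_over_dsum U F F' G G' : iso_over U F F' -> iso_over U G G' ->
  iso_over U (dsum F G) (dsum F' G').
Proof.
move=> [f hf] [g hg].
have hD V (VU : V `<=` U) (s t : dsum F G V) : (f V VU (s + t).1, g V VU (s + t).2) =
    (f V VU s.1, g V VU s.2) + (f V VU t.1, g V VU t.2) :> dsum F' G' V.
  by congr pair; rewrite homD.
have hZ V (VU : V `<=` U) (a : 'O V) (s : dsum F G V) : (f V VU (a *: s).1, g V VU (a *: s).2) =
    a *: (f V VU s.1, g V VU s.2) :> dsum F' G' V.
  by congr pair; rewrite homZ.
have hR V W (VU : V `<=` U) (WU : W `<=` U) (WV : W `<=` V) (s : dsum F G V) :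
    om_res WV ((f V VU s.1, g V VU s.2) : dsum F' G' V) =
    (f W WU (om_res WV s).1, g W WU (om_res WV s).2).
  by congr pair; apply: hom_res.
exists (HomOver hD hZ hR) => V VU /=.
have [f' f1 f2] := hf V VU; have [g' g1 g2] := hg V VU.
by exists (fun s => (f' s.1, g' s.2)) => -[s t] /=; rewrite ?f1 ?g1 ?f2 ?g2.
Qed.

Lemma iso_dsum F F' G G' : iso F F' -> iso G G' -> iso (dsum F G) (dsum F' G').
Proof. exact: iso_over_dsum. Qed.

Lemma sheaf_eq F U (s t : F U) : is_sheaf F ->
  (forall x, U x -> exists V : opens X, exists (_ : V x) (VU : V `<=` U), om_res VU s = om_res VU t) ->
  s = t.
Proof.
move=> hF h; pose I := {x : X | U x}.
have hx (j : I) : {V : opens X | V (sval j) /\ exists VU : V `<=` U, om_res VU s = om_res VU t}.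
  by apply: cid; have [V [Vx [VU e]]] := h (sval j) (svalP j); exists V; split=> //; exists VU.
pose W (j : I) := sval (hx j).
have WU j : W j `<=` U by have [] := (svalP (hx j)).2.
have cov : U `<=` \bigcup_j oset (W j).
  by move=> x Ux; exists (exist _ x Ux) => //; have [] := svalP (hx (exist _ x Ux)).
have [|u [_ uu]] := hF I U W WU cov (fun j => om_res (WU j) s).
  move=> j j'; rewrite (om_res_comp _ _ (subset_trans (@interUl _ (W j) (W j')) (WU j))).
  by rewrite (om_res_comp _ _ (subset_trans (@interUl _ (W j) (W j')) (WU j))).
rewrite -(uu s) // (uu t) // => j.
have [_ [VU e]] := svalP (hx j).
by rewrite (Prop_irrelevance (WU j) VU) e.
Qed.

Lemma sheaf_glue F U (T : forall V, F V -> Prop) : is_sheaf F ->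
  (forall x, U x -> exists V : opens X, exists (_ : V x) (VU : V `<=` U) (s : F V), T V s) ->
  (forall V V' (s : F V) (s' : F V'), V `<=` U -> V' `<=` U -> T V s -> T V' s' ->
     om_res (@interUl _ V V') s = om_res (@interUr _ V V') s') ->
  exists t : F U, forall x, U x -> exists V : opens X, exists (_ : V x) (VU : V `<=` U) (s : F V),
    T V s /\ om_res VU t = s.
Proof.
move=> hF ex comp; pose I := {x : X | U x}.
have hx (j : I) : {V : opens X & {s : F V | V (sval j) /\ (V `<=` U) /\ T V s}}.
  have [V hV] := cid (ex (sval j) (svalP j)).
  have [Vx hV'] := cid hV; have [VU hs] := cid hV'; have [s Ts] := cid hs.
  by exists V, s.
pose W (j : I) := projT1 (hx j).
pose sW (j : I) : F (W j) := sval (projT2 (hx j)).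
have WU j : W j `<=` U by have [_ []] := svalP (projT2 (hx j)).
have TW j : T (W j) (sW j) by have [_ []] := svalP (projT2 (hx j)).
have Wx j : W j (sval j) by have [] := svalP (projT2 (hx j)).
have cov : U `<=` \bigcup_j oset (W j).
  by move=> x Ux; exists (exist _ x Ux) => //; apply: Wx.
have [|t [ht _]] := hF I U W WU cov sW; first by move=> j j'; apply: comp.
exists t => x Ux; exists (W (exist _ x Ux)), (Wx (exist _ x Ux)), (WU _), (sW _).
by split; [apply: TW | apply: ht].
Qed.

Lemma locally_bijective F G (f : Defs.hom F G) : is_sheaf F -> is_sheaf G ->
  (forall U (s : F U), hom_at f s = 0 -> forall x, U x ->
     exists V : opens X, exists (_ : V x) (VU : V `<=` U), om_res VU s = 0) ->
  (forall U (t : G U) x, U x -> exists V : opens X, exists (_ : V x) (VU : V `<=` U) (s : F V),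
     hom_at f s = om_res VU t) ->
  forall U, bijective (hom_at f (U := U)).
Proof.
move=> hF hG hinj hsur U.
have homR (V W : opens X) (WV : W `<=` V) (s : F V) : om_res WV (hom_at f s) = hom_at f (om_res WV s).
  exact: hom_res.
have inj (V : opens X) : injective (hom_at f (U := V)).
  move=> s t e; apply: (sheaf_eq hF) => x Vx.
  have [|W [Wx [WV e']]] := hinj V (s - t) _ x Vx; first by rewrite /hom_at homB -!/(hom_at f _) e subrr.
  by exists W, Wx, WV; apply/eqP; rewrite -subr_eq0 -om_resB e'.
have sur (t : G U) : exists s, hom_at f s = t.
  pose T V (s : F V) := exists VU : V `<=` U, hom_at f s = om_res VU t.
  have [||s hs] := @sheaf_glue F U T hF.
  - move=> x Ux; have [V [Vx [VU [s hs]]]] := hsur U t x Ux.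
    by exists V, Vx, VU, s, VU.
  - move=> V V' s s' VU V'U [VU1 e] [VU2 e']; apply: inj.
    rewrite -!homR e e' (om_res_comp _ _ (subset_trans (@interUl _ V V') VU)).
    by rewrite (om_res_comp _ _ (subset_trans (@interUl _ V V') VU)).
  exists s; apply: (sheaf_eq hG) => x Ux; have [V [Vx [VU [s' [[VU' e] e']]]]] := hs x Ux.
  by exists V, Vx, VU; rewrite homR e' e (Prop_irrelevance VU VU').
have [g hg] := choice sur; exists g => // s; apply: inj; exact: hg.
Qed.

End ModuleSheaves.

Local Arguments fval : simpl never.

(** * Sheaves of vectors over the function field *)

Section Models.
Variables (k : fieldType) (q : {mpoly k[3]}) (D : func_field q).
Local Notation F := (aF D).
Local Notation pt := (conic_point q).
Local Notation C := (conic q).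
Local Notation OP := (OP D).
Local Notation eta := (generic_point D).
Local Notation fval := (fval D).
Implicit Types (P : pt) (U V W : opens C).

Lemma nbhd_all (I : finType) (T : I -> pt -> Prop) U P : U P ->
  (forall j, exists W : opens C, exists (_ : W P) (WU : W `<=` U), forall P', W P' -> T j P') ->
  exists W : opens C, exists (_ : W P) (WU : W `<=` U), forall P', W P' -> forall j, T j P'.
Proof.
move=> UP h.
have [W [WP [WU hW]]] : exists W : opens C, exists (_ : W P) (WU : W `<=` U), forall P', W P' ->
    forall j, j \in enum I -> T j P'.
  elim: (enum I) => [|j s [W [WP [WU IH]]]]; first by exists U, UP, (@subset_refl _ _).
  have [W' [W'P [W'U h']]] := h j.
  exists (interU W W'), (conj WP W'P), (subset_trans (@interUl _ W W') WU) => P' [h1 h2] j'.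
  by rewrite inE => /orP[/eqP ->|]; [apply: h' | apply: IH].
by exists W, WP, WU => P' WP' j; apply: hW; rewrite ?mem_enum.
Qed.

Lemma OP_nbhd_mx U P m n (v : 'M[F]_(m, n)) : U P -> mxin (OP P) v ->
  exists W : opens C, exists (_ : W P) (WU : W `<=` U), forall P', W P' -> mxin (OP P') v.
Proof.
move=> UP hv.
have [|W [WP [WU h]]] := @nbhd_all ('I_m * 'I_n)%type (fun j P' => OP P' (v j.1 j.2)) U P UP.
  by move=> j; apply: (@OP_nbhd _ _ D U P _ UP); apply: hv.
by exists W, WP, WU => P' WP' a b; apply: (h P' WP' (a, b)).
Qed.

Lemma generic_OP f : OP eta f.
Proof.
have [a [b [ha hb b0 ->]]] := ff_frac f.
have [d [g [h [hg hh <- eh]]]] := aB_homog2 ha hb.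
exists d, g, h; split=> //; last by rewrite eh.
by apply/negP => /(generic_point_mem D hh); apply/eqP; rewrite eh.
Qed.

(** One submodule of F^r for each point, with no condition relating different points. That an
    element at one point extends to a neighbourhood is the separate property [open_lattice]. *)
Record lattice (r : nat) := Lattice {
  lt_mem :> pt -> 'rV[F]_r -> Prop;
  lt0 : forall P, lt_mem P 0;
  ltD : forall P v w, lt_mem P v -> lt_mem P w -> lt_mem P (v + w);
  ltZ : forall P a v, OP P a -> lt_mem P v -> lt_mem P (a *: v) }.

Section AtU.
Variables (r : nat) (L : lattice r) (U : opens C).

(* Sections over a nonempty open set are vectors lying in all the stalks; the last
   condition makes the module over the empty set trivial. *)
Record msec := MSec {
  mv : 'rV[F]_r;
  mvP : forall P, U P -> L P mv;
  mv_empty : ~ U eta -> mv = 0 }.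
HB.instance Definition _ := gen_eqMixin msec.
HB.instance Definition _ := gen_choiceMixin msec.

Lemma mv_inj : injective mv.
Proof.
case=> [v h1 h2] [w h3 h4] /= e; subst w.
by congr MSec; apply: Prop_irrelevance.
Qed.

Program Definition msec0 : msec := {| mv := 0 |}.
Next Obligation. by move=> *; apply: lt0. Qed.
Next Obligation. by []. Qed.
Program Definition msec_opp (s : msec) : msec := {| mv := - mv s |}.
Next Obligation. by move=> s P UP; rewrite -scaleN1r; apply: ltZ; [apply/srN/sr1 | apply: mvP]. Qed.
Next Obligation. by move=> s /mv_empty ->; rewrite oppr0. Qed.
Program Definition msec_add (s t : msec) : msec := {| mv := mv s + mv t |}.
Next Obligation. by move=> s t P UP; apply: ltD; apply: mvP. Qed.
Next Obligation. by move=> s t h; rewrite !mv_empty // addr0. Qed.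
Program Definition msec_scale (a : 'O U) (s : msec) : msec := {| mv := fval a *: mv s |}.
Next Obligation. by move=> a s P UP; apply: ltZ; [apply: fval_OP | apply: mvP]. Qed.
Next Obligation. by move=> a s h; rewrite mv_empty // scaler0. Qed.

Lemma msec_addA : associative msec_add.
Proof. by move=> s t u; apply: mv_inj; rewrite /= addrA. Qed.
Lemma msec_addC : commutative msec_add.
Proof. by move=> s t; apply: mv_inj; rewrite /= addrC. Qed.
Lemma msec_add0 : left_id msec0 msec_add.
Proof. by move=> s; apply: mv_inj; rewrite /= add0r. Qed.
Lemma msec_addN : left_inverse msec0 msec_opp msec_add.
Proof. by move=> s; apply: mv_inj; rewrite /= addNr. Qed.
HB.instance Definition _ := GRing.isZmodule.Build msec msec_addA msec_addC msec_add0 msec_addN.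

Lemma msec_scaleA a b s : msec_scale a (msec_scale b s) = msec_scale (a * b) s.
Proof. by apply: mv_inj; rewrite /= scalerA fvalM. Qed.
Lemma msec_scale1 : left_id 1 msec_scale.
Proof.
move=> s; apply: mv_inj => /=; have [h|h] := pselect (U eta).
  by rewrite fval1 // scale1r.
by rewrite mv_empty // scaler0.
Qed.
Lemma msec_scaleDr : right_distributive msec_scale +%R.
Proof. by move=> a s t; apply: mv_inj; rewrite /= scalerDr. Qed.
Lemma msec_scaleDl s : {morph msec_scale^~ s : a b / a + b}.
Proof. by move=> a b; apply: mv_inj; rewrite /= fvalD scalerDl. Qed.
HB.instance Definition _ := GRing.Zmodule_isLmodule.Build ('O U) msec
  msec_scaleA msec_scale1 msec_scaleDr msec_scaleDl.

End AtU.

Section Mod.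
Variables (r : nat) (L : lattice r).

Program Definition mres U V (VU : V `<=` U) (s : msec L U) : msec L V :=
  {| mv := if pselect (V eta) then mv s else 0 |}.
Next Obligation.
move=> U V VU s P VP; case: pselect => h; last exact: lt0.
by apply: mvP; apply: VU.
Qed.
Next Obligation. by move=> U V VU s h; case: pselect. Qed.

Lemma mresE U V (VU : V `<=` U) (s : msec L U) : V eta -> mv (mres VU s) = mv s.
Proof. by rewrite /=; case: pselect. Qed.

Program Definition Mod : omod C := {|
  om_sec := fun U => (msec L U : lmodType ('O U));
  om_res := mres |}.
Next Obligation. by move=> U V VU s t; apply: mv_inj => /=; case: pselect => [h|h] //=; rewrite addr0. Qed.
Next Obligation.
move=> U V VU a s; apply: mv_inj => /=; case: pselect => [h|h]; last by rewrite scaler0.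
by rewrite fval_res.
Qed.
Next Obligation.
by move=> U UU s; apply: mv_inj => /=; case: pselect => [h|h] //; rewrite mv_empty.
Qed.
Next Obligation.
move=> U V W VU WV WU s; apply: mv_inj => /=; case: (pselect (W eta)) => [h|h] //.
by case: (pselect (V eta)) => [h'|h'] //; case: h'; apply: WV.
Qed.

Definition mvec U (s : Mod U) : 'rV[F]_r := mv (s : msec L U).

Lemma mvec_inj U : injective (@mvec U). Proof. exact: mv_inj. Qed.
Lemma mvecP U (s : Mod U) P : U P -> L P (mvec s). Proof. exact: mvP. Qed.
Lemma mvec_empty U (s : Mod U) : ~ U eta -> mvec s = 0. Proof. exact: mv_empty. Qed.
Lemma mvecD U (s t : Mod U) : mvec (s + t) = mvec s + mvec t. Proof. by []. Qed.
Lemma mvecZ U a (s : Mod U) : mvec (a *: s) = fval a *: mvec s. Proof. by []. Qed.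
Lemma mvec0 U : mvec (0 : Mod U) = 0. Proof. by []. Qed.
Lemma mvec_res U V (VU : V `<=` U) (s : Mod U) : V eta -> mvec (om_res VU s) = mvec s.
Proof. exact: mresE. Qed.

Lemma mvec_sur U v : (forall P, U P -> L P v) -> (~ U eta -> v = 0) -> exists s : Mod U, mvec s = v.
Proof. by move=> h1 h2; exists (MSec h1 h2). Qed.

Lemma Mod_sheaf : is_sheaf Mod.
Proof.
move=> I U W WU cov s hs.
have eqW j l : W j eta -> W l eta -> mvec (s j) = mvec (s l).
  move=> hj hl; have := congr1 (@mvec _) (hs j l).
  by rewrite !mvec_res.
have [v hv] : exists v, forall j, W j eta -> mvec (s j) = v.
  have [[j0 h0]|h] := pselect (exists j, W j eta); first by exists (mvec (s j0)) => j hj; apply: eqW.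
  by exists 0 => j hj; case: h; exists j.
have [|h0|t ht] := @mvec_sur U (if pselect (U eta) then v else 0).
- move=> P UP; case: pselect => h; last exact: lt0.
  have [j _ WP] := cov P UP; rewrite -(hv j (@eta_open _ _ D (W j) P WP)); exact: mvecP.
- by case: pselect.
exists t; split=> [j|t' ht'].
  apply: mvec_inj; have [h|h] := pselect (W j eta); last by rewrite !mvec_empty.
  rewrite mvec_res // ht hv //; case: pselect => [h'|h'] //; case: h'; exact: WU h.
apply: mvec_inj; have [h|h] := pselect (U eta); last by rewrite !mvec_empty.
have [j _ WP] := cov _ h; rewrite ht; case: pselect => [h'|h'] //.
have We : W j eta by [].
by rewrite -(hv j We) -(ht' j) mvec_res.
Qed.

End Mod.

Section HomMx.
Variables (r s : nat) (L : lattice r) (L' : lattice s) (U : opens C) (a : 'M[F]_(r, s)).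
Hypothesis ha : forall P, U P -> forall v, L P v -> L' P (v *m a).

Lemma mx_fun_P V (VU : V `<=` U) (v : Mod L V) P : V P -> L' P (mvec v *m a).
Proof. by move=> VP; apply: ha; [apply: VU | apply: mvecP]. Qed.

Lemma mx_fun_0 V (v : Mod L V) : ~ V eta -> mvec v *m a = 0.
Proof. by move=> /mvec_empty ->; rewrite mul0mx. Qed.

Definition mx_fun V (VU : V `<=` U) (v : Mod L V) : Mod L' V :=
  MSec (mx_fun_P VU v) (mx_fun_0 v).

Definition hom_mx : hom_over U (Mod L) (Mod L').
Proof.
refine (@HomOver _ _ U (Mod L) (Mod L') mx_fun _ _ _).
- by move=> V VU v w; apply: mvec_inj; rewrite mvecD /mvec /= mulmxDl.
- by move=> V VU b v; apply: mvec_inj; rewrite mvecZ /mvec /= scalemxAl.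
move=> V W VU WU WV v; apply: mvec_inj; have [h|h] := pselect (W eta); last by rewrite !mvec_empty.
by rewrite mvec_res // /mvec /=; case: pselect.
Defined.

Lemma hom_mxE V (VU : V `<=` U) (v : Mod L V) : mvec (hom_mx V VU v) = mvec v *m a.
Proof. by []. Qed.

End HomMx.

Lemma iso_mx r s (L : lattice r) (L' : lattice s) U (a : 'M[F]_(r, s)) a' :
  a *m a' = 1%:M -> a' *m a = 1%:M -> (forall P, U P -> forall v, L P v <-> L' P (v *m a)) ->
  iso_over U (Mod L) (Mod L').
Proof.
move=> e e' h; have h1 P (UP : U P) v : L P v -> L' P (v *m a) by move/(h P UP).
have h2 P (UP : U P) v : L' P v -> L P (v *m a').
  by move=> hv; apply/(h P UP); rewrite -mulmxA e' mulmx1.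
exists (hom_mx h1) => V VU; exists (hom_mx h2 V VU) => v; apply: mvec_inj; rewrite !hom_mxE.
  by rewrite -mulmxA e mulmx1.
by rewrite -mulmxA e' mulmx1.
Qed.

Definition generically_full r (L : lattice r) :=
  forall v, exists U : opens C, U eta /\ forall P, U P -> L P v.

(** The rows of the matrix are the images of the basis vectors, which are all sections over some
    nonempty W. After a further restriction to W', any section v is a combination of them with
    regular coefficients, and restriction to a nonempty open set loses nothing. *)
Lemma full_faithful r s (L : lattice r) (L' : lattice s) U (f : hom_over U (Mod L) (Mod L')) :
  U eta -> generically_full L ->
  exists a : 'M[F]_(r, s), forall V (VU : V `<=` U) (v : Mod L V), mvec (f V VU v) = mvec v *m a.
Proof.
move=> Ue full.
have ex (j : 'I_r) : exists w, exists V : opens C, exists (_ : V eta) (VU : V `<=` U) (v : Mod L V),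
    mvec v = delta_mx 0 j /\ mvec (f V VU v) = w.
  have [V [Ve hV]] := full (delta_mx 0 j).
  have [||v hv] := @mvec_sur _ L (interU U V) (delta_mx 0 j); [by move=> P [_ /hV]| by case; split |].
  exists (mvec (f (interU U V) (@interUl _ U V) v)), (interU U V), (conj Ue Ve), (@interUl _ U V), v.
  by [].
have [w hw] := choice ex; exists (\matrix_j w j) => V VU v.
have [Ve|Ve] := pselect (V eta); last by rewrite !mvec_empty // mul0mx.
have [W [We [WV [vs [hvs es]]]]] : exists W : opens C, exists (_ : W eta) (WV : W `<=` V)
    (vs : 'I_r -> Mod L W), (forall j, mvec (vs j) = delta_mx 0 j) /\
    forall j, mvec (f W (subset_trans WV VU) (vs j)) = w j.
  have gen n : exists W : opens C, exists (_ : W eta) (WV : W `<=` V), forall j : 'I_r, (j < n)%N ->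
      exists v : Mod L W, mvec v = delta_mx 0 j /\ mvec (f W (subset_trans WV VU) v) = w j.
    elim: n => [|n [W [We [WV IH]]]]; first by exists V, Ve, (@subset_refl _ _).
    have [hn|hn] := ltnP n r; last first.
      by exists W, We, WV => j _; apply: IH; apply: leq_trans (ltn_ord j) hn.
    have [V1 [V1e [V1U [v1 [e1 e2]]]]] := hw (Ordinal hn).
    exists (interU W V1), (conj We V1e), (subset_trans (@interUl _ W V1) WV) => j.
    rewrite ltnS leq_eqVlt => /orP[/eqP ej|/IH[v2 [e3 e4]]].
      have {ej} -> : j = Ordinal hn by apply: val_inj.
      exists (om_res (@interUr _ W V1) v1); rewrite mvec_res //; split=> //.
      by rewrite -(hom_res f V1U) mvec_res.
    exists (om_res (@interUl _ W V1) v2); rewrite mvec_res //; split=> //.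
    by rewrite -(hom_res f (subset_trans WV VU)) mvec_res.
  have [W [We [WV h]]] := gen r; have [vs hvs] := choice (fun j => h j (ltn_ord j)).
  by exists W, We, WV, vs; split=> j; have [] := hvs j.
have [W' [W'e [W'W hW']]] := @OP_nbhd_mx W eta _ _ (mvec v) We (fun i j => generic_OP _).
have ea (j : 'I_r) : exists a : 'O W', fval a = mvec v 0 j.
  by apply: fval_sur => [P WP|]; [apply: hW' | case].
have [a ha] := choice ea.
have W'V : W' `<=` V := subset_trans W'W WV.
have ev : om_res W'V v = \sum_j a j *: om_res W'W (vs j).
  apply: mvec_inj; rewrite mvec_res //.
  have -> : mvec (\sum_j a j *: om_res W'W (vs j)) = \sum_j mvec v 0 j *: delta_mx 0 j.
    rewrite (big_morph (@mvec _ _ W') (@mvecD _ _ W') (@mvec0 _ _ W')).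
    by apply: eq_bigr => j _; rewrite mvecZ ha mvec_res // hvs.
  exact: row_sum_delta.
rewrite -(mvec_res W'V (f V VU v)) // (hom_res f VU (subset_trans W'V VU)) ev.
have -> : f W' (subset_trans W'V VU) (\sum_j a j *: om_res W'W (vs j)) =
    \sum_j a j *: f W' (subset_trans W'V VU) (om_res W'W (vs j)).
  rewrite (big_morph (f W' (subset_trans W'V VU)) (homD f _) (hom0 f _)).
  by apply: eq_bigr => j _; rewrite homZ.
rewrite (big_morph (@mvec _ _ W') (@mvecD _ _ W') (@mvec0 _ _ W')).
rewrite [RHS]mulmx_sum_row; apply: eq_bigr => j _.
rewrite mvecZ ha rowK -(hom_res f (subset_trans WV VU)) mvec_res // es //.
Qed.

End Models.

(** * Comparison of a sheafification with a given sheaf *)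

Section SheafifyIso.
Variables (k : fieldType) (X : ringed_space k).
Implicit Types (U V W : opens X).

Lemma iso_bijective (F G : omod X) (f : Defs.hom F G) :
  (forall U, bijective (hom_at f (U := U))) -> iso F G.
Proof.
by move=> h; exists f => V VU; rewrite (Prop_irrelevance VU (@sub_full _ V)); apply: h.
Qed.

Variables (F G : omod X) (phi : Defs.hom F G).
Hypothesis hG : is_sheaf G.
Hypothesis phi_inj : forall U (s : F U), hom_at phi s = 0 -> forall x, U x ->
  exists V : opens X, exists (_ : V x) (VU : V `<=` U), om_res VU s = 0.
Hypothesis phi_sur : forall U (t : G U) x, U x ->
  exists V : opens X, exists (_ : V x) (VU : V `<=` U) (s : F V), hom_at phi s = om_res VU t.

Let phiR V W (WV : W `<=` V) (s : F V) : om_res WV (hom_at phi s) = hom_at phi (om_res WV s).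
Proof. exact: hom_res. Qed.

Let germ_eq x V V' (Vx : V x) (Vx' : V' x) (s : F V) (s' : F V') : germ Vx s = germ Vx' s' ->
  exists W : opens X, exists (_ : W x) (WV : W `<=` V) (WV' : W `<=` V'), om_res WV s = om_res WV' s'.
Proof. by move/clP => [W [Wx [h [h' e]]]]; exists W, Wx, h, h'. Qed.

(** The graph of the induced map on the sheafification: near every point the germ of s comes from a
    section that [phi] sends to t. Uniqueness of t is [relU]; existence, by gluing in G, is
    [relE]. *)
Let rel U (s : sheafify F U) (t : G U) := forall x (Ux : U x),
  exists V : opens X, exists (Vx : V x) (VU : V `<=` U) (s' : F V),
    germ Vx s' = shf_val s Ux /\ hom_at phi s' = om_res VU t.

Let relU U s (t t' : G U) : rel s t -> rel s t' -> t = t'.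
Proof.
move=> h h'; apply: (sheaf_eq hG) => x Ux.
have [V [Vx [VU [u [e1 e2]]]]] := h x Ux; have [V' [Vx' [VU' [u' [e1' e2']]]]] := h' x Ux.
have [|W [Wx [WV [WV' e]]]] := @germ_eq x V V' Vx Vx' u u'; first by rewrite e1 e1'.
exists W, Wx, (subset_trans WV VU).
rewrite -(om_res_comp VU WV) -e2 phiR e -phiR e2' (om_res_comp _ _ (subset_trans WV' VU')).
by rewrite (Prop_irrelevance (subset_trans WV VU) (subset_trans WV' VU')).
Qed.

Let relD U s s' (t t' : G U) : rel s t -> rel s' t' -> rel (s + s') (t + t').
Proof.
move=> h h' x Ux.
have [V [Vx [VU [u [e1 e2]]]]] := h x Ux; have [V' [Vx' [VU' [u' [e1' e2']]]]] := h' x Ux.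
exists (interU V V'), (conj Vx Vx'), (subset_trans (@interUl _ V V') VU).
exists (om_res (@interUl _ _ _) u + om_res (@interUr _ _ _) u'); split.
  by rewrite germD !germ_res ?e1 ?e1' // => *; rewrite e1 e1'.
rewrite /hom_at homD -!/(hom_at _ _) -!phiR e2 e2' om_resD.
by rewrite !(om_res_comp _ _ (subset_trans (@interUl _ V V') VU)).
Qed.

Let relZ U s (t : G U) (a : 'O U) : rel s t -> rel (a *: s) (a *: t).
Proof.
move=> h x Ux; have [V [Vx [VU [u [e1 e2]]]]] := h x Ux.
exists V, Vx, VU, (rs_res VU a *: u); split; last by rewrite /hom_at homZ -/(hom_at _ _) e2 om_resZ.
by rewrite -(germ_scaleE Ux Vx VU) e1.
Qed.

Let relR U W (WU : W `<=` U) s (t : G U) : rel s t -> rel (om_res WU s) (om_res WU t).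
Proof.
move=> h x Wx; have [V [Vx [VU [u [e1 e2]]]]] := h x (WU x Wx).
exists (interU W V), (conj Wx Vx), (@interUl _ W V), (om_res (@interUr _ _ _) u); split.
  by rewrite (germ_res Vx) e1.
rewrite -phiR e2 (om_res_comp _ _ (subset_trans (@interUr _ W V) VU)).
by rewrite (om_res_comp _ _ (subset_trans (@interUr _ W V) VU)).
Qed.

Let relE U (s : sheafify F U) : exists t, rel s t.
Proof.
pose T V (g : G V) := exists (s' : F V) (VU : V `<=` U),
  (forall y (Vy : V y), shf_val s (VU y Vy) = germ Vy s') /\ g = hom_at phi s'.
have [||t ht] := @sheaf_glue _ _ G U T hG.
- move=> x Ux; have [V [Vx [VU [s' e]]]] := shf_loc s Ux.
  by exists V, Vx, VU, (hom_at phi s'), s', VU.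
- move=> V V' _ _ VU VU' [s' [h [e ->]]] [s'' [h' [e' ->]]].
  apply: (sheaf_eq hG) => x [Vx Vx'].
  have [|W [Wx [WV [WV' e'']]]] := @germ_eq x V V' Vx Vx' s' s''.
    by rewrite -e -e' (Prop_irrelevance (h x Vx) (h' x Vx')).
  have WI : W `<=` interU V V' by move=> y Wy; split; [exact: WV y Wy | exact: WV' y Wy].
  exists W, Wx, WI; rewrite (om_res_comp _ _ WV) (om_res_comp _ _ WV').
  by rewrite !phiR e''.
exists t => x Ux; have [V [Vx [VU [g [[s' [VU' [e ->]]] e']]]]] := ht x Ux.
by exists V, Vx, VU, s'; rewrite e' -(e _ Vx) (Prop_irrelevance (VU' x Vx) Ux).
Qed.

Let fn U (s : sheafify F U) : G U := sval (cid (relE s)).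
Let fnP U (s : sheafify F U) : rel s (fn s). Proof. exact: svalP (cid (relE s)). Qed.

Theorem sheafify_iso : iso (sheafify F) G.
Proof.
have fD V (VU : V `<=` full_open X) (s t : sheafify F V) : fn (s + t) = fn s + fn t.
  by apply: (@relU _ (s + t)); [apply: fnP | apply: relD; apply: fnP].
have fZ V (VU : V `<=` full_open X) (a : 'O V) (s : sheafify F V) : fn (a *: s) = a *: fn s.
  by apply: (@relU _ (a *: s)); [apply: fnP | apply: relZ; apply: fnP].
have fR V W (VU : V `<=` full_open X) (WU : W `<=` full_open X) (WV : W `<=` V) s :
    om_res WV (fn s) = fn (om_res WV s).
  by apply: (@relU _ (om_res WV s)); [apply: relR; apply: fnP | apply: fnP].
apply: (@iso_bijective _ _ (HomOver fD fZ fR)); apply: locally_bijective => //.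
- exact: sheafify_sheaf.
- rewrite /hom_at /= => U s fs x Ux; have [V [Vx [VU [s' [e e']]]]] := fnP s Ux.
  have [V1 [V1x [V1V e1]]] : exists V1 : opens X, exists (_ : V1 x) (V1V : V1 `<=` V), om_res V1V s' = 0.
    by apply: phi_inj => //; rewrite e' fs om_res0.
  have [V2 [V2x [V2U [s2 h2]]]] := shf_loc s Ux.
  have [|W [Wx [WV [WV2 e3]]]] := @germ_eq x V1 V2 V1x V2x (om_res V1V s') s2.
    by rewrite (germ_res Vx) e -h2 (Prop_irrelevance (V2U x V2x) Ux).
  exists W, Wx, (subset_trans WV2 V2U); apply: shfP => y Wy /=.
  have h2' z (Uz : U z) (V2z : V2 z) : shf_val s Uz = germ V2z s2.
    by rewrite -h2 (Prop_irrelevance Uz (V2U z V2z)).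
  rewrite (h2' _ _ (WV2 y Wy)).
  by rewrite -(germ_res (WV2 y Wy) Wy) -e3 e1 om_res0 germ0E.
move=> U t x Ux; have [V [Vx [VU [s' e]]]] := phi_sur t Ux.
have loc y : V y -> exists W : opens X, exists (_ : W y) (WV : W `<=` V) (u : F W),
    forall z (Wz : W z), germ (WV z Wz) s' = germ Wz u.
  move=> Vy; exists V, Vy, (@subset_refl _ _), s' => z Wz.
  by congr germ; apply: Prop_irrelevance.
exists V, Vx, VU, (Shf (shf_val := fun z (Vz : V z) => germ Vz s') loc); rewrite /hom_at /=.
apply: relU (fnP _) _ => y Vy; exists V, Vy, (@subset_refl _ _), s'.
by rewrite om_res_id.
Qed.

End SheafifyIso.

(** * Bundles given by a matrix at infinity *)

Section Lattices.
Variables (k : fieldType) (q : {mpoly k[3]}) (D : func_field q).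
Local Notation A := {mpoly k[3]}.
Local Notation F := (aF D).
Local Notation B := (aB D).
Local Notation O := (aO D).
Local Notation t := (at_ D).
Local Notation ev := (@ev k q D).
Local Notation pt := (conic_point q).
Local Notation C := (conic q).
Local Notation OP := (OP D).
Local Notation eta := (generic_point D).
Local Notation fval := (fval D).
Local Notation lattice := (lattice D).
Local Notation x0 := ('X_i0 : A).
Implicit Types (P : pt) (U V W : opens C).
Let t0 : t != 0 := at0 D.

Lemma fval0 U : fval (0 : 'O U) = 0.
Proof. by apply: (addrI (fval (0 : 'O U))); rewrite -fvalD !addr0. Qed.

Section Model.
Variables (G : omod C) (r : nat) (L : lattice r) (m : forall U, G U -> 'rV[F]_r).
Hypothesis mD : forall U (s s' : G U), m (s + s') = m s + m s'.
Hypothesis mZ : forall U (a : 'O U) (s : G U), m (a *: s) = fval a *: m s.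
Hypothesis mR : forall U V (VU : V `<=` U) (s : G U), V eta -> m (om_res VU s) = m s.
Hypothesis m_empty : forall U (s : G U), ~ U eta -> m s = 0.
Hypothesis mL : forall U (s : G U) P, U P -> L P (m s).

Definition hom_model : Defs.hom G (Mod L).
Proof.
refine (@HomOver _ _ (full_open C) G (Mod L) (fun V _ s => MSec (@mL V s) (@m_empty V s)) _ _ _).
- by move=> V VU s s'; apply: mvec_inj; rewrite mvecD /mvec /= mD.
- by move=> V VU a s; apply: mvec_inj; rewrite mvecZ /mvec /= mZ.
move=> V W VU WU WV s; apply: mvec_inj; have [h|h] := pselect (W eta); last by rewrite !mvec_empty.
by rewrite mvec_res // /mvec /= mR.
Defined.

Lemma hom_modelE U (s : G U) : mvec (hom_at hom_model s) = m s.
Proof. by []. Qed.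

Lemma iso_model : (forall U (s : G U), m s = 0 -> s = 0) ->
  (forall U v, U eta -> (forall P, U P -> L P v) -> exists s : G U, m s = v) -> iso G (Mod L).
Proof.
move=> inj sur; apply: (@iso_bijective _ _ _ _ hom_model) => U.
have sur' (v : Mod L U) : exists s : G U, hom_at hom_model s = v.
  have [h|h] := pselect (U eta); last by exists 0; rewrite /hom_at hom0; apply: mvec_inj; rewrite !mvec_empty.
  have [s hs] := sur U (mvec v) h (@mvecP _ _ _ _ _ _ v).
  by exists s; apply: mvec_inj; rewrite hom_modelE.
have inj' : injective (@hom_at _ _ _ _ hom_model U).
  move=> s s' e; apply/eqP; rewrite -subr_eq0; apply/eqP; apply: inj.
  by rewrite -hom_modelE /hom_at homB -!/(hom_at _ _) e subrr.
by have [g hg] := choice sur'; exists g => // s; apply: inj'; rewrite hg.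
Qed.

End Model.

Lemma iso_mx1 r (L L' : lattice r) U : (forall P, U P -> forall v, L P v <-> L' P v) ->
  iso_over U (Mod L) (Mod L').
Proof.
move=> h; apply: (@iso_mx _ _ _ _ _ _ _ _ 1%:M 1%:M); rewrite ?mulmx1 // => P UP v.
by rewrite mulmx1; apply: h.
Qed.

Section Sum.
Variables (r s : nat) (L : lattice r) (L' : lattice s).

Program Definition lat_sum : lattice (r + s) :=
  {| lt_mem := fun P v => L P (lsubmx v) /\ L' P (rsubmx v) |}.
Next Obligation. by move=> P /=; rewrite !linear0; split; apply: lt0. Qed.
Next Obligation. by move=> P v w [h1 h2] [h3 h4] /=; rewrite !linearD; split; apply: ltD. Qed.
Next Obligation. by move=> P a v ha [h1 h2] /=; rewrite !linearZ; split; apply: ltZ. Qed.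

Lemma lat_sum_iso : iso (dsum (Mod L) (Mod L')) (Mod lat_sum).
Proof.
apply: (@iso_model _ _ _ (fun U (w : dsum (Mod L) (Mod L') U) => row_mx (mvec w.1) (mvec w.2))).
- by move=> U w w'; rewrite !mvecD add_row_mx.
- by move=> U a w; rewrite !mvecZ scale_row_mx.
- by move=> U V VU w Ve; rewrite !mvec_res.
- by move=> U w h; rewrite !mvec_empty // row_mx0.
- by move=> U w P UP /=; rewrite row_mxKl row_mxKr; split; apply: mvecP.
- move=> U [w w'] /= e; rewrite -(row_mx0 _ 1 r s) in e; have [e1 e2] := eq_row_mx e.
  by congr pair; apply: mvec_inj.
move=> U v Ue h.
have [||w hw] := @mvec_sur _ _ _ _ L U (lsubmx v); [by move=> P /h[] | by [] |].
have [||w' hw'] := @mvec_sur _ _ _ _ L' U (rsubmx v); [by move=> P /h[] | by [] |].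
by exists (w, w'); rewrite /= hw hw' hsubmxK.
Qed.

End Sum.

Program Definition lat_triv r : lattice r := {| lt_mem := fun P v => mxin (OP P) v |}.
Next Obligation. by move=> r P; apply: mxin0. Qed.
Next Obligation. by move=> r P v w; apply: mxinD. Qed.
Next Obligation. by move=> r P a v ha hv; apply: mxinZ. Qed.

Lemma zero_mod_iso (L : lattice 0) : iso (zero_mod C) (Mod L).
Proof.
apply: (@iso_model _ _ _ (fun U w => 0)).
- by move=> *; rewrite addr0.
- by move=> *; rewrite scaler0.
- by [].
- by [].
- by move=> *; apply: lt0.
- by move=> U w _; apply/rowP => -[].
by move=> U v _ _; exists 0; apply/rowP => -[].
Qed.

Lemma O_mod_iso : iso (O_mod C) (Mod (lat_triv 1)).
Proof.
apply: (@iso_model _ _ _ (fun U (w : O_mod C U) => (fval (w : 'O U))%:M)).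
- by move=> U w w'; rewrite fvalD raddfD.
- by move=> U a w; rewrite scale_scalar_mx -fvalM.
- by move=> U V VU w Ve; rewrite /= fval_res.
- by move=> U w h; rewrite fval_empty // raddf0.
- by move=> U w P UP; apply/mxin_scalar; apply: fval_OP.
- move=> U w e; apply: (@fval_inj _ _ D).
  by have := congr1 (fun a : 'M_1 => a 0 0) e; rewrite !mxE eqxx mulr1n => ->; rewrite fval0.
move=> U v Ue h.
have [||w hw] := @fval_sur _ _ D U (v 0 0); [by move=> P /h; apply | by [] |].
by exists w; rewrite hw [RHS]mx11_scalar.
Qed.

Lemma free_mod_iso r : iso (free_mod C r) (Mod (lat_triv r)).
Proof.
elim: r => [|r IH]; first exact: zero_mod_iso.
apply: iso_trans (iso_dsum O_mod_iso IH) _.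
apply: iso_trans (lat_sum_iso _ _) _; apply: iso_mx1 => P _ v.
have := mxin_row (OP P) (lsubmx (v : 'rV_(1 + r))) (rsubmx (v : 'rV_(1 + r))).
rewrite hsubmxK => h; exact: iff_sym h.
Qed.

(* The conditions at [inf] are written with [x0 \in P], which characterises it. *)
Section Latg.
Variables (r : nat) (g : 'M[F]_r).

Program Definition latg : lattice r := {| lt_mem := fun P v =>
  (x0 \notin cp_pred P -> mxin (OP P) v) /\ (x0 \in cp_pred P -> mxin O (v *m g)) |}.
Next Obligation. by move=> P; split=> _; rewrite ?mul0mx; apply: mxin0. Qed.
Next Obligation.
move=> P v w [h1 h2] [h3 h4]; split=> h; rewrite ?mulmxDl; apply: mxinD; auto.
Qed.
Next Obligation.
move=> P a v ha [h1 h2]; split=> h; rewrite -?scalemxAl; apply: mxinZ; auto.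
by have := ha; rewrite (x0_in_inf D h) => /OP_inf.
Qed.

Lemma latg_affine P v : x0 \notin cp_pred P -> latg P v <-> mxin (OP P) v.
Proof. by move=> h /=; split=> [[h1 _]|h1]; [apply: h1 | split=> //; rewrite (negPf h)]. Qed.

Lemma latg_inf P v : x0 \in cp_pred P -> latg P v <-> mxin O (v *m g).
Proof. by move=> h /=; split=> [[_ h1]|h1]; [apply: h1 | split=> //; rewrite h]. Qed.

End Latg.

Definition bun r (g : 'M[F]_r) : omod C := Mod (latg g).

Definition open_lattice r (L : lattice r) := forall U P v, U P -> L P v ->
  exists W : opens C, exists (_ : W P) (WU : W `<=` U), forall P', W P' -> L P' v.

Lemma lat_triv_open r : open_lattice (lat_triv r).
Proof. by move=> U P v; apply: OP_nbhd_mx. Qed.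

Lemma latg_open r (g : 'M[F]_r) : open_lattice (latg g).
Proof.
move=> U P v UP; have [h /(latg_inf _ _ h) hv|h /(latg_affine _ _ h) hv] := boolP (x0 \in cp_pred P).
  have [N hN] := pole_bound v.
  have [|W [WP [WU hW]]] := @OP_nbhd_mx _ _ D U P _ _ (t ^+ N *: v) UP.
    by move=> i j; rewrite (x0_in_inf D h); apply/OP_inf.
  exists W, WP, WU => P' WP'.
  have [h'|h'] := boolP (x0 \in cp_pred P'); first exact/latg_inf.
  apply/latg_affine => //; rewrite -[v](scalerK (expf_neq0 N t0)); apply: mxinZ; last exact: hW.
  by apply: (OP_B h'); rewrite -exprVn; apply: srX; apply: aBt.
have [W [WP [WU hW]]] := @OP_nbhd_mx _ _ D U P _ _ v UP hv.
exists (interU W (nonvanishing q (X_homog k i0))), (conj WP h), (subset_trans (@interUl _ W _) WU).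
by move=> P' [/hW h1 h2]; apply/latg_affine.
Qed.

Lemma open_generically_full r (L : lattice r) : open_lattice L -> (forall v, L eta v) ->
  generically_full L.
Proof. by move=> oL fL v; have [W [We [_ h]]] := @oL (full_open C) eta v I (fL v); exists W. Qed.

Lemma x0_eta : x0 \notin cp_pred eta.
Proof. by apply/negP => /(generic_point_mem D (X_homog k i0)); rewrite ev_X0; apply/eqP/oner_neq0. Qed.

Lemma latg_eta r (g : 'M[F]_r) v : latg g eta v.
Proof. by apply/latg_affine; [exact: x0_eta | move=> i j; apply: generic_OP]. Qed.

Lemma section_at r (L : lattice r) U P v : open_lattice L -> U P -> L P v ->
  exists W : opens C, exists (_ : W P) (WU : W `<=` U) (s : Mod L W), mvec s = v.
Proof.
move=> oL UP hv; have [W [WP [WU h]]] := oL U P v UP hv.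
have [s hs] := mvec_sur h (fun n => False_ind _ (n (eta_open D WP))).
by exists W, WP, WU, s.
Qed.

Lemma hom_matrix r s (L : lattice r) (L' : lattice s) U (f : hom_over U (Mod L) (Mod L')) :
  U eta -> open_lattice L -> (forall v, L eta v) ->
  exists a : 'M[F]_(r, s), (forall V (VU : V `<=` U) (v : Mod L V), mvec (f V VU v) = mvec v *m a) /\
    forall P, U P -> forall v, L P v -> L' P (v *m a).
Proof.
move=> Ue oL fL; have [a ha] := full_faithful f Ue (open_generically_full oL fL); exists a; split=> //.
move=> P UP v hv; have [W [WP [WU [w ew]]]] := section_at oL UP hv.
by rewrite -ew -(ha W WU); apply: mvecP.
Qed.

Lemma iso_matrix r s (L : lattice r) (L' : lattice s) U :
  U eta -> open_lattice L -> (forall v, L eta v) -> open_lattice L' -> (forall v, L' eta v) ->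
  forall f : hom_over U (Mod L) (Mod L'), (forall V (VU : V `<=` U), bijective (f V VU)) ->
  exists (a : 'M[F]_(r, s)) (a' : 'M[F]_(s, r)), [/\ a *m a' = 1%:M, a' *m a = 1%:M,
    forall V (VU : V `<=` U) (v : Mod L V), mvec (f V VU v) = mvec v *m a &
    forall P, U P -> forall v, L P v <-> L' P (v *m a)].
Proof.
move=> Ue oL fL oL' fL' f bf.
have [a [ha La]] := hom_matrix f Ue oL fL.
have [f' ff'] : exists f' : hom_over U (Mod L') (Mod L), forall V (VU : V `<=` U),
    cancel (f V VU) (f' V VU) /\ cancel (f' V VU) (f V VU).
  exact: hom_over_inv.
have [a' [ha' La']] := hom_matrix f' Ue oL' fL'.
have aa' : a *m a' = 1%:M.
  apply/row_matrixP => j; have [W [We [WU [w ew]]]] := section_at oL Ue (fL (delta_mx 0 j)).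
  by rewrite row_mul !rowE -ew -(ha W WU) -(ha' W WU) (ff' W WU).1 mulmx1.
have a'a : a' *m a = 1%:M.
  apply/row_matrixP => j; have [W [We [WU [w ew]]]] := section_at oL' Ue (fL' (delta_mx 0 j)).
  by rewrite row_mul !rowE -ew -(ha' W WU) -(ha W WU) (ff' W WU).2 mulmx1.
exists a, a'; split=> // P UP v; split=> [|h]; first exact: La.
by rewrite -[v]mulmx1 -aa' mulmxA; apply: La'.
Qed.

Lemma bun_iso r s (g : 'M[F]_r) (h : 'M[F]_s) : lattice_iso g h -> iso (bun g) (bun h).
Proof.
move=> [a [a' [u [u' [[e e' Ba Ba'] Ou Ou' eg eh]]]]].
apply: (@iso_mx _ _ _ _ _ _ _ _ a a') => // P _ v.
have [hP|hP] := boolP (x0 \in cp_pred P).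
  rewrite !latg_inf //; split=> [hv|hv]; first by rewrite -mulmxA eg mulmxA; apply: mxinM.
  have -> : v *m g = v *m a *m h *m u' by rewrite -(mulmxA (v *m a)) -eh !mulmxA -(mulmxA v) e mulmx1.
  exact: mxinM.
rewrite !latg_affine //; have hB m n (b : 'M[F]_(m, n)) : mxin B b -> mxin (OP P) b.
  by move=> hb i j; apply: (OP_B hP).
split=> [hv|hv]; first by apply: mxinM => //; apply: hB.
by rewrite -[v]mulmx1 -e mulmxA; apply: mxinM => //; apply: hB.
Qed.

(** The matrix a of the isomorphism preserves integral vectors at every affine point, so its entries
    lie in B by [affine_functions]. At infinity the integral vectors are spanned by the rows of
    g^-1, so that g^-1 a h is integral. *)
Lemma bun_iso_inv r s (g : 'M[F]_r) (h : 'M[F]_s) : g \in unitmx -> h \in unitmx ->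
  iso (bun g) (bun h) -> lattice_iso g h.
Proof.
move=> gu hu [f bf].
have [a [a' [aa' a'a _ La]]] := @iso_matrix _ _ (latg g) (latg h) (full_open C) I (@latg_open _ g) (@latg_eta _ g)
  (@latg_open _ h) (@latg_eta _ h) f bf.
have La' P v : latg h P v <-> latg g P (v *m a') by rewrite La // -mulmxA a'a mulmx1.
have hB m n (b : 'M[F]_(m, n)) (l : 'M_m) (l' : 'M_n) :
    (forall P v, latg l P v -> latg l' P (v *m b)) -> mxin B b.
  move=> hb i j; apply: affine_functions => P hP.
  have : mxin (OP P) ((delta_mx 0 i : 'rV_m) *m b).
    apply/(latg_affine l' _ hP); apply: hb; apply/(latg_affine _ _ hP) => i' j'.
    by rewrite mxE; case: andP => _; [apply: sr1 | apply: sr0].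
  by rewrite -rowE => /(_ 0 j); rewrite mxE.
have hO m n (b : 'M[F]_(m, n)) (l : 'M_m) (l' : 'M_n) : l \in unitmx ->
    (forall P v, latg l P v -> latg l' P (v *m b)) -> mxin O (invmx l *m b *m l').
  move=> lu hb i j.
  have : mxin O ((delta_mx 0 i : 'rV_m) *m invmx l *m b *m l').
    apply/(latg_inf l' _ (x0_inf D)); apply: hb; apply/(latg_inf _ _ (x0_inf D)).
    rewrite mulmxKV // => i' j'.
    by rewrite mxE; case: andP => _; [apply: sr1 | apply: sr0].
  by rewrite -!mulmxA -rowE => /(_ 0 j); rewrite !mulmxA mxE.
exists a, a', (invmx g *m a *m h), (invmx h *m a' *m g); split.
- split=> //; first by apply: (@hB _ _ a g h) => P v /(La P I).
  by apply: (@hB _ _ a' h g) => P v /La'.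
- by apply: (@hO _ _ a g h) => // P v /(La P I).
- by apply: (@hO _ _ a' h g) => // P v /La'.
- by rewrite !mulmxA mulmxV // mul1mx.
- by rewrite !mulmxA mulmxV // mul1mx.
Qed.

Lemma bun_sum r s (g : 'M[F]_r) (h : 'M[F]_s) : iso (dsum (bun g) (bun h)) (bun (block_mx g 0 0 h)).
Proof.
apply: iso_trans (lat_sum_iso _ _) _; apply: iso_mx1 => P _ v.
have [hP|hP] := boolP (x0 \in cp_pred P).
  have -> : latg (block_mx g 0 0 h) P v <-> mxin O (lsubmx v *m g) /\ mxin O (rsubmx v *m h).
    rewrite (latg_inf _ _ hP) -[v in v *m block_mx _ _ _ _](hsubmxK v).
    by rewrite mul_row_block !mulmx0 addr0 add0r mxin_row.
  have e1 := latg_inf g (lsubmx v) hP; have e2 := latg_inf h (rsubmx v) hP.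
by split=> [[/e1 h1 /e2 h2]|[/e1 h1 /e2 h2]]; split.
have -> : latg (block_mx g 0 0 h) P v <-> mxin (OP P) (lsubmx v) /\ mxin (OP P) (rsubmx v).
  by rewrite (latg_affine _ _ hP) -[v in mxin _ v](hsubmxK v) mxin_row.
have e1 := latg_affine g (lsubmx v) hP; have e2 := latg_affine h (rsubmx v) hP.
by split=> [[/e1 h1 /e2 h2]|[/e1 h1 /e2 h2]]; split.
Qed.

Lemma bun_zero (g : 'M[F]_0) : iso (zero_mod C) (bun g).
Proof. exact: zero_mod_iso. Qed.

Lemma bun_one : iso (O_mod C) (bun (1%:M : 'M[F]_1)).
Proof.
apply: iso_trans O_mod_iso _; apply: iso_mx1 => P _ v.
have [hP|hP] := boolP (x0 \in cp_pred P); last by rewrite (latg_affine _ _ hP).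
rewrite (latg_inf _ _ hP) mulmx1; split=> h i j; move: (h i j); rewrite (x0_in_inf D hP).
  by move/OP_inf.
by move=> ?; apply/OP_inf.
Qed.

Lemma Mod_triv_inf r P v : x0 \in cp_pred P -> lat_triv r P v <-> mxin O v.
Proof.
by move=> hP; split=> h i j; move: (h i j); rewrite (x0_in_inf D hP) => ?; apply/OP_inf.
Qed.

End Lattices.

(** * Every vector bundle comes from a matrix *)

Section Bundles.
Variables (k : fieldType) (q : {mpoly k[3]}) (D : func_field q).
Local Notation A := {mpoly k[3]}.
Local Notation F := (aF D).
Local Notation B := (aB D).
Local Notation O := (aO D).
Local Notation t := (at_ D).
Local Notation ev := (@ev k q D).
Local Notation pt := (conic_point q).
Local Notation C := (conic q).
Local Notation OP := (OP D).
Local Notation eta := (generic_point D).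
Local Notation lattice := (lattice D).
Local Notation x0 := ('X_i0 : A).
Implicit Types (P : pt) (U V W : opens C).
Let t0 : t != 0 := at0 D.

Section Localization.
Variables (p : F) (Bp : B p).

Definition in_loc f := exists n : nat, B (f * p ^+ n).

Lemma in_loc_B f : B f -> in_loc f. Proof. by exists 0%N; rewrite mulr1. Qed.
Lemma in_loc0 : in_loc 0. Proof. exact/in_loc_B/sr0. Qed.
Lemma in_loc1 : in_loc 1. Proof. exact/in_loc_B/sr1. Qed.
Lemma in_locD f g : in_loc f -> in_loc g -> in_loc (f + g).
Proof.
move=> [n hn] [m hm]; exists (n + m)%N.
rewrite (_ : _ * _ = f * p ^+ n * p ^+ m + g * p ^+ m * p ^+ n); last by rewrite exprD; ring.
by apply: srD; apply: srM => //; apply: srX.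
Qed.
Lemma in_locN f : in_loc f -> in_loc (- f).
Proof. by move=> [n hn]; exists n; rewrite mulNr; apply: srN. Qed.
Lemma in_locM f g : in_loc f -> in_loc g -> in_loc (f * g).
Proof.
move=> [n hn] [m hm]; exists (n + m)%N.
by rewrite (_ : _ * _ = (f * p ^+ n) * (g * p ^+ m)); [apply: srM | rewrite exprD; ring].
Qed.
Definition loc := Subring in_loc0 in_loc1 in_locD in_locN in_locM.

Lemma loc_OP P f : p != 0 -> x0 \notin cp_pred P -> OP P p^-1 -> loc f -> OP P f.
Proof.
move=> p0 xP hp [n hn]; rewrite -[f](mulfK (expf_neq0 n p0)) -exprVn.
by apply: srM; [apply: (OP_B xP) | apply: srX].
Qed.

Lemma loc_exprz (n : int) : p != 0 -> loc (p ^ n).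
Proof.
move=> p0; case: n => n; first by apply: in_loc_B; apply: srX.
by exists n.+1; rewrite NegzE -exprnN mulVf ?expf_neq0 //; apply: sr1.
Qed.

End Localization.

Section ClosedPoint.
Variables (P : pt) (p : F).
Hypotheses (xP : x0 \notin cp_pred P) (pP : closed_at P p).
Let Bp : B p. Proof. by case: pP. Qed.
Let p0 : p != 0. Proof. by case: pP. Qed.
Local Notation loc := (loc Bp).

Lemma OP_valuation f : OP P f \/ OP P f^-1.
Proof.
have [->|f0] := eqVneq f 0; first by left; apply: sr0.
have [[n|n] [u [hu hu' ->]]] := closed_valuation xP pP f0; [left|right].
  by apply: srM => //; apply: srX; apply: (OP_B xP).
by rewrite invfM NegzE -exprnN invrK; apply: srM => //; apply: srX; apply: (OP_B xP).
Qed.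

Lemma closed_approx m n (a : 'M[F]_(m, n)) : exists b, mxin loc b /\ mxin (OP P) (a - b).
Proof.
have h (ij : 'I_m * 'I_n) : exists b, loc b /\ OP P (a ij.1 ij.2 - b).
  have [g [e [h [hg hh ->]]]] := closed_decompose xP pP (a ij.1 ij.2).
  exists (h / p ^+ e); split; first by exists e; rewrite mulfVK ?expf_neq0.
  by rewrite addrK.
have [b hb] := choice h; exists (\matrix_(i, j) b (i, j)).
by split=> i j; rewrite !mxE; have [] := hb (i, j).
Qed.

(* Column operations over the valuation ring [OP P] bring the first row to [(d, 0)]; the
   rest is cleared by row operations, since every element of [F] is the sum of one of
   [OP P] and one with a power of [p] as denominator. *)
Lemma closed_split r (T : 'M[F]_r) : T \in unitmx -> exists a, gl loc a /\ gl (OP P) (a *m T).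
Proof.
elim: r T => [|r IH] T uT.
  by exists 1%:M; split; [apply: gl1 | rewrite (flatmx0 (_ *m _)) -(flatmx0 1%:M); apply: gl1].
have [c [d [hc _ e]]] := row_reduction (R := OP P) (X := fun=> True) (fun a b p u _ _ _ _ => I)
  (fun a b _ _ => valuation_red2 OP_valuation a b)
  (w := usubmx (T : 'M_(1 + r))) (fun _ _ => I).
pose M := (T : 'M_(1 + r)) *m c.
pose e1 := dlsubmx M; pose T' := drsubmx M.
have eM : M = block_mx d%:M 0 e1 T'.
  rewrite -[LHS]submxK; congr (block_mx _ _ _ _).
    by rewrite /ulsubmx -mul_usub_mx e row_mxKl.
  by rewrite /ursubmx -mul_usub_mx e row_mxKr.
have uM : M \in unitmx by rewrite unitmx_mul uT (gl_unitmx hc).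
have [d0 uT'] : d != 0 /\ T' \in unitmx.
  by move: uM; rewrite eM unitmxE det_lblock det_scalar1 unitfE mulf_eq0 negb_or unitmxE unitfE => /andP[].
have [a' [ha' haT']] := IH T' uT'.
have [n [u [hu hu' ed]]] := closed_valuation xP pP d0.
have u0 : u != 0 by apply: contraNneq d0 => u0; rewrite ed u0 mulr0.
have [b [hb hb']] := closed_approx (u^-1 *: (a' *m e1)).
pose a : 'M_(1 + r) := block_mx (p ^ (- n))%:M 0 (- (p ^ (- n) *: b)) a'.
have pn : p ^ (- n) * p ^ n = 1 by rewrite -expfzDr // addNr expr0z.
exists a; split.
  apply: (@gl_lower _ _ 1 r) => //.
    apply: gl_scalar; rewrite ?expfz_neq0 //; first exact: loc_exprz.
    by rewrite invr_expz opprK; apply: loc_exprz.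
  by apply/mxinN/mxinZ => //; apply: loc_exprz.
have -> : a *m T = a *m M *m invmx c by rewrite /M mulmxA mulmxK ?(gl_unitmx hc).
apply: glM; last exact: gl_inv.
rewrite eM mulmx_block !(mulmx0, mul0mx, addr0, add0r) -scalar_mxM ed mulrA pn mul1r.
apply: (@gl_lower _ _ 1 r) => //; first exact: gl_scalar.
rewrite mulNmx -scalemxAl mul_mx_scalar scalerA mulrA pn mul1r addrC.
have -> : a' *m e1 - u *: b = u *: (u^-1 *: (a' *m e1) - b) by rewrite scalerBr scalerA mulfV // scale1r.
exact: mxinZ.
Qed.

End ClosedPoint.

(* Induction on the degree of [b]: the factor [p] of [b] at a bad point [P] is a unit at the
   other points, so that a matrix over [B[1/p]] repairs [P] without spoiling them. *)
Lemma affine_trivialization (n : nat) (b : F) r (T : pt -> 'M[F]_r) : B b -> b != 0 -> O (b * t ^+ n) ->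
  (forall P, T P \in unitmx) -> (forall P, x0 \notin cp_pred P -> OP P b^-1 -> gl (OP P) (T P)) ->
  exists a, a \in unitmx /\ forall P, x0 \notin cp_pred P -> gl (OP P) (a *m T P).
Proof.
elim: n b T => [|n IH] b T Bb b0 Ob uT hT.
  exists 1%:M; split=> [|P xP]; first exact: unitmx1.
  rewrite mul1mx; apply: hT => //; apply: (OP_B xP); apply: aB_unit => //.
  by rewrite mulr1 in Ob.
have [all|] := pselect (forall P, x0 \notin cp_pred P -> OP P b^-1).
  by exists 1%:M; split=> [|P xP]; [apply: unitmx1 | rewrite mul1mx; apply: hT => //; apply: all].
move/existsNP => [P /not_implyP[xP nP]].
have [gen|[p pP]] := generic_or_closed D xP; first by case: nP.
have [Bp p0 pV hp] := pP; have [w Bw ew] := hp b Bb b0 nP.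
have w0 : w != 0 by apply: contraNneq b0 => w0; rewrite ew w0 mul0r.
have [a1 [ha1 ha1T]] := closed_split xP pP (uT P).
have other P' : x0 \notin cp_pred P' -> P' <> P -> OP P' p^-1.
  by move=> xP' ne; have [] := closed_other xP xP' pP.
have [d [Od Od']] := aB_degree Bp p0.
have d0 : (0 < d)%N.
  case: d Od Od' => // Od _; case: pV; apply: (OP_B xP); apply: aB_unit => //.
  by rewrite mulr1 in Od.
have Ow : O (w * t ^+ n).
  have -> : w * t ^+ n = b * t ^+ n.+1 * (t ^+ d.-1 * (p * t ^+ d)^-1).
    by rewrite ew -{2}(prednK d0) !exprS; field; rewrite p0 t0 expf_neq0.
  by apply: srM => //; apply: srM => //; apply: srX; apply: aOt.
have [|P' xP' hw|a2 [ua2 h2]] := IH w (fun P' => a1 *m T P') Bw w0 Ow.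
- by move=> P'; rewrite unitmx_mul uT (gl_unitmx ha1).
- have [->|ne] := pselect (P' = P) => //.
  have hp' := other P' xP' ne; apply: glM; last by apply: hT => //; rewrite ew invfM; apply: srM.
  by apply: gl_map ha1 => f; apply: loc_OP.
exists (a2 *m a1); split; first by rewrite unitmx_mul ua2 (gl_unitmx ha1).
by move=> P' xP'; rewrite -mulmxA; apply: h2.
Qed.

Section Trivialize.
Variables (V : omod C).
Hypothesis vbV : vector_bundle V.

(** f0 is one trivialization around the generic point. Every other one has a domain that meets that
    of f0, and by [iso_matrix] it differs from f0 by a constant matrix over F. *)
Lemma local_matrices : exists (r : nat) (U0 : opens C) (f0 : hom_over U0 V (Mod (lat_triv D r))),
  [/\ U0 eta, forall W (WU : W `<=` U0), bijective (f0 W WU) &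
  forall P, exists T : 'M[F]_r, [/\ T \in unitmx, U0 P -> gl (OP P) T &
    exists U1 : opens C, exists (_ : U1 P) (f : hom_over U1 V (Mod (lat_triv D r))),
      (forall W (WU : W `<=` U1), bijective (f W WU)) /\
      forall W (WU : W `<=` U1) (WU0 : W `<=` U0) s, mvec (f W WU s) = mvec (f0 W WU0 s) *m T]].
Proof.
have loc P : exists U : opens C, U P /\ exists r, iso_over U V (Mod (lat_triv D r)).
  have [U [UP [r h]]] := vbV.2 P; exists U; split=> //; exists r.
  exact: iso_over_trans h (iso_iso_over _ (free_mod_iso D r)).
have [U0 [U0e [r [f0 bf0]]]] := loc eta; exists r, U0, f0; split=> // P.
have [U1 [U1P [r1 [f bf]]]] := loc P.
have [g0 hg0] := hom_over_inv bf0.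
pose W0 := interU U1 U0.
have W01 : W0 `<=` U1 := @interUl _ U1 U0; have W00 : W0 `<=` U0 := @interUr _ U1 U0.
pose h := hom_comp (hom_restrict W01 f) (hom_restrict W00 g0).
have W0e : W0 eta by split=> //; apply: (eta_open D U1P).
have bh W (WU : W `<=` W0) : bijective (h W WU).
  apply: bij_comp; first exact: bf.
  by have [h1 h2] := hg0 W (subset_trans WU W00); exists (f0 W (subset_trans WU W00)).
have fullO s v : lat_triv D s eta v by move=> i j; apply: generic_OP.
have [a [a' [e e' ha hL]]] := iso_matrix W0e (@lat_triv_open _ _ D r) (@fullO r)
  (@lat_triv_open _ _ D r1) (@fullO r1) bh.
(* The local ranks agree, being sizes of mutually inverse matrices over F. *)
have er : r1 = r by apply/eqP; rewrite eqn_leq (mulmx1_min e) (mulmx1_min e').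
subst r1; have [ua _] := mulmx1_unit e.
exists a; split=> //.
  move=> U0P; have W0P : W0 P by split.
  have row_in (b : 'M[F]_r) : (forall v : 'rV_r, mxin (OP P) v -> mxin (OP P) (v *m b)) -> mxin (OP P) b.
    move=> hb i j; have : mxin (OP P) ((delta_mx 0 i : 'rV_r) *m b).
      by apply: hb => i' j'; rewrite mxE; case: andP => _; [apply: sr1 | apply: sr0].
    by rewrite -rowE => /(_ 0 j); rewrite mxE.
  exists a'; split=> //; first by apply: row_in => v /(hL P W0P).
  by apply: row_in => v hv; apply/(hL P W0P); rewrite /= -mulmxA e' mulmx1.
exists U1, U1P, f; split=> // W WU WU0 s.
have WW : W `<=` W0 by move=> x Wx; split; [apply: WU | apply: WU0].
rewrite -(ha W WW) /= (Prop_irrelevance (subset_trans WW W01) WU).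
by rewrite (Prop_irrelevance (subset_trans WW W00) WU0) (hg0 W WU0).1.
Qed.

Section Transition.
Variables (r : nat) (T : pt -> 'M[F]_r).

Program Definition lat_of : lattice r := {| lt_mem := fun P v => mxin (OP P) (v *m T P) |}.
Next Obligation. by move=> P /=; rewrite mul0mx; apply: (mxin0 (OP P)). Qed.
Next Obligation. by move=> P v w h h' /=; rewrite mulmxDl; apply: (@mxinD _ (OP P)). Qed.
Next Obligation. by move=> P a v ha h /=; rewrite -scalemxAl; apply: (@mxinZ _ (OP P)). Qed.

End Transition.

(** A section over U is encoded by its coordinates for f0 on U and U0 together, an open set that is
    nonempty if U is. At P the matrix [T P] passes to coordinates for a trivialization near P, where
    regularity can be tested; conversely, local sections with the prescribed coordinates glue. *)
Lemma bundle_lattice : exists (r : nat) (T : pt -> 'M[F]_r), [/\ forall P, T P \in unitmx,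
  exists U : opens C, U eta /\ forall P, U P -> gl (OP P) (T P) & iso V (Mod (lat_of T))].
Proof.
have [r [U0 [f0 [U0e bf0 loc]]]] := local_matrices.
have [T hT] := choice loc; exists r, T; split; first by move=> P; have [] := hT P.
  by exists U0; split=> // P; have [] := hT P.
pose m U (s : V U) := mvec (f0 (interU U U0) (@interUr _ U U0) (om_res (@interUl _ U U0) s)).
have m_res U W (WU : W `<=` U) (W0 : W `<=` U0) (s : V U) : W eta ->
    mvec (f0 W W0 (om_res WU s)) = m U s.
  move=> We; have WI : W `<=` interU U U0 by move=> x Wx; split; [apply: WU | apply: W0].
  rewrite /m -(mvec_res WI) // (hom_res f0 _ W0) (om_res_comp _ _ WU).
  by [].
have m_loc P U W U1 (WU : W `<=` U) (WU1 : W `<=` U1) (f : hom_over U1 V (Mod (lat_triv D r))) (s : V U) :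
    (forall W (WU : W `<=` U1) (WU0 : W `<=` U0) s, mvec (f W WU s) = mvec (f0 W WU0 s) *m T P) ->
    W eta -> mvec (f W WU1 (om_res WU s)) = m U s *m T P.
  move=> hf We; have I1 := @interUl _ W U0; have I2 := @interUr _ W U0.
  rewrite -(mvec_res I1) // (hom_res f _ (subset_trans I1 WU1)) (hf _ _ I2).
  by rewrite (om_res_comp _ _ (subset_trans I1 WU)) m_res.
have mD U (s s' : V U) : m U (s + s') = m U s + m U s' by rewrite /m om_resD homD mvecD.
have mZ U (a : 'O U) (s : V U) : m U (a *: s) = fval D a *: m U s.
  have [h|h] := pselect (U eta); last by rewrite fval_empty // scale0r /m mvec_empty // => -[].
  by rewrite /m om_resZ homZ mvecZ fval_res.
have mR U W (WU : W `<=` U) (s : V U) : W eta -> m W (om_res WU s) = m U s.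
  move=> We; rewrite /m (om_res_comp _ _ (subset_trans (@interUl _ W U0) WU)) m_res //.
have m_empty U (s : V U) : ~ U eta -> m U s = 0 by move=> h; rewrite /m mvec_empty // => -[].
have mL U (s : V U) P : U P -> lat_of T P (m U s).
  move=> UP; have [_ _ [U1 [U1P [f [_ hf]]]]] := hT P.
  have We : interU U U1 eta by exact: (@eta_open _ _ D (interU U U1) P).
  rewrite /= -(m_loc P U _ U1 (@interUl _ U U1) (@interUr _ U U1) f s hf We).
  by apply: (@mvecP _ _ _ _ (lat_triv D r)).
have inj U (s : V U) : m U s = 0 -> s = 0.
  move=> ms; apply: (sheaf_eq vbV.1) => P UP.
  have [_ _ [U1 [U1P [f [bf hf]]]]] := hT P.
  have We : interU U U1 eta by exact: (@eta_open _ _ D (interU U U1) P).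
  exists (interU U U1), (conj UP U1P), (@interUl _ _ _); rewrite om_res0.
  apply: (bij_inj (bf _ (@interUr _ U U1))); rewrite hom0; apply: mvec_inj.
  by rewrite (m_loc P U _ U1 _ _ f s hf We) ms mul0mx.
apply: (iso_model mD mZ mR m_empty mL inj) => U v Ue hv.
have inj2 U' (s s' : V U') : m U' s = m U' s' -> s = s'.
  move=> e; apply/eqP; rewrite -subr_eq0; apply/eqP; apply: inj.
  by apply: (addIr (m U' s')); rewrite -mD subrK add0r.
have [||s hs] := @sheaf_glue _ _ V U (fun W s => W eta -> m W s = v) vbV.1.
- move=> P UP; have [uT _ [U1 [U1P [f [bf hf]]]]] := hT P.
  have [W [WP [WU [w ew]]]] := section_at (@lat_triv_open _ _ D r) (conj UP U1P : interU U U1 P) (hv P UP).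
  have WU1 : W `<=` U1 := subset_trans WU (@interUr _ _ _).
  have [g _ gK] := bf W WU1.
  exists W, WP, (subset_trans WU (@interUl _ _ _)), (g w) => We.
  have := m_loc P W W U1 (@subset_refl _ _) WU1 f (g w) hf We.
  by rewrite om_res_id gK ew => /(can_inj (mulmxK uT)).
- move=> W W' s s' _ _ h h'; apply: inj2.
  have [We|We] := pselect (interU W W' eta); last by rewrite !m_empty.
  by rewrite !mR // h ?h' //; case: We.
exists s; have [W [We [WU [s' [h e]]]]] := hs eta Ue.
by rewrite -(mR _ _ WU) // e h.
Qed.

(** The transition matrices [T P] are invertible over the local rings outside the zeros of one form
    g, whose value serves as b in [affine_trivialization]. The resulting a trivializes the bundle
    over the affine part, and [a *m T (inf D)] is all that remains at infinity. *)
Theorem bundle_bun : exists r (g : 'M[F]_r), g \in unitmx /\ iso V (bun g).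
Proof.
have [r [T [uT [U [Ue hU]] iV]]] := bundle_lattice.
have [d [g [hg ge gU]]] := open_basis Ue.
have [Bg Og] := homog_ev D hg; have g0 := ev_neq0 D hg ge.
have [|a [ua ha]] := affine_trivialization Bg g0 Og uT.
  move=> P xP hP; apply: hU; apply: gU; apply/negP => gP.
  by move/(OP_inv xP Bg g0): hP; apply; apply/(in_idealP D xP hg).
exists r, (a *m T (inf D)); split; first by rewrite unitmx_mul ua uT.
apply: iso_trans iV _; apply: iso_sym.
apply: (@iso_mx _ _ _ _ _ _ _ _ a (invmx a)); rewrite ?mulmxV ?mulVmx // => P _ v.
have [xP|xP] := boolP (x0 \in cp_pred P).
  rewrite (latg_inf _ _ xP) -(Mod_triv_inf _ xP) /= mulmxA (x0_in_inf D xP).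
  by [].
by rewrite (latg_affine _ _ xP) /= -mulmxA (mxin_gl v (ha P xP)).
Qed.

End Trivialize.

End Bundles.

(** * Tensor products and duals of line bundles *)

Section Presented.
Variables (k : fieldType) (q : {mpoly k[3]}) (D : func_field q).
Local Notation F := (aF D).
Local Notation C := (conic q).
Local Notation eta := (generic_point D).
Local Notation fval := (fval D).
Implicit Types (U V W : opens C).
Variables (S : opens C -> Type) (Sres : forall U V, V `<=` U -> S U -> S V).
Hypothesis Sres_id : forall U (UU : U `<=` U) s, Sres UU s = s.
Hypothesis Sres_comp : forall U V W (VU : V `<=` U) (WV : W `<=` V) (WU : W `<=` U) s,
  Sres WV (Sres VU s) = Sres WU s.
Variable rel : forall U, mterm ('O U) (S U) -> mterm ('O U) (S U) -> Prop.
Hypothesis rel_res : forall U V (VU : V `<=` U) t u,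
  rel t u -> rel (mterm_res Sres VU t) (mterm_res Sres VU u).
Local Notation G := (presented Sres_id Sres_comp rel_res).

Variables (r : nat) (L : lattice D r) (e : forall U, S U -> 'rV[F]_r).
Hypothesis eR : forall U V (VU : V `<=` U) s, V eta -> e (Sres VU s) = e s.
Hypothesis e_empty : forall U (s : S U), ~ U eta -> e s = 0.
Hypothesis eL : forall U (s : S U) P, U P -> L P (e s).

(** The value of a formal term. On the empty open set [fval] sends 1 to 0, and compatibility with
    the module axioms holds there because every value is 0 ([mev_empty]). *)
Fixpoint mev U (t : mterm ('O U) (S U)) : 'rV[F]_r :=
  match t with
  | MGen s => e s
  | MZero => 0
  | MOpp t => - mev t
  | MAdd t u => mev t + mev u
  | MScale a t => fval a *: mev t
  end.

Hypothesis e_rel : forall U (t u : mterm ('O U) (S U)), U eta -> rel t u -> @mev U t = @mev U u.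

Lemma mev_empty U (t : mterm ('O U) (S U)) : ~ U eta -> @mev U t = 0.
Proof.
move=> h; elim: t => //= [s|t ->|t -> u ->|a t ->]; rewrite ?e_empty ?oppr0 ?addr0 ?scaler0 //.
Qed.

Lemma mev_cong U (t u : mterm ('O U) (S U)) : mcong (@rel U) t u -> @mev U t = @mev U u.
Proof.
move=> h; have [Ue|Ue] := pselect (U eta); last by rewrite !mev_empty.
elim: h => /= {t u} //.
- by move=> t u; apply: e_rel.
- by move=> t u v _ -> _ ->.
- by move=> t u _ ->.
- by move=> t t' u u' _ -> _ ->.
- by move=> a t u _ ->.
- by move=> t u v; rewrite addrA.
- by move=> t u; rewrite addrC.
- by move=> t; rewrite add0r.
- by move=> t; rewrite addNr.
- by move=> a b t; rewrite scalerA fvalM.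
- by move=> t; rewrite fval1 // scale1r.
- by move=> a t u; rewrite scalerDr.
- by move=> a b t; rewrite fvalD scalerDl.
Qed.

Definition pval U (x : G U) : 'rV[F]_r := @mev U (rep (x : Quot (mcong_eqv (@rel U)))).

Lemma pval_cl U t : @pval U (pm_cl (@rel U) t : G U) = @mev U t.
Proof. by apply: mev_cong; apply: (rep_cl (mcong_eqv (@rel U))). Qed.

Lemma mev_res U V (VU : V `<=` U) t : V eta -> @mev V (mterm_res Sres VU t) = @mev U t.
Proof.
move=> Ve; elim: t => //= [s|t ->|t -> u ->|a t ->] //; first exact: eR.
by rewrite fval_res.
Qed.

Lemma mevL U (t : mterm ('O U) (S U)) P : U P -> L P (@mev U t).
Proof.
move=> UP; elim: t => /= [s||t h|t h u h'|a t h]; [exact: eL | exact: lt0 | | exact: ltD |].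
  by rewrite -scaleN1r; apply: ltZ => //; apply/srN/sr1.
by apply: ltZ => //; apply: fval_OP.
Qed.

Definition presented_hom : Defs.hom G (Mod L).
Proof.
apply: (@hom_model _ _ _ G r L pval).
- by move=> U; elim/pm_clW=> t; elim/pm_clW=> u; rewrite pm_clD (pval_cl (MAdd t u)) (pval_cl t) (pval_cl u).
- by move=> U a; elim/pm_clW=> t; rewrite pm_clZ (pval_cl (MScale a t)) (pval_cl t).
- move=> U V VU; elim/pm_clW=> t Ve; rewrite (pval_cl t) -(mev_res VU t Ve) -(pval_cl (mterm_res Sres VU t)).
  by congr (@pval V _); apply: pres_resE.
- by move=> U; elim/pm_clW=> t h; rewrite (pval_cl t) mev_empty.
- by move=> U; elim/pm_clW=> t P UP; rewrite (pval_cl t); apply: mevL.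
Defined.

Lemma presented_homE U t : mvec (hom_at presented_hom (pm_cl (@rel U) t : G U)) = @mev U t.
Proof. exact: pval_cl. Qed.

End Presented.

Section LineBundles.
Variables (k : fieldType) (q : {mpoly k[3]}) (D : func_field q).
Local Notation A := {mpoly k[3]}.
Local Notation F := (aF D).
Local Notation O := (aO D).
Local Notation t := (at_ D).
Local Notation ev := (@ev k q D).
Local Notation pt := (conic_point q).
Local Notation C := (conic q).
Local Notation OP := (OP D).
Local Notation eta := (generic_point D).
Local Notation fval := (fval D).
Local Notation x0 := ('X_i0 : A).
Local Notation x1 := ('X_i1 : A).
Implicit Types (P : pt) (U V W : opens C) (c : F).
Let t0 : t != 0 := at0 D.

(** L is free at P on c. [invertible] asks in addition that the same c generate in a
    neighbourhood. *)
Definition generates (L : lattice D 1) P c := c != 0 /\ forall w, L P w <-> OP P (w 0 0 / c).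

Definition invertible (L : lattice D 1) := forall U P, U P ->
  exists W : opens C, exists (_ : W P) (WU : W `<=` U) (c : F), forall P', W P' -> generates L P' c.

Lemma generates_mem L P c : generates L P c -> L P c%:M.
Proof. by move=> [c0 ->]; rewrite mxE eqxx mulr1n divff //; apply: sr1. Qed.

Lemma t_units P : x0 \notin cp_pred P -> x1 \notin cp_pred P -> forall n : int, OP P (t ^ n).
Proof.
move=> h0 h1; have e : ev x0 / ev x1 = t by rewrite ev_X0 ev_X1 invrK mul1r.
have h : OP P t by rewrite -e; apply: OP_homog (X_homog k i0) (X_homog k i1) h1.
have h' : OP P t^-1 by rewrite -e invf_div; apply: OP_homog (X_homog k i1) (X_homog k i0) h0.
by case=> n; [apply: srX | rewrite NegzE -exprnN -exprVn; apply: srX].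
Qed.

Lemma line_invertible (n : int) : invertible (latg (t ^ n)%:M).
Proof.
move=> U P UP; have [h|h] := boolP (x0 \in cp_pred P).
  exists (interU U (nonvanishing q (X_homog k i1))), (conj UP (x1_notin D h)), (@interUl _ U _).
  exists (t ^ (- n)) => P' [_ h1]; split=> [|w]; first exact: expfz_neq0.
  have e f : f / t ^ (- n) = f * t ^ n by rewrite -invr_expz invrK.
  have [h0|h0] := boolP (x0 \in cp_pred P').
    rewrite (latg_inf _ _ h0) e mul_mx_scalar (x0_in_inf D h0) OP_inf; split=> [/(_ 0 0)|ho i j].
      by rewrite mxE mulrC.
    by rewrite mxE !ord1 mulrC.
  have ht := t_units h0 h1.
  rewrite (latg_affine _ _ h0) e; split=> [/(_ 0 0) ?|ho i j]; first exact: srM.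
  by rewrite !ord1 -[w 0 0](mulfK (expfz_neq0 n t0)) invr_expz; apply: srM.
exists (interU U (nonvanishing q (X_homog k i0))), (conj UP h), (@interUl _ U _), 1 => P' [_ h0].
split=> [|w]; first exact: oner_neq0.
by rewrite (latg_affine _ _ h0) divr1; split=> [|ho i j]; [apply | rewrite !ord1].
Qed.

Section Tensor.
Variables (G1 G2 : omod C) (r : nat) (L : lattice D r) (M : lattice D 1) (LM : lattice D r).
Variables (f1 : Defs.hom G1 (Mod L)) (f2 : Defs.hom G2 (Mod M)).
Hypothesis bij1 : forall U, bijective (hom_at f1 (U := U)).
Hypothesis bij2 : forall U, bijective (hom_at f2 (U := U)).
Hypothesis invM : invertible M.
Hypothesis hLM : forall P c, generates M P c -> forall v, LM P (c *: v) <-> L P v.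

Let v1 U (s : G1 U) := mvec (hom_at f1 s).
Let v2 U (s : G2 U) := mvec (hom_at f2 s) 0 0.
Let e U (p : G1 U * G2 U) := v2 p.2 *: v1 p.1.

Let v1D U (s s' : G1 U) : v1 (s + s') = v1 s + v1 s'. Proof. by rewrite /v1 /hom_at homD mvecD. Qed.
Let v1Z U a (s : G1 U) : v1 (a *: s) = fval a *: v1 s. Proof. by rewrite /v1 /hom_at homZ mvecZ. Qed.
Let v2D U (s s' : G2 U) : v2 (s + s') = v2 s + v2 s'.
Proof. by rewrite /v2 /hom_at homD mvecD mxE. Qed.
Let v2Z U a (s : G2 U) : v2 (a *: s) = fval a * v2 s.
Proof. by rewrite /v2 /hom_at homZ mvecZ mxE. Qed.
Let v1R U V (VU : V `<=` U) (s : G1 U) : V eta -> v1 (om_res VU s) = v1 s.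
Proof. by move=> Ve; rewrite /v1 -(mvec_res VU) //; congr mvec; rewrite /hom_at (hom_res f1 _ (@sub_full _ V)). Qed.
Let v2R U V (VU : V `<=` U) (s : G2 U) : V eta -> v2 (om_res VU s) = v2 s.
Proof. by move=> Ve; rewrite /v2 -(mvec_res VU) //; congr (mvec _ 0 0); rewrite /hom_at (hom_res f2 _ (@sub_full _ V)). Qed.
Let v1_sur U v : U eta -> (forall P, U P -> L P v) -> exists s : G1 U, v1 s = v.
Proof.
move=> Ue h; have [w hw] := mvec_sur h (fun n => False_ind _ (n Ue)).
by have [g _ gK] := bij1 U; exists (g w); rewrite /v1 gK.
Qed.
Let v2_sur U c : U eta -> (forall P, U P -> M P c%:M) -> exists s : G2 U, v2 s = c.
Proof.
move=> Ue h; have [w hw] := mvec_sur h (fun n => False_ind _ (n Ue)).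
by have [g _ gK] := bij2 U; exists (g w); rewrite /v2 gK hw mxE eqxx.
Qed.
Let v2_inj U : injective (@v2 U).
Proof.
move=> s s' h; apply: (bij_inj (bij2 U)); apply: mvec_inj.
by rewrite [LHS]mx11_scalar [RHS]mx11_scalar; congr _%:M.
Qed.
Let v1_inj U : injective (@v1 U).
Proof. by move=> s s' h; apply: (bij_inj (bij1 U)); apply: mvec_inj. Qed.

Let eL U (p : G1 U * G2 U) P : U P -> LM P (e p).
Proof.
move=> UP; have [W [WP [WU [c gc]]]] := invM UP; have [c0 hc] := gc P WP.
have -> : e p = (v2 p.2 / c) *: (c *: v1 p.1) by rewrite scalerA divfK.
apply: ltZ; first by apply/hc; apply: mvecP.
by apply/(hLM (gc P WP)); apply: mvecP.
Qed.

Lemma pretensor_hom : exists f : Defs.hom (pretensor G1 G2) (Mod LM), forall U t,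
  mvec (hom_at f (pm_cl (@tensor_rel _ _ G1 G2 U) t : pretensor G1 G2 U)) = mev e t.
Proof.
unshelve eexists (@presented_hom _ _ D _ _ _ _ _ _ r LM e _ _ eL _); last exact: presented_homE.
- by move=> U V VU s Ve; rewrite /e /= v1R ?v2R.
- by move=> U s h; rewrite /e /v1 mvec_empty // scaler0.
move=> U t1 t2 Ue [s s' u|s u u'|a s u|a s u] /=; rewrite /e /=.
- by rewrite v1D scalerDr.
- by rewrite v2D scalerDl.
- by rewrite v1Z !scalerA mulrC.
- by rewrite v2Z scalerA.
Qed.

(** Near each point let u0 be the section of G2 given by a generator c of M. Every element of the
    presheaf tensor product restricts to a single tensor of some s with u0, and its image is c times
    the vector of s. Local injectivity and surjectivity are then clear, and sheafification does the
    rest. *)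
Lemma tensor_line : iso (tensor G1 G2) (Mod LM).
Proof.
have [f hf] := pretensor_hom.
pose tens U (s : G1 U) (u : G2 U) : pretensor G1 G2 U := pm_cl (@tensor_rel _ _ G1 G2 U) (MGen (s, u)).
have tDl U s s' u : @tens U (s + s') u = tens U s u + tens U s' u.
  by rewrite /tens pm_clD; apply/clP; apply: mcong_rel; constructor.
have tZl U a s u : @tens U (a *: s) u = a *: tens U s u.
  by rewrite /tens pm_clZ; apply/clP; apply: mcong_rel; constructor.
have tZr U a s u : @tens U s (a *: u) = a *: tens U s u.
  by rewrite /tens pm_clZ; apply/clP; apply: mcong_rel; constructor.
have t0l U u : @tens U 0 u = 0 by rewrite -(scale0r (0 : G1 U)) tZl scale0r.
have fE U s u : mvec (hom_at f (tens U s u)) = v2 u *: v1 s by rewrite hf.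
have gen U P : U P -> exists W : opens C, exists (_ : W P) (WU : W `<=` U) (c : F) (u0 : G2 W),
    [/\ forall P', W P' -> generates M P' c, c != 0, v2 u0 = c &
        forall x : pretensor G1 G2 U, exists s, om_res WU x = tens W s u0].
  move=> UP; have [W [WP [WU [c gc]]]] := invM UP.
  have We : W eta by apply: (eta_open D WP).
  have [|u0 hu0] := @v2_sur W c We; first by move=> P' /gc; apply: generates_mem.
  exists W, WP, WU, c, u0; split=> //; first by case: (gc P WP).
  elim/pm_clW; elim=> [[s u]||x [s hs]|x [s hs] y [s' hs']|a x [s hs]].
  - have [||a ha] := @fval_sur _ _ D W (v2 u / c); [|by []|].
      move=> P' WP'; have [_ h] := gc P' WP'; apply/h; apply: mvecP; exact: WU.
    exists (a *: om_res WU s); rewrite (tZl W a (om_res WU s) u0) -(tZr W a (om_res WU s) u0).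
    transitivity (tens W (om_res WU s) (om_res WU u)); first exact: (pres_resE (@tensor_rel_res _ _ G1 G2) WU (MGen (s, u))).
    congr (tens W _ _).
    by apply: v2_inj; rewrite v2R // v2Z ha hu0 divfK //; case: (gc P WP).
  - by exists 0; rewrite t0l om_res0.
  - exists (- s); rewrite (esym (pm_oppE _ x) : pm_cl _ (MOpp x) = - pm_cl _ x :> pretensor G1 G2 U).
    by rewrite om_resN hs -scaleN1r -tZl scaleN1r.
  - exists (s + s'); rewrite (esym (pm_addE _ x y) : pm_cl _ (MAdd x y) = pm_cl _ x + pm_cl _ y :> pretensor G1 G2 U).
    by rewrite om_resD hs hs' tDl.
  - exists (rs_res WU a *: s); rewrite (esym (pm_scaleE _ a x) : pm_cl _ (MScale a x) = a *: pm_cl _ x :> pretensor G1 G2 U).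
    by rewrite om_resZ hs tZl.
apply: (@sheafify_iso _ _ _ _ f) => [|U x fx P UP|U v P UP]; first exact: Mod_sheaf.
  have [W [WP [WU [c [u0 [gc c0 hu0 hx]]]]]] := gen U P UP.
  exists W, WP, WU; have [s hs] := hx x; rewrite hs.
  have : mvec (hom_at f (om_res WU x)) = 0.
    by rewrite /hom_at -(hom_res f (@sub_full _ U)) -/(hom_at f x) fx om_res0.
  rewrite hs fE hu0 => /eqP; rewrite scaler_eq0 (negPf c0) /= => /eqP e0.
  have -> : s = 0 by apply: v1_inj; rewrite e0 /v1 /hom_at hom0.
  exact: t0l.
have [W [WP [WU [c [u0 [gc c0 hu0 _]]]]]] := gen U P UP.
have We : W eta by apply: (eta_open D WP).
have [|s hs] := @v1_sur W (c^-1 *: mvec v) We.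
  move=> P' WP'; apply/(hLM (gc P' WP')); rewrite scalerA divff // scale1r.
  by apply: mvecP; apply: WU.
exists W, WP, WU, (tens W s u0); apply: mvec_inj.
by rewrite fE hs hu0 scalerA divff // scale1r mvec_res.
Qed.

End Tensor.

Lemma iso_bij (G G' : omod C) : iso G G' -> exists f : Defs.hom G G', forall U, bijective (hom_at f (U := U)).
Proof. by move=> [f h]; exists f => U; apply: h. Qed.

Lemma tensor_bun (G1 G2 : omod C) r (g : 'M[F]_r) (n : int) :
  iso G1 (bun g) -> iso G2 (bun ((t ^ n)%:M : 'M[F]_1)) -> iso (tensor G1 G2) (bun (t ^ n *: g)).
Proof.
move=> /iso_bij[f1 b1] /iso_bij[f2 b2].
apply: (tensor_line b1 b2 (line_invertible n)) => P c [c0 hc] v.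
have [h|h] := boolP (x0 \in cp_pred P).
  rewrite !(latg_inf _ _ h) -scalemxAl -scalemxAr scalerA.
  have hcO w : O (w * t ^ n) <-> O (w / c).
    have := hc w%:M; rewrite (latg_inf _ _ h) (x0_in_inf D h) OP_inf -scalar_mxM mxE eqxx mulr1n => <-.
    by split=> [?|/(_ 0 0)]; [apply: mxin_scalar | rewrite mxE eqxx mulr1n].
  have h1 : O (c * t ^ n) by apply/hcO; rewrite divff //; apply: sr1.
  have tn0 := expfz_neq0 n t0.
  have h2 : O (c * t ^ n)^-1 by rewrite invfM mulrC; apply: (hcO _).1; rewrite mulVf //; apply: sr1.
  split=> hv; last exact: mxinZ.
  by rewrite -[v *m g](scalerK (mulf_neq0 c0 tn0)); apply: mxinZ.
rewrite !(latg_affine _ _ h).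
have hcP w : OP P w <-> OP P (w / c).
  have := hc w%:M; rewrite (latg_affine _ _ h) mxE eqxx mulr1n => <-.
  by split=> [?|/(_ 0 0)]; [apply: mxin_scalar | rewrite mxE eqxx mulr1n].
have h1 : OP P c by apply/hcP; rewrite divff //; apply: sr1.
have h2 : OP P c^-1 by rewrite -[c^-1]mul1r; apply: (hcP 1).1; apply: sr1.
by split=> hv; [rewrite -[v](scalerK c0); apply: mxinZ | apply: mxinZ].
Qed.

Section Dual.
Variables (G : omod C) (M M' : lattice D 1).
Hypothesis isoG : iso G (Mod M).
Hypotheses (invM : invertible M) (openM : open_lattice M) (fullM : forall v, M eta v).
Hypothesis hM' : forall P c, generates M P c -> forall v, M' P v <-> OP P (c * v 0 0).

(** By [full_faithful] a homomorphism to O over U is multiplication by one element of F, which [m]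
    picks out (0 on the empty set). That element is admissible at P exactly when it sends a local
    generator c of M into [OP P]. *)
Lemma dual_line : iso (dual G) (Mod M').
Proof.
have [o bo] := O_mod_iso D; have [f bf] := isoG.
have [o' ho'] := hom_over_inv bo; have [f' hf'] := hom_over_inv bf.
have fT V : V `<=` full_open C := @sub_full _ V.
pose K U (phi : hom_over U G (O_mod C)) (a : 'M[F]_1) := forall V (VU : V `<=` U) (s : G V),
  mvec (o V (fT V) (phi V VU s)) = mvec (f V (fT V) s) *m a.
have irr (G1 G2 : omod C) (h : Defs.hom G1 G2) V VU s : h V VU s = h V (fT V) s.
  by congr (h V _ s); apply: Prop_irrelevance.
have ex U (phi : hom_over U G (O_mod C)) : U eta -> exists a, K U phi a.
  move=> Ue; pose h := hom_comp (hom_restrict (fT U) o) (hom_comp phi (hom_restrict (fT U) f')).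
  have [a ha] := full_faithful h Ue (open_generically_full openM fullM); exists a => V VU s.
  rewrite -(ha V VU) /h /= !irr; congr (mvec (o V _ (phi V VU _))).
  by rewrite (hf' V (fT V)).1.
have sec U P v : U P -> M P v -> exists W : opens C, exists (_ : W P) (WU : W `<=` U) (s : G W),
    mvec (f W (fT W) s) = v.
  move=> UP /(section_at openM UP)[W [WP [WU [w ew]]]].
  by exists W, WP, WU, (f' W (fT W) w); rewrite (hf' W (fT W)).2.
have uniq U (phi : hom_over U G (O_mod C)) a b : U eta -> K U phi a -> K U phi b -> a = b.
  move=> Ue ha hb; have [W [We [WU [s es]]]] := sec U eta 1%:M Ue (fullM _).
  by have := ha W WU s; rewrite (hb W WU s) es !mul1mx.
pose m U (phi : dual G U) : 'rV[F]_1 := if pselect (U eta) is left h then sval (cid (ex U phi h)) else 0.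
have mK U (phi : dual G U) : K U phi (m U phi).
  rewrite /m; case: pselect => [h|h]; first by case: cid.
  by move=> V VU s; rewrite !mvec_empty ?mul0mx // => /VU.
have mP U (phi : dual G U) a : (~ U eta -> a = 0) -> K U phi a -> m U phi = a.
  move=> a0 ha; have [h|h] := pselect (U eta); first exact: uniq h (mK U phi) ha.
  by rewrite a0 // /m; case: pselect.
have m_empty U (phi : dual G U) : ~ U eta -> m U phi = 0 by rewrite /m; case: pselect.
apply: (@iso_model _ _ D (dual G) 1 M' m).
- move=> U phi psi; apply: mP => [h|V VU s]; first by rewrite !m_empty // addr0.
  by rewrite /= homD mvecD mulmxDr (mK U phi) (mK U psi).
- move=> U a phi; apply: mP => [h|V VU s]; first by rewrite m_empty // scaler0.
  have [h|h] := pselect (V eta); last by rewrite !mvec_empty // mul0mx.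
  by rewrite /= homZ mvecZ fval_res // -scalemxAr (mK U phi).
- move=> U V VU phi Ve; apply: mP => [/(_ Ve) //|W WV s].
  exact: mK U phi W (subset_trans WV VU) s.
- exact: m_empty.
- move=> U phi P UP; have [W [WP [WU [c gc]]]] := invM UP.
  have [W' [WP' [WU' [s es]]]] := sec U P c%:M UP (generates_mem (gc P WP)).
  apply/(hM' (gc P WP)); have := @mvecP _ _ _ _ (lat_triv D 1) _ (o W' (fT W') (phi W' WU' s)) P WP'.
  by rewrite (mK U phi) es mul_scalar_mx => /(_ 0 0); rewrite mxE.
- move=> U phi m0; apply: hom_overP => V VU s; apply: (bij_inj (bo V (fT V))); apply: mvec_inj.
  by rewrite (mK U phi) m0 mulmx0 hom0.
move=> U v Ue hv; have hv' P (UP : U P) w : M P w -> lat_triv D 1 P (w *m (v : 'M_1)).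
  have [W [WP [WU [c gc]]]] := invM UP; have [c0 hc] := gc P WP.
  move=> /hc h1 i j; rewrite !ord1 mxE big_ord1.
  have -> : w 0 0 * v 0 0 = w 0 0 / c * (c * v 0 0) by rewrite mulrA divfK.
  by apply: srM => //; apply/(hM' (gc P WP)); apply: hv.
exists (hom_comp (hom_restrict (fT U) o') (hom_comp (hom_mx hv') (hom_restrict (fT U) f)) : dual G U).
apply: mP => [/(_ Ue) //|V VU s].
by rewrite /= !irr (ho' V (fT V)).2 hom_mxE.
Qed.

End Dual.

Lemma dual_bun (G : omod C) (n : int) :
  iso G (bun ((t ^ n)%:M : 'M[F]_1)) -> iso (dual G) (bun ((t ^ (- n))%:M : 'M[F]_1)).
Proof.
move=> h; apply: (dual_line h (line_invertible n) (@latg_open _ _ _ _ _) (@latg_eta _ _ _ _ _)).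
move=> P c [c0 hc] v; have tn0 := expfz_neq0 n t0.
have [hP|hP] := boolP (x0 \in cp_pred P).
  have hcO w : O (w * t ^ n) <-> O (w / c).
    have := hc w%:M; rewrite (latg_inf _ _ hP) (x0_in_inf D hP) OP_inf -scalar_mxM mxE eqxx mulr1n => <-.
    by split=> [?|/(_ 0 0)]; [apply: mxin_scalar | rewrite mxE eqxx mulr1n].
  rewrite (latg_inf _ _ hP) (x0_in_inf D hP) OP_inf.
  have h1 : O (c * t ^ n) by apply/hcO; rewrite divff //; apply: sr1.
  have h2 : O (c * t ^ n)^-1 by rewrite invfM mulrC; apply: (hcO _).1; rewrite mulVf //; apply: sr1.
  rewrite mul_mx_scalar -invr_expz; split=> [/(_ 0 0)|ho i j].
    rewrite mxE => ho; rewrite (_ : c * v 0 0 = c * t ^ n * ((t ^ n)^-1 * v 0 0)); first exact: srM.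
    by rewrite mulrA mulfK.
  rewrite !ord1 mxE (_ : _ * _ = (c * t ^ n)^-1 * (c * v 0 0)); first exact: srM.
  by rewrite invfM; field; rewrite c0 tn0.
have hcP w : OP P w <-> OP P (w / c).
  have := hc w%:M; rewrite (latg_affine _ _ hP) mxE eqxx mulr1n => <-.
  by split=> [?|/(_ 0 0)]; [apply: mxin_scalar | rewrite mxE eqxx mulr1n].
have h1 : OP P c by apply/hcP; rewrite divff //; apply: sr1.
rewrite (latg_affine _ _ hP); split=> [/(_ 0 0) ?|ho i j]; first exact: srM.
rewrite !ord1 -[v 0 0](mulKf c0) -[c^-1]mul1r; apply: srM => //; apply: (hcP 1).1; apply: sr1.
Qed.

Lemma tensor_pow_bun (G : omod C) (n m : int) : iso G (bun ((t ^ n)%:M : 'M[F]_1)) ->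
  iso (tensor_pow G m) (bun ((t ^ (n * m))%:M : 'M[F]_1)).
Proof.
have pow (G' : omod C) (n' : int) j : iso G' (bun ((t ^ n')%:M : 'M[F]_1)) ->
    iso (iter j (tensor G') (O_mod C)) (bun ((t ^ (n' * j%:Z))%:M : 'M[F]_1)).
  move=> h; elim: j => [|j IH] /=; first by rewrite mulr0 expr0z; apply: bun_one.
  apply: iso_trans (tensor_bun h IH) _.
  by rewrite scale_scalar_mx -expfzDr // -(addn1 j) PoszD mulrDr mulr1; apply: iso_refl.
case: m => m h; first exact: pow.
rewrite NegzE mulrN -mulNr; apply: (pow _ _ m.+1); exact: dual_bun.
Qed.

End LineBundles.

(** * The cotangent bundle *)

Section Cotangent.
Variables (k : fieldType) (q : {mpoly k[3]}) (D : func_field q).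
Hypothesis q_nonsingular : nonsingular_form q.
Local Notation A := {mpoly k[3]}.
Local Notation F := (aF D).
Local Notation O := (aO D).
Local Notation t := (at_ D).
Let t0 : t != 0 := at0 D.
Local Notation ev := (@ev k q D).
Local Notation der := (@der k q D).
Local Notation pt := (conic_point q).
Local Notation C := (conic q).
Local Notation OP := (OP D).
Local Notation fval := (fval D).
Local Notation X i := ('X_i : A).
Local Notation e i := (ev (X i)).
Local Notation qd := (std_form_d (ff_c D) (ff_l0 D) (ff_l1 D) (ff_m0 D) (ff_m1 D) (ff_m2 D)).
Local Notation omega := (latg ((t ^ (-1))%:M : 'M[F]_1)).
Implicit Types (P : pt) (U V W : opens C) (c f g : F).

Lemma qd_homog i : qd i \is 1.-homog.
Proof.
have hX := X_homog k; have hC (l : k) j : (l%:MP * X j) \is 1.-homog by rewrite mul_mpolyC rpredZ.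
elim/I3_ind: i; rewrite /std_form_d /= mul_mpolyC; apply: rpredZ; rewrite ?mulNr;
  repeat first [exact: hC | exact: hX | apply: rpredB | apply: rpredD | apply: rpredMn | rewrite rpredN].
Qed.

Lemma euler : \sum_i X i * qd i = q *+ 2.
Proof. by rewrite sum3 [in RHS](ff_q D) /std_form_d /std_form /=; ring. Qed.

(* By Euler's identity, the partial derivative that does not vanish can be chosen with
   respect to another coordinate than [X j]. *)
Lemma smooth_indices P : exists j b, [/\ j != b, X j \notin cp_pred P & qd b \notin cp_pred P].
Proof.
have [j hj] := cp_relevant P; suff [b [jb hb]] : exists b, j != b /\ qd b \notin cp_pred P by exists j, b.
have [K [th hth]] := ResidueField.residue_field (cp_ideal P) (@cp_prime _ _ P).
apply: contrapT => no; have qdP b : j != b -> qd b \in cp_pred P.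
  by move=> jb; apply/negPn/negP => hb; apply: no; exists b.
have qdj : qd j \in cp_pred P.
  have : X j * qd j \in cp_pred P.
    have -> : X j * qd j = 2%:R * q - \sum_(i | i != j) X i * qd i.
      by rewrite mulr_natl -euler (bigD1 j) //= addrK.
    apply: cpB; first exact/cpMl/cp_q.
    by elim/big_ind: _ => [|x y|i ij]; [apply: cp0 | apply: cpD | apply/cpMl/qdP; rewrite eq_sym].
  by move/cp_prime => /orP[|//]; rewrite (negPf hj).
case/negP: hj; apply/hth; move: q_nonsingular; rewrite {1}(ff_q D) => ns.
apply: (nonsingular_partials (th := th) ns) => [|i]; first by rewrite -(ff_q D); apply/hth/cp_q.
by apply/hth; have [<-|/qdP] := eqVneq j i.
Qed.

Lemma third_index (j b : 'I_3) : j != b -> exists a, [/\ a != j, a != b & forall i, [\/ i = j, i = a | i = b]].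
Proof.
elim/I3_ind: j; elim/I3_ind: b => // _.
all: try by exists i0; split=> //; apply: I3_ind; solve [by constructor 1|by constructor 2|by constructor 3].
all: try by exists i1; split=> //; apply: I3_ind; solve [by constructor 1|by constructor 2|by constructor 3].
all: by exists i2; split=> //; apply: I3_ind; solve [by constructor 1|by constructor 2|by constructor 3].
Qed.

Lemma der0 : der 0 = 0. Proof. by rewrite -{1}(rmorph0 (ai D)) der_cst. Qed.
Lemma der1 : der 1 = 0. Proof. by rewrite -(rmorph1 (ai D)) der_cst. Qed.

Lemma derV f : f != 0 -> der f^-1 = - (der f / f ^+ 2).
Proof.
move=> f0; have : der (f * f^-1) = 0 by rewrite divff // der1.
rewrite derM => /eqP; rewrite addr_eq0 => /eqP h; apply: (mulfI f0).
by rewrite -[LHS]opprK -h; field.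
Qed.

(** The vector product of x and dx is the gradient of q, for the derivation chosen. The entry for b
    = 0 follows from the others by Euler's identity; the sign is the orientation of (j, a, b). *)
Lemma wronskian (a b j : 'I_3) : a != j -> b != j -> a != b ->
  e j * der (e a) - e a * der (e j) = ev (qd b) \/ e j * der (e a) - e a * der (e j) = - ev (qd b).
Proof.
have d0 : der (e i0) = 0 by rewrite ev_X0 der1.
have d1 : der (e i1) = ev (qd i2) by rewrite ev_X1 der_X1.
have d2 : der (e i2) = - ev (qd i1) by rewrite ev_X2 der_X2.
have eu : e i0 * ev (qd i0) + e i1 * ev (qd i1) + e i2 * ev (qd i2) = 0.
  by rewrite -!rmorphM -!rmorphD -(sum3 (fun i => X i * qd i)) euler rmorphMn /= ev_q mul0rn.
have e01 : e i0 = 1 := ev_X0 D; rewrite e01 mul1r in eu.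
have eu0 : ev (qd i0) = - (e i1 * ev (qd i1) + e i2 * ev (qd i2)).
  by apply/eqP; rewrite -addr_eq0 addrA eu.
elim/I3_ind: a; elim/I3_ind: b; elim/I3_ind: j => //= _ _ _; rewrite ?d0 ?d1 ?d2 ?e01.
- by left; ring.
- by right; ring.
- by right; rewrite eu0; ring.
- by left; ring.
- by left; rewrite eu0; ring.
- by right; ring.
Qed.

Lemma der_ratio (a j : 'I_3) : e j != 0 ->
  der (e a / e j) = (e j * der (e a) - e a * der (e j)) / e j ^+ 2.
Proof. by move=> h; rewrite derM derV //; field. Qed.

Lemma omega_generates j P : X j \notin cp_pred P -> generates omega P (e j)^-1.
Proof.
move=> hj; have ej0 := ev_neq0 D (X_homog k j) hj; split=> [|w]; first by rewrite invr_eq0.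
rewrite invrK; have hr i i' : X i' \notin cp_pred P -> OP P (e i / e i').
  by apply: OP_homog; apply: X_homog.
have [h|h] := boolP (X i0 \in cp_pred P).
  rewrite (latg_inf _ _ h) mul_mx_scalar; have h1 := x1_notin D h.
  have -> : mxin O (t ^ (-1) *: w) <-> OP P (w 0 0 * e i1).
    rewrite ev_X1 (x0_in_inf D h) OP_inf; split=> [/(_ 0 0)|ho i i']; first by rewrite mxE mulrC.
    by rewrite !ord1 mxE mulrC.
  have e10 := ev_neq0 D (X_homog k i1) h1; split=> ho.
    by rewrite (_ : _ * _ = w 0 0 * e i1 * (e j / e i1)); [apply: srM => //; apply: hr | field].
  by rewrite (_ : _ * _ = w 0 0 * e j * (e i1 / e j)); [apply: srM => //; apply: hr | field].
rewrite (latg_affine _ _ h); split=> [/(_ 0 0) ho|ho i i'].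
  by apply: srM => //; have := hr j i0 h; rewrite ev_X0 divr1.
rewrite !ord1 -[w 0 0](mulfK ej0); apply: srM => //.
by have := hr i0 j hj; rewrite ev_X0 mul1r.
Qed.

(** It suffices to treat x_a / x_j with x_j invertible at P. By [wronskian] the derivative is q_b /
    x_j^2 up to sign; q_b has degree 1 and 1 / x_j generates [omega] at P. This difference of
    degrees is why Omega is O(-1) for the degree of the plane. *)
Lemma der_omega P f : OP P f -> omega P (der f)%:M.
Proof.
have [j [b [_ hj _]]] := smooth_indices P.
have [ej0 gj] := omega_generates hj.
have -> g : omega P g%:M <-> OP P (g * e j) by rewrite gj mxE eqxx mulr1n invrK.
have ejn0 : e j != 0 by rewrite -invr_eq0.
pose N u := OP P u /\ OP P (der u * e j).
have ND u v : N u -> N v -> N (u + v).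
  by move=> [h1 h2] [h3 h4]; split; rewrite ?derD ?mulrDl; apply: srD.
have NM u v : N u -> N v -> N (u * v).
  move=> [h1 h2] [h3 h4]; split; first exact: srM.
  rewrite derM (_ : _ * _ = der u * e j * v + u * (der v * e j)); last by ring.
  by apply: srD; apply: srM.
have Nu a : N (e a / e j).
  split; first by apply: OP_homog hj; apply: X_homog.
  rewrite der_ratio //; have [->|aj] := eqVneq a j.
    by rewrite subrr !mul0r; apply: sr0.
  have [b' [b'a b'j _]] := third_index aj.
  have h : OP P (ev (qd b') / e j) by apply: OP_homog hj; [apply: qd_homog | apply: X_homog].
  have ab : a != b' by rewrite eq_sym.
  have [->|->] := wronskian aj b'j ab.
    by rewrite (_ : _ * _ = ev (qd b') / e j) //; field.
  by rewrite (_ : _ * _ = - (ev (qd b') / e j)); [apply: srN | field].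
have Nh d (h : A) : h \is d.-homog -> N (ev h / e j ^+ d).
  elim/homog_ind => {d h} [d|d h h'|c|d i h _ hN].
  - by rewrite rmorph0 mul0r; split; rewrite ?der0 ?mul0r; apply: sr0.
  - by rewrite rmorphD mulrDl; apply: ND.
  - rewrite ev_C divr1; split; first exact: in_local_cst.
    by rewrite der_cst mul0r; apply: sr0.
  rewrite rmorphM exprS (_ : _ / _ = e i / e j * (ev h / e j ^+ d)); first exact: NM.
  by rewrite invfM mulrACA.
move=> [d [g [h [hg hh hP ->]]]].
have h0 := ev_neq0 D hh hP; have jd := expf_neq0 d ejn0.
have [g1 g2] := Nh d g hg; have [h1 h2] := Nh d h hh.
have hV : OP P (ev h / e j ^+ d)^-1.
  by rewrite invf_div -rmorphXn; apply: OP_homog hh hP; apply: homogX.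
have -> : ev g / ev h = ev g / e j ^+ d * (ev h / e j ^+ d)^-1 by rewrite invf_div mulrA divfK.
have Nhv : N (ev h / e j ^+ d)^-1.
  split=> //; rewrite derV ?mulf_neq0 ?invr_eq0 //.
  set u := ev h / e j ^+ d in h1 h2 hV *.
  have -> : - (der u / u ^+ 2) * e j = - (der u * e j * (u^-1 * u^-1)) by rewrite expr2 invfM; ring.
  by apply/srN/srM => //; apply: srM.
exact: (NM _ _ (conj g1 g2) Nhv).2.
Qed.

End Cotangent.

(** * Kaehler differentials *)

Section Kaehler.
Variables (k : fieldType) (q : {mpoly k[3]}) (D : func_field q).
Hypothesis q_nonsingular : nonsingular_form q.
Local Notation A := {mpoly k[3]}.
Local Notation F := (aF D).
Local Notation t := (at_ D).
Local Notation ev := (@ev k q D).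
Local Notation der := (@der k q D).
Local Notation pt := (conic_point q).
Local Notation C := (conic q).
Local Notation OP := (OP D).
Local Notation eta := (generic_point D).
Local Notation fval := (fval D).
Local Notation X i := ('X_i : A).
Local Notation e i := (ev (X i)).
Local Notation qd := (std_form_d (ff_c D) (ff_l0 D) (ff_l1 D) (ff_m0 D) (ff_m1 D) (ff_m2 D)).
Local Notation omega := (latg ((t ^ (-1))%:M : 'M[F]_1)).
Local Notation pre := (prekaehler C).
Implicit Types (P : pt) (U V W : opens C).

Definition kd U (x : 'O U) : pre U := pm_cl (@kaehler_rel k C U) (MGen x).

Lemma kdD U (x y : 'O U) : kd (x + y) = kd x + kd y.
Proof. by rewrite /kd pm_clD; apply/clP; apply: mcong_rel; constructor. Qed.

Lemma kdM U (x y : 'O U) : kd (x * y) = x *: kd y + y *: kd x.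
Proof. by rewrite /kd !pm_clZ pm_clD; apply/clP; apply: mcong_rel; constructor. Qed.

Lemma kd_cst U c : kd (rs_cst (r := C) U c) = 0.
Proof. by apply/clP; apply: mcong_rel; constructor. Qed.

Lemma kd_res U V (VU : V `<=` U) (x : 'O U) : om_res VU (kd x) = kd (rs_res VU x).
Proof. exact: (pres_resE (@kaehler_rel_res k C) VU (MGen x)). Qed.

Section Span.
Variables (j a b : 'I_3) (W : opens C) (u : 'I_3 -> 'O W).
Hypothesis We : W eta.
Hypothesis jab : forall i, [\/ i = j, i = a | i = b].
Hypothesis hj : forall P, W P -> X j \notin cp_pred P.
Hypothesis hb : forall P, W P -> qd b \notin cp_pred P.
Hypothesis hu : forall i, fval (u i) = e i / e j.
Let ej0 : e j != 0. Proof. by have := ev_neq0 D (X_homog k j) (hj We). Qed.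
Let qb0 : ev (qd b) != 0. Proof. by have := ev_neq0 D (qd_homog D b) (hb We). Qed.

Definition in_span (x : 'O W) := exists c : 'O W, kd x = c *: kd (u a).

Lemma in_spanD x y : in_span x -> in_span y -> in_span (x + y).
Proof. by move=> [c h] [d h']; exists (c + d); rewrite kdD h h' scalerDl. Qed.

Lemma in_spanM x y : in_span x -> in_span y -> in_span (x * y).
Proof. by move=> [c h] [d h']; exists (x * d + y * c); rewrite kdM h h' !scalerA scalerDl. Qed.

Lemma in_span_cst c : in_span (rs_cst (r := C) W c).
Proof. by exists 0; rewrite kd_cst scale0r. Qed.

(** B is a formal gradient of x in the u_i. Keeping it as data lets [diffD] and [diffM] compute the
    gradient of the equation in [span_relation]. *)
Definition diff (x : 'O W) (B : 'I_3 -> 'O W) := kd x = \sum_i B i *: kd (u i).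

Lemma diffD x y B B' : diff x B -> diff y B' -> diff (x + y) (fun i => B i + B' i).
Proof. by rewrite /diff kdD => -> ->; rewrite -big_split; apply: eq_bigr => i _; rewrite scalerDl. Qed.

Lemma diffM x y B B' : diff x B -> diff y B' -> diff (x * y) (fun i => x * B' i + y * B i).
Proof.
rewrite /diff kdM => -> ->; rewrite !scaler_sumr -big_split; apply: eq_bigr => i _.
by rewrite !scalerA scalerDl.
Qed.

Lemma diff_cst c : diff (rs_cst (r := C) W c) (fun=> 0).
Proof. by rewrite /diff kd_cst big1 // => i _; rewrite scale0r. Qed.

Lemma diff_u i : diff (u i) (fun i' => if i' == i then 1 else 0).
Proof.
rewrite /diff (bigD1 i) //= eqxx scale1r big1 ?addr0 // => i' /negPf ->.
by rewrite scale0r.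
Qed.

(** The differential of the equation, divided by c and written in the u_i = x_i / x_j. The long term
    repeats the shape of [std_form], with negated constants in place of subtraction. *)
Lemma span_relation : exists B : 'I_3 -> 'O W,
  \sum_i B i *: kd (u i) = 0 /\ forall i, fval (B i) = ev (qd i) / (ai D (ff_c D) * e j).
Proof.
pose cst c := rs_cst (r := C) W c.
have fc c : fval (cst c) = ai D c by apply: fval_cst.
have c0 : ai D (ff_c D) != 0 by rewrite fmorph_eq0; apply: ff_c0.
pose l0 := cst (- ff_l0 D); pose l1 := cst (- ff_l1 D).
pose m0 := cst (- ff_m0 D); pose m1 := cst (- ff_m1 D); pose m2 := cst (- ff_m2 D).
have := diffD (diffD (diffM (diff_u i2) (diff_u i2))
  (diffM (diffD (diffM (diff_cst (- ff_l0 D)) (diff_u i0)) (diffM (diff_cst (- ff_l1 D)) (diff_u i1))) (diff_u i2)))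
  (diffD (diffD (diffM (diff_cst (- ff_m0 D)) (diffM (diff_u i0) (diff_u i0)))
    (diffM (diff_cst (- ff_m1 D)) (diffM (diff_u i0) (diff_u i1))))
    (diffM (diff_cst (- ff_m2 D)) (diffM (diff_u i1) (diff_u i1)))).
rewrite -/(cst _) -/l0 -/l1 -/m0 -/m1 -/m2.
set Q := (Q in diff Q _); set B := (B in diff _ B) => hB; exists B; split.
  suff Q0 : Q = 0 by rewrite -hB Q0 -(rmorph0 (rs_cst (r := C) W)) kd_cst.
  apply: (@fval_inj _ _ D); rewrite fval0 /Q !(fvalD, fvalM) !fc !hu !rmorphN.
  have := congr1 ev (ff_q D); rewrite ev_q /std_form !(rmorphM, rmorphB, rmorphD, rmorphXn) /= !ev_C.
  set x0 := e i0; set x1 := e i1; set x2 := e i2 => /esym/eqP; rewrite mulf_eq0 (negPf c0) /= => /eqP h.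
  rewrite -[RHS](mul0r (e j ^+ 2)^-1) -h; field; exact: ej0.
elim/I3_ind; rewrite /B /= !(fvalD, fvalM) ?fval0 ?fval1 // !fc !hu !rmorphN /std_form_d /=;
  rewrite !(rmorphM, rmorphB, rmorphN, rmorphD, rmorphMn) /= !ev_C; field; by rewrite c0 ej0.
Qed.

(* The differential of the equation expresses [kd (u b)] through [kd (u a)], as the
   coefficient [qd b] is invertible; and [u j = 1]. *)
Lemma in_span_u i : in_span (u i).
Proof.
have sa : in_span (u a) by exists 1; rewrite scale1r.
have sj : in_span (u j).
  have -> : u j = rs_cst (r := C) W 1 by apply: (@fval_inj _ _ D); rewrite hu divff // fval_cst // rmorph1.
  exact: in_span_cst.
have [B [B0 hB]] := span_relation.
have c0 : ai D (ff_c D) != 0 by rewrite fmorph_eq0; apply: ff_c0.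
have [||y hy] := @fval_sur _ _ D W (ai D (ff_c D) * (e j / ev (qd b))); [|by []|].
  move=> P WP; apply: srM; first exact: in_local_cst.
  by apply: OP_homog (hb WP); [apply: X_homog | apply: qd_homog].
have yB : y * B b = 1.
  apply: (@fval_inj _ _ D); rewrite fvalM fval1 // hy hB; field.
  by rewrite qb0 ej0 c0.
have sb : in_span (u b).
  have e1 : kd (u b) = \sum_(i | i != b) (- y * B i) *: kd (u i).
    rewrite -[LHS]scale1r -yB -scalerA; move: B0; rewrite (bigD1 b) //= => /eqP.
    rewrite addr_eq0 => /eqP ->; rewrite scalerN -scaleNr scaler_sumr; apply: eq_bigr => i' _.
    by rewrite scalerA.
  rewrite /in_span e1; elim/big_ind: _ => [|_ _ [c ->] [c' ->]|i' i'b].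
  - by exists 0; rewrite scale0r.
  - by exists (c + c'); rewrite scalerDl.
  have [c hc] : in_span (u i') by case: (jab i') => ei; rewrite ei //; rewrite ei eqxx in i'b.
  by exists (- y * B i' * c); rewrite hc scalerA.
by case: (jab i) => ->.
Qed.

Lemma in_span_homog d h : h \is d.-homog -> exists x : 'O W, fval x = ev h / e j ^+ d /\ in_span x.
Proof.
elim/homog_ind => {d h} [d|d g h [x [ex hx]] [y [ey hy]]|c|d i h _ [x [ex hx]]].
- exists (rs_cst (r := C) W 0); split; last exact: in_span_cst.
  by rewrite fval_cst // !rmorph0 mul0r.
- by exists (x + y); split; [rewrite fvalD ex ey rmorphD mulrDl | apply: in_spanD].
- by exists (rs_cst (r := C) W c); split; [rewrite fval_cst // ev_C divr1 | apply: in_span_cst].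
exists (u i * x); split; last by apply: in_spanM => //; apply: in_span_u.
by rewrite fvalM hu ex rmorphM exprS invfM mulrACA.
Qed.

(** The quotient rule in the form w dx = dy - x dw for x w = y, where w = h / x_j^d is invertible on
    W. *)
Lemma in_span_fraction (x : 'O W) d g h : g \is d.-homog -> h \is d.-homog ->
  (forall P, W P -> h \notin cp_pred P) -> fval x = ev g / ev h -> in_span x.
Proof.
move=> hg hh hP ex; have [y [ey [c hy]]] := in_span_homog hg; have [w [ew [c' hw]]] := in_span_homog hh.
have h0 := ev_neq0 D hh (hP _ We); have jd := expf_neq0 d ej0.
have exy : x * w = y.
  by apply: (@fval_inj _ _ D); rewrite fvalM ex ew ey; field; rewrite jd h0.
have [||v hv] := @fval_sur _ _ D W (e j ^+ d / ev h); [|by []|].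
  by move=> P WP; rewrite -rmorphXn; apply: OP_homog hh (hP _ WP); apply: homogX.
have vw : v * w = 1.
  by apply: (@fval_inj _ _ D); rewrite fvalM fval1 // hv ew; field; rewrite jd h0.
have e1 : kd x = v *: (w *: kd x) by rewrite scalerA vw scale1r.
have e2 : w *: kd x = kd y - x *: kd w by rewrite -exy kdM addrC addKr.
by exists (v * (c - x * c')); rewrite e1 e2 hy hw scalerA -scalerBl scalerA.
Qed.

End Span.

Lemma pre_generated U P (x : pre U) j a b : U P -> (forall i, [\/ i = j, i = a | i = b]) ->
  X j \notin cp_pred P -> qd b \notin cp_pred P ->
  exists W : opens C, exists (_ : W P) (WU : W `<=` U) (al c : 'O W),
    [/\ fval al = e a / e j, om_res WU x = c *: kd al &
      forall P', W P' -> X j \notin cp_pred P' /\ qd b \notin cp_pred P'].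
Proof.
move=> UP jab hj hb.
pose N := interU (interU U (nonvanishing q (X_homog k j))) (nonvanishing q (qd_homog D b)).
have NP : N P by [].
have NU : N `<=` U by move=> y [[]].
have NW W : W `<=` N -> forall P', W P' -> X j \notin cp_pred P' /\ qd b \notin cp_pred P'.
  by move=> WN P' /WN [[]].
have ex_u W : W `<=` N -> W eta -> exists u : 'I_3 -> 'O W, forall i, fval (u i) = e i / e j.
  move=> WN We; have ex i : exists x : 'O W, fval x = e i / e j.
    apply: fval_sur => [P' WP'|]; last by [].
    by apply: OP_homog (NW _ WN _ WP').1; apply: X_homog.
  by have [u hu] := choice ex; exists u.
elim/pm_clW: x => s.
(* Stated for every [al] with the prescribed value, so that W may shrink during the induction on the
   term: the restriction of one [al] is again such an [al]. *)
suff [W [WP [WN h]]] : exists W : opens C, exists (_ : W P) (WN : W `<=` N), forall al : 'O W,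
    fval al = e a / e j -> exists c : 'O W,
    om_res (subset_trans WN NU) (pm_cl (@kaehler_rel k C U) s : pre U) = c *: kd al.
  have We : W eta by apply: (eta_open D WP).
  have [u hu] := ex_u W WN We; have [c hc] := h _ (hu a).
  by exists W, WP, (subset_trans WN NU), (u a), c; split=> //; apply: NW.
elim: s => [f||s [W [WP [WN h]]]|s [W [WP [WN h]]] s' [W' [WP' [WN' h']]]|f s [W [WP [WN h]]]].
- have [d [g [h [hg hh hP ef]]]] := @fval_OP _ _ D U f P UP.
  pose W := interU N (nonvanishing q hh); have WN : W `<=` N := @interUl _ _ _.
  have We : W eta by apply: (@eta_open _ _ D W P).
  exists W, (conj NP hP), WN => al hal; have [u hu] := ex_u W WN We.
  have -> : al = u a by apply: (@fval_inj _ _ D); rewrite hal hu.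
  have [||||c hc] := @in_span_fraction j a b W u We jab _ _ hu (rs_res (subset_trans WN NU) f) d g h hg hh.
  + by move=> P' /(NW _ WN)[].
  + by move=> P' /(NW _ WN)[].
  + by move=> P' [].
  + by rewrite fval_res.
  by exists c; rewrite -hc; apply: kd_res.
- exists N, NP, (@subset_refl _ _) => al _; exists 0.
  by rewrite scale0r; apply: om_res0.
- exists W, WP, WN => al /h[c hc]; exists (- c).
  rewrite (esym (pm_oppE _ s) : pm_cl _ (MOpp s) = - pm_cl _ s :> pre U).
  by rewrite om_resN hc scaleNr.
- have I1 := @interUl _ W W'; have I2 := @interUr _ W W'.
  exists (interU W W'), (conj WP WP'), (subset_trans I1 WN) => al hal.
  have Ie : interU W W' eta by apply: (@eta_open _ _ D (interU W W') P).
  have [u hu] := ex_u W WN (I1 _ Ie); have [u' hu'] := ex_u W' WN' (I2 _ Ie).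
  have [c hc] := h _ (hu a); have [c' hc'] := h' _ (hu' a).
  exists (rs_res I1 c + rs_res I2 c').
  rewrite (esym (pm_addE _ s s') : pm_cl _ (MAdd s s') = pm_cl _ s + pm_cl _ s' :> pre U).
  rewrite om_resD scalerDl; congr (_ + _).
    rewrite -(om_res_comp (subset_trans WN NU) I1) hc om_resZ kd_res; congr (_ *: kd _).
    by apply: (@fval_inj _ _ D); rewrite fval_res // hu hal.
  rewrite -(om_res_comp (subset_trans WN' NU) I2) hc' om_resZ kd_res; congr (_ *: kd _).
  by apply: (@fval_inj _ _ D); rewrite fval_res // hu' hal.
exists W, WP, WN => al /h[c hc]; exists (rs_res (subset_trans WN NU) f * c).
rewrite (esym (pm_scaleE _ f s) : pm_cl _ (MScale f s) = f *: pm_cl _ s :> pre U).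
by rewrite om_resZ hc scalerA.
Qed.

Lemma prekaehler_hom : exists f : Defs.hom pre (Mod omega), forall U (x : 'O U),
  mvec (hom_at f (kd x)) = (der (fval x))%:M.
Proof.
pose dv U (x : 'O U) : 'rV[F]_1 := (der (fval x))%:M.
have d0 : der 0 = 0 := der0 D.
unshelve eexists (@presented_hom _ _ D _ _ _ _ _ _ 1 omega dv _ _ _ _);
  last by move=> U x; apply: presented_homE.
- by move=> U V VU x Ve; rewrite /dv fval_res.
- by move=> U x h; rewrite /dv fval_empty // d0 raddf0.
- by move=> U x P UP; apply: der_omega => //; apply: fval_OP.
move=> U t1 t2 Ue [x y|x y|c] /=; rewrite /dv.
- by rewrite fvalD derD raddfD.
- by rewrite fvalM derM !scale_scalar_mx -raddfD addrC [der _ * _]mulrC.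
- by rewrite fval_cst // der_cst raddf0.
Qed.

(** The map dx -> der x is checked locally. There every differential is c d(x_a / x_j), and the
    derivative of x_a / x_j is q_b / x_j^2 up to sign. As 1 / x_j generates [omega] and q_b / x_j is
    a unit, this is a generator: it determines c and attains every section. *)
Theorem Omega_bun : iso (Omega C) (bun ((t ^ (-1))%:M : 'M[F]_1)).
Proof.
have [f hf] := prekaehler_hom.
have loc P : exists j a b (s : F), [/\ forall i, [\/ i = j, i = a | i = b],
    X j \notin cp_pred P, qd b \notin cp_pred P, s = 1 \/ s = -1 &
    e j != 0 -> der (e a / e j) = s * ev (qd b) / e j ^+ 2].
  have [j [b [jb hj hb]]] := smooth_indices D q_nonsingular P; have [a [aj ab jab]] := third_index jb.
  have bj : b != j by rewrite eq_sym.
  have [h|h] := wronskian D aj bj ab; [exists j, a, b, 1 | exists j, a, b, (- 1)]; split; auto.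
    by move=> ej0; rewrite der_ratio // h mul1r.
  by move=> ej0; rewrite der_ratio // h mulN1r.
apply: (@sheafify_iso _ _ _ _ f) => [|U x fx P UP|U v P UP]; first exact: Mod_sheaf.
  have [j [a [b [s [jab hj hb hs hd]]]]] := loc P.
  have [W [WP [WU [al [c [hal hc hW]]]]]] := pre_generated x UP jab hj hb.
  exists W, WP, WU; rewrite hc.
  have We : W eta by apply: (eta_open D WP).
  have ej0 := ev_neq0 D (X_homog k j) hj; have qb0 := ev_neq0 D (qd_homog D b) hb.
  have s0 : s != 0 by case: hs => ->; rewrite ?oppr_eq0 oner_neq0.
  have : mvec (hom_at f (om_res WU x)) = 0.
    by rewrite /hom_at -(hom_res f (@sub_full _ U)) -/(hom_at f x) fx om_res0.
  rewrite hc /hom_at homZ mvecZ -/(hom_at f _) hf hal hd // => /(congr1 (fun m : 'M_1 => m 0 0)).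
  rewrite !mxE eqxx mulr1n => /eqP; rewrite mulf_eq0 => /orP[/eqP c0|].
    have -> : c = 0 by apply: (@fval_inj _ _ D); rewrite c0 fval0.
    exact: scale0r.
  by rewrite !mulf_eq0 invr_eq0 expf_eq0 /= (negPf s0) (negPf qb0) (negPf ej0).
have [j [a [b [s [jab hj hb hs hd]]]]] := loc P.
pose W := interU (interU U (nonvanishing q (X_homog k j))) (nonvanishing q (qd_homog D b)).
have WP : W P by [].
have WU : W `<=` U by move=> y [[]].
have We : W eta by apply: (eta_open D WP).
have ej0 := ev_neq0 D (X_homog k j) hj; have qb0 := ev_neq0 D (qd_homog D b) hb.
have s0 : s != 0 by case: hs => ->; rewrite ?oppr_eq0 oner_neq0.
have [||al hal] := @fval_sur _ _ D W (e a / e j); [|by []|].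
  by move=> P' [[_ hj'] _]; apply: OP_homog hj'; apply: X_homog.
(* The solution c of c * der (x_a / x_j) = v. It is regular on W because v e_j is, 1 / e_j being a
   generator of [omega], and because q_b is invertible. *)
have [||c hc] := @fval_sur _ _ D W (mvec v 0 0 * e j * (s^-1 * (e j / ev (qd b)))); [|by []|].
  move=> P' [[UP' hj'] hb']; apply: srM.
    have [_ h] := omega_generates D hj'; rewrite -[e j]invrK; apply/h; exact: mvecP UP'.
  apply: srM; last by apply: OP_homog hb'; [apply: X_homog | apply: qd_homog].
  by case: hs => ->; rewrite ?invrN invr1; [apply: sr1 | apply/srN/sr1].
exists W, WP, WU, (c *: kd al); apply: mvec_inj; rewrite mvec_res //.
rewrite /hom_at homZ mvecZ -/(hom_at f _) hf hal hc hd //.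
rewrite [RHS]mx11_scalar scale_scalar_mx; congr _%:M; field.
by rewrite ej0 qb0 s0.
Qed.

End Kaehler.

(** * Direct sums and standard bundles *)

Section DirectSums.
Variables (k : fieldType) (X : ringed_space k).
Implicit Types (F G H : omod X).

Lemma iso_dsumA F G H : iso (dsum (dsum F G) H) (dsum F (dsum G H)).
Proof.
pose f (V : opens X) (VU : V `<=` full_open X) (s : dsum (dsum F G) H V) : dsum F (dsum G H) V := (s.1.1, (s.1.2, s.2)).
have fD (V : opens X) (VU : V `<=` full_open X) s t : f V VU (s + t) = f V VU s + f V VU t by [].
have fZ (V : opens X) (VU : V `<=` full_open X) (a : 'O V) s : f V VU (a *: s) = a *: f V VU s by [].
have fR (V W : opens X) (VU : V `<=` full_open X) (WU : W `<=` full_open X) (WV : W `<=` V) s :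
  om_res WV (f V VU s) = f W WU (om_res WV s) by [].
exists (HomOver fD fZ fR) => V VU.
by exists (fun s => ((s.1, s.2.1), s.2.2)) => [[[]]|[? []]].
Qed.

Lemma iso_dsum0 F : iso (dsum (zero_mod X) F) F.
Proof.
pose f (V : opens X) (VU : V `<=` full_open X) (s : dsum (zero_mod X) F V) : F V := s.2.
have fD (V : opens X) (VU : V `<=` full_open X) s t : f V VU (s + t) = f V VU s + f V VU t by [].
have fZ (V : opens X) (VU : V `<=` full_open X) (a : 'O V) s : f V VU (a *: s) = a *: f V VU s by [].
have fR (V W : opens X) (VU : V `<=` full_open X) (WU : W `<=` full_open X) (WV : W `<=` V) s :
  om_res WV (f V VU s) = f W WU (om_res WV s) by [].
exists (HomOver fD fZ fR) => V VU.
exists (fun s => (0, s)) => [[s0 s]|s] //=; congr pair.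
by apply/rowP => -[].
Qed.

Lemma iso_dsumr0 F : iso (dsum F (zero_mod X)) F.
Proof.
pose f (V : opens X) (VU : V `<=` full_open X) (s : dsum F (zero_mod X) V) : F V := s.1.
have fD (V : opens X) (VU : V `<=` full_open X) s t : f V VU (s + t) = f V VU s + f V VU t by [].
have fZ (V : opens X) (VU : V `<=` full_open X) (a : 'O V) s : f V VU (a *: s) = a *: f V VU s by [].
have fR (V W : opens X) (VU : V `<=` full_open X) (WU : W `<=` full_open X) (WV : W `<=` V) s :
  om_res WV (f V VU s) = f W WU (om_res WV s) by [].
exists (HomOver fD fZ fR) => V VU.
exists (fun s => (s, 0)) => [[s s0]|s] //=; congr pair.
by apply/rowP => -[].
Qed.

End DirectSums.

Section StandardBundles.
Variables (k : fieldType) (q : {mpoly k[3]}) (D : func_field q).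
Local Notation A := {mpoly k[3]}.
Local Notation F := (aF D).
Local Notation t := (at_ D).
Local Notation pt := (conic_point q).
Local Notation C := (conic q).
Local Notation OP := (OP D).
Local Notation x0 := ('X_i0 : A).
Implicit Types (P : pt) (U V W : opens C).
Let t0 : t != 0 := at0 D.

(** A suitable t^N g is integral at infinity, hence near it; at the affine points nearby the factor
    t^-N is harmless because 1/t lies in B. *)
Lemma pole_nbhd U P m n (g : 'M[F]_(m, n)) : x0 \in cp_pred P -> U P ->
  exists W : opens C, exists (_ : W P) (WU : W `<=` U),
    forall P', W P' -> x0 \notin cp_pred P' -> mxin (OP P') g.
Proof.
move=> h UP; have [N hN] := pole_bound g.
have [|W [WP [WU hW]]] := @OP_nbhd_mx _ _ D U P _ _ (t ^+ N *: g) UP.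
  by move=> i j; rewrite (x0_in_inf D h); apply/OP_inf.
exists W, WP, WU => P' WP' h'.
rewrite -[g](scalerK (expf_neq0 N t0)); apply: mxinZ; last exact: hW.
by apply: (OP_B h'); rewrite -exprVn; apply: srX; apply: aBt.
Qed.

(** The affine part is trivial by definition. Near infinity multiplication by g is a trivialization,
    since by [pole_nbhd] both g and its inverse are integral at the nearby affine points. *)
Lemma bun_rank r (g : 'M[F]_r) : g \in unitmx -> bundle_of_rank r (bun g).
Proof.
move=> ug; split=> [|P]; first exact: Mod_sheaf.
suff [U [UP h]] : exists U : opens C, U P /\ iso_over U (bun g) (Mod (lat_triv D r)).
  exists U; split=> //; apply: iso_over_trans h (iso_over_sym _).
  exact: iso_iso_over (free_mod_iso D r).
have [h|h] := boolP (x0 \in cp_pred P).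
  have [W [WP [_ hW]]] := @pole_nbhd (full_open C) P _ _ g h I.
  have [W' [W'P [W'W hW']]] := @pole_nbhd W P _ _ (invmx g) h WP.
  exists W'; split=> //; apply: (@iso_mx _ _ _ _ _ _ _ _ g (invmx g)); rewrite ?mulmxV ?mulVmx //.
  move=> P' WP' v; have [h'|h'] := boolP (x0 \in cp_pred P').
    by rewrite (latg_inf _ _ h') Mod_triv_inf.
  rewrite (latg_affine _ _ h') /= -(mxin_gl v (_ : gl (OP P') g)) //.
  exists (invmx g); split; rewrite ?mulmxV ?mulVmx //; last exact: hW'.
  by apply: hW => //; apply: W'W.
exists (nonvanishing q (X_homog k i0)); split=> //; apply: iso_mx1 => P' h' v.
exact: latg_affine.
Qed.

Lemma blk_unitmx b : blk D b \in unitmx.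
Proof.
case: b; last exact: unitmx1.
by rewrite unitmxE (det_lblock (_ : 'M_1)) !det_scalar1 mulr1 unitfE invr_eq0.
Qed.

Lemma std_unitmx s : std D s \in unitmx.
Proof.
elim: s => [|b s IH]; first by rewrite unitmxE det_mx00 unitr1.
by rewrite unitmxE det_lblock unitrM -!unitmxE IH andbT unitmxZ ?blk_unitmx // unitfE expfz_neq0.
Qed.

Lemma std_perm s s' : perm_eq s s' -> lattice_iso (std D s) (std D s').
Proof.
elim: s s' => [|b s IH] s' hp; first by move: hp; rewrite perm_sym => /perm_nilP ->; apply: lattice_iso_refl.
have /path.splitPr hs : b \in s' by rewrite -(perm_mem hp) mem_head.
case: hs hp => s1 s2 hp; apply: lattice_iso_trans (lattice_iso_sym (std_move D s1 b s2)).
apply: lattice_iso_diag (lattice_iso_refl _) (IH _ _).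
by rewrite -(perm_cons b) (perm_trans hp) // perm_catC /= perm_cons perm_catC.
Qed.

Lemma bun_std_cons b s (G G' : omod C) : iso G (bun (t ^ b.2 *: blk D b.1)) -> iso G' (bun (std D s)) ->
  iso (dsum G G') (bun (std D (b :: s))).
Proof. by move=> h h'; apply: iso_trans (iso_dsum h h') (bun_sum _ _). Qed.

Lemma bun_std_cat I (l : seq I) (G : I -> omod C) (f : I -> bool * int) s G' :
  (forall i, iso (G i) (bun (t ^ (f i).2 *: blk D (f i).1))) -> iso G' (bun (std D s)) ->
  iso (dsum (bigdsum [seq G i | i <- l]) G') (bun (std D ([seq f i | i <- l] ++ s))).
Proof.
move=> hG hs; elim: l => [|i l IH] /=; first exact: iso_trans (iso_dsum0 _) hs.
by apply: iso_trans (iso_dsumA _ _ _) _; apply: bun_std_cons (hG i) IH.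
Qed.

Lemma bun_std_seq I (l : seq I) (G : I -> omod C) (f : I -> bool * int) :
  (forall i, iso (G i) (bun (t ^ (f i).2 *: blk D (f i).1))) ->
  iso (bigdsum [seq G i | i <- l]) (bun (std D [seq f i | i <- l])).
Proof.
move=> hG; elim: l => [|i l IH] /=; first exact: bun_zero.
exact: bun_std_cons (hG i) IH.
Qed.

End StandardBundles.

(** * Extensions of the structure sheaf by the cotangent bundle *)

Section Extensions.
Variables (k : fieldType) (q : {mpoly k[3]}) (D : func_field q).
Hypothesis q_nonsingular : nonsingular_form q.
Local Notation A := {mpoly k[3]}.
Local Notation F := (aF D).
Local Notation B := (aB D).
Local Notation O := (aO D).
Local Notation t := (at_ D).
Local Notation z := (az D).
Local Notation pt := (conic_point q).
Local Notation C := (conic q).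
Local Notation OP := (OP D).
Local Notation eta := (generic_point D).
Local Notation x0 := ('X_i0 : A).
Local Notation om := (latg (t^-1%:M : 'M[F]_1)).
Local Notation one := (latg (1%:M : 'M[F]_1)).
Implicit Types (P : pt) (U V W : opens C).
Let t0 : t != 0 := at0 D.

Lemma Omega_line : iso (Omega C) (Mod om).
Proof. by have := Omega_bun D q_nonsingular; rewrite exprN1. Qed.

Definition lat_exact r (g : 'M[F]_r) (al : 'M[F]_(1, r)) (be : 'M[F]_(r, 1)) :=
  [/\ al *m be = 0 /\ (forall w : 'rV_1, w *m al = 0 -> w = 0),
      forall P w, om P w -> latg g P (w *m al),
      forall P v, latg g P v -> one P (v *m be),
      forall P v, latg g P v -> v *m be = 0 -> exists w, om P w /\ v = w *m al &
      forall P f, one P f -> exists v, latg g P v /\ v *m be = f].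

Definition lat_split r (g : 'M[F]_r) (be : 'M[F]_(r, 1)) :=
  exists a : 'M[F]_(1, r), a *m be = 1%:M /\ forall P f, one P f -> latg g P (f *m a).

Lemma iso_pair (G1 G2 : omod C) : iso G1 G2 -> exists (f : Defs.hom G1 G2) (f' : Defs.hom G2 G1),
  forall U, cancel (hom_at f (U := U)) (hom_at f' (U := U)) /\ cancel (hom_at f' (U := U)) (hom_at f (U := U)).
Proof.
by move=> [f /hom_over_inv[f' h]]; exists f, f' => U; have [] := h U (@sub_full _ U).
Qed.

Lemma hom_atR (G1 G2 : omod C) (h : Defs.hom G1 G2) U V (VU : V `<=` U) s :
  om_res VU (hom_at h s) = hom_at h (om_res VU s).
Proof. exact: hom_res. Qed.

Lemma lattice_hom r s (g : 'M[F]_r) (h : 'M[F]_s) (a : 'M[F]_(r, s)) :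
  (forall P v, latg g P v -> latg h P (v *m a)) ->
  exists f : Defs.hom (bun g) (bun h), forall U (v : bun g U), mvec (hom_at f v) = mvec v *m a.
Proof. by move=> ha; exists (hom_mx (fun P (_ : full_open C P) v => @ha P v)). Qed.

Lemma hom_lattice r s (g : 'M[F]_r) (h : 'M[F]_s) (f : Defs.hom (bun g) (bun h)) :
  exists a : 'M[F]_(r, s), (forall U (v : bun g U), mvec (hom_at f v) = mvec v *m a) /\
    forall P v, latg g P v -> latg h P (v *m a).
Proof.
have [a [h1 h2]] := hom_matrix f (I : full_open C eta) (@latg_open _ _ _ _ g) (@latg_eta _ _ _ _ g).
by exists a; split=> [U v|P]; [apply: h1 | apply: h2].
Qed.

Lemma latg_section r (g : 'M[F]_r) U P v : U P -> latg g P v ->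
  exists W : opens C, exists (_ : W P) (WU : W `<=` U) (s : bun g W), mvec s = v.
Proof. exact: section_at (@latg_open _ _ _ _ g). Qed.

Lemma exact_extension r (g : 'M[F]_r) al be : lat_exact g al be ->
  exists (i : Defs.hom (Omega C) (bun g)) (p : Defs.hom (bun g) (O_mod C)),
    short_exact i p /\ (splits p -> lat_split g be).
Proof.
move=> [[ab inj] hal hbe ker sur].
have [phi [phi' hphi]] := iso_pair Omega_line; have [psi [psi' hpsi]] := iso_pair (bun_one D).
have [ia hia] := lattice_hom hal; have [pb hpb] := lattice_hom hbe.
pose i : Defs.hom (Omega C) (bun g) := hom_comp ia phi.
pose p : Defs.hom (bun g) (O_mod C) := hom_comp psi' pb.
have iE U s : mvec (hom_at i (s : Omega C U)) = mvec (hom_at phi s) *m al by rewrite -hia.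
have pE U s : hom_at psi (hom_at p (s : bun g U)) = hom_at pb s by rewrite -[RHS](hpsi U).2.
have p0 U (s : bun g U) : hom_at p s = 0 <-> mvec s *m be = 0.
  rewrite -hpb; split=> h; first by rewrite -pE h /hom_at hom0.
  apply: (can_inj (hpsi U).1); rewrite pE; apply: mvec_inj; rewrite h /hom_at hom0 //.
exists i, p; split; last first.
  move=> [j hj]; have [a [ha La]] := hom_lattice (hom_comp j psi' : Defs.hom (Mod one) (bun g)).
  exists a; split=> //; have [W [We [_ [s es]]]] := @latg_section _ (1%:M : 'M_1) (full_open C) eta 1%:M I (@latg_eta _ _ _ _ _ _).
  have := hpb W (hom_at j (hom_at psi' s)); rewrite -pE hj (hpsi W).2 es.
  have := ha W s; rewrite -[hom_at (hom_comp _ _) s]/(hom_at j (hom_at psi' s)) => ->.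
  by rewrite es mul1mx.
split=> [U s s' e|U s|U s x Ux].
- apply: (can_inj (hphi U).1); apply: mvec_inj; apply/eqP; rewrite -subr_eq0; apply/eqP.
  by apply: inj; rewrite mulmxBl -!iE e subrr.
- rewrite p0; split=> [sb x Ux|h].
    have [w [hw ew]] := ker x (mvec s) (@mvecP _ _ _ _ _ _ s x Ux) sb.
    have [W [Wx [WU [w' ew']]]] := @latg_section _ _ U x w Ux hw.
    exists W, Wx, WU, (hom_at phi' w'); apply: mvec_inj.
    by rewrite mvec_res ?iE ?(hphi W).2 ?ew' //; apply: (eta_open D Wx).
  have [Ue|Ue] := pselect (U eta); last by rewrite mvec_empty // mul0mx.
  have [V [Ve [VU [w ew]]]] := h eta Ue.
  by rewrite -(mvec_res VU s Ve) ew iE -mulmxA ab mulmx0.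
have [v [hv ev]] := sur x (mvec (hom_at psi s)) (@mvecP _ _ _ _ _ _ (hom_at psi s) x Ux).
have [W [Wx [WU [w ew]]]] := @latg_section _ _ U x v Ux hv.
exists W, Wx, WU, w; apply: (can_inj (hpsi W).1); rewrite pE; apply: mvec_inj.
by rewrite hpb ew ev -hom_atR mvec_res //; apply: (eta_open D Wx).
Qed.

Section Converse.
Variables (G : omod C) (i : Defs.hom (Omega C) G) (p : Defs.hom G (O_mod C)).
Hypothesis ex : short_exact i p.

Lemma extension_pi0 U (s : Omega C U) : hom_at p (hom_at i s) = 0.
Proof.
by case: ex => _ h _; apply/h => x Ux; exists U, Ux, (@subset_refl _ _), s; rewrite om_res_id.
Qed.

Lemma extension_exact r (g : 'M[F]_r) : iso G (bun g) ->
  exists al be, lat_exact g al be /\ (lat_split g be -> splits p).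
Proof.
move=> isoG; have [iinj ker sur] := ex.
have [phi [phi' hphi]] := iso_pair Omega_line; have [psi [psi' hpsi]] := iso_pair (bun_one D).
have [ga [ga' hga]] := iso_pair isoG.
have [al [hal Lal]] := hom_lattice (hom_comp ga (hom_comp i phi') : Defs.hom (Mod om) (bun g)).
have [be [hbe Lbe]] := hom_lattice (hom_comp psi (hom_comp p ga') : Defs.hom (bun g) (Mod one)).
have iE U (s : Omega C U) : mvec (hom_at ga (hom_at i s)) = mvec (hom_at phi s) *m al.
  by rewrite -hal -[hom_at (hom_comp _ _) _]/(hom_at ga (hom_at i (hom_at phi' (hom_at phi s)))) (hphi U).1.
have pE U (s : G U) : mvec (hom_at psi (hom_at p s)) = mvec (hom_at ga s) *m be.
  by rewrite -hbe -[hom_at (hom_comp _ _) _]/(hom_at psi (hom_at p (hom_at ga' (hom_at ga s)))) (hga U).1.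
have ps0 U (s : G U) : mvec (hom_at ga s) *m be = 0 -> hom_at p s = 0.
  by rewrite -pE => h; apply: (can_inj (hpsi U).1); apply: mvec_inj; rewrite h /hom_at hom0.
exists al, be; split; last first.
  move=> [a [ae La]]; have [h hh] := lattice_hom La.
  exists (hom_comp ga' (hom_comp h psi)) => U s; apply: (can_inj (hpsi U).1); apply: mvec_inj.
  rewrite pE -[hom_at (hom_comp _ _) s]/(hom_at ga' (hom_at h (hom_at psi s))) (hga U).2 hh.
  by rewrite -mulmxA ae mulmx1.
split=> //.
- split.
    have [W [We [_ [w ew]]]] := @latg_section _ (t^-1%:M : 'M_1) (full_open C) eta 1%:M I (@latg_eta _ _ _ _ _ _).
    have := pE W (hom_at i (hom_at phi' w)); rewrite extension_pi0 iE (hphi W).2 ew mul1mx => <-.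
    by rewrite /hom_at hom0.
  move=> w hw; have [W [We [_ [w' ew]]]] := @latg_section _ (t^-1%:M : 'M_1) (full_open C) eta w I (@latg_eta _ _ _ _ _ _).
  have e0 : hom_at i (hom_at phi' w') = 0.
    by apply: (can_inj (hga W).1); apply: mvec_inj; rewrite iE (hphi W).2 ew hw /hom_at hom0.
  have e1 : hom_at phi' w' = 0 by apply: iinj; rewrite e0 /hom_at hom0.
  by rewrite -ew -[w'](hphi W).2 e1 /hom_at hom0.
- move=> P v hv vb; have [W [WP [_ [w ew]]]] := @latg_section _ g (full_open C) P v I hv.
  have [|V [VP [VW [s es]]]] := (ker W (hom_at ga' w)).1 _ P WP; first by apply: ps0; rewrite (hga W).2 ew.
  have Ve : V eta by apply: (eta_open D VP).
  exists (mvec (hom_at phi s)); split; first exact: mvecP VP.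
  by rewrite -iE -es -hom_atR (hga W).2 mvec_res.
move=> P f hf; have [W [WP [_ [w ew]]]] := @latg_section _ (1%:M : 'M_1) (full_open C) P f I hf.
have [V [VP [VW [s es]]]] := sur W (hom_at psi' w) P WP.
have Ve : V eta by apply: (eta_open D VP).
exists (mvec (hom_at ga s)); split; first exact: mvecP VP.
by rewrite -pE -es -hom_atR (hpsi W).2 mvec_res.
Qed.

(** Locally the section 1 of O lifts to some e, and (s, c) -> i s + c e identifies the direct sum of
    Omega and O with G there. Surjectivity glues in Omega the local preimages of g - p(g) e. *)
Lemma extension_vb : is_sheaf G -> vector_bundle G.
Proof.
move=> hG; have [iinj ker sur] := ex; split=> // x.
have [V [Vx [VU [e he]]]] := sur (full_open C) (1 : 'O (full_open C)) x I.
have pe W (WV : W `<=` V) : hom_at p (om_res WV e) = (1 : 'O W).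
  rewrite -hom_atR -he (om_res_comp _ _ (@sub_full _ W)).
  exact: (rmorph1 (rs_res (@sub_full _ W))).
pose f W (WV : W `<=` V) (s : dsum (Omega C) (O_mod C) W) : G W :=
  hom_at i s.1 + (s.2 : 'O W) *: om_res WV e.
have fD (W : opens C) (WV : W `<=` V) s s' : f W WV (s + s') = f W WV s + f W WV s'.
  by rewrite /f [(s + s').1]/= /hom_at homD [(s + s').2]/= scalerDl addrACA.
have fZ (W : opens C) (WV : W `<=` V) (a : 'O W) s : f W WV (a *: s) = a *: f W WV s.
  by rewrite /f /hom_at /= homZ scalerDr scalerA.
have fR (W W' : opens C) (WV : W `<=` V) (WV' : W' `<=` V) (WW : W' `<=` W) s :
    om_res WW (f W WV s) = f W' WV' (om_res WW s).
  by rewrite /f om_resD om_resZ hom_atR (om_res_comp _ _ WV').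
have pf W (WV : W `<=` V) s : hom_at p (f W WV s) = s.2.
  rewrite /f /hom_at homD homZ -!/(hom_at _ _) extension_pi0 add0r pe.
  exact: mulr1.
have finj W (WV : W `<=` V) : injective (f W WV).
  move=> [s1 s2] [s1' s2'] h; have e2 : s2 = s2' by have := congr1 (hom_at p (U := W)) h; rewrite !pf.
  by move: h; rewrite /f /= e2 => /addIr /iinj ->.
have fsur W (WV : W `<=` V) (g : G W) : exists s, f W WV s = g.
  pose c : 'O W := hom_at p g; pose g0 := g - c *: om_res WV e.
  have pg0 : hom_at p g0 = 0.
    rewrite /g0 /hom_at homB homZ -!/(hom_at _ _) pe -/c.
    by transitivity (c - c * 1 : 'O W); last by rewrite mulr1 subrr.
  pose T W' (w : Omega C W') := exists WW : W' `<=` W, hom_at i w = om_res WW g0.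
  have [||w hw] := @sheaf_glue _ _ (Omega C) W T (sheafify_sheaf (F := prekaehler C)).
  - move=> y Wy; have [W' [W'y [WW [w ew]]]] := (ker W g0).1 pg0 y Wy.
    by exists W', W'y, WW, w, WW.
  - move=> W1 W2 w1 w2 h1 h2 [h1' e1] [h2' e2]; apply: iinj.
    rewrite -!hom_atR e1 e2 (om_res_comp _ _ (subset_trans (@interUl _ W1 W2) h1)).
    by rewrite (om_res_comp _ _ (subset_trans (@interUl _ W1 W2) h1)).
  have ew : hom_at i w = g0.
    apply: (sheaf_eq hG) => y Wy; have [W' [W'y [WW [w' [[WW' e'] e'']]]]] := hw y Wy.
    by exists W', W'y, WW; rewrite hom_atR e'' e' (Prop_irrelevance WW WW').
  by exists (w, c); rewrite /f /= ew subrK.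
have [U [Ux hU]] : exists U : opens C, U x /\ iso_over U (dsum (Omega C) (O_mod C)) (free_mod C 2).
  have [_ h] : bundle_of_rank 2 (bun (block_mx (t^-1%:M : 'M[F]_1) 0 0 (1%:M : 'M_1))).
    have ub : block_mx (t^-1%:M : 'M[F]_1) 0 0 (1%:M : 'M_1) \in unitmx.
      by rewrite unitmxE det_lblock det1 mulr1 det_scalar1 unitfE invr_eq0.
    exact: bun_rank ub.
  have [U [Ux hU]] := h x; exists U; split=> //; apply: iso_over_trans hU.
  apply: iso_iso_over; apply: iso_trans (bun_sum _ _).
  exact: iso_dsum Omega_line (bun_one D).
exists (interU V U); split=> //; exists 2%N.
apply: iso_over_trans (iso_over_restrict (@interUr _ V U) hU).
apply: iso_over_sym; apply: iso_over_restrict (@interUl _ V U) _.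
exists (HomOver fD fZ fR) => W WV /=.
have [g hg] := choice (fsur W WV); exists g => // s; apply: (finj W WV); exact: hg.
Qed.

End Converse.

(** The extension of O by Omega with class c; for c = z it is the Quillen block [blk D true]. *)
Definition ext c : 'M[F]_(1 + 1) := block_mx t^-1%:M 0 c%:M 1%:M.

Lemma mul_ext c (v : 'rV[F]_(1 + 1)) :
  v *m ext c = row_mx (t^-1 *: lsubmx v + c *: rsubmx v) (rsubmx v).
Proof.
by rewrite -{1}(hsubmxK v) mul_row_block mulmx0 add0r mulmx1 !mul_mx_scalar.
Qed.

Lemma ext_inf c P v : x0 \in cp_pred P ->
  latg (ext c) P v <-> mxin O (t^-1 *: lsubmx v + c *: rsubmx v) /\ mxin O (rsubmx v).
Proof. by move=> h; rewrite (latg_inf _ _ h) mul_ext mxin_row. Qed.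

Lemma ext_affine c P v : x0 \notin cp_pred P ->
  latg (ext c) P v <-> mxin (OP P) (lsubmx v) /\ mxin (OP P) (rsubmx v).
Proof. by move=> h; rewrite (latg_affine _ _ h) -mxin_row hsubmxK. Qed.

Lemma om_inf P w : x0 \in cp_pred P -> om P w <-> mxin O (t^-1 *: w).
Proof. by move=> h; rewrite (latg_inf _ _ h) mul_mx_scalar. Qed.

Lemma one_inf P w : x0 \in cp_pred P -> one P w <-> mxin O w.
Proof. by move=> h; rewrite (latg_inf _ _ h) mulmx1. Qed.

Lemma ext_exact c : lat_exact (ext c) (row_mx 1%:M 0) (col_mx 0 1%:M).
Proof.
have mb (v : 'rV[F]_(1 + 1)) : v *m col_mx 0 1%:M = rsubmx v.
  by rewrite -{1}(hsubmxK v) mul_row_col mulmx0 mulmx1 add0r.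
have ma (w : 'M[F]_1) : w *m row_mx 1%:M 0 = row_mx w 0 by rewrite mul_mx_row mulmx1 mulmx0.
split; first split.
- by rewrite mul_row_col mulmx0 mul0mx addr0.
- by move=> w; rewrite ma -(row_mx0 _ 1 1 1) => /eq_row_mx[].
- move=> P w; rewrite ma; have [h|h] := boolP (x0 \in cp_pred P).
    rewrite (om_inf _ h) (ext_inf _ _ h) row_mxKl row_mxKr scaler0 addr0 => hw; split=> //.
    exact: mxin0.
  rewrite (latg_affine _ _ h) (ext_affine _ _ h) row_mxKl row_mxKr => hw; split=> //.
  exact: mxin0.
- move=> P v; rewrite mb; have [h|h] := boolP (x0 \in cp_pred P).
    by rewrite (ext_inf _ _ h) (one_inf _ h) => -[].
  by rewrite (ext_affine _ _ h) (latg_affine _ _ h) => -[].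
- move=> P v hv; rewrite mb => v2; exists (lsubmx v).
  rewrite ma -v2 hsubmxK; split=> //; move: hv; have [h|h] := boolP (x0 \in cp_pred P).
    by rewrite (ext_inf _ _ h) (om_inf _ h) v2 scaler0 addr0 => -[].
  by rewrite (ext_affine _ _ h) (latg_affine _ _ h) => -[].
move=> P f hf; have [h|h] := boolP (x0 \in cp_pred P).
  (* The first entry cancels the contribution c f at infinity, where it is multiplied by t^-1. *)
  exists (row_mx (- (t * c) *: f) f); rewrite mb row_mxKr; split=> //.
  rewrite (ext_inf _ _ h) row_mxKl row_mxKr; split; last by have := (one_inf f h).1 hf.
  rewrite scalerA mulrN mulrA mulVf // mul1r scaleNr addNr; exact: mxin0.
exists (row_mx 0 f); rewrite mb row_mxKr; split=> //.
rewrite (ext_affine _ _ h) row_mxKl row_mxKr; split; first exact: mxin0.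
by have := (latg_affine _ f h).1 hf.
Qed.

(** A splitting is a row (c, 1) with c in B and c / t + z in O. Then c is integral at infinity,
    hence a constant, and c + t z would lie in tO, against the independence of 1 and t z in the
    residue field. *)
Lemma quillen_nonsplit : ~ lat_split (ext z) (col_mx 0 1%:M).
Proof.
move=> [a [ae La]]; have a2 : rsubmx a = 1%:M.
  by rewrite -ae -{2}(hsubmxK a) mul_row_col mulmx0 mulmx1 add0r.
pose c := lsubmx a 0 0; have Bc : B c.
  apply: affine_functions => P h.
  have : latg (ext z) P (1%:M *m a) by apply/La/(latg_affine _ _ h); apply: (mxin1 (OP P)).
  by rewrite mul1mx (ext_affine _ _ h) => -[/(_ 0 0)].
have Oc : O (t^-1 * c + z).
  have h := x0_inf D; have : latg (ext z) (inf D) (1%:M *m a) by apply/La/(one_inf _ h); apply: (mxin1 O).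
  by rewrite mul1mx (ext_inf _ _ h) a2 => -[/(_ 0 0) h1 _]; move: h1; rewrite /c !mxE eqxx mulr1.
have Oc' : O c.
  rewrite (_ : c = t * (t^-1 * c + z) - t * z); last by rewrite mulrDr mulVKf // addrK.
  by apply: srB; [apply: srM => //; apply: aOt | apply: aOz].
have [c' ec] := aBO Bc Oc'.
have [|_ /eqP] := @a_indep _ D c' 1; last by rewrite oner_eq0.
by rewrite -ec rmorph1 mul1r (_ : _ / _ = t^-1 * c + z) //; field.
Qed.

(** Row operations over B remove b, column operations over O remove o, and the nonzero constant al
    is a unit in both rings. The matrices a and u solve a * ext z = ext c * u. *)
Lemma ext_quillen (b o : F) (al : k) : B b -> O o -> al != 0 ->
  lattice_iso (ext z) (ext (- (b + ai D al * (t * z) + t * o) / t)).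
Proof.
move=> Bb Oo al0; have il0 : ai D al != 0 by rewrite fmorph_eq0.
pose a : 'M[F]_(1 + 1) := block_mx (- (ai D al)^-1)%:M 0 (b / ai D al)%:M 1%:M.
pose u : 'M[F]_(1 + 1) := block_mx (- (ai D al)^-1)%:M 0 (- (o / ai D al))%:M 1%:M.
have n0 : - (ai D al)^-1 != 0 by rewrite oppr_eq0 invr_eq0.
have glk (R : subring F) : (forall c, R (ai D c)) -> gl R ((- (ai D al)^-1)%:M : 'M_1).
  move=> hk; apply: gl_scalar => //; first by rewrite -fmorphV; apply/srN/hk.
  by rewrite invrN invrK; apply/srN/hk.
have gla : gl B a.
  apply: gl_lower (glk B (@aBk _ D)) (gl1 _ _) _; apply: mxin_scalar.
  by apply: srM => //; rewrite -fmorphV; apply: aBk.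
have glu : gl O u.
  apply: gl_lower (glk O (@aOk _ D)) (gl1 _ _) _; apply: mxin_scalar.
  by apply/srN/srM => //; rewrite -fmorphV; apply: aOk.
set c := - (_ + _ + _) / t.
have e : a *m ext z = ext c *m u.
  rewrite /a /u /ext !mulmx_block !(mulmx0, mul0mx, mul1mx, mulmx1, addr0, add0r) -!scalar_mxM -!raddfD /=.
  congr (block_mx _%:M _ _%:M _); first by rewrite mulrC.
  by rewrite /c; field; rewrite t0 il0.
have -> : ext c = a *m ext z *m invmx u by rewrite e mulmxK ?(gl_unitmx glu).
by apply: lattice_iso_gl => //; apply: gl_inv.
Qed.

(* A section [e] of the quotient over the affine part, together with [al], puts [g] into the
   form [ext c]. The class of [c] modulo [B + tO] is a multiple of that of [t * z]: the
   extension splits if it is zero, and can be rescaled to [ext z] otherwise. *)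
Lemma exact_cases r (g : 'M[F]_r) al be : g \in unitmx -> lat_exact g al be ->
  lat_split g be \/ iso (bun g) (bun (ext z)).
Proof.
move=> ug [[ab inj] Lal Lbe ker sur].
have delta_aff P j : x0 \notin cp_pred P -> latg g P (delta_mx 0 j).
  move=> h; apply/(latg_affine _ _ h) => i' j'; rewrite mxE.
  by case: andP => _; [apply: sr1 | apply: sr0].
have Bbe j : B (be j 0).
  apply: affine_functions => P h; have := Lbe P _ (delta_aff P j h).
  by rewrite -rowE (latg_affine _ _ h) => /(_ 0 0); rewrite mxE.
have Bal : mxin B al.
  move=> i' j; apply: affine_functions => P h.
  have : latg g P (1%:M *m al) by apply/Lal/(latg_affine _ _ h); apply: (mxin1 (OP P)).
  by rewrite mul1mx (latg_affine _ _ h).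
(* The values of [be] on B^r form an ideal of B. Since [be] is onto at every affine point, a
   generator d of it is invertible at all of them, hence in B; this provides a section e over the
   affine part with [e *m be] = 1. *)
pose I f := exists v : 'rV[F]_r, mxin B v /\ f = (v *m be) 0 0.
have [||f f' [v [Bv ->]] [v' [Bv' ->]]|f f' Bf [v [Bv ->]]|d [Id hd]] := @ff_pid _ _ D I.
- by move=> _ [v [Bv ->]]; rewrite mxE; apply: sr_sum => j; apply: srM.
- by exists 0; split; [apply: mxin0 | rewrite mul0mx mxE].
- by exists (v + v'); split; [apply: mxinD | rewrite mulmxDl [RHS]mxE].
- by exists (f *: v); split; [apply: mxinZ | rewrite -scalemxAl [RHS]mxE].
have Idelta j : I (be j 0).
  exists (delta_mx 0 j); split; last by rewrite -rowE mxE.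
  by move=> i' j'; rewrite mxE; case: andP => _; [apply: sr1 | apply: sr0].
have BdV : B d^-1.
  apply: affine_functions => P h.
  have [|v [hv ev]] := sur P 1%:M; first by apply/(latg_affine _ _ h); apply: (mxin1 (OP P)).
  have hw j : exists w, B w /\ be j 0 = w * d by have [w Bw ew] := hd _ (Idelta j); exists w.
  have [w hw'] := choice hw.
  have e1 : (\sum_j v 0 j * w j) * d = 1.
    transitivity ((v *m be) 0 0); last by rewrite ev mxE eqxx.
    by rewrite mxE big_distrl /=; apply: eq_bigr => j _; rewrite (hw' j).2 mulrA.
  have d0 : d != 0 by apply: contraTneq (oner_neq0 F) => d0; rewrite -e1 d0 mulr0 eqxx.
  rewrite (_ : d^-1 = \sum_j v 0 j * w j); last by rewrite -[RHS](mulfK d0) e1 mul1r.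
  apply: sr_sum => j; apply: srM; last by apply: (OP_B h); case: (hw' j).
  by move/(latg_affine _ _ h): hv; apply.
have d0 : d != 0.
  apply/eqP => d0; have [|v [_ ev]] := sur eta 1%:M; first exact: latg_eta.
  have be0 : be = 0 by apply/colP => j; have [w _ ->] := hd _ (Idelta j); rewrite d0 mulr0 mxE.
  have := congr1 (fun m : 'M_1 => m 0 0) ev; rewrite be0 mulmx0 !mxE eqxx => /esym/eqP.
  by rewrite oner_eq0.
have [e0 [Be0 ed]] := Id; pose e := d^-1 *: e0.
have Be : mxin B e by apply: mxinZ.
have ebe : e *m be = 1%:M.
  by apply/matrixP => i' j'; rewrite !ord1 -scalemxAl mxE -ed mulVf // mxE eqxx.
have ker_row j : exists w : 'rV[F]_1, delta_mx 0 j - be j 0 *: e = w *m al.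
  have [||w [_ ->]] := ker eta (delta_mx 0 j - be j 0 *: e); [exact: latg_eta | | by exists w].
  rewrite mulmxBl -rowE -scalemxAl ebe; apply/matrixP => i' j'.
  by rewrite !ord1 !mxE eqxx mulr1 subrr.
(* [ga] is the projection to Omega along e; (ga, be) and the rows (al, e) are inverse changes of
   basis over B. *)
have [w hw] := choice ker_row; pose ga := \matrix_j w j : 'M[F]_(r, 1).
have gaal : ga *m al = 1%:M - be *m e.
  apply/row_matrixP => j; rewrite row_mul rowK -hw linearB /= row1 row_mul; congr (_ - _).
  by rewrite [row j be]mx11_scalar mul_scalar_mx mxE.
have alga : al *m ga = 1%:M.
  apply/eqP; rewrite -subr_eq0; apply/eqP/inj.
  by rewrite mulmxBl mul1mx -mulmxA gaal mulmxBr mulmx1 mulmxA ab mul0mx subr0 subrr.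
have ega : e *m ga = 0.
  by apply: inj; rewrite -mulmxA gaal mulmxBr mulmx1 mulmxA ebe mul1mx subrr.
have Bga : mxin B ga.
  move=> j i'; rewrite ord1 mxE; apply: affine_functions => P h.
  have [||w' [hw' ew']] := ker P (delta_mx 0 j - be j 0 *: e).
  - rewrite (latg_affine _ _ h); apply: mxinB; first by apply/(latg_affine g _ h); apply: delta_aff.
    by apply: mxinZ => [|i1 j1]; apply: (OP_B h).
  - rewrite mulmxBl -rowE -scalemxAl ebe; apply/matrixP => i1 j1.
    by rewrite !ord1 !mxE eqxx mulr1 subrr.
  have -> : w j = w'.
    by apply/eqP; rewrite -subr_eq0; apply/eqP/inj; rewrite mulmxBl -hw ew' subrr.
  by move/(latg_affine _ _ h): hw'; apply.
pose a := row_mx ga be : 'M[F]_(r, 1 + 1); pose a' := col_mx al e : 'M[F]_(1 + 1, r).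
have aa' : a *m a' = 1%:M by rewrite mul_row_col gaal subrK.
have a'a : a' *m a = 1%:M.
  by rewrite mul_col_row alga ab ega ebe -scalar_mx_block.
(* v0 is a lift of 1 at infinity. It differs from the affine lift e by c0 times [al], and c0
   represents the extension class up to sign and the factor t. *)
have [|v0 [hv0 ev0]] := sur (inf D) 1%:M; first by apply/(one_inf _ (x0_inf D)); apply: (mxin1 O).
pose c0 := (v0 *m ga) 0 0.
have v0E : v0 = c0 *: al + e.
  rewrite -[LHS]mulmx1 -aa' mulmxA mul_mx_row ev0 mul_row_col mul1mx; congr (_ + _).
  by rewrite [v0 *m ga]mx11_scalar mul_scalar_mx.
have iso1 : iso (bun g) (bun (ext (- c0 / t))).
  apply: (@iso_mx _ _ _ _ _ _ _ _ a a') => // P _ v.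
  have vE : v = (v *m ga) *m al + (v *m be) *m e.
    by rewrite -[LHS]mulmx1 -aa' mulmxA mul_mx_row mul_row_col.
  have [h|h] := boolP (x0 \in cp_pred P); last first.
    rewrite (ext_affine _ _ h) mul_mx_row row_mxKl row_mxKr (latg_affine _ _ h).
    have OB m n (b : 'M[F]_(m, n)) : mxin B b -> mxin (OP P) b by move=> hb i' j'; apply: (OP_B h).
    split=> [hv|[h1 h2]]; first by split; apply: mxinM => //; apply: OB => // i' j'; rewrite ord1.
    by rewrite vE; apply: mxinD; apply: mxinM => //; apply: OB.
  rewrite (ext_inf _ _ h) mul_mx_row row_mxKl row_mxKr.
  have ew : t^-1 *: (v *m ga) + (- c0 / t) *: (v *m be) = t^-1 *: (v *m ga - c0 *: (v *m be)).
    by rewrite scalerBr scalerA -scaleNr; congr (_ + _ *: _); ring.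
  rewrite ew -(om_inf _ h) -(one_inf _ h) (x0_in_inf D h).
  have vE2 : v = (v *m ga - c0 *: (v *m be)) *m al + (v *m be) *m v0.
    rewrite v0E mulmxDr -scalemxAr mulmxBl -scalemxAl addrA subrK.
    exact: vE.
  have Lv0 (f : 'M[F]_1) : one (inf D) f -> latg g (inf D) (f *m v0).
    move/(one_inf _ (x0_inf D)) => hf; rewrite [f]mx11_scalar mul_scalar_mx.
    by apply: ltZ => //; apply/OP_inf.
  split=> [hv|[h1 h2]]; last by rewrite vE2; apply: ltD; [apply: Lal | apply: Lv0].
  have h2 := Lbe _ _ hv; split=> //.
  have [||w' [hw' ew']] := ker (inf D) (v - (v *m be) *m v0).
  - by rewrite -scaleN1r; apply: ltD => //; apply: ltZ; [apply/srN/sr1 | apply: Lv0].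
  - by rewrite mulmxBl -(mulmxA _ v0 be) ev0 mulmx1 subrr.
  have -> // : v *m ga - c0 *: (v *m be) = w'.
  apply/eqP; rewrite -subr_eq0; apply/eqP/inj; rewrite mulmxBl -ew'; apply/eqP; rewrite subr_eq0.
  by apply/eqP/(addIr ((v *m be) *m v0)); rewrite subrK -vE2.
have [b [l [o [Bb Oo ec]]]] := a_dec c0.
have [l0|l0] := eqVneq l 0; [left|right]; last first.
  by apply: iso_trans iso1 (iso_sym _); apply: bun_iso; rewrite ec; apply: ext_quillen.
exists (b *: al + e); split; first by rewrite mulmxDl -scalemxAl ab scaler0 add0r.
move=> P f hf; have [h|h] := boolP (x0 \in cp_pred P); last first.
  apply/(latg_affine _ _ h); apply: mxinM; first by have := (latg_affine _ f h).1 hf.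
  apply: mxinD => [|i' j']; last exact: (OP_B h (Be i' j')).
  by apply: mxinZ => [|i' j']; [apply: (OP_B h Bb) | apply: (OP_B h (Bal i' j'))].
have {}h := x0_in_inf D h; rewrite h in hf *.
have -> : b *: al + e = v0 + ((- (t * o))%:M : 'M_1) *m al.
  rewrite v0E ec l0 rmorph0 mul0r addr0 mul_scalar_mx scaleNr scalerDl.
  by rewrite [RHS]addrAC addrK.
move/(one_inf _ (x0_inf D)): hf => hf; rewrite [f]mx11_scalar mul_scalar_mx.
apply: ltZ; first exact/OP_inf.
apply: ltD => //; apply: Lal; apply/(om_inf _ (x0_inf D)).
by rewrite scale_scalar_mx mulrN mulKf //; apply/mxin_scalar/srN.
Qed.

End Extensions.

Local Close Scope classical_set_scope.

Lemma nonsingular_homog (k : fieldType) (q : {mpoly k[3]}) : nonsingular_form q -> q \is 2.-homog.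
Proof.
move=> /(_ k idfun)[h _]; rewrite (_ : q = map_mpoly idfun q) //.
by apply/mpolyP => m; rewrite mcoeff_map_mpoly.
Qed.

(** * The Quillen bundle and the decomposition of vector bundles *)

Section Decomposition.
Variables (k : fieldType) (q : {mpoly k[3]}) (D : func_field q).
Hypothesis q_nonsingular : nonsingular_form q.
Local Notation F := (aF D).
Local Notation t := (at_ D).
Local Notation C := (conic q).
Local Notation Q := (bun (ext (az D))).

(** The exponents change sign because Omega is the line t^-1. *)
Definition summands (m n : seq int) : seq (bool * int) :=
  [seq (false, - i) | i <- m] ++ [seq (true, - j) | j <- n].

Lemma Omega_pow_bun i : iso (tensor_pow (Omega C) i) (bun ((t ^ (- i))%:M : 'M[F]_1)).
Proof. by have := tensor_pow_bun i (Omega_bun D q_nonsingular); rewrite mulN1r. Qed.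

Lemma decomposition_bun m n :
  iso (dsum (bigdsum [seq tensor_pow (Omega C) i | i <- m])
            (bigdsum [seq tensor Q (tensor_pow (Omega C) j) | j <- n]))
      (bun (std D (summands m n))).
Proof.
apply: (bun_std_cat m (f := fun i => (false, - i))) => [i|] /=.
  by rewrite scalemx1; apply: Omega_pow_bun.
apply: (bun_std_seq n (f := fun j => (true, - j))) => j /=.
by apply: tensor_bun (Omega_pow_bun j); apply: iso_refl.
Qed.

Lemma bun_std_inj s s' : iso (bun (std D s)) (bun (std D s')) -> perm_eq s s'.
Proof. by move/(bun_iso_inv (std_unitmx D s) (std_unitmx D s'))/std_unique. Qed.

Lemma bundle_std (V : omod C) : vector_bundle V -> exists s, iso V (bun (std D s)).
Proof.
move=> /(bundle_bun D)[r [g [ug h]]]; have [s hs] := lattice_classification ug.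
by exists s; apply: iso_trans h (bun_iso hs).
Qed.

Lemma summandsP s : exists m n, perm_eq s (summands m n).
Proof.
exists [seq - b.2 | b <- s & ~~ b.1], [seq - b.2 | b <- s & b.1].
rewrite /summands -!map_comp perm_sym perm_catC.
rewrite (_ : [seq _ | b <- s & b.1] = [seq b <- s | b.1]); last first.
  by rewrite -[RHS]map_id; apply/eq_in_map => -[[] n]; rewrite mem_filter //= opprK.
rewrite (_ : [seq _ | b <- s & ~~ b.1] = [seq b <- s | ~~ b.1]); last first.
  by rewrite -[RHS]map_id; apply/eq_in_map => -[[] n]; rewrite mem_filter //= opprK.
by rewrite perm_filterC.
Qed.

Lemma summands_inj m n m' n' : perm_eq (summands m n) (summands m' n') -> perm_eq m m' /\ perm_eq n n'.
Proof.
have opK (c : bool) (l : seq int) : [seq - b.2 | b <- [seq (c, - i) | i <- l]] = l.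
  by rewrite -map_comp -[RHS]map_id; apply: eq_map => i /=; rewrite opprK.
have fil (c : bool) (l : seq int) d : [seq b <- [seq (c, - i) | i <- l] | b.1 == d] =
    if c == d then [seq (c, - i) | i <- l] else [::].
  by rewrite filter_map /preim /=; case: (c == d); rewrite ?filter_predT ?filter_pred0.
move=> h; split.
  have := perm_map (fun b : bool * int => - b.2) (perm_filter (fun b => b.1 == false) h).
  by rewrite /summands !filter_cat !fil /= !cats0 !opK.
have := perm_map (fun b : bool * int => - b.2) (perm_filter (fun b => b.1 == true) h).
by rewrite /summands !filter_cat !fil /= !opK.
Qed.

Lemma quillen_std : iso Q (bun (std D [:: (true, 0)])).
Proof.
apply: iso_trans (iso_sym (iso_dsumr0 _)) _; apply: bun_std_cons; last exact: bun_zero.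
by rewrite /= expr0z scale1r; apply: iso_refl.
Qed.

(** Two nonzero summands would have nonempty standard forms, and by uniqueness their concatenation
    would be the one-block form of the Quillen bundle. *)
Lemma quillen_indecomposable : indecomposable Q.
Proof.
have zero_std : iso (zero_mod C) (bun (std D [::])) := bun_zero _.
split=> [h|[F1 [F2 [v1 n1 v2 n2 h]]]].
  have /perm_size // : perm_eq [:: (true, 0 : int)] [::].
  by apply: bun_std_inj; apply: iso_trans (iso_sym quillen_std) (iso_trans h zero_std).
have [s1 h1] := bundle_std v1; have [s2 h2] := bundle_std v2.
have hp : perm_eq [:: (true, 0 : int)] (s1 ++ s2).
  apply: bun_std_inj; apply: iso_trans (iso_sym quillen_std) (iso_trans h _).
  have -> : s1 = [seq id b | b <- s1] by rewrite map_id.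
  apply: iso_trans (bun_std_cat s1 (G := fun b => bun (t ^ b.2 *: blk D b.1)) (f := id) _ h2).
    apply: iso_dsum (iso_refl _); apply: iso_trans h1 (iso_sym _).
    by have := bun_std_seq s1 (fun b => iso_refl (bun (t ^ b.2 *: blk D b.1))); rewrite map_id.
  by move=> b; apply: iso_refl.
have := perm_size hp; rewrite size_cat.
case: s1 h1 hp => [|b s1] h1 hp; first by case: n1; apply: iso_trans h1 (iso_sym zero_std).
case: s2 h2 hp => [|b' s2] h2 hp; first by case: n2; apply: iso_trans h2 (iso_sym zero_std).
by rewrite /= addnS.
Qed.

Lemma quillen_rank : bundle_of_rank 2 Q.
Proof. exact: bun_rank (blk_unitmx D true). Qed.

Lemma quillen_extension : nonsplit_extension (Omega C) (O_mod C) Q.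
Proof.
split; first exact: Mod_sheaf.
have [i [p [ip split_p]]] := exact_extension q_nonsingular (ext_exact (az D)).
by exists i, p; split=> // /split_p; apply: quillen_nonsplit.
Qed.

(** An extension is itself a vector bundle, so it is given by a matrix; [exact_cases] then leaves
    only a split extension or the Quillen block. *)
Lemma quillen_unique (Q' : omod C) : nonsplit_extension (Omega C) (O_mod C) Q' -> iso Q' Q.
Proof.
move=> [sh [i [p [ip nsp]]]].
have [r [g [ug h]]] := bundle_bun D (extension_vb D q_nonsingular ip sh).
have [al [be [ex sp]]] := extension_exact q_nonsingular ip h.
by have [/sp//|h'] := exact_cases ug ex; apply: iso_trans h h'.
Qed.

End Decomposition.

Theorem theoremA (k : fieldType) (q : {mpoly k[3]})
    (q_nonsingular : nonsingular_form q) (q_anisotropic : no_rational_point q) :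
  let C := conic q in
  exists Q : omod C,
    [/\ nonsplit_extension (Omega C) (O_mod C) Q
        /\ (forall Q' : omod C, nonsplit_extension (Omega C) (O_mod C) Q' -> iso Q' Q),
        bundle_of_rank 2 Q,
        indecomposable Q
      & forall V : omod C, vector_bundle V ->
        let decomposition (m n : seq int) : omod C :=
          dsum (bigdsum [seq tensor_pow (Omega C) i | i <- m])
               (bigdsum [seq tensor Q (tensor_pow (Omega C) j) | j <- n]) in
        exists m n : seq int,
          iso V (decomposition m n)
          /\ forall m' n' : seq int, iso V (decomposition m' n') ->
             perm_eq m' m /\ perm_eq n' n].
Proof.
have [D] := func_field_exists (nonsingular_homog q_nonsingular) q_anisotropic.
move=> C; exists (bun (ext (az D))); split.
- by split; [apply: quillen_extension | apply: quillen_unique].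
- exact: quillen_rank.
- exact: quillen_indecomposable.
move=> V /(bundle_std D)[s hs] decomposition.
have dec m n : iso (decomposition m n) (bun (std D (summands m n))) := decomposition_bun D q_nonsingular m n.
have [m [n hmn]] := summandsP s; exists m, n; split.
  exact: iso_trans hs (iso_trans (bun_iso (std_perm D hmn)) (iso_sym (dec m n))).
move=> m' n' h; apply: summands_inj; rewrite -(permPr hmn); apply: (bun_std_inj (D := D)).
exact: iso_trans (iso_sym (dec m' n')) (iso_trans (iso_sym h) hs).
Qed.
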